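(* Let $1\le p,q<\infty$, $d>0$, $s>0$, $r_0>0$. Let $\Omega\subset X$ be open and $E\subset F\subset\overline{\Omega}$ be such that the $d$-dimensional Hausdorff measure $\Lambda_d$ satisfies, for some constants $C,C'>0$, $$C r^d\le\Lambda_d(F\cap B(x,r))\le C'r^d\quad\text{for all }x\in E\text{ and }0<r\le r_0 .$$ Assume that $E$ is totally bounded and $\Lambda_d$-measurable, and that for all $x\in E$ and $0<r\le r_0$ the restriction $\mu|_\Omega$ satisfies $$0<\mu(B(x,2r)\cap\Omega)\le C''\mu(B(x,r)\cap\Omega)<\infty\quad\text{and}\quad\mu(B(x,r)\cap\Omega)\ge C'''r^s,$$ with $C'',C'''>0$ independent of $x$ and $r$. (1) If $\alpha>0$ and $d>s-\alpha p$, then functions in $M^{\alpha,p}(\Omega,\mu)$ have traces on $E$, defined by $$u(x):=\lim_{r\to0}\frac{1}{\mu(B(x,r)\cap\Omega)}\int_{B(x,r)\cap\Omega}u\,d\mu\quad\text{for }\Lambda_d\text{-a.e. }x\in E,\qquad( * )$$ and the trace mapping $M^{\alpha,p}(\Omega,\mu)\hookrightarrow L^q(E,\Lambda_d)$ is compact whenever $q(s-\alpha p)<dp$. (2) If $d>s-p$ and the restriction $\mu|_\Omega$ also supports the $p$-Poincar\'e inequality for minimal $p$-weak upper gradients on $\Omega$, then the trace mapping $N^{1,p}(\Omega,\mu)\hookrightarrow L^q(E,\Lambda_d)$, defined by $( * )$, is bounded whenever $q(s-p)\le dp$, and compact if $q(s-p)<dp$.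
   Context: $X$ is a metric space (with metric denoted $\mathrm{dist}$ here) equipped with a positive complete Borel measure $\mu$; $B(x,r)$ is the open ball in $X$; it is assumed that $\Lambda_d(E)>0$. The spaces $M^{\alpha,p}(\Omega,\mu)$ and $N^{1,p}(\Omega,\mu)$ are defined on $\Omega$ regarded as a metric space in its own right, equipped with $\mu|_\Omega$. For a metric measure space $Z$ with measure $\mu$: a nonnegative Borel function $g$ is a Haj\l asz $\alpha$-gradient of $u:Z\to\mathbf{R}$ if $|u(x)-u(y)|\le\mathrm{dist}(x,y)^\alpha(g(x)+g(y))$ for $\mu$-a.e. $x,y\in Z$. $M^{\alpha,p}(Z,\mu)$ consists of all $u\in L^p(Z,\mu)$ with a Haj\l asz $\alpha$-gradient in $L^p(Z,\mu)$, with norm $\|u\|_{L^p}+\inf_g\|g\|_{L^p}$. A Borel function $g:Z\to[0,\infty]$ is an upper gradient of $u:Z\to[-\infty,\infty]$ if $|u(\gamma(0))-u(\gamma(l_\gamma))|\le\int_\gamma g\,ds$ for all rectifiable curves $\gamma:[0,l_\gamma]\to Z$ (left-hand side $=\infty$ if a term is infinite); it is a $p$-weak upper gradient if this holds for all curves outside a family $\Gamma$ for which some $0\le\rho\in L^p(Z,\mu)$ has $\int_\gamma\rho\,ds=\infty$ for all $\gamma\in\Gamma$. The minimal $p$-weak upper gradient $g_u$ is the $\mu$-a.e. smallest $p$-weak upper gradient in $L^p_{\rm loc}$ (it exists whenever $u$ has an upper gradient in $L^p_{\rm loc}$). $N^{1,p}(Z,\mu)$ is the space of $u$ with $\|u\|_{N^{1,p}}=(\int_Z|u|^pd\mu+\inf_g\int_Zg^pd\mu)^{1/p}<\infty$.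 $\mu|_\Omega$ supports the $p$-Poincar\'e inequality for $g_u$ on $\Omega$ if there are $C>0$, $\lambda\ge1$ such that for all balls $B$ of the metric space $\Omega$ (with $0<\mu(B)<\infty$) and all $u\in L^1_{\rm loc}(\Omega,\mu)$ (integrable on balls) with minimal $p$-weak upper gradient $g_u\in L^p(\Omega,\mu)$, $$\frac1{\mu(B)}\int_B|u-u_{B,\mu}|\,d\mu\le C\operatorname{diam}(B)\Bigl(\frac1{\mu(\lambda B)}\int_{\lambda B}g_u^p\,d\mu\Bigr)^{1/p},\qquad u_{B,\mu}=\frac1{\mu(B)}\int_Bu\,d\mu .$$ A mapping is compact if the image of every bounded sequence has a convergent subsequence. *)

(* Defs.v *)
From HB Require Import structures.
From mathcomp Require Import all_boot all_order all_algebra.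
From mathcomp Require Import all_classical all_reals all_analysis measurable_realfun.

Set Implicit Arguments.
Unset Strict Implicit.
Unset Printing Implicit Defensive.

Import Order.TTheory GRing.Theory Num.Theory.
Import numFieldNormedType.Exports.

Local Open Scope classical_set_scope.
Local Open Scope ring_scope.
Local Open Scope ereal_scope.

(* The sigma-algebra is the domain of the measure, which for a complete measure
   is larger than the Borel one; [complete_borel] below relates the two. *)
#[short(type="metricMeasurableType")]
HB.structure Definition MetricMeasurable (R : numDomainType) disp :=
  {T of Metric R T & Measurable disp T}.

Section metric_notions.
Context (R : realType) (X : metricType R).

Definition totally_bounded (A : set X) : Prop :=
  forall e : R, (0 < e)%R ->
    exists s : seq X, A `<=` \bigcup_(x in [set` s]) ball x e.

Definition diam (A : set X) : \bar R :=
  ereal_sup [set (mdist x y)%:E | x in A & y in A].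

(* The empty set is singled out because its [diam] is -oo. *)
Definition diam_pow (d : R) (A : set X) : \bar R :=
  if A == set0 then 0 else diam A `^ d.

Definition hausdorff_pre (d delta : R) (A : set X) : \bar R :=
  ereal_inf [set \sum_(k <oo) diam_pow d (B k) | B in
    [set B : (set X)^nat |
      (forall k, diam (B k) <= delta%:E) /\ A `<=` \bigcup_k B k]].

(* No normalising constant is included. *)
Definition hausdorff (d : R) (A : set X) : \bar R :=
  ereal_sup [set hausdorff_pre d delta A | delta in [set t : R | (0 < t)%R]].

End metric_notions.

Section hausdorff_outer_measure.
Context (R : realType) (disp : measure_display)
  (X : metricMeasurableType R disp) (d : R).

Lemma diam_pow_ge0 (A : set X) : 0 <= diam_pow d A.
Proof. by rewrite /diam_pow; case: ifPn => // _; exact: poweR_ge0. Qed.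

Let gauge (delta : R) (A : set (g_sigma_algebraType [set: set X])) : \bar R :=
  if diam A <= delta%:E then diam_pow d A else +oo.

Let gauge_ge0 delta A : 0 <= gauge delta A.
Proof. by rewrite /gauge; case: ifPn => // _; exact: diam_pow_ge0. Qed.

Let gauge_set0 delta : gauge delta set0 = 0.
Proof.
rewrite /gauge /diam_pow eqxx ifT// /diam.
rewrite (_ : [set _ | _ in _ & _ in _] = set0) ?ereal_sup0 ?leNye//.
by rewrite -subset0 => z [x].
Qed.

Let hausdorff_preE delta : hausdorff_pre d delta = mu_ext (gauge delta).
Proof.
apply/funext => A; apply/eqP; rewrite eq_le; apply/andP; split; last first.
  apply: le_ereal_inf_tmp => _ [B [dB AB] <-].
  apply: ereal_inf_lbound; exists B.
    by split => // i; exact: sub_gen_smallest.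
  by apply: eq_eseriesr => k _; rewrite /gauge dB.
apply: le_ereal_inf_tmp => _ [B [_ AB] <-].
have [dB|] := pselect (forall k, diam (B k) <= delta%:E).
  rewrite (eq_eseriesr (g := fun k => diam_pow d (B k))); last first.
    by move=> k _; rewrite /gauge dB.
  by apply: ereal_inf_lbound; exists B.
move=> /existsNP[k /negP/negPf dBk].
by rewrite (@eseries_pinfty _ _ xpredT k) ?leey// /gauge ?dBk// => n _;
  rewrite -ltNye (lt_le_trans _ (gauge_ge0 delta (B n))).
Qed.

Let hausdorff_pre_le delta A : (0 < delta)%R ->
  hausdorff_pre d delta A <= hausdorff d (A : set X).
Proof. by move=> d0; apply: ereal_sup_ubound; exists delta. Qed.

Let hausdorff0 : hausdorff d (@set0 X) = 0.
Proof.
apply/eqP; rewrite eq_le; apply/andP; split.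
  apply: ge_ereal_sup => _ [delta _ <-].
  by rewrite hausdorff_preE (mu_ext0 (gauge_set0 _) (gauge_ge0 _)).
apply: le_trans (hausdorff_pre_le _ ltr01).
by rewrite hausdorff_preE; exact: mu_ext_ge0.
Qed.

Let hausdorff_ge0 (A : set X) : 0 <= hausdorff d A.
Proof.
apply: le_trans (hausdorff_pre_le _ ltr01).
by rewrite hausdorff_preE; exact: mu_ext_ge0.
Qed.

Let le_hausdorff :
  {homo (hausdorff d : set X -> \bar R) : A B / A `<=` B >-> A <= B}.
Proof.
move=> A B AB; apply: ge_ereal_sup => _ [delta delta0 <-].
apply: le_trans (hausdorff_pre_le _ delta0).
by rewrite hausdorff_preE; exact: le_mu_ext.
Qed.

Let hausdorff_sigma_subadditive :
  sigma_subadditive (hausdorff d : set X -> \bar R).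
Proof.
move=> F; apply: ge_ereal_sup => _ [delta delta0 <-].
rewrite hausdorff_preE.
apply: le_trans (mu_ext_sigma_subadditive (gauge_ge0 delta) F) _.
apply: lee_nneseries => [n _ _|n _]; first exact: mu_ext_ge0.
by rewrite -hausdorff_preE; exact: hausdorff_pre_le.
Qed.

HB.instance Definition _ := isOuterMeasure.Build R X (hausdorff d)
  hausdorff0 hausdorff_ge0 le_hausdorff hausdorff_sigma_subadditive.

End hausdorff_outer_measure.

Section hausdorff_measure.
Context (R : realType) (disp : measure_display)
  (X : metricMeasurableType R disp) (d : R).

Definition hausdorff_outer : {outer_measure set X -> \bar R} := hausdorff d.

Definition hausdorff_measure :
    {measure set (caratheodory_type hausdorff_outer) -> \bar R} :=
  (hausdorff_outer : set (caratheodory_type hausdorff_outer) -> \bar R).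

End hausdorff_measure.
Arguments hausdorff_outer {R disp} X d.
Arguments hausdorff_measure {R disp} X d.

Section Lebesgue_spaces.
Context (R : realType) (disp : measure_display) (T : measurableType disp)
  (mu : {measure set T -> \bar R}).

(* For [1 <= p] this is the norm of [L^p(D, mu)] as [Lnorm] integrates the
   extension of [f] by 0 outside [D]. *)
Definition Lp_norm (D : set T) (p : R) (f : T -> \bar R) : \bar R :=
  Lnorm mu p%:E (f \_ D).

Definition Lp (D : set T) (p : R) (f : T -> \bar R) : Prop :=
  measurable_fun D f /\ Lp_norm D p f < +oo.

(* Division is the one of \bar R, where +oo^-1 = 0. *)
Definition average (A : set T) (u : T -> \bar R) : \bar R :=
  (mu A)^-1 * \int[mu]_(x in A) u x.

(* [tr] is a mapping into [L^q(E, mu)] from the space [dom] with norm [norm];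
   functions are used instead of their classes modulo null sets. *)
Section mappings_into_Lq.
Context (V : Type) (dom : set V) (norm : V -> \bar R) (E : set T) (q : R)
  (tr : V -> T -> R).

Definition maps_into_Lq : Prop :=
  forall u, dom u -> Lp E q (EFin \o tr u).

Definition bounded_into_Lq : Prop :=
  maps_into_Lq /\
  exists K : R, forall u, dom u ->
    Lp_norm E q (EFin \o tr u) <= K%:E * norm u.

Definition compact_into_Lq : Prop :=
  maps_into_Lq /\
  forall u_ : V^nat,
    (forall n, dom (u_ n)) ->
    (exists K : R, forall n, norm (u_ n) <= K%:E) ->
    exists2 phi : nat -> nat, {homo phi : m n / (m < n)%N} &
      exists2 v : T -> R, Lp E q (EFin \o v) &
        Lp_norm E q (fun x => (tr (u_ (phi n)) x - v x)%:E)
          @[n --> \oo] --> 0.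

End mappings_into_Lq.

End Lebesgue_spaces.

(* Below, a subset [Z] is regarded as a metric space in its own right, equipped
   with the restriction of [mu]: only the points, balls and curves of [Z] and
   the values on [Z] of functions defined on [X] matter. *)
Section metric_measure_space.
Context (R : realType) (disp : measure_display)
  (X : metricMeasurableType R disp) (mu : {measure set X -> \bar R}).

Definition complete_borel : Prop :=
  (@open X `<=` measurable) /\ measure_is_complete mu.

Context (Z : set X).

Definition borel_fun disp' (Y : measurableType disp') (g : X -> Y) : Prop :=
  measurable_fun (Z : set (g_sigma_algebraType (@open X))) g.

Definition ball_of (x : X) (r : R) : set X := ball x r `&` Z.

Definition hajlasz_gradient (alpha : R) (u g : X -> R) : Prop :=
  [/\ borel_fun g, forall x, Z x -> (0 <= g x)%R &
    exists2 N : set X, mu.-negligible N &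
      forall x y, (Z `\` N) x -> (Z `\` N) y ->
        (`|u x - u y| <= mdist x y `^ alpha * (g x + g y))%R].

Definition hajlasz_norm (alpha p : R) (u : X -> R) : \bar R :=
  Lp_norm mu Z p (EFin \o u) +
  ereal_inf [set Lp_norm mu Z p (EFin \o g) | g in hajlasz_gradient alpha u].

Definition hajlasz_space (alpha p : R) (u : X -> R) : Prop :=
  Lp mu Z p (EFin \o u) /\
  exists2 g, hajlasz_gradient alpha u g & Lp mu Z p (EFin \o g).

Definition curve_length (gamma : R -> X) (a b : R) : \bar R :=
  ereal_sup [set (\sum_(i < size s)
      mdist (gamma (nth a (a :: s) i)) (gamma (nth a s i)))%R%:E
    | s in [set s : seq R | itv_partition a b s]].

(* A curve is a pair [(l, gamma)] of its length and its parameterization by arc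
   length on [0, l]; the values of [gamma] outside [0, l] are irrelevant.
   Constant curves are excluded. *)
Definition rectifiable_curve (c : R * (R -> X)) : Prop :=
  [/\ (0 < c.1)%R,
      (forall t, (0 <= t <= c.1)%R -> Z (c.2 t)) &
      (forall a b, (0 <= a)%R -> (a <= b)%R -> (b <= c.1)%R ->
        curve_length c.2 a b = (b - a)%:E)].

Definition curve_integral (c : R * (R -> X)) (g : X -> \bar R) : \bar R :=
  \int[lebesgue_measure]_(t in `[0%R, c.1]) g (c.2 t).

(* In \bar R, [`|a - b| = +oo] as soon as [a] or [b] is infinite, including when
   [a = b]. *)
Definition upper_gradient_on (c : R * (R -> X)) (u g : X -> \bar R) : Prop :=
  `|u (c.2 0%R) - u (c.2 c.1)| <= curve_integral c g.

Definition nneg_borel (g : X -> \bar R) : Prop :=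
  borel_fun g /\ forall x, Z x -> 0 <= g x.

Definition upper_gradient (u g : X -> \bar R) : Prop :=
  nneg_borel g /\ forall c, rectifiable_curve c -> upper_gradient_on c u g.

Definition exceptional (p : R) (Gamma : set (R * (R -> X))) : Prop :=
  exists rho : X -> \bar R,
    [/\ nneg_borel rho, Lp mu Z p rho &
      forall c, Gamma c -> curve_integral c rho = +oo].

Definition weak_upper_gradient (p : R) (u g : X -> \bar R) : Prop :=
  nneg_borel g /\
  exists2 Gamma, exceptional p Gamma &
    forall c, rectifiable_curve c -> ~ Gamma c -> upper_gradient_on c u g.

Definition Lp_loc (p : R) (g : X -> \bar R) : Prop :=
  forall x r, Z x -> (0 < r)%R -> Lp mu (ball_of x r) p g.

Definition minimal_weak_upper_gradient (p : R) (u g : X -> \bar R) : Prop :=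
  [/\ weak_upper_gradient p u g, Lp_loc p g &
    forall h, weak_upper_gradient p u h -> Lp_loc p h ->
      {ae mu, forall x, Z x -> g x <= h x}].

Definition newtonian_norm (p : R) (u : X -> \bar R) : \bar R :=
  ((\int[mu]_(x in Z) `|u x| `^ p) +
   ereal_inf [set \int[mu]_(x in Z) g x `^ p | g in upper_gradient u]) `^ p^-1.

Definition newtonian_space (p : R) (u : X -> \bar R) : Prop :=
  measurable_fun Z u /\ newtonian_norm p u < +oo.

Definition supports_poincare (p : R) : Prop :=
  exists C lambda : R, [/\ (0 < C)%R, (1 <= lambda)%R &
    forall x r, Z x -> (0 < r)%R ->
    let B := ball_of x r in let lB := ball_of x (lambda * r) in
    0 < mu B -> mu B < +oo ->
    forall u g, Lp_loc 1 u -> minimal_weak_upper_gradient p u g ->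
      Lp mu Z p g ->
      average mu B (fun y => `|u y - average mu B u|) <=
      C%:E * diam B * (average mu lB (fun y => g y `^ p)) `^ p^-1].

Definition trace (u : X -> \bar R) (x : X) : R :=
  lim (fine (average mu (ball_of x r) u) @[r --> 0^'+]).

(* For almost every [x \in E] with respect to the [d]-dimensional Hausdorff
   measure, the limit defining the trace exists and is finite. *)
Definition has_trace (d : R) (E : set X) (u : X -> \bar R) : Prop :=
  {ae hausdorff_measure X d, forall x, E x ->
    average mu (ball_of x r) u @[r --> 0^'+] --> (trace u x)%:E}.

End metric_measure_space.

(* Main.v *)
Require Import Defs.
From HB Require Import structures.
From mathcomp Require Import all_boot all_order all_algebra.
From mathcomp Require Import all_classical all_reals all_analysis measurable_realfun.
From mathcomp Require Import ring lra.

Set Implicit Arguments.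
Unset Strict Implicit.
Unset Printing Implicit Defensive.

Import Order.TTheory GRing.Theory Num.Theory.
Import numFieldNormedType.Exports.

Local Open Scope classical_set_scope.
Local Open Scope ring_scope.
Local Open Scope ereal_scope.

(* At scale r_a = rho / 2^a let T_a u (x) be the average of u over a ball of radius r_a
   centred at a point, close to x, of a finite r_a-separated net of E.  Both a Hajlasz
   gradient and the Poincare inequality bound |T_(a+1) u - T_a u| by
   r_a^beta (nu (B) / mu (B))^(1/p), where nu is the integral of the p-th power of the
   gradient.  The two-sided bound on the Hausdorff measure bounds the overlap of the balls
   at each scale, so the sum over all scales of the tau-th powers of these increments, with
   geometrically growing weights, is integrable on E as soon as d + beta tau - s tau / p > 0.
   Hence T_a u converges almost everywhere, at a geometric rate controlled in L^tau.  As each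
   T_a has finite rank, a diagonal argument gives compactness.

   In the borderline case q (s - p) = d p this loses a logarithm, so one truncates instead,
   at the levels t_b proportional to 2^(b (s - p) / p).  If the trace exceeds t_b at x, some
   scale r_(b+n) carries an amount of energy at least eps t_b^p 2^(- kappa n) mu(B) / r^p.  A
   cutoff function removes the balls whose energy is far larger than expected at the level
   b, after which the sets carrying the energies for different b overlap boundedly, and the
   estimates sum over b, n and the size of the energy.  The truncation is performed by
   hand-made upper gradients, since the sets {u > t} need not be Borel modulo null sets. *)

(** * Hausdorff measure of balls *)

(** The strict inequalities on [q] enter only through the positivity of
    [d + beta * tau - s * tau / p] with [tau] the larger of [p] and [q]; for [tau = q] this number
    is [(d * p - q * (s - beta * p)) / p]. The main obstacle is that finiteness and doubling of [mu]
    are known only for small balls centred on [E], which may lie in the boundary of [Omega], whereas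
    the Poincare inequality concerns balls centred in [Omega], functions integrable on every ball,
    and minimal gradients. Bounded functions are therefore cut off near [E], centres are moved into
    [Omega], and minimal weak upper gradients are constructed; being almost everywhere below any
    explicit gradient, they need no further description. No derivative along curves is taken:
    gradients are compared through integral bounds on all subintervals. In the borderline case
    [t_b ^ q * r_b ^ d] does not depend on [b]. This ties the level [b] to the scale [r_b], where
    averages of [|u|] are still at most [t_b / 4], so that only finer scales matter. The exponent
    [kappa] is half of the excess [d - s + p], which leaves a geometric gain in [n] after
    covering. *)

Section hausdorff_borel.
Context (R : realType) (disp : measure_display)
  (X : metricMeasurableType R disp) (d : R).
Local Notation H := (hausdorff_outer X d).
Implicit Types (A B : set X).

Lemma diam0 : diam (@set0 X) = -oo.
Proof.
rewrite /diam (_ : [set _ | _ in _ & _ in _] = set0) ?ereal_sup0//.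
by rewrite -subset0 => z [x].
Qed.

Lemma hausdorff_pre_antitone (s t : R) A : (s <= t)%R ->
  hausdorff_pre d t A <= hausdorff_pre d s A.
Proof.
move=> st; apply: ereal_inf_le_tmp => _ [S [dS AS] <-]; exists S => //; split => // k.
by rewrite (le_trans (dS k))// lee_fin.
Qed.

(** A covering set of diameter at most [t < delta] cannot meet both [A] and [B], so every cover
    splits into a cover of [A] and a cover of [B]. *)
Lemma hausdorff_pre_separated (t delta : R) A B : (t < delta)%R ->
  (forall x y, A x -> B y -> (delta <= mdist x y)%R) ->
  hausdorff_pre d t A + hausdorff_pre d t B <= hausdorff_pre d t (A `|` B).
Proof.
move=> td AB; apply: le_ereal_inf_tmp => _ [S [dS ABS] <-].
(* Sets that miss [C] are replaced by the empty set, which costs nothing and whose diameter [-oo]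
   respects the bound. *)
pose r C k := if `[< S k `&` C !=set0 >] then S k else set0.
have rle C : C `<=` A `|` B ->
    hausdorff_pre d t C <= \sum_(k <oo) diam_pow d (r C k).
  move=> CAB; apply: ereal_inf_lbound; exists (r C) => //; split => [k|x Cx].
    by rewrite /r; case: ifPn => // _; rewrite diam0 leNye.
  have [k _ Skx] := ABS _ (CAB _ Cx); exists k => //.
  by rewrite /r ifT//; apply/asboolP; exists x.
apply: le_trans (leeD (rle A _) (rle B _)) _; [by left|by right|].
rewrite -nneseriesD; try by move=> *; exact: diam_pow_ge0.
apply: lee_nneseries => [k _ _|k _].
  by rewrite adde_ge0//; exact: diam_pow_ge0.
rewrite /r; case: ifPn => [/asboolP[x [Sx Ax]]|_]; last first.
  rewrite {1}/diam_pow eqxx add0e.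
  by case: ifPn => // _; rewrite /diam_pow eqxx; exact: diam_pow_ge0.
case: ifPn => [/asboolP[y [Sy By]]|_]; last first.
  by rewrite {2}/diam_pow eqxx adde0.
have : (mdist x y)%:E <= t%:E.
  by apply: le_trans (dS k); apply: ereal_sup_ubound; exists x => //; exists y.
by rewrite lee_fin leNgt (lt_le_trans td)//; exact: AB.
Qed.

(** The property of metric outer measures. The two suprema over scales are independent, so [A] and
    [B] are tested at separate scales [s] and [t], then compared at a common scale below [delta]. *)
Lemma hausdorff_separated (delta : R) A B : (0 < delta)%R ->
  (forall x y, A x -> B y -> (delta <= mdist x y)%R) ->
  H A + H B <= H (A `|` B).
Proof.
move=> d0 AB.
have preC s t : (0 < s)%R -> (0 < t)%R ->
    hausdorff_pre d s A + hausdorff_pre d t B <= H (A `|` B).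
  move=> s0 t0; pose m := (Num.min (Num.min s t) (delta / 2))%R.
  have m0 : (0 < m)%R by rewrite !lt_min s0 t0 divr_gt0.
  have md : (m < delta)%R.
    by rewrite gt_min ltr_pdivrMr// ltr_pMr// (ltrDl 1 1) ltr01 orbT.
  apply: (@le_trans _ _ (hausdorff_pre d m A + hausdorff_pre d m B)).
    by apply: leeD; apply: hausdorff_pre_antitone; rewrite !ge_min lexx ?orbT.
  apply: (le_trans (hausdorff_pre_separated md AB)).
  by apply: ereal_sup_ubound; exists m.
have [->|fH] := eqVneq (H (A `|` B)) +oo; first by rewrite leey.
have fH' : H (A `|` B) \is a fin_num by rewrite ge0_fin_numE ?ltey.
have fA : H A \is a fin_num.
  by rewrite ge0_fin_numE// (le_lt_trans (le_outer_measure _ _ _ _) (_ : H (A `|` B) < _))// ltey.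
rewrite -leeBrDl//.
apply: ge_ereal_sup => _ [t /= t0 <-].
have pf : hausdorff_pre d t B \is a fin_num.
  rewrite ge0_fin_numE; first last.
    by apply: le_ereal_inf_tmp => _ [S _ <-]; apply: nneseries_ge0 => *; exact: diam_pow_ge0.
  rewrite (@le_lt_trans _ _ (H (A `|` B)))// ?ltey//.
  apply: (@le_trans _ _ (H B)); last exact: le_outer_measure.
  by apply: ereal_sup_ubound; exists t.
rewrite leeBrDl// -leeBrDr//.
apply: ge_ereal_sup => _ [s /= s0 <-].
by rewrite leeBrDr//; exact: preC.
Qed.

Section rings.
Variables (x0 : X) (r : R).
Let s (n : nat) : R := (r - n.+1%:R^-1)%R.
Let sS n : (s n < s n.+1)%R.
Proof. by rewrite ltrD2l ltrN2 ltf_pV2 ?posrE// ltr_nat. Qed.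
Let s_le m n : (m <= n)%N -> (s m <= s n)%R.
Proof. by move=> mn; rewrite lerD2l lerN2 lef_pV2 ?posrE// ler_nat ltnS. Qed.
Let s_lt n : (s n < r)%R.
Proof. by rewrite ltrBlDr ltrDl. Qed.

Let sep A B (a b : R) : (a < b)%R ->
  (forall x, A x -> (mdist x0 x <= a)%R) -> (forall x, B x -> (b <= mdist x0 x)%R) ->
  H A + H B <= H (A `|` B).
Proof.
move=> ab Aa Bb; apply: (@hausdorff_separated (b - a)%R); first by rewrite subr_gt0.
move=> x y /Aa xa /Bb yb; rewrite lerBlDr (le_trans yb)//.
by rewrite (le_trans (metric_triangle _ x _))// addrC lerD2l.
Qed.

(** Caratheodory's argument: the rings accumulate from inside at the sphere of radius [r]. Rings
    with indices of the same parity are at positive distance from each other, hence the sums over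
    [k.*2 + o] below. *)
Let ring A n := A `&` [set y | (s n <= mdist x0 y < s n.+1)%R].

Let ring_sum A (o n : nat) :
  \sum_(0 <= k < n) H (ring A (k.*2 + o)) <=
  H (\bigcup_(k in `I_n) ring A (k.*2 + o)).
Proof.
elim: n => [|n IH]; first by rewrite big_geq.
rewrite big_nat_recr//= (_ : \bigcup_(_ in `I_n.+1) _ =
  \bigcup_(k in `I_n) ring A (k.*2 + o) `|` ring A (n.*2 + o)).
  apply: le_trans (leeD IH (lexx _)) _.
  have [n0|n0] := posnP n.
    rewrite (_ : \bigcup_(_ in _) _ = set0) ?outer_measure0 ?add0e ?set0U//.
    by rewrite n0 -subset0 => y [].
  apply: (@sep _ _ (s (n.*2 + o).-1) (s (n.*2 + o))).
  - have : (0 < n.*2 + o)%N by rewrite addn_gt0 double_gt0 n0.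
    by case: (n.*2 + o)%N => // m _; exact: sS.
  - move=> y [k /= kn [_ /= /andP[_ /ltW]]] /le_trans; apply; apply: s_le.
    by rewrite -ltnS prednK ?addn_gt0 ?double_gt0 ?n0// -addSn -addSn leq_add2r
       -doubleS leq_double.
  - by move=> y [_ /= /andP[]].
apply/seteqP; split => [y [k /= kn rky]|y [[k /= kn rky]|rny]].
- by move: kn; rewrite ltnS leq_eqVlt => /orP[/eqP kn|kn];
    [right; rewrite -kn|left; exists k].
- by exists k => //=; exact: ltnW.
- by exists n => /=.
Qed.

Let ring_summable A : H A < +oo -> \sum_(n <oo) H (ring A n) < +oo.
Proof.
move=> HA.
have le2 n : \sum_(0 <= k < n.*2) H (ring A k) <= H A + H A.
  have -> : \sum_(0 <= k < n.*2) H (ring A k) =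
      \sum_(0 <= k < n) H (ring A (k.*2 + 0)) + \sum_(0 <= k < n) H (ring A (k.*2 + 1)).
    elim: n => [|n IH]; first by rewrite !big_geq// adde0.
    by rewrite doubleS !big_nat_recr//= IH addn0 addn1 addeACA addeA.
  by apply: leeD; apply: (le_trans (ring_sum A _ n));
    apply: le_outer_measure => y [k _ []].
apply: (@le_lt_trans _ _ (H A + H A)); last by rewrite lte_add_pinfty.
apply: lime_le; first by apply: is_cvg_nneseries.
apply: nearW => n; apply: le_trans (le2 n).
apply: lee_sum_nneg_natr => //; rewrite -addnn; exact: leq_addr.
Qed.

(** The part of [A] inside radius [s n] is separated from the outside of the ball, and the rest of
    the ball is covered by the rings from [n] on, whose measures form the tail of a convergent
    series. Balls suffice later, because the functions on [E] used below are assembled from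
    indicators of balls. *)
Lemma hausdorff_ball : H.-caratheodory (ball x0 r).
Proof.
apply: le_caratheodory_measurable => A.
have [->|HA] := eqVneq (H A) +oo; first by rewrite leey.
have {}HA : H A < +oo by rewrite ltey.
have step n : H (A `&` ball x0 r) + H (A `&` ~` ball x0 r) <=
    H A + \sum_(n <= k <oo) H (ring A k).
  pose An := A `&` [set y | (mdist x0 y < s n)%R].
  have le1 : H An + H (A `&` ~` ball x0 r) <= H A.
    apply: (@le_trans _ _ (H (An `|` (A `&` ~` ball x0 r)))); last first.
      by apply: le_outer_measure => y [[]|[]].
    apply: (@sep _ _ (s n) r) => //.
    + by move=> y [_ /ltW].
    + by move=> y [_]; rewrite ballEmdist /= => /negP; rewrite -leNgt.
  have le2 : H (A `&` ball x0 r) <= H An + \sum_(n <= k <oo) H (ring A k).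
    apply: (@le_trans _ _ (H (An `|` \bigcup_k ring A (k + n)))).
      apply: le_outer_measure => y [Ay]; rewrite ballEmdist /= => yr.
      have [yn|yn] := ltP (mdist x0 y) (s n); first by left.
      right.
      (* The least [k] with the point inside radius [s k] is one more than the index of its ring. *)
      have /ex_minnP[m] : exists k, (mdist x0 y < s k)%R.
        have [k kr] := ltr_add_invr yr; exists k.
        by rewrite ltrBrDr.
      case: m => [|m] ym minm.
        by move: yn; rewrite leNgt (lt_le_trans ym)// s_le.
      have nm : (n <= m)%N.
        rewrite leqNgt; apply/negP => mn.
        by move: yn; rewrite leNgt (lt_le_trans ym)// s_le.
      exists (m - n)%N => //; split => //=; rewrite subnK// ym andbT leNgt.
      by apply/negP => /minm; rewrite ltnn.
    apply: le_trans (outer_measureU2 _ _ _) _; rewrite leeD2l//.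
    apply: le_trans (outer_measure_sigma_subadditive _ _) _.
    by rewrite -(@nneseries_addn _ (fun k => H (ring A k)) n).
  by apply: (le_trans (leeD2r _ le2)); rewrite addeAC leeD2r.
apply/lee_addgt0Pr => e e0.
have /fine_cvgP[_ /cvgrPdist_lt /(_ _ e0)[n _ /(_ n (leqnn n))]] :=
  nneseries_tail_cvg (ring_summable HA) (fun k _ => outer_measure_ge0 _ _).
rewrite sub0r normrN => tail.
apply: le_trans (step n) _; rewrite leeD2l//.
have tf : \sum_(n <= k <oo) H (ring A k) \is a fin_num.
  rewrite ge0_fin_numE ?nneseries_ge0// (le_lt_trans _ (ring_summable HA))//.
  by rewrite [leRHS](@nneseries_split _ _ 0 n)// add0n leeDr// sume_ge0.
by rewrite -(fineK tf) lee_fin (le_trans (ler_norm _))// ltW.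
Qed.

End rings.
End hausdorff_borel.

(** * Separated nets and grids *)

Section separated_nets.
Context (R : realType) (disp : measure_display)
  (X : metricMeasurableType R disp) (E : set X).

(** Induction on a list of balls of radius [r / 2] covering [E]. Two points of one such ball are
    less than [r] apart, so a ball adds at most one point to the net; after that, or if no point can
    be added, its points are all within [r] of the net. *)
Lemma exists_separated_net (r : R) : totally_bounded E -> (0 < r)%R ->
  exists s : seq X, [/\ (forall c, c \in s -> E c),
    pairwise (fun x y => (r <= mdist x y)%R) s &
    forall x, E x -> exists2 c, c \in s & (mdist c x < r)%R].
Proof.
move=> Etb r0; have [t Et] := Etb _ (divr_gt0 r0 (ltr0Sn _ 1)).
suff [s [sE sr ts]] : exists s : seq X, [/\ (forall c, c \in s -> E c),
    pairwise (fun x y => (r <= mdist x y)%R) s &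
    forall x, E x -> (exists2 z, z \in t & ball z (r / 2) x) ->
      exists2 c, c \in s & (mdist c x < r)%R].
  exists s; split => // x Ex; apply: ts => //.
  by have [z /= zt zx] := Et _ Ex; exists z.
elim: t {Et} => [|z t [s [sE sr ts]]]; first by exists [::]; split => // x _ [].
have [[w [Ew zw ws]]|nw] := pselect (exists w, [/\ E w, ball z (r / 2) w &
    forall c, c \in s -> (r <= mdist w c)%R]).
  exists (w :: s); split.
  - by move=> c; rewrite inE => /orP[/eqP->|/sE].
  - by rewrite /= sr andbT; apply/allP => c /ws.
  - move=> x Ex [z' ]; rewrite inE => /orP[/eqP ->|z't] zx.
      exists w; first exact: mem_head.
      have := ball_splitr zw zx; by rewrite ballEmdist.
    have [|c cs cx] := ts x Ex; first by exists z'.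
    by exists c => //; rewrite inE cs orbT.
exists s; split => // x Ex [z']; rewrite inE => /orP[/eqP ->|z't] zx; last first.
  by apply: ts => //; exists z'.
apply: contrapT => nc; apply: nw; exists x; split => // c cs.
by rewrite leNgt; apply/negP => xc; apply: nc; exists c => //; rewrite metric_sym.
Qed.

Variables (d : R) (F : set X) (C C' r0 : R).
Local Notation H := (hausdorff_outer X d).
Hypothesis C0 : (0 < C)%R.
Hypothesis hreg : forall x r, E x -> (0 < r <= r0)%R ->
  (C * r `^ d)%:E <= H (F `&` ball x r) <= (C' * r `^ d)%:E.

(** Volume comparison: the balls of radius [r / 2] about separated points are disjoint, each meets
    [F] in measure at least [C * (r / 2) ^ d], and all lie in one ball of radius [(2 * L + 1) * r].
    That ball is centred at a point [c0] of the list and not at [y], because the upper bound holds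
    only at points of [E]. *)
Lemma separated_packing (s : seq X) (y : X) (r L : R) :
  (0 < r)%R -> (1 <= L)%R -> ((2 * L + 1) * r <= r0)%R ->
  (forall c, c \in s -> E c) ->
  pairwise (fun x y => (r <= mdist x y)%R) s ->
  (forall c, c \in s -> (mdist c y < L * r)%R) -> s != [::] ->
  ((size s)%:R <= C' / C * (2 * (2 * L + 1)) `^ d)%R.
Proof.
move=> r_gt0 L1 Lr sE sr sy.
case: s sE sr sy => // c0 s0 sE sr sy _.
set s := c0 :: s0.
have pack (t : seq X) : pairwise (fun x y => (r <= mdist x y)%R) t ->
    \sum_(c <- t) H (F `&` ball c (r / 2)) <=
    H (F `&` \bigcup_(c in [set` t]) ball c (r / 2)).
  elim: t => [|c t IH] /=; first by rewrite big_nil => _; exact: outer_measure_ge0.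
  move=> /andP[/allP ct /IH {}IH]; rewrite big_cons.
  rewrite [leRHS](hausdorff_ball d c (r / 2)%R (F `&` _)).
  apply: leeD.
    apply: le_outer_measure => x [Fx cx]; split => //; split => //.
    by exists c => //=; rewrite mem_head.
  apply: le_trans IH _; apply: le_outer_measure => x [Fx [z /= zt zx]].
  split; first by split => //; exists z => //=; rewrite inE zt orbT.
  move=> cx; have := ball_splitl zx cx.
  by rewrite ballEmdist /= ltNge metric_sym ct.
have : \sum_(c <- s) (C * (r / 2) `^ d)%:E <= (C' * ((2 * L + 1) * r) `^ d)%:E.
  apply: (@le_trans _ _ (\sum_(c <- s) H (F `&` ball c (r / 2)))).
    rewrite big_seq [leRHS]big_seq; apply: lee_sum => c cs.
    apply: (andP (hreg (sE _ cs) _)).1; rewrite divr_gt0//=.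
    apply: le_trans Lr; rewrite mulrC; apply: ler_wpM2r; first exact: ltW.
    by rewrite (@le_trans _ _ 1%R)// ?invf_le1 ?ler1n// lerDr mulr_ge0// (le_trans _ L1).
  apply: le_trans (pack _ sr) _.
  have c0s : c0 \in s by rewrite mem_head.
  have r1 : (0 < (2 * L + 1) * r <= r0)%R.
    by rewrite Lr mulr_gt0// ltr_wpDl// mulr_ge0// (le_trans _ L1).
  have /andP[_] := hreg (sE _ c0s) r1; apply: le_trans.
  apply: le_outer_measure => x [Fx [c /= cs cx]]; split => //; move: cx.
  rewrite !ballEmdist /= => cx.
  rewrite (le_lt_trans (metric_triangle _ c _))//.
  rewrite (le_lt_trans (lerD (metric_triangle _ y _) (lexx _)))//.
  rewrite mulrDl mul1r; apply: ltrD; last first.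
    by rewrite (lt_le_trans cx)// ler_pdivrMr// ler_peMr ?ler1n// ltW.
  by rewrite -mulrA mulr_natl mulr2n; apply: ltrD; rewrite ?(metric_sym y) ?sy.
rewrite sumEFin lee_fin big_const_seq count_predT iter_addr_0 => le1.
have rd : (0 < (r / 2) `^ d)%R by rewrite powR_gt0// divr_gt0.
have {}le1 : ((size s)%:R * (C * (r / 2) `^ d) <=
    C' * ((2 * L + 1) * r) `^ d)%R by rewrite mulr_natl.
rewrite -(ler_pM2r (mulr_gt0 C0 rd)) (le_trans le1)// mulrACA.
have L0 : (0 <= 2 * L + 1)%R by rewrite addr_ge0// mulr_ge0// (le_trans _ L1).
rewrite divfK ?gt_eqF// -powRM ?mulr_ge0 ?divr_ge0 ?(ltW r_gt0)//.
by have -> : (2 * (2 * L + 1) * (r / 2) = (2 * L + 1) * r)%R by field.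
Qed.
End separated_nets.

(* [mass_dbl] iterates the doubling inequality from [t] to [L * t]; [net_overlap] is where
   both sides of the bound on the Hausdorff measure are used. *)
Record grid (R : realType) (disp : measure_display)
    (X : metricMeasurableType R disp) (mu : {measure set X -> \bar R})
    (Omega E : set X) (d s L : R) := Grid {
  rho : R ;
  net : nat -> seq X ;
  overlap : nat ;
  dblC : R ;
  lowC : R ;
  hausC : R ;
  rho_gt0 : (0 < rho)%R ;
  dblC_gt0 : (0 < dblC)%R ;
  lowC_gt0 : (0 < lowC)%R ;
  hausC_gt0 : (0 < hausC)%R ;
  net_sub : forall a c, c \in net a -> E c ;
  net_cover : forall a x, E x ->
    exists2 c, c \in net a & (mdist c x < rho / 2 ^+ a)%R ;
  net_overlap : forall a y,
    (size [seq c <- net a | (mdist c y < L * (rho / 2 ^+ a))%R] <= overlap)%N ;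
  mass_fin : forall x t, E x -> (0 < t <= L * rho)%R ->
    0 < mu (ball_of Omega x t) < +oo ;
  mass_dbl : forall x t, E x -> (0 < t <= rho)%R ->
    mu (ball_of Omega x (L * t)) <= dblC%:E * mu (ball_of Omega x t) ;
  mass_low : forall x t, E x -> (0 < t <= rho)%R ->
    (lowC * t `^ s)%:E <= mu (ball_of Omega x t) ;
  haus_up : forall x t, E x -> (0 < t <= L * rho)%R ->
    hausdorff d (E `&` ball x t) <= (hausC * t `^ d)%:E }.

Section grid_exists.
Context (R : realType) (disp : measure_display)
  (X : metricMeasurableType R disp) (mu : {measure set X -> \bar R}).
Variables (d s r0 : R) (Omega E F : set X).
Hypotheses (hmu : complete_borel mu) (hOmega : open Omega).
Hypotheses (hd : (0 < d)%R) (hr0 : (0 < r0)%R) (hEF : E `<=` F).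
Hypothesis hreg : exists C C' : R, [/\ (0 < C)%R, (0 < C')%R &
    forall x r, E x -> (0 < r <= r0)%R ->
      (C * r `^ d)%:E <= hausdorff d (F `&` ball x r) <= (C' * r `^ d)%:E].
Hypothesis hEtb : totally_bounded E.
Hypothesis hdbl : exists C'' C''' : R, [/\ (0 < C'')%R, (0 < C''')%R &
    forall x r, E x -> (0 < r <= r0)%R ->
      [/\ 0 < mu (ball x (2 * r) `&` Omega),
          mu (ball x (2 * r) `&` Omega) <= C''%:E * mu (ball x r `&` Omega),
          C''%:E * mu (ball x r `&` Omega) < +oo &
          (C''' * r `^ s)%:E <= mu (ball x r `&` Omega)]].

Lemma mball_open (x : X) (r : R) : open (ball x r).
Proof.
rewrite openE => y; rewrite ballEmdist /= => xy; apply/nbhs_ballP.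
exists (r - mdist x y)%R => /=; first by rewrite subr_gt0.
move=> z; rewrite !ballEmdist /= => yz.
by rewrite (le_lt_trans (metric_triangle _ y _))// -ltrBrDl.
Qed.

Lemma measurable_ball_of x r : measurable (ball_of Omega x r).
Proof. by apply: hmu.1; apply: openI => //; exact: mball_open. Qed.

Lemma ball_of_subset (x y : X) (r t : R) : (mdist y x + r <= t)%R ->
  ball_of Omega x r `<=` ball_of Omega y t.
Proof.
move=> xyr z []; rewrite ballEmdist /= => xz Oz; split => //.
rewrite ballEmdist /=; apply: le_lt_trans (metric_triangle _ x _) _.
by apply: lt_le_trans xyr; rewrite ltrD2l.
Qed.

Lemma exists_grid (L delta : R) : (1 <= L)%R -> (0 < delta)%R ->
  exists g : grid mu Omega E d s L, (rho g <= delta)%R.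
Proof.
move=> L1 delta0; have [C [C' [C0 C'0 reg]]] := hreg.
have [D [l [D0 l0 dbl]]] := hdbl.
have L0 : (0 < L)%R by exact: lt_le_trans L1.
have [k Lk] : exists k, (L <= 2 ^+ k)%R.
  exists (Num.truncn L).+1; rewrite ltW// (lt_le_trans (truncnS_gt _))//.
  by rewrite -natrX ler_nat ltnW// ltn_expl.
(* The three bounds are the requested one, room for the packing ball of radius [(2 * L + 1) * rho],
   and room for [k] doublings, where [L <= 2 ^+ k]. *)
pose rho := Num.min delta (Num.min (r0 / (2 * L + 1)) (r0 / 2 ^+ k))%R.
have L2 : (0 < 2 * L + 1)%R by rewrite ltr_wpDl// mulr_ge0// ltW.
have rho0 : (0 < rho)%R by rewrite !lt_min delta0 !divr_gt0// exprn_gt0.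
have rhoL : ((2 * L + 1) * rho <= r0)%R.
  by rewrite mulrC -ler_pdivlMr// !ge_min lexx orbT.
have rhok : (2 ^+ k * rho <= r0)%R.
  by rewrite mulrC -ler_pdivlMr ?exprn_gt0// !ge_min lexx !orbT.
have rada0 a : (0 < rho / 2 ^+ a)%R by rewrite divr_gt0// exprn_gt0.
have rad_le a : (rho / 2 ^+ a <= rho)%R.
  by rewrite ler_pdivrMr ?exprn_gt0// ler_peMr ?exprn_ege1 ?ler1n ?ltW.
have [net netP] : exists net : nat -> seq X, forall a,
    [/\ (forall c, c \in net a -> E c),
    pairwise (fun x y => (rho / 2 ^+ a <= mdist x y)%R) (net a) &
    forall x, E x -> exists2 c, c \in net a & (mdist c x < rho / 2 ^+ a)%R].
  have [net netP] := choice (fun a => exists_separated_net hEtb (rada0 a)).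
  by exists net.
pose B := (C' / C * (2 * (2 * L + 1)) `^ d)%R.
(* Positivity and finiteness at radius [t] are read off the doubling condition at radius [t / 2]. *)
have mass x t : E x -> (0 < t <= 2 * r0)%R ->
    0 < mu (ball_of Omega x t) < +oo.
  move=> Ex /andP[t0 tr].
  have t2 : (0 < t / 2 <= r0)%R by rewrite divr_gt0//= ler_pdivrMr// mulrC.
  have [] := dbl x (t / 2)%R Ex t2; rewrite mulrC divfK// => -> h1 h2 _.
  by rewrite (le_lt_trans h1).
have Lr0 : (L * rho <= r0)%R.
  apply: le_trans rhoL; rewrite ler_pM2r// mulr_natl mulr2n -addrA lerDl.
  by rewrite addr_ge0// ltW.
have dblk j x t : E x -> (0 < t)%R -> (2 ^+ j * t <= r0)%R ->
    mu (ball_of Omega x (2 ^+ j * t)) <= (D ^+ j)%:E * mu (ball_of Omega x t).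
  move=> Ex t0; elim: j => [|j IH] jr; first by rewrite !expr0 mul1r mul1e.
  have jr' : (0 < 2 ^+ j * t <= r0)%R.
    rewrite mulr_gt0 ?exprn_gt0//=; apply: le_trans jr.
    by rewrite ler_pM2r// exprS ler_peMl ?exprn_ge0// ler1n.
  have [_ + _ _] := dbl x (2 ^+ j * t)%R Ex jr'.
  rewrite mulrA -exprS => /le_trans; apply.
  rewrite exprS EFinM -muleA; apply: lee_wpmul2l; first by rewrite lee_fin ltW.
  by apply: IH; have /andP[] := jr'.
unshelve eexists (@Grid _ _ _ mu Omega E d s L rho net (Num.truncn B).+1 (D ^+ k)%R l C' _ _ _ _ _ _ _ _ _ _ _) => //=.
- by rewrite exprn_gt0.
- by move=> a c; have [+ _ _] := netP a; apply.
- by move=> a x; have [_ _] := netP a; apply.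
- move=> a y; set t := (X in size X).
  have [->//|tn] := eqVneq t [::].
  have [nE np _] := netP a.
  rewrite -(ler_nat R) ltW// (le_lt_trans _ (truncnS_gt _))//.
  have tE c : c \in t -> E c by rewrite mem_filter => /andP[_ /nE].
  have ty c : c \in t -> (mdist c y < L * (rho / 2 ^+ a))%R.
    by rewrite mem_filter => /andP[].
  have rL : ((2 * L + 1) * (rho / 2 ^+ a) <= r0)%R.
    by apply: le_trans rhoL; rewrite ler_pM2l.
  by apply: (separated_packing C0 reg (rada0 a) L1 rL tE _ ty tn) => //;
    exact: pairwise_filter.
- move=> x t Ex /andP[t0 tr]; apply: mass => //; rewrite t0/=.
  by rewrite (le_trans tr)// (le_trans Lr0)// ler_peMl ?ler1n// ltW.
- move=> x t Ex /andP[t0 tr].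
  apply: (@le_trans _ _ (mu (ball_of Omega x (2 ^+ k * t)))).
    apply: le_measure; rewrite ?inE; [exact: measurable_ball_of..|].
    by apply: ball_of_subset; rewrite mdistxx add0r ler_pM2r.
  apply: dblk => //; apply: le_trans rhok.
  by rewrite ler_pM2l// exprn_gt0.
- move=> x t Ex /andP[t0 tr].
  have [|//] := dbl x t Ex _; rewrite t0/= (le_trans tr)// (le_trans _ Lr0)//.
  by rewrite ler_peMl// ltW.
- move=> x t Ex /andP[t0 tr].
  have tr0 : (0 < t <= r0)%R by rewrite t0 (le_trans tr).
  have /andP[_] := reg x t Ex tr0; apply: le_trans.
  by apply: (le_outer_measure (hausdorff_outer X d)) => y [/hEF].
- by rewrite !ge_min lexx.
Qed.

End grid_exists.

(** * Absolutely continuous functions along curves *)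

Section interval_integrals.
Context (R : realType).
Local Notation mu := (@lebesgue_measure R).
Implicit Types (a b c l : R) (H K : R -> \bar R).

Definition Iint H a b := \int[mu]_(t in `[a, b]) H t.

Lemma Iint_ge0 H a b : (forall t, (a <= t <= b)%R -> 0 <= H t) -> 0 <= Iint H a b.
Proof. by move=> H0; apply: integral_ge0 => t /=; rewrite in_itv/= => /H0. Qed.

Lemma measurable_itvS a b l H : (0 <= a)%R -> (b <= l)%R ->
  measurable_fun `[0%R, l] H -> measurable_fun `[a, b] H.
Proof.
move=> a0 bl; apply: measurable_funS => // t /=.
by rewrite !in_itv/= => /andP[/(le_trans a0)-> /le_trans->].
Qed.

Lemma Iint_split H a b c : (a <= c)%R -> (c <= b)%R ->
  measurable_fun `[a, b] H -> (forall t, (a <= t <= b)%R -> 0 <= H t) ->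
  Iint H a b = Iint H a c + Iint H c b.
Proof.
move=> ac cb mH H0; rewrite /Iint -(@integral_itv_obnd_cbnd _ c); last first.
  by apply: measurable_funS mH => // t /=; rewrite !in_itv/= => /andP[/ltW/(le_trans ac)-> ->].
rewrite -ge0_integral_setU//=.
- congr (\int[_]_(t in _) _); apply/seteqP; split => t /=; rewrite !in_itv/=.
    move=> /andP[-> ->]; rewrite !andbT/=; have [|] := leP t c; by [left|right].
  move=> [/andP[-> /le_trans->]|/andP[/ltW/(le_trans ac)-> ->]] //.
- by apply: measurable_funS mH => // t /=; rewrite !in_itv/= => -[/andP[-> /le_trans->]|/andP[/ltW/(le_trans ac)-> ->]].
- by move=> t tab; apply: H0; move: tab => /=; rewrite !in_itv/= => -[/andP[-> /le_trans->]|/andP[/ltW/(le_trans ac)-> ->]].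
- by apply/disj_setPRL => t /=; rewrite !in_itv/= => /andP[ct _] /andP[_ tc]; move: tc; rewrite leNgt ct.
Qed.

Lemma eq_Iint H K a b : measurable_fun `[a, b] H -> measurable_fun `[a, b] K ->
  (forall t, (a < t < b)%R -> H t = K t) -> Iint H a b = Iint K a b.
Proof.
move=> mH mK HK; rewrite /Iint.
have oo G : measurable_fun `[a, b] G -> measurable_fun `]a, b[ G.
  by apply: measurable_funS => // t /=; rewrite !in_itv/= => /andP[/ltW-> /ltW->].
rewrite !(@integral_itv_bndoo _ a b _ true false)//; [|exact: oo..].
by apply: eq_integral => t; rewrite inE/= in_itv/= => /HK.
Qed.

Lemma le_Iint H K a b : measurable_fun `[a, b] H -> measurable_fun `[a, b] K ->
  (forall t, (a <= t <= b)%R -> 0 <= H t) ->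
  (forall t, (a <= t <= b)%R -> H t <= K t) -> Iint H a b <= Iint K a b.
Proof.
by move=> mH mK H0 HK; apply: ge0_le_integral => //= t; rewrite in_itv.
Qed.

Lemma sub_Iint H a b a' b' : (a <= a')%R -> (b' <= b)%R ->
  measurable_fun `[a, b] H -> (forall t, (a <= t <= b)%R -> 0 <= H t) ->
  Iint H a' b' <= Iint H a b.
Proof.
move=> aa bb mH H0; apply: ge0_subset_integral => //= t /=; rewrite !in_itv//=.
by move=> /andP[/(le_trans aa)-> /le_trans->].
Qed.

(* [f] is absolutely continuous with [H] bounding its derivative. *)
Definition ac_bound l (f : R -> R) H := forall a b,
  (0 <= a)%R -> (a <= b)%R -> (b <= l)%R -> (`|f a - f b|)%:E <= Iint H a b.

Section minimum.
Variables (l : R) (f : R -> R) (H1 H2 : R -> \bar R).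
Hypotheses (mH1 : measurable_fun `[0%R, l] H1) (mH2 : measurable_fun `[0%R, l] H2).
Hypotheses (H1_ge0 : forall t, (0 <= t <= l)%R -> 0 <= H1 t)
  (H2_ge0 : forall t, (0 <= t <= l)%R -> 0 <= H2 t).
Hypotheses (iH1 : Iint H1 0 l < +oo) (iH2 : Iint H2 0 l < +oo).
Hypotheses (fH1 : ac_bound l f H1) (fH2 : ac_bound l f H2).

Let K (S : set R) t := if `[< S t >] then H1 t else H2 t.

Let K_ge0 S t : (0 <= t <= l)%R -> 0 <= K S t.
Proof. by rewrite /K; case: ifPn => _; [exact: H1_ge0|exact: H2_ge0]. Qed.

Let mK S : measurable S -> measurable_fun `[0%R, l] (K S).
Proof.
move=> mS; apply: measurable_fun_if => //.
- apply: (measurable_fun_bool true); apply: measurableI => //.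
  rewrite (_ : _ @^-1` _ = S)//; apply/seteqP; split => x /=; [exact: asboolW|exact: asboolT].
- by apply: measurable_funS mH1 => //; exact: subIsetl.
- by apply: measurable_funS mH2 => //; exact: subIsetl.
Qed.

(** The bound by [H1] on [S] and by [H2] elsewhere. It is propagated from finite unions of intervals
    to open sets, then to measurable sets by outer regularity, and finally applied to the set where
    [H1 <= H2]. *)
Let P (S : set R) := measurable S /\ ac_bound l f (K S).

Let P0 : P set0.
Proof.
split=> // a b a0 ab bl; rewrite (_ : K set0 = H2); first exact: fH2.
by apply/funext => t; rewrite /K; case: ifPn => // /asboolP.
Qed.

Let PU S c d : P S -> P (S `|` `]c, d[%classic).
Proof.
move=> [mS PS]; have mSU : measurable (S `|` `]c, d[%classic) by exact: measurableU.
split => // a b a0 ab bl.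
(* [[c', d']] is the part of [[a, b]] inside []c, d[], degenerate if they do not meet. The bound
   [H1] is used on it and [K S] on the two outer pieces. *)
pose c' := Num.max a (Num.min c b); pose d' := Num.max c' (Num.min d b).
have ac' : (a <= c')%R by rewrite le_max lexx.
have c'd' : (c' <= d')%R by rewrite le_max lexx.
have c'b : (c' <= b)%R by rewrite ge_max ab ge_min lexx orbT.
have d'b : (d' <= b)%R by rewrite ge_max c'b ge_min lexx orbT.
have c'0 := le_trans a0 ac'; have d'0 := le_trans c'0 c'd'.
have c'l := le_trans c'b bl; have d'l := le_trans d'b bl.
have nn x y : (0 <= x)%R -> (y <= l)%R -> forall t, (x <= t <= y)%R -> 0 <= K (S `|` `]c, d[%classic) t.
  by move=> x0 yl t /andP[xt ty]; apply: K_ge0; rewrite (le_trans x0)//= (le_trans ty).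
rewrite (@Iint_split _ a b c')//; [|exact: measurable_itvS (mK mSU)|exact: nn].
rewrite (@Iint_split _ c' b d')//; [|exact: measurable_itvS (mK mSU)|exact: nn].
rewrite (@eq_Iint _ (K S) a c'); [|exact: measurable_itvS (mK _)..|]; last first.
  move=> t /andP[ta tc]; rewrite /K asbool_or; case: asboolP => //= _.
  case: ifPn => // /asboolP /=; rewrite in_itv/= => /andP[ct td]; exfalso.
  by move: tc; rewrite lt_max ltNge (ltW ta)/= lt_min ltNge (ltW ct).
rewrite (@eq_Iint _ H1 c' d'); [|exact: measurable_itvS (mK _)|exact: measurable_itvS mH1|]; last first.
  move=> t /andP[tc td]; rewrite /K asbool_or ifT//; apply/orP; right.
  apply/asboolP; rewrite /= in_itv/=; move: tc td.
  rewrite /d' lt_max (ltNge t c') /c' => tc; rewrite (ltW tc)/= lt_min => /andP[-> tb].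
  by move: tc; rewrite gt_max gt_min andbT (ltNge b) (ltW tb) orbF => /andP[].
rewrite (@eq_Iint _ (K S) d' b); [|exact: measurable_itvS (mK _)..|]; last first.
  move=> t /andP[td tb]; rewrite /K asbool_or; case: asboolP => //= _.
  case: ifPn => // /asboolP /=; rewrite in_itv/= => /andP[ct td'']; exfalso.
  by move: td; rewrite gt_max gt_min (ltNge b) (ltW tb) orbF => /andP[_]; rewrite ltNge ltW.
apply: le_trans (leeD (PS _ _ a0 ac' c'l) (leeD (fH1 c'0 c'd' d'l) (PS _ _ d'0 d'b bl))).
rewrite -!EFinD lee_fin.
have -> : (f a - f b = (f a - f c') + ((f c' - f d') + (f d' - f b)))%R by ring.
by apply: (le_trans (ler_normD _ _)); rewrite lerD2l ler_normD.
Qed.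

Let iH12 : mu.-integrable `[0%R, l] (fun t => H1 t + H2 t).
Proof.
apply/integrableP; split; first exact: emeasurable_funD.
under eq_integral.
  move=> t; rewrite inE/= in_itv/= => t0; rewrite gee0_abs; last by rewrite adde_ge0 ?H1_ge0 ?H2_ge0.
  over.
rewrite ge0_integralD//=; first by rewrite lte_add_pinfty.
all: by move=> t; rewrite in_itv.
Qed.

(** Dominated convergence with majorant [H1 + H2]: membership that is eventually constant makes
    [K (S_ n)] converge at almost every point. *)
Let P_lim (S_ : (set R)^nat) (S : set R) : (forall n, P (S_ n)) -> measurable S ->
  {ae mu, forall t, (0 <= t <= l)%R -> \forall n \near \oo, S_ n t <-> S t} -> P S.
Proof.
move=> PS mS SS; split => // a b a0 ab bl.
have [_ _ cv] : [/\ mu.-integrable `[a, b] (K S),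
    [sequence \int[mu]_(x in `[a, b]) `|K (S_ n) x - K S x| ]_n @ \oo --> 0
  & [sequence \int[mu]_(x in `[a, b]) K (S_ n) x ]_n @ \oo --> \int[mu]_(x in `[a, b]) K S x].
  have tl t : `[a, b]%classic t -> (0 <= t <= l)%R.
    by rewrite /= in_itv/= => /andP[/(le_trans a0)-> /le_trans->].
  apply: (@dominated_convergence _ _ _ mu _ _ _ _ (fun t => H1 t + H2 t)) => //.
  - by move=> n; apply: measurable_itvS (mK _) => //; exact: (PS n).1.
  - exact: measurable_itvS (mK _).
  - have [A [mA A0 SA]] := SS; exists A; split => // t /= ht; apply: SA => /= tS.
    apply: ht => /tl /tS {}tS; apply: cvg_near_cst.
    by apply: filterS tS => n Sn; rewrite /K (asbool_equiv_eq Sn).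
  - by apply: integrableS iH12 => // t /tl; rewrite /= in_itv.
  - apply: aeW => t n /tl t0; rewrite gee0_abs ?K_ge0// /K.
    by case: ifPn => _; rewrite ?leeDl ?leeDr ?H1_ge0 ?H2_ge0.
rewrite /Iint; move/cvg_lim : (cv) => /(_ (@ereal_hausdorff R)) <-; apply: lime_ge.
  by apply/cvg_ex; eexists; exact: cv.
by apply: nearW => n; exact: (PS n).2.
Qed.

Let P_open U : open U -> P U.
Proof.
move=> oU.
pose ok (q : rat * rat) := `[< `](ratr q.1 : R), (ratr q.2 : R)[%classic `<=` U >].
(* Codes of no pair, or of an interval that leaves [U], yield the empty interval []0, 0[]. *)
pose cd n : R * R := if unpickle n is Some q then
  if ok q then (ratr q.1, ratr q.2) else (0, 0)%R else (0, 0)%R.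
have cdU n : `](cd n).1, (cd n).2[%classic `<=` U.
  have nil : `](0%R : R), (0%R : R)[%classic `<=` U.
    by move=> t /=; rewrite in_itv/= => /andP[/lt_trans h /h]; rewrite ltxx.
  by rewrite /cd; case: (unpickle n) => // q; case: ifPn => // /asboolP.
pose S_ := fix S_ n := if n is n'.+1 then S_ n' `|` `](cd n').1, (cd n').2[%classic else set0.
have SU n : S_ n `<=` U by elim: n => //= n IH t [/IH//|]; exact: cdU.
apply: (@P_lim S_).
- by elim=> [|n IH]; [exact: P0|exact: PU].
- exact: open_measurable.
- apply: aeW => t _; have [Ut|nU] := pselect (U t); last first.
    by apply: nearW => n; split => // /SU.
  have [e e0 etU] : exists2 e : R, (0 < e)%R & ball t e `<=` U.
    by move: oU; rewrite openE => /(_ _ Ut) /nbhs_ballP[e /= e0 etU]; exists e.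
  have [q1] := @rat_in_itvoo R (t - e)%R t ltac:(by rewrite ltrBlDr ltrDl).
  have [q2] := @rat_in_itvoo R t (t + e)%R ltac:(by rewrite ltrDl).
  rewrite !in_itv/= => /andP[q2a q2b] /andP[q1a q1b].
  exists (pickle (q1, q2)).+1 => // n /=; elim: n => // n IH.
  rewrite ltnS leq_eqVlt => /orP[/eqP nE|/IH [_ h]]; split => //; last by left; exact: h.
  move=> _; right; rewrite -nE /cd pickleK /= ifT; first by rewrite in_itv/= q1b.
  apply/asboolP => z /=; rewrite in_itv/= => /andP[z1 z2]; apply: etU.
  rewrite /ball/= ltr_norml; apply/andP; split; lra.
Qed.

Let P_measurable S : measurable S -> P S.
Proof.
(* Outer regularity requires finite measure, so [S] is cut to [[0, l]], the only place where [K S]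
   is integrated. *)
move=> mS; pose S' := S `&` `[0%R, l]%classic.
have mS' : measurable S' by exact: measurableI.
have lS' : mu S' < +oo.
  apply: (@le_lt_trans _ _ (mu `[0%R, l]%classic)).
    by apply: le_measure; rewrite ?inE//; exact: subIsetr.
  by rewrite lebesgue_measure_itv/=; case: ifPn => // _; rewrite ltry.
have [U_ UP] := choice (fun n : nat => @lebesgue_regularity_outer R S' n.+1%:R^-1 mS' lS' ltac:(by [])).
pose V := fix V n := if n is n'.+1 then V n' `&` U_ n else U_ 0%N.
have oV n : open (V n).
  elim: n => [|n IH] /=; first by have [] := UP 0%N.
  by apply: openI => //; have [] := UP n.+1.
have S'V n : S' `<=` V n.
  elim: n => [|n IH] /=; first by have [_ +] := UP 0%N.
  by rewrite subsetI; split => //; have [] := UP n.+1.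
have VU n k : (k <= n)%N -> V n `<=` U_ k.
  elim: n => [|n IH]; first by rewrite leqn0 => /eqP ->.
  by rewrite leq_eqVlt => /orP[/eqP ->|/IH h] /= t [] // /h.
pose N := (\bigcap_n U_ n) `\` S'.
have mU n : measurable (U_ n) by apply: open_measurable; have [] := UP n.
have mN : measurable N by apply: measurableD => //; exact: bigcapT_measurable.
have N0 : mu N = 0.
  apply/eqP; rewrite eq_le measure_ge0 andbT; apply/lee_addgt0Pr => e e0.
  have [n ne] := ltr_add_invr e0; rewrite add0e.
  apply: (@le_trans _ _ (mu (U_ n `\` S'))).
    have mUS : measurable (U_ n `\` S') by apply: measurableD.
    by apply: le_measure; rewrite ?inE// => t [h ?]; split => //; exact: h.
  have [_ _ /ltW/le_trans->//] := UP n.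
  by rewrite lee_fin ltW// -[ltLHS]add0r.
apply: (@P_lim V) => //; first by move=> n; exact: P_open.
exists N; split => // t /= ht; split.
  move=> n _; apply: contrapT => nU; apply: ht => t0; exists n => // m /= nm; split.
    by move=> Vt; exfalso; apply: nU; exact: VU Vt.
  by move=> St; apply: S'V; split => //=; rewrite in_itv.
move=> [St]; apply: contra_not ht => _ t0; apply: nearW => n; split => // _.
by apply: S'V; split => //=; rewrite in_itv.
Qed.

Lemma ac_bound_min : ac_bound l f (fun t => mine (H1 t) (H2 t)).
Proof.
pose S := `[0%R, l]%classic `&` [set t | H1 t <= H2 t].
have mS : measurable S by exact: measurable_lee.
have [_ PS] := P_measurable mS; move=> a b a0 ab bl.
rewrite (_ : Iint _ a b = Iint (K S) a b); first exact: PS.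
apply: eq_Iint => [||t /andP[/ltW ta /ltW tb]].
- by apply: measurable_mine; [exact: measurable_itvS mH1|exact: measurable_itvS mH2].
- exact: measurable_itvS (mK mS).
have t0 : (0 <= t <= l)%R by rewrite (le_trans a0)//= (le_trans tb).
rewrite /K /S asbool_and; rewrite [X in X && _]asboolT; last by rewrite /= in_itv.
rewrite andTb; case: asboolP => /= [h|/negP]; first by rewrite minEle h.
by rewrite -ltNge => /ltW h; rewrite minC minEle h.
Qed.
End minimum.

Section locality.
Variables (l k : R) (f : R -> R) (H : R -> \bar R) (D : set R).
Hypotheses (mH : measurable_fun `[0%R, l] H) (mD : measurable D).
Hypothesis H_ge0 : forall t, (0 <= t <= l)%R -> 0 <= H t.
Hypothesis iH : Iint H 0 l < +oo.
Hypothesis fH : ac_bound l f H.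
Hypothesis fD : forall t, (0 <= t <= l)%R -> D t -> f t = k.

Let K t := H t * (\1_(~` D) t)%:E.

Let K_ge0 t : (0 <= t <= l)%R -> 0 <= K t.
Proof. by move=> t0; rewrite mule_ge0 ?H_ge0// lee_fin. Qed.

Let mK : measurable_fun `[0%R, l] K.
Proof.
apply: emeasurable_funM => //; apply/measurable_EFinP.
by apply: measurable_funTS; apply: measurable_indic; exact: measurableC.
Qed.

(** Absolute continuity of the integral at one point, by dominated convergence on shrinking
    intervals. Together with [fH] it gives the continuity of [f]. *)
Let small (x e : R) : (0 <= x <= l)%R -> (0 < e)%R ->
  exists2 del : R, (0 < del)%R & forall a b, (0 <= a)%R -> (b <= l)%R ->
    (x - del <= a)%R -> (b <= x + del)%R -> Iint H a b < e%:E.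
Proof.
move=> /andP[x0 xl] e0.
pose I (n : nat) : set R := `[(x - n.+1%:R^-1)%R, (x + n.+1%:R^-1)%R]%classic.
pose G n t := H t * (\1_(I n) t)%:E.
have mG n : measurable_fun `[0%R, l] (G n).
  apply: emeasurable_funM => //; apply/measurable_EFinP.
  by apply: measurable_funTS; apply: measurable_indic; exact: measurable_itv.
have [_ _] : [/\ mu.-integrable `[0%R, l] (cst (0 : \bar R)),
    [sequence \int[mu]_(t in `[0%R, l]) `|G n t - 0| ]_n @ \oo --> 0
  & [sequence \int[mu]_(t in `[0%R, l]) G n t ]_n @ \oo --> \int[mu]_(t in `[0%R, l]) 0].
  apply: (@dominated_convergence _ _ _ mu _ _ _ _ H) => //.
  - exists [set x]; split; [exact: measurable_set1|exact: lebesgue_measure_set1|].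
    move=> t /=; apply: contra_notP => /eqP tx _; apply: cvg_near_cst.
    have tx0 : (0 < `|t - x|)%R by rewrite normr_gt0 subr_eq0.
    near=> n; rewrite /G indicE memNset ?mule0//= /I /= in_itv/= => /andP[h1 h2].
    have : (n.+1%:R^-1 < `|t - x|)%R by near: n; exact: (near_infty_natSinv_lt (PosNum tx0)).
    by rewrite ltNge ler_distl h1 h2.
  - apply/integrableP; split => //; under eq_integral.
      move=> t; rewrite inE/= in_itv/= => t0; rewrite gee0_abs ?H_ge0//; over.
    exact: iH.
  - apply: aeW => t n /=; rewrite in_itv/= => t0; rewrite gee0_abs; last first.
      by rewrite mule_ge0 ?H_ge0// lee_fin.
    by rewrite /G indicE; case: (_ \in _); rewrite ?mule1// mule0 H_ge0.
rewrite integral0 => /fine_cvgP[fin] /cvgrPdist_lt /(_ _ e0).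
move=> /(filterI fin)[n _ /(_ n (leqnn n))] [/= fn].
rewrite sub0r normrN => le_e.
exists n.+1%:R^-1%R => // a b a0 bl xa bx.
apply: (@le_lt_trans _ _ (\int[mu]_(t in `[0%R, l]) G n t)); last first.
  by rewrite -(fineK fn) lte_fin (le_lt_trans (ler_norm _)).
rewrite (_ : Iint H a b = Iint (G n) a b).
  apply: sub_Iint => // t t0; rewrite mule_ge0 ?H_ge0// lee_fin//.
apply: eq_Iint; [exact: measurable_itvS mH|exact: measurable_itvS (mG n)|].
move=> t /andP[ta tb]; rewrite /G indicE mem_set ?mule1// /I /= in_itv/=.
by rewrite (le_trans xa (ltW ta)) (le_trans (ltW tb) bx).
Unshelve. all: by end_near. Qed.

(** Let [t1] and [t2] be the infimum and the supremum of the times of [[a, b]] in [D]. By continuity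
    [f] equals [k] at both, so the stretch between them contributes nothing, and the interiors of
    the two outer stretches avoid [D]. *)
Lemma ac_bound_off : ac_bound l f K.
Proof.
move=> a b a0 ab bl.
have mHab x y : (0 <= x)%R -> (y <= l)%R -> measurable_fun `[x, y] H.
  by move=> ? ?; exact: measurable_itvS mH.
have mKab x y : (0 <= x)%R -> (y <= l)%R -> measurable_fun `[x, y] K.
  by move=> ? ?; exact: measurable_itvS mK.
have off x y : (0 <= x)%R -> (x <= y)%R -> (y <= l)%R ->
    (forall t, (x < t < y)%R -> ~ D t) -> (`|f x - f y|)%:E <= Iint K x y.
  move=> x0 xy yl nD; rewrite (_ : Iint K x y = Iint H x y); first exact: fH.
  apply: eq_Iint; [exact: mKab|exact: mHab|].
  by move=> t /nD Dt; rewrite /K indicE mem_set// mule1.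
pose A := [set t | (a <= t <= b)%R /\ D t].
have [[t0 At0]|A0] := pselect (A !=set0); last first.
  apply: off => // t /andP[ta tb] Dt; apply: A0; exists t.
  by rewrite /A /= (ltW ta) (ltW tb).
have hA : has_inf A by split; [exists t0|exists a => t [/andP[]]].
have hA' : has_sup A by split; [exists t0|exists b => t [/andP[]]].
set t1 := inf A; set t2 := sup A.
have at1 : (a <= t1)%R by apply: lb_le_inf; [exists t0|move=> t [/andP[]]].
have t2b : (t2 <= b)%R by apply: ge_sup; [exists t0|move=> t [/andP[]]].
have t1t0 : (t1 <= t0)%R by apply: ge_inf => //; exists a => t [/andP[]].
have t0t2 : (t0 <= t2)%R by apply: ub_le_sup => //; exists b => t [/andP[]].
have t12 := le_trans t1t0 t0t2.
have t1l : (0 <= t1 <= l)%R by rewrite (le_trans a0)//= (le_trans t12)// (le_trans t2b).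
have t2l : (0 <= t2 <= l)%R by rewrite (le_trans a0)//= ?(le_trans t2b)// (le_trans at1).
have ft1 : f t1 = k.
  apply/eqP; rewrite -subr_eq0 -normr_le0; apply/ler_addgt0Pl => e e0; rewrite addr0.
  have [del del0 dH] := small t1l e0.
  have [t [/andP[ta tb] Dt] tt1] := inf_adherent del0 hA.
  have t1t : (t1 <= t)%R by apply: ge_inf; [exists a => z [/andP[]]|rewrite /A/= ta tb].
  rewrite -(@fD t)//; last by rewrite (le_trans a0)//= (le_trans tb).
  rewrite -lee_fin (le_trans (fH _ t1t _)) ?(le_trans tb)//; first by have /andP[] := t1l.
  apply/ltW/dH; [by have /andP[] := t1l|exact: le_trans tb bl| |exact: ltW].
  by rewrite lerBlDr lerDl ltW.
have ft2 : f t2 = k.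
  apply/eqP; rewrite -subr_eq0 -normr_le0; apply/ler_addgt0Pl => e e0; rewrite addr0.
  have [del del0 dH] := small t2l e0.
  have [t [/andP[ta tb] Dt] tt1] := sup_adherent del0 hA'.
  have t1t : (t <= t2)%R by apply: ub_le_sup; [exists b => z [/andP[]]|rewrite /A/= ta tb].
  rewrite -(@fD t)//; last by rewrite (le_trans a0)//= (le_trans tb).
  rewrite distrC -lee_fin (le_trans (fH _ t1t _)) ?(le_trans a0)//; first by have /andP[] := t2l.
  apply/ltW/dH; [exact: le_trans a0 ta|by have /andP[] := t2l|exact: ltW|].
  by rewrite lerDl ltW.
have [t1l0 t1ll] := andP t1l; have [t2l0 t2ll] := andP t2l.
have K0 x y : (0 <= x)%R -> (y <= l)%R -> forall t, (x <= t <= y)%R -> 0 <= K t.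
  by move=> x0 yl t /andP[xt ty]; apply: K_ge0; rewrite (le_trans x0)//= (le_trans ty).
rewrite (@Iint_split _ a b t1) ?(le_trans t12)//; [|exact: mKab|exact: K0].
rewrite (@Iint_split _ t1 b t2)//; [|exact: mKab|exact: K0].
have -> : (f a - f b = (f a - f t1) + (f t2 - f b))%R by rewrite ft1 ft2; ring.
apply: (@le_trans _ _ ((`|f a - f t1|)%:E + (`|f t2 - f b|)%:E)).
  by rewrite -EFinD lee_fin ler_normD.
apply: leeD.
  apply: off => // t /andP[ta tt1] Dt; move: (tt1); rewrite ltNge => /negP; apply.
  apply: ge_inf; first by exists a => z [/andP[]].
  by rewrite /A /= (ltW ta) (le_trans (ltW tt1))// (le_trans t12).
apply: (@le_trans _ _ (Iint K t2 b)); last by rewrite leeDr// Iint_ge0//; exact: K0.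
apply: off => // t /andP[tt2 tb] Dt; move: (tt2); rewrite ltNge => /negP; apply.
apply: ub_le_sup; first by exists b => z [/andP[]].
by rewrite /A /= (ltW tb) andbT; split => //; rewrite (le_trans at1)// (le_trans t12)// ltW.
Qed.
End locality.
End interval_integrals.

Section translation.
Context (R : realType).
Local Notation mu := (@lebesgue_measure R).

(** The translate of Lebesgue measure agrees with it on intervals, hence everywhere. This is needed
    because a subcurve carries its own arc length parameter, which starts at 0. *)
Lemma Iint_shift (H : R -> \bar R) (k a b : R) :
  measurable_fun `[(k + a)%R, (k + b)%R] H ->
  (forall t, (k + a <= t <= k + b)%R -> 0 <= H t) ->
  Iint (fun t => H (k + t)%R) a b = Iint H (k + a) (k + b).
Proof.
move=> mH H0; pose phi : measurableTypeR R -> measurableTypeR R := (fun t => k + t)%R.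
have mphi : measurable_fun setT phi.
  by apply: measurable_funD => //; exact: measurable_cst.
pose mphi_mixin := isMeasurableFun.Build _ _ _ _ phi mphi.
pose mphi_pack : {mfun measurableTypeR R >-> measurableTypeR R} := HB.pack phi mphi_mixin.
have itvE (x y : R) b1 b2 : phi @^-1` [set` Interval (BSide b1 (k + x)%R) (BSide b2 (k + y)%R)] =
    [set` Interval (BSide b1 x) (BSide b2 y)].
  apply/seteqP; split => t /=; rewrite !in_itv/= /phi; case: b1 b2 => [] [] /=;
    by rewrite ?lerD2l ?ltrD2l.
have E A : measurable A -> mu A = pushforward mu mphi_pack A.
  move=> mA; apply: lebesgue_measure_unique => // _ [[x y] _ <-] /=.
  rewrite /pushforward (_ : [set` _] = [set` `](k + (x - k))%R, (k + (y - k))%R] ]).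
    rewrite itvE !lebesgue_measure_itv/= !lte_fin.
    by rewrite !ltrD2l !ltrD2r; case: ifPn => // _; rewrite -!EFinB; congr (_%:E); ring.
  by rewrite ![(k + (_ - k))%R]addrC !subrK.
rewrite /Iint -[in LHS]itvE.
rewrite -(ge0_integral_pushforward mphi mu)//; last first.
  by move=> t; rewrite inE/= in_itv/=; exact: H0.
apply: esym; apply: eq_measure_integral => A mA _; exact: E.
Qed.
End translation.

Section curves.
Context (R : realType) (disp : measure_display)
  (X : metricMeasurableType R disp) (Z : set X).
Hypothesis oZ : open Z.
Local Notation XB := (g_sigma_algebraType (@open X)).
Local Notation mu := (@lebesgue_measure R).
Implicit Types (c : R * (R -> X)) (h : X -> \bar R).

Lemma curve_length_shift (g : R -> X) (k a b : R) :
  curve_length (fun t => g (k + t)%R) a b = curve_length g (k + a) (k + b).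
Proof.
have pathE (x y : R) (s : seq R) : itv_partition (k + x)%R (k + y)%R (map (+%R k) s) <-> itv_partition x y s.
  rewrite /itv_partition path_map last_map (inj_eq (addrI k)).
  by rewrite (@eq_path _ _ <%O)// => u v /=; rewrite ltrD2l.
have sumE (s : seq R) : (\sum_(i < size s)
   mdist (g (k + nth a (a :: s) i)) (g (k + nth a s i)))%R =
   (\sum_(i < size (map (+%R k) s))
   mdist (g (nth (k + a) (k + a :: map (+%R k) s) i)) (g (nth (k + a) (map (+%R k) s) i)))%R.
  rewrite size_map; apply: eq_bigr => i _.
  rewrite (nth_map a)//; congr (mdist (g _) _).
  by rewrite -(nth_map a (k + a)%R (+%R k) (s := a :: s))// ltnW// ltnS.
congr ereal_sup; apply/seteqP; split => [_ [s ps <-]|_ [s ps <-]].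
  by exists (map (+%R k) s); [exact/pathE|rewrite /= -sumE].
have sE : s = map (+%R k) (map (fun t => t - k)%R s).
  by rewrite -map_comp -[LHS]map_id; apply: eq_map => t /=; rewrite addrC subrK.
exists (map (fun t => t - k)%R s); first by apply/pathE; rewrite -sE.
by rewrite sumE -sE.
Qed.

Lemma rectifiable_lipschitz c a b : rectifiable_curve Z c ->
  (0 <= a)%R -> (a <= b)%R -> (b <= c.1)%R -> (mdist (c.2 a) (c.2 b) <= b - a)%R.
Proof.
move=> [c0 cZ cl] a0 ab bc; have [->|ab'] := eqVneq a b.
  by rewrite mdistxx subrr.
rewrite -lee_fin -(cl a b)//; apply: ereal_sup_ubound; exists [:: b].
  by rewrite /itv_partition /= lt_neqAle ab' ab eqxx.
by rewrite big_ord_recl big_ord0 addr0.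
Qed.

Lemma rectifiable_subcurve c a b : rectifiable_curve Z c ->
  (0 <= a)%R -> (a < b)%R -> (b <= c.1)%R ->
  rectifiable_curve Z ((b - a)%R, fun t => c.2 (a + t)%R).
Proof.
move=> [c0 cZ cl] a0 ab bc; split => /=; first by rewrite subr_gt0.
- move=> t /andP[t0 tb]; apply: cZ; rewrite addr_ge0//=.
  by rewrite (le_trans _ bc)// -lerBrDl.
- move=> x y x0 xy yb; rewrite curve_length_shift cl.
  + by congr EFin; ring.
  + by rewrite addr_ge0.
  + by rewrite lerD2l.
  + by rewrite (le_trans _ bc)// -lerBrDl.
Qed.

(** Clamping the parameter to [[0, c.1]] extends the curve to a 1-Lipschitz map of the whole line,
    for which preimages of open sets are open. *)
Lemma measurable_along c h : rectifiable_curve Z c -> borel_fun Z h ->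
  measurable_fun `[0%R, c.1] (h \o c.2).
Proof.
move=> rc mh; have [c0 cZ cl] := rc.
pose cl' (t : R) : R := Num.min (Num.max t 0%R) c.1.
have cl'I t : (0 <= cl' t <= c.1)%R.
  by rewrite /cl' le_min ge_min le_max lexx orbT (ltW c0) lexx orbT.
have cl'_lip (x y : R) : (x <= y)%R -> (cl' x <= cl' y <= cl' x + (y - x))%R.
  rewrite /cl' => xy; rewrite /Num.min /Num.max; do 4! case: ifPn; rewrite -?leNgt; lra.
pose g : R -> XB := fun t => c.2 (cl' t).
have glip (x y : R) : (mdist (c.2 (cl' x)) (c.2 (cl' y)) <= `|x - y|)%R.
  wlog xy : x y / (x <= y)%R => [wl|].
    have [/wl//|/ltW/wl] := leP x y; by rewrite metric_sym distrC.
  have /andP[h1 h2] := cl'_lip _ _ xy.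
  have /andP[h3 _] := cl'I x; have /andP[_ h4] := cl'I y.
  rewrite (le_trans (rectifiable_lipschitz rc h3 h1 h4))//.
  rewrite distrC ger0_norm ?subr_ge0//; lra.
have mg : measurable_fun setT g.
  apply: (@measurability _ _ _ XB setT g (@open X)) => //.
  move=> _ [U oU <-]; rewrite setTI; apply: open_measurable.
  rewrite openE => t Ut.
  have : nbhs (g t : X) U by exact: open_nbhs_nbhs.
  move=> /nbhs_ballP[e /= e0 eU]; apply/nbhs_ballP; exists e => // z.
  rewrite /ball/= => tz; apply: eU; rewrite ballEmdist /=.
  exact: le_lt_trans (glip _ _) tz.
have mZ : measurable_fun `[0%R, c.1] (h \o g).
  apply: (measurable_comp (F := (Z : set XB))) => //.
  - exact: sub_gen_smallest.
  - by move=> _ [t _ <-]; exact: cZ.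
  - exact: measurable_funTS.
apply: eq_measurable_fun mZ => t; rewrite inE /= in_itv/= => /andP[t0 tc] /=.
by rewrite /g /cl' (max_idPl t0) (min_idPl tc).
Qed.

Lemma curve_integral_sub c h a b : rectifiable_curve Z c -> nneg_borel Z h ->
  (0 <= a)%R -> (a < b)%R -> (b <= c.1)%R ->
  curve_integral ((b - a)%R, fun t => c.2 (a + t)%R) h = Iint (h \o c.2) a b.
Proof.
move=> rc [mh h0] a0 ab bc; rewrite /curve_integral /=.
have := @Iint_shift R (h \o c.2) a 0%R (b - a)%R; rewrite addr0 [in X in X -> _]addrC.
rewrite subrK.
move=> E; rewrite -E//; first exact: measurable_itvS (measurable_along rc mh).
have [_ cZ _] := rc; move=> t /andP[t1 t2]; apply: h0; apply: cZ.
by rewrite (le_trans a0 t1) (le_trans t2).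
Qed.

End curves.

Lemma poweR_le (R : realType) (r : R) (x y : \bar R) : (0 <= r)%R -> 0 <= x -> x <= y ->
  x `^ r <= y `^ r.
Proof.
move=> r0 x0 xy; apply: gt0_ler_poweR => //; rewrite in_itv/= ?x0 ?leey//.
by rewrite (le_trans x0 xy).
Qed.

Lemma poweRK (R : realType) (r : R) (x : \bar R) : r != 0%R -> 0 <= x ->
  (x `^ r) `^ r^-1 = x.
Proof. by move=> r0 x0; rewrite -poweRrM mulfV// poweRe1. Qed.

Lemma poweRVK (R : realType) (r : R) (x : \bar R) : r != 0%R -> 0 <= x ->
  (x `^ r^-1) `^ r = x.
Proof. by move=> r0 x0; rewrite -poweRrM mulVf// poweRe1. Qed.

Section Lp_facts.
Context (R : realType) (disp : measure_display) (T : measurableType disp)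
  (mu : {measure set T -> \bar R}).

Lemma Lp_normE (D : set T) (p : R) (f : T -> \bar R) : p != 0%R ->
  Lp_norm mu D p f = (\int[mu]_(x in D) `|f x| `^ p) `^ p^-1.
Proof.
move=> p0; rewrite /Lp_norm unlock [in RHS]integral_mkcond; congr (_ `^ _).
apply: eq_integral => x _; rewrite !patchE; case: ifPn => // _.
by rewrite abse0 poweR0r.
Qed.

Lemma LpP (D : set T) (p : R) (f : T -> \bar R) : (0 < p)%R ->
  Lp mu D p f <-> measurable_fun D f /\ \int[mu]_(x in D) `|f x| `^ p < +oo.
Proof.
move=> p0; rewrite /Lp Lp_normE ?gt_eqF//; split => -[mf H]; split => //.
  by apply: lty_poweRy H; rewrite invr_neq0// gt_eqF.
exact: poweR_lty.
Qed.

Lemma Lp_ge0P (D : set T) (p : R) (f : T -> \bar R) : (0 < p)%R ->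
  (forall x, D x -> 0 <= f x) ->
  Lp mu D p f <-> measurable_fun D f /\ \int[mu]_(x in D) f x `^ p < +oo.
Proof.
move=> p0 f0; rewrite LpP//.
suff -> : \int[mu]_(x in D) `|f x| `^ p = \int[mu]_(x in D) f x `^ p by [].
by apply: eq_integral => x; rewrite inE => /f0 h; rewrite gee0_abs.
Qed.
End Lp_facts.

Section curves_finite.
Context (R : realType) (disp : measure_display)
  (X : metricMeasurableType R disp) (Z : set X).
Hypothesis oZ : open Z.
Implicit Types (c : R * (R -> X)) (h : X -> \bar R).

(** Testing all subcurves, and not only the whole curve, turns the upper gradient inequality into
    absolute continuity of the values of [v], to which the lemmas on intervals apply. *)
Definition along c (v g : X -> \bar R) := forall a b,
  (0 <= a)%R -> (a < b)%R -> (b <= c.1)%R ->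
  `|v (c.2 a) - v (c.2 b)| <= Iint (g \o c.2) a b.

Lemma along_ge0 c h : rectifiable_curve Z c -> nneg_borel Z h ->
  forall t, (0 <= t <= c.1)%R -> 0 <= (h \o c.2) t.
Proof. by move=> [_ cZ _] [_ h0] t t0; apply: h0; exact: cZ. Qed.

Lemma curve_integral_ge0 c h : rectifiable_curve Z c -> nneg_borel Z h ->
  0 <= curve_integral c h.
Proof. by move=> rc hh; apply: Iint_ge0; exact: along_ge0. Qed.

Lemma Iint_curve_le c h a b : rectifiable_curve Z c -> nneg_borel Z h ->
  (0 <= a)%R -> (b <= c.1)%R -> Iint (h \o c.2) a b <= curve_integral c h.
Proof.
move=> rc hh a0 bc; apply: sub_Iint => //; last exact: along_ge0.
exact: (measurable_along oZ rc hh.1).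
Qed.

Lemma le_curve_integral c h k : rectifiable_curve Z c -> nneg_borel Z h -> nneg_borel Z k ->
  (forall x, Z x -> h x <= k x) -> curve_integral c h <= curve_integral c k.
Proof.
move=> rc hh kk hk; apply: le_Iint.
- exact: measurable_along rc hh.1.
- exact: measurable_along rc kk.1.
- exact: along_ge0.
- by move=> t t0; apply: hk; have [_ cZ _] := rc; exact: cZ.
Qed.

(** An infinite value at one end makes the left-hand side infinite, even when both ends carry the
    same infinite value, and this contradicts the finite integral. *)
Lemma along_finite c v g : rectifiable_curve Z c -> nneg_borel Z g ->
  curve_integral c g < +oo -> along c v g ->
  forall t, (0 <= t <= c.1)%R -> v (c.2 t) \is a fin_num.
Proof.
move=> rc gg fg vg t /andP[t0 tc].
have c0 : (0 < c.1)%R by have [] := rc.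
have H (a b : R) : (0 <= a)%R -> (a < b)%R -> (b <= c.1)%R ->
    v (c.2 a) \is a fin_num /\ v (c.2 b) \is a fin_num.
  move=> a0 ab bc; have := le_lt_trans (vg _ _ a0 ab bc)
    (le_lt_trans (Iint_curve_le rc gg a0 bc) fg).
  by case: (v (c.2 a)) => [x| |]; case: (v (c.2 b)) => [y| |].
have [tc'|tc'] := ltP t c.1; first by have [] := H t c.1 t0 tc' (lexx _).
have -> : t = c.1 by apply/le_anti; rewrite tc.
by have [] := H 0%R c.1 (lexx _) c0 (lexx _).
Qed.

Lemma along_ac c v g : rectifiable_curve Z c -> nneg_borel Z g ->
  curve_integral c g < +oo -> along c v g ->
  ac_bound c.1 (fun t => fine (v (c.2 t))) (g \o c.2).
Proof.
move=> rc gg fg vg a b a0 ab bc.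
have vf := along_finite rc gg fg vg.
have [->|ab'] := eqVneq a b.
  rewrite subrr normr0; apply: Iint_ge0 => t /andP[bt tb].
  by apply: along_ge0 rc gg _ _; rewrite (le_trans _ bt)//= ?(le_trans tb)// (le_trans a0).
have va : v (c.2 a) \is a fin_num by apply: vf; rewrite a0 (le_trans ab).
have vb : v (c.2 b) \is a fin_num by apply: vf; rewrite bc (le_trans a0).
have := vg a b a0 _ bc; rewrite lt_neqAle ab' ab => /(_ isT).
by rewrite -{1}(fineK va) -{1}(fineK vb).
Qed.

Lemma ac_along c v g : (forall t, (0 <= t <= c.1)%R -> v (c.2 t) \is a fin_num) ->
  ac_bound c.1 (fun t => fine (v (c.2 t))) (g \o c.2) -> along c v g.
Proof.
move=> vf ac a b a0 ab bc; have := ac a b a0 (ltW ab) bc.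
have va : v (c.2 a) \is a fin_num by apply: vf; rewrite a0 (le_trans (ltW ab)).
have vb : v (c.2 b) \is a fin_num by apply: vf; rewrite bc (le_trans a0)// ltW.
by move/le_trans => h; apply: le_trans (h _ (lexx _)); rewrite -{1}(fineK va) -{1}(fineK vb).
Qed.

End curves_finite.

(** * Existence of minimal weak upper gradients *)

Section weak_gradients.
Context (R : realType) (disp : measure_display)
  (X : metricMeasurableType R disp) (mu : {measure set X -> \bar R}) (Z : set X).
Hypotheses (hmu : complete_borel mu) (oZ : open Z).
Variable (p : R).
Hypothesis p1 : (1 <= p)%R.
Local Notation XB := (g_sigma_algebraType (@open X)).
Implicit Types (c : R * (R -> X)) (h g rho : X -> \bar R).

Let p0 : (0 < p)%R. Proof. exact: lt_le_trans p1. Qed.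
Let pN0 : p != 0%R. Proof. by rewrite gt_eqF. Qed.
Let mZ : measurable Z. Proof. exact: hmu.1. Qed.
Let mZB : measurable (Z : set XB). Proof. exact: sub_gen_smallest. Qed.

Lemma borel_measurable (A : set X) : measurable (A : set XB) -> measurable A.
Proof.
suff : <<s @open X >> `<=` (measurable : set (set X)) by exact.
apply: smallest_sub; last exact: hmu.1.
exact: sigma_algebra_measurable.
Qed.

Lemma borel_fun_measurable (disp' : measure_display) (Y : measurableType disp') (g : X -> Y) :
  borel_fun Z g -> measurable_fun Z g.
Proof. by move=> mg _ A mA; apply: borel_measurable; exact: mg. Qed.

Lemma Lp_nneg h : nneg_borel Z h -> Lp mu Z p h <-> \int[mu]_(x in Z) h x `^ p < +oo.
Proof.
move=> [mh h0]; rewrite Lp_ge0P//; split => [[]//|]; split => //.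
exact: borel_fun_measurable.
Qed.

(* The family of curves along which [rho] is not integrable is exceptional. *)
Definition wug v g rho := [/\ nneg_borel Z g, nneg_borel Z rho, Lp mu Z p rho &
  forall c, rectifiable_curve Z c -> curve_integral c rho < +oo ->
    curve_integral c g < +oo /\ along c v g].

Lemma wug_weak v g rho : wug v g rho -> weak_upper_gradient mu Z p v g.
Proof.
move=> [hg hr rL H]; split => //.
exists [set c | curve_integral c rho = +oo]; first by exists rho; split.
move=> c rc /= cr; have [] := H c rc.
  by rewrite ltey; apply/eqP.
by move=> _ /(_ 0%R c.1); apply => //; have [] := rc.
Qed.

(** If the integral of [rho] along a curve is finite, so is its integral along every subcurve; hence
    no subcurve belongs to the exceptional family. *)
Lemma weak_upper_gradient_along v g : weak_upper_gradient mu Z p v g ->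
  exists rho, [/\ nneg_borel Z rho, Lp mu Z p rho &
  forall c, rectifiable_curve Z c -> curve_integral c rho < +oo -> along c v g].
Proof.
move=> [hg [Gamma [rho [hr rL Hr]] HG]]; exists rho; split => // c rc cr a b a0 ab bc.
pose c' := ((b - a)%R, fun t : R => c.2 (a + t)%R).
have rc' : rectifiable_curve Z c' by exact: rectifiable_subcurve.
have := HG c' rc'; rewrite /upper_gradient_on (curve_integral_sub oZ rc hg a0 ab bc)/=.
rewrite addr0 (addrC a) subrK; apply => /Hr.
rewrite (curve_integral_sub oZ rc hr a0 ab bc) => E.
by have := le_lt_trans (Iint_curve_le oZ rc hr a0 bc) cr; rewrite E ltxx.
Qed.

(** Countable unions of exceptional families are exceptional. The [p]-th powers are summed with
    weights [k n] that make the [n]-th integral at most [1 / 2 ^ n.+1], so no triangle inequality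
    for infinite sums is required; [rho] still dominates a positive multiple of each [rho_ n]. *)
Lemma Lp_combine (rho_ : (X -> \bar R)^nat) :
  (forall n, nneg_borel Z (rho_ n)) -> (forall n, Lp mu Z p (rho_ n)) ->
  exists rho, [/\ nneg_borel Z rho, Lp mu Z p rho &
    forall c, rectifiable_curve Z c -> curve_integral c rho < +oo ->
      forall n, curve_integral c (rho_ n) < +oo].
Proof.
move=> hr Lr.
have I0 n : 0 <= \int[mu]_(x in Z) rho_ n x `^ p.
  by apply: integral_ge0 => *; exact: poweR_ge0.
have If n : \int[mu]_(x in Z) rho_ n x `^ p < +oo by apply/Lp_nneg.
pose A n := fine (\int[mu]_(x in Z) rho_ n x `^ p).
have A0 n : (0 <= A n)%R by exact: fine_ge0.
pose k n : R := (1 / (2 ^ n.+1)%:R / (1 + A n))%R.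
have k0 n : (0 < k n)%R by rewrite !divr_gt0// ?ltr0n ?expn_gt0// ltr_pwDl.
pose f n x := (k n)%:E * rho_ n x `^ p.
have f0 n x : 0 <= f n x by rewrite mule_ge0 ?lee_fin ?(ltW (k0 n))// poweR_ge0.
pose rho x := (\sum_(n <oo) f n x) `^ p^-1.
have S0 x : 0 <= \sum_(n <oo) f n x by exact: nneseries_ge0.
have mf n : borel_fun Z (f n).
  apply: measurable_funeM.
  exact: (measurableT_comp (measurable_poweR p) (hr n).1).
have mrho : borel_fun Z rho.
  apply: (measurableT_comp (measurable_poweR p^-1)).
  exact: (@ge0_emeasurable_sum _ XB R Z f xpredT (fun k x _ _ => f0 k x) (fun k _ => mf k)).
have hrho : nneg_borel Z rho by split => // x _; exact: poweR_ge0.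
exists rho; split => //.
- apply/Lp_nneg => //; under eq_integral do rewrite poweRVK//.
  rewrite integral_nneseries//; last by move=> n; exact: borel_fun_measurable.
  apply: (@le_lt_trans _ _ (\sum_(n <oo) (1 / (2 ^ n.+1)%:R)%:E)).
    apply: lee_nneseries => [n _ _|n _]; first by apply: integral_ge0.
    rewrite ge0_integralZl//; first last.
    + by rewrite lee_fin ltW.
    + by move=> *; exact: poweR_ge0.
    + apply: (measurableT_comp (measurable_poweR p)).
      by apply: borel_fun_measurable; exact: (hr n).1.
    rewrite -(@fineK _ (\int[mu]_(x in Z) _)) ?ge0_fin_numE// -EFinM lee_fin.
    rewrite -/(A n) /k mulrAC ler_pdivrMr ?ltr_pwDl// ler_wpM2l//.
    by rewrite lerDr.
  by apply: le_lt_trans (epsilon_trick0 _ _) _ => //; rewrite ltry.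
- move=> c rc crho n.
  have kp : (0 < (k n) `^ p^-1)%R by rewrite powR_gt0.
  have le1 x : Z x -> rho_ n x <= ((k n) `^ p^-1)^-1%:E * rho x.
    move=> Zx; have r0 := (hr n).2 x Zx.
    have : f n x `^ p^-1 <= rho x.
      apply: poweR_le => //; first by rewrite invr_ge0 ltW.
      rewrite (@nneseriesD1 _ _ n)//. 
      by rewrite leeDl// nneseries_ge0.
    rewrite /f poweRM ?poweR_ge0 ?lee_fin ?(ltW (k0 n))// poweRK// => h.
    by rewrite lee_pdivlMl.
  have hk : nneg_borel Z (fun x => ((k n) `^ p^-1)^-1%:E * rho x).
    split; first exact: measurable_funeM.
    by move=> x Zx; rewrite mule_ge0 ?(hrho.2)// lee_fin invr_ge0 ltW.
  apply: le_lt_trans (le_curve_integral oZ rc (hr n) hk le1) _.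
  rewrite /curve_integral ge0_integralZl//=.
  + by rewrite lte_mul_pinfty// lee_fin invr_ge0 ltW.
  + exact: measurable_along rc hrho.1.
  + by move=> t; rewrite in_itv/= => t0; exact: along_ge0 rc hrho t t0.
  + by rewrite lee_fin invr_ge0 ltW.
Qed.

Lemma nneg_borel_mine g1 g2 : nneg_borel Z g1 -> nneg_borel Z g2 ->
  nneg_borel Z (fun x => mine (g1 x) (g2 x)).
Proof.
move=> [m1 n1] [m2 n2]; split; first exact: measurable_mine.
by move=> x Zx; rewrite le_min n1// n2.
Qed.

Lemma wug_combine v g rho : nneg_borel Z g ->
  (exists rho_ : (X -> \bar R)^nat, [/\ forall n, nneg_borel Z (rho_ n),
     forall n, Lp mu Z p (rho_ n) &
     forall c, rectifiable_curve Z c ->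
       (forall n, curve_integral c (rho_ n) < +oo) ->
       curve_integral c g < +oo /\ along c v g]) ->
  exists rho, wug v g rho.
Proof.
move=> hg [rho_ [hr Lr H]]; have [r [hr' Lr' Hr]] := Lp_combine hr Lr.
by exists r; split => // c rc /(Hr c rc); exact: H.
Qed.

Lemma wug_min v g1 g2 : (exists rho, wug v g1 rho) -> (exists rho, wug v g2 rho) ->
  exists rho, wug v (fun x => mine (g1 x) (g2 x)) rho.
Proof.
move=> [r1 [h1 hr1 L1 H1]] [r2 [h2 hr2 L2 H2]].
have hm := nneg_borel_mine h1 h2.
apply: wug_combine => //; exists (fun n => if n is 0%N then r1 else r2).
split; [by case|by case|move=> c rc fin].
have [f1 a1] := H1 c rc (fin 0%N); have [f2 a2] := H2 c rc (fin 1%N).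
split.
  apply: le_lt_trans f1; apply: (le_curve_integral oZ rc hm h1) => x _.
  by rewrite ge_min lexx.
apply: ac_along; first exact: along_finite rc h1 f1 a1.
apply: (@ac_bound_min R c.1 _ (g1 \o c.2) (g2 \o c.2)) => //.
- exact: measurable_along rc h1.1.
- exact: measurable_along rc h2.1.
- exact: along_ge0 rc h1.
- exact: along_ge0 rc h2.
- exact: along_ac rc h1 f1 a1.
- exact: along_ac rc h2 f2 a2.
Qed.

(** The infimum of a decreasing sequence is also its limit. Along a curve on which [g_ 0] is
    integrable, dominated convergence with majorant [g_ 0] passes the inequality on each subinterval
    to that limit. *)
Lemma wug_lim v (g_ : (X -> \bar R)^nat) : (forall n, exists rho, wug v (g_ n) rho) ->
  (forall x, {homo g_^~ x : n m / (n <= m)%N >-> m <= n}) ->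
  exists rho, wug v (fun x => einfs (g_^~ x) 0%N) rho.
Proof.
move=> wg ndg.
have [rho_ wr] := choice wg.
have cvG x : g_^~ x @ \oo --> einfs (g_^~ x) 0%N.
  have -> : einfs (g_^~ x) 0%N = ereal_inf (range (g_^~ x)).
    by congr ereal_inf; apply/seteqP; split => _ [n _ <-]; exists n.
  exact: ereal_nonincreasing_cvgn.
have leG x n : einfs (g_^~ x) 0%N <= g_ n x.
  by apply: ereal_inf_lbound; exists n.
have hG : nneg_borel Z (fun x => einfs (g_^~ x) 0%N).
  split; first by apply: measurable_fun_einfs => n; have [[]] := wr n.
  move=> x Zx; apply: le_ereal_inf_tmp => _ [n _ <-].
  by have [[_ h0] _ _ _] := wr n; exact: h0.
apply: wug_combine => //; exists rho_; split.
- by move=> n; have [] := wr n.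
- by move=> n; have [] := wr n.
move=> c rc fin.
have gn n : curve_integral c (g_ n) < +oo /\ along c v (g_ n).
  by have [_ _ _] := wr n; apply.
have hg n : nneg_borel Z (g_ n) by have [] := wr n.
split.
  apply: le_lt_trans (gn 0%N).1; apply: (le_curve_integral oZ rc hG (hg 0%N)) => x _.
  exact: leG.
move=> a b a0 ab bc.
have tl t : `[a, b]%classic t -> (0 <= t <= c.1)%R.
  by rewrite /= in_itv/= => /andP[/(le_trans a0)-> /le_trans->].
have [_ _ cv] : [/\ lebesgue_measure.-integrable `[a, b] ((fun x => einfs (g_^~ x) 0%N) \o c.2),
    [sequence \int[lebesgue_measure]_(x in `[a, b])
       `|(g_ n \o c.2) x - ((fun x => einfs (g_^~ x) 0%N) \o c.2) x| ]_n @ \oo --> 0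
  & [sequence \int[lebesgue_measure]_(x in `[a, b]) (g_ n \o c.2) x ]_n @ \oo -->
    \int[lebesgue_measure]_(x in `[a, b]) ((fun x => einfs (g_^~ x) 0%N) \o c.2) x].
  apply: (@dominated_convergence _ _ _ lebesgue_measure _ _ _ _ (g_ 0%N \o c.2)) => //.
  - by move=> n; apply: measurable_itvS (measurable_along oZ rc (hg n).1).
  - by apply: measurable_itvS (measurable_along oZ rc hG.1).
  - by apply: aeW => t _; exact: cvG.
  - apply/integrableP; split; first exact: measurable_itvS (measurable_along oZ rc (hg 0%N).1).
    apply: le_lt_trans (gn 0%N).1.
    have -> : \int[lebesgue_measure]_(x in `[a, b]) `|(g_ 0%N \o c.2) x| = Iint (g_ 0%N \o c.2) a b.
      apply: eq_integral => t; rewrite inE => /tl t0; rewrite gee0_abs//.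
      exact: along_ge0 rc (hg 0%N) t t0.
    exact: (Iint_curve_le oZ rc (hg 0%N) a0 bc).
  - apply: aeW => t n /tl t0; rewrite gee0_abs; last exact: along_ge0 rc (hg n) t t0.
    exact: ndg.
rewrite /Iint; move/cvg_lim : (cv) => /(_ (@ereal_hausdorff R)) <-; apply: lime_ge.
  by apply/cvg_ex; eexists; exact: cv.
by apply: nearW => n; exact: (gn n).2.
Qed.

(** Only local integrability of [g] is given, but a curve is bounded and lies in one of the balls of
    radius [n + 1] about [x0]. The truncations of [g] to these balls are in [L^p] and are combined
    with [rho] into one weight, whose finite integral forces that of [g] to be finite. *)
Lemma weak_wug v g : Z !=set0 -> weak_upper_gradient mu Z p v g -> Lp_loc mu Z p g ->
  exists rho, wug v g rho.
Proof.
move=> [x0 Zx0] wg Lg; have hg := wg.1.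
have [rho [hr Lr Hr]] := weak_upper_gradient_along wg.
pose k n x := g x * (\1_(ball x0 n.+1%:R) x)%:E.
have kE n x : k n x = if x \in (ball x0 n.+1%:R : set X) then g x else 0.
  by rewrite /k indicE; case: ifPn => _; rewrite ?mule1// mule0.
have hk n : nneg_borel Z (k n).
  split; last by move=> x Zx; rewrite mule_ge0 ?lee_fin ?(hg.2).
  apply: emeasurable_funM; first exact: hg.1.
  apply/measurable_EFinP; apply: measurable_funTS; apply: measurable_indic.
  by apply: sub_gen_smallest; exact: mball_open.
apply: wug_combine => //.
exists (fun n => if n is n'.+1 then k n' else rho); split; [by case|move=> [//|n]|].
  apply/Lp_nneg => //.
  have /Lp_ge0P[//||_] := Lg x0 n.+1%:R Zx0 (ltr0Sn _ _); first by move=> x [_] /(hg.2).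
  apply: le_lt_trans; rewrite [leLHS]integral_mkcond [leRHS]integral_mkcond.
  rewrite le_eqVlt; apply/orP; left; apply/eqP; apply: eq_integral => x _; rewrite !patchE kE in_setI andbC.
  by case: (x \in Z) => //=; case: ifPn => // _; rewrite poweR0r.
move=> c rc fin; split; last exact: Hr c rc (fin 0%N).
have [N cN] : exists n : nat, (mdist x0 (c.2 0%R) + c.1 < n.+1%:R)%R.
  by exists (Num.truncn (mdist x0 (c.2 0%R) + c.1)); exact: truncnS_gt.
have := fin N.+1; rewrite /= /curve_integral.
suff -> : \int[lebesgue_measure]_(t in `[0%R, c.1]) k N (c.2 t) =
  \int[lebesgue_measure]_(t in `[0%R, c.1]) g (c.2 t) by [].
apply: eq_integral => t; rewrite inE/= in_itv/= => /andP[t0 tc]; rewrite kE mem_set//.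
rewrite ballEmdist /=; apply: le_lt_trans cN.
apply: le_trans (metric_triangle _ (c.2 0%R) _) _; rewrite lerD2l.
by apply: le_trans (rectifiable_lipschitz rc (lexx _) t0 tc) _; rewrite subr0.
Qed.

Lemma Lp_Lp_loc f : nneg_borel Z f -> Lp mu Z p f -> Lp_loc mu Z p f.
Proof.
move=> hf /(Lp_nneg hf) fin x r Zx r0; apply/Lp_ge0P => //; first by move=> y [_ /(hf.2)].
have mf : measurable_fun Z f by apply: borel_fun_measurable; exact: hf.1.
split; first by apply: measurable_funS mf => // y [].
apply: le_lt_trans fin; apply: ge0_subset_integral => //.
- exact: (measurable_ball_of hmu oZ).
- exact: (measurableT_comp (measurable_poweR p)).
- by move=> y _; exact: poweR_ge0.
- by move=> y [].
Qed.

(** The Poincare inequality is assumed for minimal gradients, so one must be produced. Gradients of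
    finite energy are stable under minima and decreasing limits, hence some [g] attains the infimum
    [m]. For a competitor [f], the minimum of [g] and [f] has the same energy as [g] and lies below
    it, so the two agree almost everywhere. *)
Lemma exists_minimal_gradient v h : weak_upper_gradient mu Z p v h -> Lp mu Z p h ->
  exists2 g, minimal_weak_upper_gradient mu Z p v g & Lp mu Z p g.
Proof.
move=> wh Lh; have hh := wh.1.
have [Z0|Z0] := pselect (Z !=set0); last first.
  exists h => //; split => //; first exact: Lp_Lp_loc.
  by move=> k _ _; apply: aeW => x Zx; exfalso; apply: Z0; exists x.
pose I g := \int[mu]_(x in Z) g x `^ p.
pose G := [set g | (exists rho, wug v g rho) /\ I g < +oo].
have Gh : G h by split; [apply: weak_wug => //; exact: Lp_Lp_loc|exact/Lp_nneg].
have nG g : G g -> nneg_borel Z g by move=> [[rho []]].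
have I0 g : 0 <= I g by apply: integral_ge0 => *; exact: poweR_ge0.
have mp g : nneg_borel Z g -> measurable_fun Z (fun x => g x `^ p).
  move=> hg; apply: (measurableT_comp (measurable_poweR p)).
  by apply: borel_fun_measurable; exact: hg.1.
have Imin g1 g2 : nneg_borel Z g1 -> nneg_borel Z g2 ->
    I (fun x => mine (g1 x) (g2 x)) <= I g1.
  move=> h1 h2; have hm := nneg_borel_mine h1 h2; apply: ge0_le_integral => //.
  - by move=> *; exact: poweR_ge0.
  - exact: mp.
  - exact: mp.
  - by move=> x Zx; apply: poweR_le; [exact: ltW|exact: hm.2|rewrite ge_min lexx].
have Gmin g1 g2 : G g1 -> (exists rho, wug v g2 rho) -> G (fun x => mine (g1 x) (g2 x)).
  move=> g1G w2; have [w1 f1] := g1G; split; first exact: wug_min.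
  by apply: le_lt_trans f1; apply: Imin; [exact: nG|have [rho []] := w2].
pose m := ereal_inf (I @` G).
have m0 : 0 <= m by apply: le_ereal_inf_tmp => _ [g _ <-].
have mf : m \is a fin_num.
  by rewrite ge0_fin_numE// (le_lt_trans _ Gh.2)//; apply: ereal_inf_lbound; exists h.
have [g_ g_P] : exists g_ : nat -> X -> \bar R, forall n, G (g_ n) /\ I (g_ n) < m + n.+1%:R^-1%:E.
  suff gex n : exists g, G g /\ I g < m + n.+1%:R^-1%:E.
    by have [g_ g_P] := choice gex; exists g_.
  have [_ [g Gg <-] lt] := @lb_ereal_inf_adherent R (I @` G) n.+1%:R^-1 ltac:(by []) mf.
  by exists g.
pose k := fix k n : X -> \bar R := if n is n'.+1 then (fun x => mine (g_ n x) (k n' x)) else g_ 0%N.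
have kG n : G (k n).
  elim: n => [|n IH]; first exact: (g_P 0%N).1.
  by apply: Gmin; [exact: (g_P n.+1).1|exact: IH.1].
have kg n : I (k n) <= m + n.+1%:R^-1%:E.
  apply: le_trans (ltW (g_P n).2); case: n => [|n]; first by rewrite lexx.
  by apply: Imin; apply: nG; [exact: (g_P n.+1).1|exact: kG].
have kd x : {homo k^~ x : n m / (n <= m)%N >-> m <= n}.
  apply/nonincreasing_seqP => n /=; by rewrite ge_min lexx orbT.
pose g x := einfs (k^~ x) 0%N.
have wg : exists rho, wug v g rho by apply: wug_lim => // n; have [] := kG n.
have hg : nneg_borel Z g by have [rho []] := wg.
have gm : I g <= m.
  apply/lee_addgt0Pr => e e0; have [n] := ltr_add_invr e0; rewrite add0r => ne.
  apply: (@le_trans _ _ (I (k n))); last by rewrite (le_trans (kg n))// leeD2l// lee_fin ltW.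
  apply: ge0_le_integral => //.
  - by move=> *; exact: poweR_ge0.
  - exact: mp.
  - by apply: mp; exact: nG.
  - move=> x Zx; apply: poweR_le; [exact: ltW|exact: hg.2|].
    by apply: ereal_inf_lbound; exists n.
have gG : G g by split => //; rewrite (le_lt_trans gm)// -ge0_fin_numE.
have Lg : Lp mu Z p g by apply/Lp_nneg => //; exact: gG.2.
exists g => //; split; [by have [rho /wug_weak] := wg|exact: Lp_Lp_loc|].
move=> f wf Lf; have wf' := weak_wug Z0 wf Lf.
pose f' x := mine (g x) (f x).
have f'G : G f' by exact: Gmin.
have hf' := nG _ f'G.
have If' : I f' = I g.
  apply/le_anti; rewrite Imin//=; last by exact: wf.1.
  by apply: le_trans gm _; apply: ereal_inf_lbound; exists f'.
have ig k' : G k' -> mu.-integrable Z (fun x => k' x `^ p).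
  move=> Gk; apply/integrableP; split; first by apply: mp; exact: nG.
  have -> : \int[mu]_(x in Z) `|k' x `^ p| = I k'; last exact: Gk.2.
  by apply: eq_integral => x _; rewrite gee0_abs// poweR_ge0.
have B0 : \int[mu]_(x in Z) (g x `^ p - f' x `^ p) = 0.
  rewrite integralB ?ig// -/(I g) -/(I f') If' subee//.
  by rewrite ge0_fin_numE// gG.2.
have D0 : {ae mu, forall x, Z x -> g x `^ p - f' x `^ p = 0}.
  have mD : measurable_fun Z (fun x => g x `^ p - f' x `^ p).
    by apply: emeasurable_funB; apply: mp; exact: nG.
  apply/(ae_eq_integral_abs _ mZ mD).
  rewrite -B0; apply: ae_eq_integral => //; first exact: measurableT_comp.
  have fg := integrable_ae mZ (ig _ gG); have ff := integrable_ae mZ (ig _ f'G).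
  apply: filterS2 fg ff => x fg ff Zx; rewrite gee0_abs// sube_ge0 ?ff//.
  by apply: poweR_le; [exact: ltW|exact: hf'.2|rewrite ge_min lexx].
have fg := integrable_ae mZ (ig _ gG); have ff := integrable_ae mZ (ig _ f'G).
apply: filterS3 D0 fg ff => x D0 fg ff Zx.
have E : g x `^ p = f' x `^ p.
  move: (D0 Zx) (fg Zx) (ff Zx).
  case: (g x `^ p) (f' x `^ p) => [a| |] [b| |]//= [ab] _ _.
  by congr (_%:E); apply/eqP; rewrite -subr_eq0 ab.
have : g x = f' x.
  by rewrite -(poweRK pN0 (hg.2 x Zx)) E poweRK//; exact: hf'.2.
by move=> ->; rewrite ge_min lexx orbT.
Qed.

End weak_gradients.

(** * Averages at dyadic scales *)

Section averages.
Context (R : realType) (disp : measure_display) (T : measurableType disp)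
  (mu : {measure set T -> \bar R}).

(** The deviation of the average from [b] is at most the integral over [A] of the distance to [b],
    divided by the mass of [A]. One constant [b] on a large ball thus controls the averages over all
    subsets of comparable mass. *)
Lemma average_close (A B : set T) (u : T -> \bar R) (b M : R) :
  measurable A -> measurable B -> A `<=` B -> measurable_fun B u ->
  0 < mu A < +oo ->
  \int[mu]_(y in B) `|u y - b%:E| <= M%:E ->
  [/\ mu.-integrable A u, average mu A u \is a fin_num &
     (`|fine (average mu A u) - b| <= M / fine (mu A))%R].
Proof.
move=> mA mB AB mu_ /andP[A0 Aoo] H.
have Af : mu A \is a fin_num by rewrite ge0_fin_numE.
have m0 : (0 < fine (mu A))%R by rewrite fine_gt0 ?A0.
have mub : measurable_fun B (fun y => `|u y - b%:E|).
  by apply: measurableT_comp => //; apply: emeasurable_funB => //; exact: measurable_cst.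
have HA : \int[mu]_(y in A) `|u y - b%:E| <= M%:E.
  by apply: le_trans H; apply: ge0_subset_integral.
have mA_u : measurable_fun A u by exact: measurable_funS mu_.
have icst : mu.-integrable A (cst b%:E).
  apply/integrableP; split; first exact: measurable_cst.
  by rewrite integral_cst//= lte_mul_pinfty.
have iub : mu.-integrable A (fun y => u y - b%:E).
  apply/integrableP; split; last exact: le_lt_trans HA (ltry _).
  by apply: emeasurable_funB => //; exact: measurable_cst.
have iu : mu.-integrable A u.
  apply: (@eq_integrable _ _ _ mu A mA (fun y => (u y - b%:E) + cst b%:E y)).
    - by move=> y _; rewrite subeK.
  - exact: integrableD.
have If := integrable_fin_num mA iu.
have avE : average mu A u = (fine (\int[mu]_(y in A) u y) / fine (mu A))%:E.
  rewrite /average -(fineK If) -(fineK Af) muleC inver gt_eqF//.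
split => //; first by rewrite avE.
rewrite avE /= ler_pdivlMr// -[X in (_ * X)%R](gtr0_norm m0) -normrM mulrBl divfK ?gt_eqF//.
rewrite -lee_fin; apply: le_trans HA.
have -> : (`|fine (\int[mu]_(y in A) u y) - b * fine (mu A)|)%:E =
    `|\int[mu]_(y in A) (u y - b%:E)|.
  by rewrite (integralB mA iu icst) integral_cst// -[in RHS](fineK If) -[in RHS](fineK Af).
by apply: le_abse_integral => //; case/integrableP : iub.
Qed.

End averages.

Lemma powR_gtD (R : realType) (x r t : R) : (0 < x)%R ->
  (x `^ (r + t) = x `^ r * x `^ t)%R.
Proof. by move=> x0; rewrite powRD//; apply/implyP => _; rewrite gt_eqF. Qed.

Lemma powR_predr (R : realType) (x r : R) : (0 < x)%R ->
  (x `^ r = x `^ (r - 1) * x)%R.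
Proof. by move=> x0; rewrite -{3}(powRr1 (ltW x0)) -powR_gtD// subrK. Qed.

Lemma sum_filter_mul (R : realType) (I : Type) (l : seq I) (P : pred I) (x : \bar R) :
  0 <= x -> \sum_(c <- l) x * (P c)%:R%:E = (count P l)%:R%:E * x.
Proof.
move=> x0; elim: l => [|c l IH]; first by rewrite big_nil mul0e.
rewrite big_cons IH /= natrD EFinD ge0_muleDl ?lee_fin ?ler0n//.
by rewrite muleC.
Qed.

Lemma nneseries_geometric (R : realType) (k x : R) : (0 <= k)%R -> (0 < x < 1)%R ->
  \sum_(n <oo) (k * x ^+ n)%:E <= (k / (1 - x))%:E.
Proof.
move=> k0 /andP[x0 x1]; apply: lime_le.
  by apply: is_cvg_nneseries => n _ _; rewrite lee_fin mulr_ge0// exprn_ge0// ltW.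
apply: nearW => n; rewrite sumEFin lee_fin.
apply: le_trans (geometric_le_lim n k0 x0 _); last by rewrite gtr0_norm.
by rewrite /series/=.
Qed.

Lemma lee_bigsum_term (R : realDomainType) (T : eqType) (l : seq T) (c : T) (g : T -> \bar R) :
  (forall i, 0 <= g i) -> c \in l -> g c <= \sum_(i <- l) g i.
Proof.
move=> g0; elim: l => [//|i l IH]; rewrite inE big_cons => /orP[/eqP ->|/IH h].
  by apply: leeDl; apply: sume_ge0 => j _.
by apply: le_trans h _; apply: leeDr.
Qed.

Lemma lee_nneseries_term (R : realType) (g : nat -> \bar R) a :
  (forall i, 0 <= g i) -> g a <= \sum_(i <oo) g i.
Proof.
move=> g0; rewrite (@nneseriesD1 _ _ a)//.
by apply: leeDl; apply: nneseries_ge0.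
Qed.

Section grid_traces.
Context (R : realType) (disp : measure_display)
  (X : metricMeasurableType R disp) (mu : {measure set X -> \bar R})
  (Omega E : set X) (d s L : R) (gr : grid mu Omega E d s L).
Hypotheses (hmu : complete_borel mu) (oO : open Omega)
  (mE : (hausdorff_outer X d).-caratheodory E).
Hypotheses (L10 : (10 <= L)%R).
Local Notation Lam := (hausdorff_measure X d).
Local Notation XC := (caratheodory_type (hausdorff_outer X d)).

Definition gradius a : R := (rho gr / 2 ^+ a)%R.

Lemma rad_gt0 a : (0 < gradius a)%R.
Proof. by rewrite divr_gt0 ?rho_gt0// exprn_gt0. Qed.

Lemma radS a : (gradius a = 2 * gradius a.+1)%R.
Proof. by rewrite /gradius exprS invfM mulrCA (mulrA 2%R) divff// mul1r. Qed.

Lemma rad_add a n : gradius (a + n) = (gradius a / 2 ^+ n)%R.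
Proof. by rewrite /gradius exprD invfM mulrA. Qed.

Lemma rad_le a b : (a <= b)%N -> (gradius b <= gradius a)%R.
Proof.
move=> ab; rewrite -(subnKC ab) rad_add ler_pdivrMr ?exprn_gt0//.
by rewrite ler_peMr ?exprn_ege1 ?ler1n ?(ltW (rad_gt0 _)).
Qed.

Lemma rad_le_rho a : (gradius a <= rho gr)%R.
Proof. by have := rad_le (leq0n a); rewrite {2}/gradius expr0 divr1. Qed.

Lemma rad_powR a e : (gradius a `^ e = rho gr `^ e * (2 `^ (- e)) ^+ a)%R.
Proof.
rewrite /gradius powRM ?(ltW (rho_gt0 gr)) ?invr_ge0 ?exprn_ge0//; congr (_ * _)%R.
elim: a => [|a IH]; first by rewrite !expr0 invr1 powR1.
rewrite !exprS invfM powRM ?invr_ge0 ?exprn_ge0// IH; congr (_ * _)%R.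
by rewrite -powR_inv1// -powRrM mulN1r.
Qed.

Definition mass a c := fine (mu (ball_of Omega c (gradius a))).

Lemma mball_ofP x t : measurable (ball_of Omega x t).
Proof. exact: (measurable_ball_of hmu oO). Qed.

Lemma radL a (k : R) : (0 < k <= L)%R -> (0 < k * gradius a <= L * rho gr)%R.
Proof.
move=> /andP[k0 kL]; rewrite mulr_gt0 ?rad_gt0//=.
by apply: ler_pM => //; [exact: ltW|exact/ltW/rad_gt0|exact: rad_le_rho].
Qed.

Lemma ball_mass x t : E x -> (0 < t <= L * rho gr)%R ->
  0 < mu (ball_of Omega x t) < +oo.
Proof. exact: mass_fin. Qed.

Lemma rad1 a : (0 < gradius a <= rho gr)%R.
Proof. by rewrite rad_gt0 rad_le_rho. Qed.

Lemma massE a c : E c -> mu (ball_of Omega c (gradius a)) = (mass a c)%:E.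
Proof.
move=> Ec; rewrite /mass fineK//.
have := @ball_mass c (gradius a) Ec; rewrite -[gradius a]mul1r radL; last first.
  by rewrite ltr01 (le_trans _ L10)// ler1n.
by move=> /(_ isT) /andP[m0 moo]; rewrite ge0_fin_numE.
Qed.

Lemma mass_gt0 a c : E c -> (0 < mass a c)%R.
Proof.
move=> Ec; rewrite -lte_fin -massE//.
have := @ball_mass c (gradius a) Ec; rewrite -[gradius a]mul1r radL; last first.
  by rewrite ltr01 (le_trans _ L10)// ler1n.
by move=> /(_ isT) /andP[].
Qed.

Lemma mass_ge a c : E c -> (lowC gr * gradius a `^ s <= mass a c)%R.
Proof. by move=> Ec; rewrite -lee_fin -massE//; apply: mass_low => //; exact: rad1. Qed.

(** Taking the first suitable centre makes functions of the cell into step functions on differences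
    of balls, hence measurable. The default [point] is not reached on [E], which the net covers. *)
Fixpoint pickf (l : seq X) (r : R) (x : X) : X :=
  if l is c :: l' then if (mdist c x < r)%R then c else pickf l' r x else point.

Definition cell a x := pickf (net gr a) (gradius a) x.

Lemma cellP a x : E x -> cell a x \in net gr a /\ (mdist (cell a x) x < gradius a)%R.
Proof.
move=> Ex; rewrite /cell.
have : exists2 c, c \in net gr a & (mdist c x < gradius a)%R by exact: net_cover.
elim: (net gr a) => [[]//|c l IH [c']] /=; case: ifPn => [cx _ _|ncx].
  by rewrite mem_head.
rewrite inE => /orP[/eqP ->|c'l c'x]; first by rewrite (negbTE ncx).
by have [|h1 h2] := IH; [exists c'|rewrite inE h1 orbT].
Qed.

Lemma cell_E a x : E x -> E (cell a x).
Proof. by move=> /(cellP a)[/(net_sub) ]. Qed.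

Lemma measurable_hball c r : measurable (ball c r : set XC).
Proof. exact: hausdorff_ball. Qed.

Lemma measurable_cell a (G : X -> R) : measurable_fun (E : set XC) (G \o cell a : XC -> R).
Proof.
rewrite /cell.
elim: (net gr a) => [|c l IH] /=; first exact: measurable_cst.
rewrite (_ : _ \o _ = (fun x => if (mdist c x < gradius a)%R then G c else G (pickf l (gradius a) x))); last first.
  by apply/funext => x /=; case: ifPn.
have mb : measurable_fun (E : set XC) (fun x : XC => (mdist c x < gradius a)%R).
  apply: (@measurable_fun_bool _ XC E _ true); apply: (@measurableI _ XC) => //.
  rewrite (_ : _ @^-1` _ = ball c (gradius a)); first exact: measurable_hball.
  by rewrite ballEmdist.
apply: (@measurable_fun_if _ _ XC (measurableTypeR R) (fun _ => G c)
  (fun x => G (pickf l (gradius a) x)) E mE _ mb).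
- exact: (@measurable_cst _ _ XC (measurableTypeR R)).
- by apply: (@measurable_funS _ _ XC (measurableTypeR R) E) IH => //; exact: subIsetl.
Qed.

Section oscillation.
Variables (p beta K : R).
Hypotheses (p1 : (1 <= p)%R) (K0 : (0 <= K)%R).
Let p0 : (0 < p)%R. Proof. exact: lt_le_trans p1. Qed.

Definition nu (f : X -> \bar R) (A : set X) := fine (\int[mu]_(y in A `&` Omega) f y).

(* The right-hand side of the Poincare inequality, [f] being the [p]-th power of a gradient. *)
Definition osc (f : X -> \bar R) a c :=
  (K * gradius a `^ beta * (nu f (ball c (L * gradius a)) / mass a c) `^ p^-1)%R.

(** The interface between gradients and traces: Hajlasz gradients and the Poincare inequality both
    provide it. The radius [4 * gradius a] leaves room for the cell balls of the next scale and for
    balls centred at the points of the cell. *)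
Definition osc_control (u f : X -> \bar R) := forall a c, c \in net gr a ->
  exists b : R, \int[mu]_(y in ball_of Omega c (4 * gradius a)) `|u y - b%:E| <=
    (mass a c * osc f a c)%:E.

Definition energy (f : X -> \bar R) := [/\ measurable_fun Omega f,
  forall y, Omega y -> 0 <= f y & \int[mu]_(y in Omega) f y < +oo].

Lemma osc_ge0 f a c : (0 <= osc f a c)%R.
Proof. by rewrite !mulr_ge0// powR_ge0. Qed.

Section one_function.
Variables (u f : X -> \bar R).
Hypotheses (mu_ : measurable_fun Omega u) (ouf : osc_control u f).

Definition Tavg a x := fine (average mu (ball_of Omega (cell a x) (gradius a)) u).

(** A ball inside the fourfold ball with radius [t] at least [gradius a.+1] has mass comparable to
    that of [c], because its dilate by [L] contains the ball of radius [gradius a] about [c]; then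
    [average_close] applies. *)
Let ball_close a c : c \in net gr a -> exists2 b : R,
   \int[mu]_(y in ball_of Omega c (4 * gradius a)) `|u y - b%:E| <=
    (mass a c * osc f a c)%:E &
   forall y t, E y -> (gradius a.+1 <= t)%R -> (mdist c y + t <= 4 * gradius a)%R ->
     [/\ mu.-integrable (ball_of Omega y t) u,
        average mu (ball_of Omega y t) u \is a fin_num &
       (`|fine (average mu (ball_of Omega y t) u) - b| <= dblC gr * osc f a c)%R].
Proof.
move=> ca; have [b Hb] := ouf ca; exists b => // y t Ey ta yt.
have Ec := net_sub ca; have r0 := rad_gt0 a; have m0 := mass_gt0 a Ec.
have t0 : (0 < t)%R by apply: lt_le_trans ta; exact: rad_gt0.
have t4 : (t <= 4 * gradius a)%R by apply: le_trans yt; rewrite lerDr mdist_ge0.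
have ar := rad_le_rho a.
have tL : (0 < t <= L * rho gr)%R.
  rewrite t0 (le_trans t4)//; have /andP[_] := @radL a 4%R ltac:(rewrite (le_trans _ L10) ?ltr0n ?ler_nat//).
  by [].
have [iu fu avgb] := average_close (mball_ofP y t) (mball_ofP c (4 * gradius a)%R)
  (ball_of_subset yt) (measurable_funS (hmu.1 _ oO) (@subIsetr _ _ _) mu_) (ball_mass Ey tL) Hb.
split => //; apply: le_trans avgb _.
have mt0 : (0 < fine (mu (ball_of Omega y t)))%R.
  by have /andP[h1 h2] := ball_mass Ey tL; rewrite fine_gt0// h1.
rewrite ler_pdivrMr// [leRHS]mulrAC; apply: ler_wpM2r; first exact: osc_ge0.
have mtf : mu (ball_of Omega y t) \is a fin_num.
  by have /andP[h1 h2] := ball_mass Ey tL; rewrite ge0_fin_numE.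
have : mu (ball_of Omega c (gradius a)) <= (dblC gr)%:E * mu (ball_of Omega y t).
  have [tr|tr] := leP t (rho gr).
    have dt : mu (ball_of Omega y (L * t)) <= (dblC gr)%:E * mu (ball_of Omega y t).
      by apply: mass_dbl => //; rewrite t0.
    apply: le_trans dt.
    apply: le_measure; rewrite ?inE; [exact: mball_ofP..|].
    apply: ball_of_subset; rewrite metric_sym.
    have : (10 * t <= L * t)%R by rewrite ler_pM2r.
    have := mdist_ge0 c y; have := radS a; lra.
  apply: (@le_trans _ _ ((dblC gr)%:E * mu (ball_of Omega y (rho gr)))).
    have dt : mu (ball_of Omega y (L * rho gr)) <= (dblC gr)%:E * mu (ball_of Omega y (rho gr)).
      by apply: mass_dbl => //; rewrite rho_gt0/=.
    apply: le_trans dt.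
    apply: le_measure; rewrite ?inE; [exact: mball_ofP..|].
    apply: ball_of_subset; rewrite metric_sym.
    have : (10 * rho gr <= L * rho gr)%R by rewrite ler_pM2r// rho_gt0.
    have := mdist_ge0 c y; lra.
  apply: lee_wpmul2l; first by rewrite lee_fin ltW// dblC_gt0.
  apply: le_measure; rewrite ?inE; [exact: mball_ofP..|].
  by apply: ball_of_subset; rewrite mdistxx add0r ltW.
by rewrite massE// -(fineK mtf) -EFinM lee_fin.
Qed.

Let cell_ball a x : E x -> (mdist (cell a x) (cell a x) + gradius a <= 4 * gradius a)%R.
Proof. by move=> Ex; rewrite mdistxx; have := rad_gt0 a; lra. Qed.

Lemma Tavg_step a x : E x ->
  (`|Tavg a.+1 x - Tavg a x| <= 2 * dblC gr * osc f a (cell a x))%R.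
Proof.
move=> Ex; have [ca cx] := cellP a Ex; have [ca' cx'] := cellP a.+1 Ex.
have [b _ Hb] := ball_close ca; have r0 := rad_gt0 a; have rS := radS a.
have [_ _ h1] := Hb (cell a x) (gradius a) (cell_E a Ex) (rad_le (leqnSn a)) (cell_ball a Ex).
have [|_ _ h2] := Hb (cell a.+1 x) (gradius a.+1) (cell_E _ Ex) (lexx _).
  have := metric_triangle (cell a x) x (cell a.+1 x); rewrite (metric_sym x); lra.
rewrite /Tavg; set A := fine _ in h2 *; set B := fine _ in h1 *.
have -> : (A - B = (A - b) - (B - b))%R by ring.
by apply: le_trans (ler_normB _ _) _; rewrite -mulrA mulr_natl mulr2n lerD.
Qed.

Lemma Tavg_ball a x t : E x -> (gradius a.+1 <= t <= gradius a)%R ->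
  average mu (ball_of Omega x t) u \is a fin_num /\
  (`|fine (average mu (ball_of Omega x t) u) - Tavg a x| <=
     2 * dblC gr * osc f a (cell a x))%R.
Proof.
move=> Ex /andP[t1 t2]; have [ca cx] := cellP a Ex.
have [b _ Hb] := ball_close ca; have r0 := rad_gt0 a.
have [_ _ h1] := Hb (cell a x) (gradius a) (cell_E a Ex) (rad_le (leqnSn a)) (cell_ball a Ex).
have [|_ fi h2] := Hb x t Ex t1; first lra.
split => //; rewrite /Tavg; set A := fine _ in h2 *; set B := fine _ in h1 *.
have -> : (A - B = (A - b) - (B - b))%R by ring.
by apply: le_trans (ler_normB _ _) _; rewrite -mulrA mulr_natl mulr2n lerD.
Qed.

Lemma Tavg_osc a x : E x ->
  \int[mu]_(y in ball_of Omega (cell a x) (gradius a)) `|u y - (Tavg a x)%:E| <=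
  (mass a (cell a x) * ((1 + dblC gr) * osc f a (cell a x)))%:E.
Proof.
move=> Ex; have [ca cx] := cellP a Ex.
have [b Hb0 Hb] := ball_close ca; have r0 := rad_gt0 a.
have [iu _ h1] := Hb (cell a x) (gradius a) (cell_E a Ex) (rad_le (leqnSn a)) (cell_ball a Ex).
set B := ball_of Omega (cell a x) (gradius a) in iu h1 *.
have mB : measurable B by exact: mball_ofP.
have mub (k : R) : measurable_fun B (fun y => `|u y - k%:E|).
  apply: measurableT_comp => //; apply: emeasurable_funB; last exact: measurable_cst.
  by apply: measurable_funS mu_; [exact: hmu.1|exact: subIsetr].
have le0 : \int[mu]_(y in B) `|u y - b%:E| <= (mass a (cell a x) * osc f a (cell a x))%:E.
  apply: le_trans Hb0; apply: ge0_subset_integral => //.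
  - exact: mball_ofP.
  - apply: measurableT_comp => //; apply: emeasurable_funB; last exact: measurable_cst.
    by apply: measurable_funS mu_; [exact: hmu.1|exact: subIsetr].
  - by apply: ball_of_subset; rewrite mdistxx; lra.
apply: (@le_trans _ _ (\int[mu]_(y in B) (`|u y - b%:E| + (dblC gr * osc f a (cell a x))%:E))).
  apply: ge0_le_integral => //.
    by apply: emeasurable_funD => //; exact: measurable_cst.
  move=> y By; apply: (@le_trans _ _ (`|u y - b%:E| + `|(b - Tavg a x)%:E|)).
    have -> : u y - (Tavg a x)%:E = (u y - b%:E) + (b - Tavg a x)%:E.
      by case: (u y) => [z| |] //; rewrite -!EFinB -EFinD; congr EFin; ring.
    exact: lee_abs_add.
  by rewrite leeD2l// lee_fin /= distrC.
have c0 : (0 <= dblC gr * osc f a (cell a x))%R.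
  by rewrite mulr_ge0 ?osc_ge0// ltW// dblC_gt0.
rewrite (@ge0_integralD _ _ _ mu B mB (fun y => `|u y - b%:E|) (cst (dblC gr * osc f a (cell a x))%:E))//.
rewrite integral_cst// massE; last exact: cell_E.
rewrite -EFinM; apply: le_trans (leeD2r _ le0) _; rewrite -EFinD lee_fin; lra.
Qed.

End one_function.

Section energy_sums.
Variables (f : X -> \bar R).
Hypothesis ef : energy f.

Let mf A : measurable A -> measurable_fun (A `&` Omega) f.
Proof. by move=> mA; have [h _ _] := ef; apply: measurable_funS h; [exact: hmu.1|exact: subIsetr]. Qed.

Let mAO A : measurable A -> measurable (A `&` Omega).
Proof. by move=> mA; apply: measurableI => //; exact: hmu.1. Qed.

Lemma nuE A : measurable A -> \int[mu]_(y in A `&` Omega) f y = (nu f A)%:E.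
Proof.
move=> mA; rewrite /nu fineK//; have [h f0 foo] := ef.
rewrite ge0_fin_numE; last by apply: integral_ge0 => y [_ /f0].
apply: le_lt_trans foo; apply: ge0_subset_integral => //; [exact: mAO|exact: hmu.1].
Qed.

Lemma nu_ge0 A : (0 <= nu f A)%R.
Proof. by apply: fine_ge0; apply: integral_ge0 => y [_]; have [_ + _] := ef; apply. Qed.

Lemma le_nu A B : measurable A -> measurable B -> A `<=` B -> (nu f A <= nu f B)%R.
Proof.
move=> mA mB AB; rewrite -lee_fin -!nuE//; apply: ge0_subset_integral.
- exact: mAO. - exact: mAO. - exact: mf.
- by move=> y [_]; have [_ + _] := ef; apply.
- exact: setSI.
Qed.

Lemma nu_le_total A : measurable A -> (nu f A <= fine (\int[mu]_(y in Omega) f y))%R.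
Proof.
move=> mA; have -> : fine (\int[mu]_(y in Omega) f y) = nu f setT by rewrite /nu setTI.
exact: le_nu.
Qed.

(** The sum is the integral of [f] times a sum of indicators, and that sum is at most [N] at every
    point. *)
Lemma sum_nu (I : eqType) (l : seq I) (B : I -> set X) (A : set X) (N : nat) :
  (forall c, measurable (B c)) -> measurable A -> (forall c, c \in l -> B c `<=` A) ->
  (forall y, (size [seq c <- l | y \in B c] <= N)%N) ->
  (\sum_(c <- l) nu f (B c) <= N%:R * nu f A)%R.
Proof.
move=> mB mA BA sz; rewrite -lee_fin EFinM -sumEFin.
have [h f0 foo] := ef.
have g0 c y : (A `&` Omega) y -> 0 <= f y * (\1_(B c) y)%:E.
  by move=> [_ /f0 y0]; rewrite mule_ge0// lee_fin.
have mg c : measurable_fun (A `&` Omega) (fun y => f y * (\1_(B c) y)%:E).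
  apply: emeasurable_funM; first exact: mf.
  by apply/measurable_EFinP; apply: measurable_funTS; exact: measurable_indic.
have -> : \sum_(c <- l) (nu f (B c))%:E =
    \int[mu]_(y in A `&` Omega) (\sum_(c <- l) f y * (\1_(B c) y)%:E).
  rewrite ge0_integral_sum//; last exact: mAO.
  apply: eq_big_seq => c cl; rewrite -nuE// [LHS]integral_mkcond [RHS]integral_mkcond.
  apply: eq_integral => y _; rewrite !patchE !in_setI indicE.
  have [yB|yB] := boolP (y \in B c); last by rewrite mule0; case: ifP.
  by rewrite (mem_set (BA c cl y (set_mem yB))) mule1.
rewrite -nuE// -ge0_integralZl//; first last.
- by move=> y [_ /f0].
- exact: mf.
- exact: mAO.
apply: ge0_le_integral => //.
- exact: mAO.
- by move=> y Ay; apply: sume_ge0 => c _; exact: g0.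
- exact: emeasurable_sum.
- by apply: measurable_funeM; exact: mf.
move=> y Ay; under eq_bigr do rewrite indicE.
have y0 : 0 <= f y by case: Ay => _ /f0.
rewrite sum_filter_mul// lee_wpmul2r// lee_fin ler_nat -size_filter; exact: sz.
Qed.

End energy_sums.

Section majorant.
Variable (tau : R).
Hypothesis pt : (p <= tau)%R.
Let e : R := (d + beta * tau - s * tau / p)%R.
Hypothesis e0 : (0 < e)%R.

Let tau0 : (0 < tau)%R. Proof. exact: lt_le_trans pt. Qed.

(** Half of the decay of [gradius a ^ e], which is a multiple of [theta ^ (2 a)]: one factor
    [theta ^ a] pays for the growing weights, the other keeps the series over the scales
    convergent. *)
Definition theta : R := (2 `^ (- (e / 2)))%R.

Lemma theta01 : (0 < theta < 1)%R.
Proof.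
rewrite powR_gt0//= /theta powRN invf_lt1 ?powR_gt0//.
have : (1 `^ (e / 2) < 2 `^ (e / 2) :> R)%R.
  by apply: gt0_ltr_powR; rewrite ?nnegrE ?divr_gt0// ltr1n.
by rewrite powR1.
Qed.

Definition wgt f a c : R := (theta^-1 ^+ a * osc f a c `^ tau)%R.

(* The weights of [wgt] grow geometrically in [a], so that a bound on [Wmaj] at [x] makes the
   oscillations at [x] decay geometrically. *)
Definition Wmaj f x : \bar R := \sum_(a <oo) \sum_(c <- net gr a)
  (wgt f a c)%:E * (\1_(ball c (gradius a)) x)%:E.

Lemma wgt_ge0 f a c : (0 <= wgt f a c)%R.
Proof. by rewrite mulr_ge0 ?powR_ge0// exprn_ge0// invr_ge0; case/andP: theta01 => /ltW. Qed.

Let term_ge0 f a c x : 0 <= (wgt f a c)%:E * (\1_(ball c (gradius a)) x)%:E.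
Proof. by rewrite mule_ge0// lee_fin ?wgt_ge0. Qed.

Lemma Wmaj_ge0 f x : 0 <= Wmaj f x.
Proof. by apply: nneseries_ge0 => n _ _; apply: sume_ge0 => c _. Qed.

Let mterm f a c : measurable_fun (E : set XC)
  (fun x : XC => (wgt f a c)%:E * (\1_(ball c (gradius a)) x)%:E).
Proof.
apply: (@measurable_funeM _ XC); apply/(@measurable_EFinP _ XC).
by apply: (@measurable_funTS _ _ XC (measurableTypeR R));
  apply: (@measurable_indic _ XC); exact: measurable_hball.
Qed.

Lemma measurable_Wmaj f : measurable_fun (E : set XC) (Wmaj f : XC -> \bar R).
Proof.
apply: (@ge0_emeasurable_sum _ XC R E (fun a x => \sum_(c <- net gr a)
  (wgt f a c)%:E * (\1_(ball c (gradius a)) x)%:E) xpredT).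
  by move=> a x _ _; apply: sume_ge0 => c _.
by move=> a _; apply: (@emeasurable_sum _ XC).
Qed.

Definition Wcst : R :=
  (K `^ tau * (lowC gr) `^ (- (tau / p)) * (overlap gr)%:R * hausC gr * rho gr `^ e)%R.

(** Since [tau >= p], the power [tau / p] of the energy of a ball splits into one linear factor,
    which the overlap bound can sum over the net, and a power [tau / p - 1], which the total energy
    bounds. *)
Let osc_pow f a c (M : R) : energy f -> E c ->
  (fine (\int[mu]_(y in Omega) f y) <= M)%R -> (0 < M)%R ->
  (osc f a c `^ tau * gradius a `^ d <= K `^ tau * (lowC gr) `^ (- (tau / p)) *
     M `^ (tau / p - 1) * nu f (ball c (L * gradius a)) * gradius a `^ e)%R.
Proof.
move=> ef Ec VM M0.
have r0 := rad_gt0 a; have m0 := mass_gt0 a Ec; have ml := mass_ge a Ec.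
set n := nu f _.
have n0 : (0 <= n)%R by exact: nu_ge0.
have nM : (n <= M)%R.
  by apply: le_trans (nu_le_total ef _) VM; apply: hmu.1; exact: mball_open.
have l0 := lowC_gt0 gr.
have ls0 : (0 < lowC gr * gradius a `^ s)%R by rewrite mulr_gt0// powR_gt0.
have tp0 : (0 < tau / p)%R by rewrite divr_gt0.
have h1 : ((n / mass a c) `^ (tau / p) <=
    M `^ (tau / p - 1) * n * ((lowC gr) `^ (- (tau / p)) * gradius a `^ (- (s * (tau / p)))))%R.
  apply: (@le_trans _ _ ((n / (lowC gr * gradius a `^ s)) `^ (tau / p))%R).
    apply: ge0_ler_powR; rewrite ?nnegrE ?divr_ge0 ?(ltW m0) ?(ltW ls0) ?(ltW tau0) ?(ltW p0)//.
    by rewrite ler_wpM2l// lef_pV2 ?posrE.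
  rewrite powRM ?invr_ge0 ?(ltW ls0)//.
  have -> : ((lowC gr * gradius a `^ s)^-1 `^ (tau / p) =
      (lowC gr) `^ (- (tau / p)) * gradius a `^ (- (s * (tau / p))))%R.
    rewrite -powR_inv1 ?(ltW ls0)// -powRrM mulN1r powRM ?powR_ge0 ?(ltW l0)//.
    by rewrite -powRrM mulrN.
  apply: ler_wpM2r; first by rewrite mulr_ge0 ?powR_ge0.
  have [->|nN0] := eqVneq n 0%R; first by rewrite powR0 ?gt_eqF// mulr0.
  have np : (0 < n)%R by rewrite lt_neqAle eq_sym nN0.
  rewrite powR_predr//; apply: ler_wpM2r => //.
  apply: ge0_ler_powR; rewrite ?nnegrE ?(ltW M0)//.
  by rewrite subr_ge0 ler_pdivlMr// mul1r.
rewrite /osc -/n powRM ?mulr_ge0 ?powR_ge0//.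
rewrite -[X in (_ * X * _ <= _)%R]powRrM (mulrC p^-1)%R.
rewrite powRM ?powR_ge0// -(powRrM _ beta).
have E' : (gradius a `^ e = gradius a `^ d * gradius a `^ (beta * tau) * gradius a `^ (- (s * (tau / p))))%R.
  by rewrite -!powR_gtD//; congr (_ `^ _)%R; rewrite /e mulrA.
rewrite E'.
have P0 : (0 <= K `^ tau * gradius a `^ (beta * tau) * gradius a `^ d)%R.
  by rewrite !mulr_ge0 ?powR_ge0.
have H := ler_wpM2l P0 h1.
rewrite [leLHS](_ : _ = K `^ tau * gradius a `^ (beta * tau) * gradius a `^ d * (n / mass a c) `^ (tau / p))%R; last by ring.
apply: le_trans H _.
by rewrite le_eqVlt; apply/orP; left; apply/eqP; ring.
Qed.

Lemma integral_Wmaj f (M : R) : energy f ->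
  (fine (\int[mu]_(y in Omega) f y) <= M)%R -> (0 < M)%R ->
  \int[Lam]_(x in (E : set XC)) Wmaj f x <= (Wcst / (1 - theta) * M `^ (tau / p))%:E.
Proof.
move=> ef VM M0; have /andP[th0 th1] := theta01.
have mfin a : measurable_fun (E : set XC) (fun x : XC => \sum_(c <- net gr a)
    (wgt f a c)%:E * (\1_(ball c (gradius a)) x)%:E) by apply: (@emeasurable_sum _ XC).
have CM : (0 <= Wcst * M `^ (tau / p))%R.
  by rewrite !mulr_ge0 ?powR_ge0// ltW// hausC_gt0.
rewrite (@integral_nneseries _ XC R Lam E mE); last 2 first.
- exact: mfin.
- by move=> a x _; apply: sume_ge0 => c _.
have -> : (Wcst / (1 - theta) * M `^ (tau / p) = Wcst * M `^ (tau / p) / (1 - theta))%R by ring.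
apply: le_trans (nneseries_geometric CM theta01).
apply: lee_nneseries => [a _ _|a _].
  by apply: integral_ge0 => x _; apply: sume_ge0 => c _.
rewrite (@ge0_integral_sum _ XC R Lam E mE X (fun c x => (wgt f a c)%:E * (\1_(ball c (gradius a)) x)%:E)) //.
have rE c : E c -> (0 < gradius a <= L * rho gr)%R.
  by move=> _; rewrite -[gradius a]mul1r radL// ltr01 (le_trans _ L10)// ler1n.
apply: (@le_trans _ _ (\sum_(c <- net gr a) (theta^-1 ^+ a * hausC gr * (osc f a c `^ tau * gradius a `^ d))%:E)).
  rewrite big_seq [leRHS]big_seq; apply: lee_sum => c ca; have Ec := net_sub ca.
  rewrite (@ge0_integralZl _ XC R Lam E mE (fun x => (\1_(ball c (gradius a)) x)%:E)); last 3 first.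
  - apply/(@measurable_EFinP _ XC).
    by apply: (@measurable_funTS _ _ XC (measurableTypeR R));
      apply: (@measurable_indic _ XC); exact: measurable_hball.
  - by move=> x _; rewrite lee_fin.
  - by rewrite lee_fin wgt_ge0.
  rewrite (@integral_indic _ XC R Lam E mE); last exact: measurable_hball.
  apply: (@le_trans _ _ ((wgt f a c)%:E * (hausC gr * gradius a `^ d)%:E)).
    rewrite lee_wpmul2l ?lee_fin ?wgt_ge0// setIC.
    by apply: haus_up => //; exact: rE Ec.
  by rewrite -EFinM lee_fin /wgt le_eqVlt; apply/orP; left; apply/eqP; ring.
rewrite sumEFin lee_fin -mulr_sumr.
apply: (@le_trans _ _ (theta^-1 ^+ a * hausC gr * (\sum_(c <- net gr a)
   (K `^ tau * (lowC gr) `^ (- (tau / p)) *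
     M `^ (tau / p - 1) * nu f (ball c (L * gradius a)) * gradius a `^ e)))%R).
  apply: ler_wpM2l.
    by rewrite mulr_ge0 ?exprn_ge0 ?invr_ge0 ?(ltW th0)// ltW// hausC_gt0.
  by rewrite big_seq [leRHS]big_seq; apply: ler_sum => c /net_sub Ec; exact: osc_pow.
rewrite -mulr_suml -mulr_sumr.
have sn : (\sum_(c <- net gr a) nu f (ball c (L * gradius a)) <= (overlap gr)%:R * M)%R.
  apply: le_trans (sum_nu ef (A := setT) (N := overlap gr) _ _ _ _) _ => //.
  - by move=> c; apply: hmu.1; exact: mball_open.
  - move=> y; apply: leq_trans (net_overlap gr a y); rewrite !size_filter.
    by apply: sub_count => c; rewrite inE ballEmdist.
  - by rewrite ler_wpM2l// /nu setTI.
have MM : (M `^ (tau / p - 1) * M = M `^ (tau / p))%R.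
  by rewrite -powR_predr.
have te : (2 `^ (- e) = theta * theta)%R.
  by rewrite /theta -powR_gtD//; congr (_ `^ _)%R; field.
rewrite rad_powR te exprMn.
have tt : (theta^-1 ^+ a * theta ^+ a = 1)%R by rewrite -exprMn mulVf ?gt_eqF// expr1n.
set S := (\sum_(i <- _) _)%R in sn *.
have -> : (theta^-1 ^+ a * hausC gr * (K `^ tau * lowC gr `^ (- (tau / p)) *
   M `^ (tau / p - 1) * S * (rho gr `^ e * (theta ^+ a * theta ^+ a))) =
   (theta^-1 ^+ a * theta ^+ a) * (hausC gr * K `^ tau * lowC gr `^ (- (tau / p)) *
   rho gr `^ e * theta ^+ a * M `^ (tau / p - 1)) * S)%R by ring.
rewrite tt mul1r.
apply: le_trans (ler_wpM2l _ sn) _.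
  by rewrite !mulr_ge0 ?powR_ge0 ?exprn_ge0 ?(ltW th0) ?(ltW (hausC_gt0 gr)).
rewrite -MM /Wcst; by rewrite le_eqVlt; apply/orP; left; apply/eqP; ring.
Qed.

Lemma osc_le_Wmaj f a x : E x -> Wmaj f x < +oo ->
  (osc f a (cell a x) <= (theta `^ tau^-1) ^+ a * fine (Wmaj f x) `^ tau^-1)%R.
Proof.
move=> Ex Wf; have [ca cx] := cellP a Ex; have /andP[th0 th1] := theta01.
have Wfin : Wmaj f x \is a fin_num by rewrite ge0_fin_numE// Wmaj_ge0.
have : (wgt f a (cell a x) <= fine (Wmaj f x))%R.
  rewrite -lee_fin fineK//.
  pose g i := \sum_(c <- net gr i) (wgt f i c)%:E * (\1_(ball c (gradius i)) x)%:E.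
  have g0 i : 0 <= g i by apply: sume_ge0 => c _; exact: term_ge0.
  apply: le_trans (lee_nneseries_term a g0).
  apply: le_trans (lee_bigsum_term (fun c => term_ge0 f a c x) ca).
  have -> : (\1_(ball (cell a x) (gradius a)) x)%:E = 1 :> \bar R.
    by rewrite indicE mem_set// ballEmdist.
  by rewrite mule1 lexx.
rewrite /wgt exprVn ler_pdivrMl ?exprn_gt0// => h.
have o0 := osc_ge0 f a (cell a x).
have W0 : (0 <= fine (Wmaj f x))%R by rewrite fine_ge0// Wmaj_ge0.
rewrite -[leLHS](powRr1 o0) -(mulfV (lt0r_neq0 tau0)) powRrM.
apply: le_trans (ge0_ler_powR _ _ _ h) _; rewrite ?nnegrE ?invr_ge0 ?powR_ge0 ?(ltW tau0)//.
  by rewrite mulr_ge0// exprn_ge0// ltW.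
rewrite powRM ?exprn_ge0 ?(ltW th0)//.
by rewrite -(powR_mulrn _ (ltW th0)) powRAC powR_mulrn ?powR_ge0.
Qed.

End majorant.
End oscillation.
End grid_traces.

(** * Geometric limits, diagonal extraction and bounds in L^q *)

Lemma geometric_cauchy (R : realType) (y : nat -> R) (B x : R) :
  (0 <= B)%R -> (0 < x < 1)%R ->
  (forall a, `|y a.+1 - y a| <= B * x ^+ a)%R ->
  exists l : R, forall a, (`|y a - l| <= B / (1 - x) * x ^+ a)%R.
Proof.
move=> B0 /andP[x0 x1] step; pose c := (B / (1 - x))%R.
have x1' : (0 < 1 - x)%R by rewrite subr_gt0.
have cB a : (B * x ^+ a = c * x ^+ a - c * x ^+ a.+1)%R.
  by rewrite /c exprS; field; rewrite gt_eqF.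
have c0 a : (0 <= c * x ^+ a)%R by rewrite mulr_ge0 ?divr_ge0 ?exprn_ge0// ltW.
(* The intervals from [lo a] to [up a] are nested: by [cB] the loss of half-length from one scale to
   the next is exactly the bound on one step. *)
pose lo a := (y a - c * x ^+ a)%R; pose up a := (y a + c * x ^+ a)%R.
have loS : {homo lo : a b / (a <= b)%N >-> (a <= b)%R}.
  apply/nondecreasing_seqP => a; have := step a; rewrite /lo cB ler_distl; lra.
have upS : {homo up : a b / (a <= b)%N >-> (b <= a)%R}.
  apply/nonincreasing_seqP => a; have := step a; rewrite /up cB ler_distl; lra.
have lu a b : (lo a <= up b)%R.
  apply: le_trans (loS _ _ (leq_maxl a b)) _; apply: le_trans (upS _ _ (leq_maxr a b)).
  by rewrite /lo /up; have := c0 (maxn a b); lra.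
exists (sup (range lo)) => a.
have h1 : (lo a <= sup (range lo))%R.
  by apply: ub_le_sup; [exists (up 0%N) => _ [n _ <-]|exists a].
have h2 : (sup (range lo) <= up a)%R.
  by apply: ge_sup; [exists (lo 0%N), 0%N|move=> _ [n _ <-]].
move: h1 h2; rewrite /lo /up -/c ler_distl; lra.
Qed.

(** Split according to [a <= N]. With the free threshold [N] this weak form of Young's inequality
    takes the place of Holder's inequality on sets of finite measure. *)
Lemma powR_young (R : realType) (q t : R) (a N : R) : (0 < q)%R -> (q <= t)%R ->
  (0 <= a)%R -> (0 < N)%R -> (a `^ q <= N `^ q + N `^ (q - t) * a `^ t)%R.
Proof.
move=> q0 qt a0 N0; have [aN|Na] := leP a N.
  apply: (@le_trans _ _ (N `^ q)%R); last by rewrite lerDl mulr_ge0 ?powR_ge0.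
  by apply: ge0_ler_powR; rewrite ?nnegrE ?(ltW q0) ?(ltW N0).
have a0' := lt_trans N0 Na.
apply: (@le_trans _ _ (N `^ (q - t) * a `^ t)%R); last by rewrite lerDr powR_ge0.
have -> : (a `^ q = a `^ (q - t) * a `^ t)%R by rewrite -powR_gtD// subrK.
apply: ler_wpM2r; first exact: powR_ge0.
rewrite -(opprB t) !powRN lef_pV2 ?posrE ?powR_gt0//.
by apply: ge0_ler_powR; rewrite ?nnegrE ?subr_ge0// ltW.
Qed.

Lemma powR_add_le (R : realType) (t a b : R) : (0 <= t)%R -> (0 <= a)%R -> (0 <= b)%R ->
  ((a + b) `^ t <= 2 `^ t * (a `^ t + b `^ t))%R.
Proof.
move=> t0; wlog ab : a b / (a <= b)%R => [wl|] a0 b0.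
  by have [/wl|/ltW/wl h] := leP a b; [exact|rewrite addrC (addrC (a `^ t)%R); exact: h].
apply: (@le_trans _ _ ((2 * b) `^ t)%R).
  apply: ge0_ler_powR; rewrite ?nnegrE ?addr_ge0 ?mulr_ge0//.
  by rewrite mulr_natl mulr2n lerD2r.
by rewrite powRM// ler_wpM2l ?powR_ge0// lerDr powR_ge0.
Qed.

Section complete_measurable.
Context (R : realType) (disp : measure_display) (T : measurableType disp)
  (mu : {measure set T -> \bar R}).

Lemma complete_measurable_fun (disp' : measure_display) (Y : measurableType disp')
  (D : set T) (f g : T -> Y) : measure_is_complete mu -> measurable D ->
  {ae mu, forall x, D x -> f x = g x} -> measurable_fun D g -> measurable_fun D f.
Proof.
move=> cmu mD [N [mN N0 fg]] mg _ A mA.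
have -> : D `&` f @^-1` A = ((D `&` g @^-1` A) `\` N) `|` (D `&` f @^-1` A `&` N).
  apply/seteqP; split => x /=.
    move=> [Dx fA]; have [Nx|nN] := pselect (N x); [by right|left; split => //; split => //].
    rewrite -(_ : f x = g x)//.
    by apply: contrapT => h; apply: nN; apply: fg => /= /(_ Dx).
  move=> [[[Dx gA] nN]|[[Dx fA] _]] //; split => //.
  rewrite (_ : f x = g x)//.
  by apply: contrapT => h; apply: nN; apply: fg => /= /(_ Dx).
apply: measurableU; first by apply: measurableD => //; exact: mg.
by apply: cmu; exists N; split => // x [].
Qed.
End complete_measurable.

(** An ultrafilter finer than the cofinite filter makes all coordinates converge at once. Finitely
    many of its members always have a common element beyond any given index, which yields the
    subsequence without iterated extraction. *)
Lemma diagonal_subsequence (R : realType) (x : nat -> nat -> R) (B : nat -> R) :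
  (forall n k, `|x n k| <= B k)%R ->
  exists2 phi : nat -> nat, {homo phi : m n / (m < n)%N} &
    exists y : nat -> R, forall n k, (k <= n)%N -> (`|x (phi n) k - y k| < n.+1%:R^-1)%R.
Proof.
move=> xB.
have [G [uG sG]] := @ultraFilterLemma nat (\oo : set_system nat) _.
have pG : ProperFilter G by exact: ultra_proper.
have yex k : exists y : R, forall e : R, (0 < e)%R -> G [set m | (`|x m k - y| < e)%R].
  have [|y [_ cy]] := @segment_compact R (- B k)%R (B k) ((x^~ k) @ G) _.
    by apply: nearW => n /=; rewrite in_itv/= -ler_norml.
  exists y => e e0; have [//|nG] := in_ultra_setVsetC [set m | (`|x m k - y| < e)%R] uG.
  have hB : ((x^~ k) @ G) (~` ball (y : R) e).
    rewrite /fmap /= (_ : _ @^-1` _ = ~` [set m | (`|x m k - y| < e)%R])//.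
    by apply/seteqP; split => m /=; rewrite /ball/= distrC.
  by have [z [z1 z2]] := cy _ _ hB (nbhsx_ballx (y : R) e e0).
have [y yP] := choice yex.
have step n N : exists m, (N < m)%N /\ forall k, (k <= n)%N -> (`|x m k - y k| < n.+1%:R^-1)%R.
  have GN : G [set m | (N < m)%N] by apply: sG; exists N.+1.
  have Gk k : G [set m | (`|x m k - y k| < n.+1%:R^-1)%R].
    by apply: yP.
  have Gall : G [set m | forall k, (k <= n)%N -> (`|x m k - y k| < n.+1%:R^-1)%R].
    have : forall j, G [set m | forall k, (k < j)%N -> (`|x m k - y k| < n.+1%:R^-1)%R].
      elim=> [|j IH]; first by apply: nearW.
      apply: filterS2 IH (Gk j) => m h hj k; rewrite ltnS leq_eqVlt => /orP[/eqP->//|]; exact: h.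
    by move=> /(_ n.+1).
  have := filter_ex (filterI GN Gall); by move=> [m [h1 h2]]; exists m.
have [h hP] := choice (fun nN : nat * nat => step nN.1 nN.2).
pose phi := fix phi n := if n is n'.+1 then h (n, phi n') else h (0%N, 0%N).
exists phi.
  apply: homo_ltn; [exact: ltn_trans|move=> n /=].
  by have [] := hP (n.+1, phi n).
exists y => -[|n] k kn; first by have [_] := hP (0%N, 0%N); apply.
by have [_] := hP (n.+1, phi n); apply.
Qed.

Lemma geometric_small (R : realType) (C x e : R) : (0 < x < 1)%R -> (0 < e)%R ->
  exists n, (C * x ^+ n <= e)%R.
Proof.
move=> /andP[x0 x1] e0.
have : (C * x ^+ n)%R @[n --> \oo] --> (C * 0)%R.
  by apply: cvgMr; apply: cvg_expr; rewrite gtr0_norm.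
rewrite mulr0 => /cvgrPdist_le /(_ e e0) [M _ /(_ M (leqnn M))].
by rewrite /= sub0r normrN => h; exists M; apply: le_trans (ler_norm _) h.
Qed.

Lemma harmonic_small (R : realType) (C e : R) : (0 < e)%R ->
  exists M, forall n, (M <= n)%N -> (C * n.+1%:R^-1 <= e)%R.
Proof.
move=> e0; have := @cvg_harmonic R; move=> /(@cvgMr R _ _ _ _ C); rewrite mulr0.
move=> /cvgrPdist_le /(_ e e0) [M _ HM]; exists M => n /HM.
by rewrite /= sub0r normrN => h; apply: le_trans (ler_norm _) h.
Qed.

Lemma ge0_cvge0 (R : realType) (a : nat -> \bar R) : (forall n, 0 <= a n) ->
  (forall e : R, (0 < e)%R -> exists M, forall n, (M <= n)%N -> a n <= e%:E) ->
  a n @[n --> \oo] --> 0.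
Proof.
move=> a0 H; apply/fine_cvgP; split.
  have [M HM] := H 1%R ltr01; exists M => // n /= /HM h.
  by rewrite ge0_fin_numE//; apply: le_lt_trans h (ltry _).
apply/cvgrPdist_le => e e0; have [M HM] := H e e0; exists M => // n /= /HM h.
rewrite sub0r normrN ger0_norm ?fine_ge0// -lee_fin fineK//.
by rewrite ge0_fin_numE//; apply: le_lt_trans h (ltry _).
Qed.

Section Lq_bound.
Context (R : realType) (disp : measure_display) (T : measurableType disp)
  (m : {measure set T -> \bar R}).

Lemma ae_mono (P Q : T -> Prop) : (forall x, P x -> Q x) ->
  {ae m, forall x, P x} -> {ae m, forall x, Q x}.
Proof. by move=> PQ; exact: filterS. Qed.

Lemma complete_measurable_cvg (D : set T) (g : nat -> T -> R) (h : T -> R) :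
  measure_is_complete m -> measurable D -> (forall n, measurable_fun D (g n)) ->
  {ae m, forall x, D x -> g n x @[n --> \oo] --> h x} -> measurable_fun D h.
Proof.
move=> cm mD mg gh; have [N [mN N0 hN]] := gh.
have good x : D x -> ~ N x -> g n x @[n --> \oo] --> h x.
  by move=> Dx nN; apply: contrapT => H; apply: nN; apply: hN => /= /(_ Dx).
apply: (@complete_measurable_fun _ _ _ m _ R D h (h \_ ~` N) cm mD).
  exists N; split => // x /= H; apply: contrapT => nN; apply: H => Dx.
  by rewrite patchE mem_set.
apply/measurable_restrict => //; first exact: measurableC.
apply: (measurable_fun_cvg (h := g)) => [n|x [Dx nN]]; last exact: good.
by apply: measurable_funS (mg n).
Qed.

Lemma limn_einf_lt (a : nat -> \bar R) (c : \bar R) : limn_einf a < c ->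
  forall M, exists2 n, (M <= n)%N & a n < c.
Proof.
move=> ac M; apply: contrapT => H.
suff : c <= limn_einf a by rewrite leNgt ac.
have h : c <= einfs a M.
  apply: le_ereal_inf_tmp => _ [n /= Mn <-].
  by rewrite leNgt; apply/negP => anc; apply: H; exists n.
apply: (le_trans h); rewrite limn_einf_lim (cvg_lim _ (@cvg_einfs_sup _ a))//.
by apply: ereal_sup_ubound; exists M.
Qed.

Lemma limn_einf_le (a : nat -> \bar R) (c : \bar R) : (forall n, a n <= c) ->
  limn_einf a <= c.
Proof.
move=> ac; rewrite limn_einf_lim; apply: lime_le; first exact: is_cvg_einfs.
apply: nearW => n; apply: le_trans (ac n).
by apply: ereal_inf_lbound; exists n => /=.
Qed.

Lemma measurable_fun_limn_einf (D : set T) (f : nat -> T -> \bar R) :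
  (forall n, measurable_fun D (f n)) -> measurable_fun D (fun x => limn_einf (f^~ x)).
Proof.
move=> mf; rewrite /limn_einf; apply: measurableT_comp => //.
by apply: measurable_fun_limn_esup => n; exact: measurableT_comp.
Qed.

Lemma ae_fin_integral (D : set T) (W : T -> \bar R) (A : R) : measurable D ->
  measurable_fun D W -> (forall x, D x -> 0 <= W x) -> \int[m]_(x in D) W x <= A%:E ->
  {ae m, forall x, D x -> W x < +oo}.
Proof.
move=> mD mW W0 WA.
have iW : m.-integrable D W.
  apply/integrableP; split => //.
  have -> : \int[m]_(x in D) `|W x| = \int[m]_(x in D) W x.
    by apply: eq_integral => x; rewrite inE => /W0 h; rewrite gee0_abs.
  by apply: le_lt_trans WA _; rewrite ltry.
have := integrable_ae mD iW; apply: filterS => x h Dx.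
by have := h Dx; rewrite fin_numElt => /andP[].
Qed.

(** Passage from a majorant in [L^tau] to the exponent [q <= tau]. The threshold [N] stays free: it
    is of the size of the norm when boundedness is proved, and arbitrarily small when convergence is
    proved. *)
Lemma integral_powR_bound (D : set T) (g : T -> R) (W : T -> \bar R)
    (A delta kappa tau q N : R) :
  measurable D -> m D < +oo -> measurable_fun D g -> measurable_fun D W ->
  (forall x, D x -> 0 <= W x) -> \int[m]_(x in D) W x <= A%:E ->
  (0 <= delta)%R -> (0 <= kappa)%R -> (0 < q <= tau)%R -> (0 < N)%R ->
  {ae m, forall x, D x -> W x < +oo ->
    (`|g x| <= delta + kappa * fine (W x) `^ tau^-1)%R} ->
  \int[m]_(x in D) `|(g x)%:E| `^ q <=
    (N `^ q * fine (m D) + N `^ (q - tau) * 2 `^ tau *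
     (delta `^ tau * fine (m D) + kappa `^ tau * A))%:E.
Proof.
move=> mD mDoo mg mW W0 WA d0 k0 /andP[q0 qt] N0 H.
have t0 : (0 < tau)%R by exact: lt_le_trans qt.
have mDf : m D \is a fin_num by rewrite ge0_fin_numE.
pose c1 := (N `^ (q - tau) * 2 `^ tau)%R.
have c10 : (0 <= c1)%R by rewrite mulr_ge0 ?powR_ge0.
pose k1 := (N `^ q + c1 * delta `^ tau)%R.
have k10 : (0 <= k1)%R by rewrite addr_ge0 ?mulr_ge0 ?powR_ge0.
pose k2 := (c1 * kappa `^ tau)%R.
have k20 : (0 <= k2)%R by rewrite mulr_ge0 ?powR_ge0.
apply: (@le_trans _ _ (\int[m]_(x in D) (k1%:E + k2%:E * W x))).
  apply: ae_ge0_le_integral => //.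
  - by move=> x _; exact: poweR_ge0.
  - apply: (measurableT_comp (measurable_poweR q)).
    by apply: measurableT_comp => //; exact/measurable_EFinP.
  - by move=> x Dx; rewrite adde_ge0 ?mule_ge0 ?lee_fin// W0.
  - by apply: emeasurable_funD; [exact: measurable_cst|exact: measurable_funeM].
  have := ae_fin_integral mD mW W0 WA; apply: filterS2 H => x h1 h2 Dx.
  have Wx := h2 Dx; have := h1 Dx Wx.
  have : W x \is a fin_num by rewrite ge0_fin_numE// W0.
  have := W0 x Dx; case: (W x) => [w| |]//; rewrite lee_fin => w0 _ /= hg.
  rewrite lee_fin; apply: le_trans (powR_young q0 qt (normr_ge0 (g x)) N0) _.
  rewrite /k1 /k2 -addrA lerD2l /c1 -!mulrA -mulrDr ler_wpM2l ?powR_ge0//.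
  apply: (@le_trans _ _ ((delta + kappa * w `^ tau^-1) `^ tau)%R).
    by apply: ge0_ler_powR; rewrite ?nnegrE ?addr_ge0 ?mulr_ge0 ?powR_ge0 ?(ltW t0).
  apply: le_trans (powR_add_le _ _ _) _; rewrite ?mulr_ge0 ?powR_ge0 ?(ltW t0)//.
  by rewrite powRM ?powR_ge0// -(powRrM w) mulVf ?gt_eqF// powRr1// mulrDr.
rewrite (@ge0_integralD _ _ _ m D mD (cst k1%:E) (fun x => k2%:E * W x))//; last 2 first.
- by move=> x Dx; rewrite mule_ge0 ?lee_fin// W0.
- exact: measurable_funeM.
rewrite integral_cst// ge0_integralZl// -(fineK mDf) -EFinM.
apply: le_trans (leeD2l _ (lee_wpmul2l _ WA)) _; first by rewrite lee_fin.
by rewrite -EFinM -EFinD lee_fin /= /k1 /k2 /c1 le_eqVlt; apply/orP; left; apply/eqP; ring.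
Qed.

End Lq_bound.

(** * Traces of functions with controlled oscillation *)

Section grid_trace_operator.
Context (R : realType) (disp : measure_display)
  (X : metricMeasurableType R disp) (mu : {measure set X -> \bar R})
  (Omega E : set X) (d s L : R) (gr : grid mu Omega E d s L).
Hypotheses (hmu : complete_borel mu) (oO : open Omega)
  (mE : (hausdorff_outer X d).-caratheodory E) (L10 : (10 <= L)%R).
Local Notation Lam := (hausdorff_measure X d).
Local Notation XC := (caratheodory_type (hausdorff_outer X d)).
Variables (p beta K tau : R).
Hypotheses (p1 : (1 <= p)%R) (K0 : (0 <= K)%R) (pt : (p <= tau)%R)
  (e0 : (0 < d + beta * tau - s * tau / p)%R).
Let p0 : (0 < p)%R. Proof. exact: lt_le_trans p1. Qed.
Let tau0 : (0 < tau)%R. Proof. exact: lt_le_trans pt. Qed.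
Local Notation W := (Wmaj gr p beta K tau).
Local Notation rad := (gradius gr).
Let eta := (theta d s p beta tau `^ tau^-1)%R.
Let Ctr := (4 * dblC gr / (1 - eta))%R.

(** One number bounds both the [L^p] norm and the energy, so that the estimates are homogeneous in
    [N]. Outside the borderline exponent, both function spaces enter only through this predicate. *)
Definition admissible (N : R) (u : X -> \bar R) :=
  [/\ measurable_fun Omega u,
     \int[mu]_(y in Omega) `|u y| `^ p <= (N `^ p)%:E &
     exists f, [/\ energy mu Omega f, osc_control gr p beta K u f &
       \int[mu]_(y in Omega) f y <= (N `^ p)%:E]].

Let eta01 : (0 < eta < 1)%R.
Proof.
have /andP[t0 t1] := theta01 e0; rewrite powR_gt0//= (_ : 1 = 1 `^ tau^-1)%R; last by rewrite powR1.
by apply: gt0_ltr_powR; rewrite ?nnegrE ?invr_gt0 ?(ltW t0).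
Qed.

Let Ctr0 : (0 <= Ctr)%R.
Proof.
have /andP[_ h] := eta01.
by rewrite divr_ge0 ?subr_ge0 ?(ltW h)// mulr_ge0// ltW// dblC_gt0.
Qed.

Lemma hausdorff_fin_grid : Lam E < +oo.
Proof.
apply: (@le_lt_trans _ _ (\sum_(c <- net gr 0) (hausC gr * rho gr `^ d)%:E)); last first.
  by rewrite sumEFin ltry.
have EU : E `<=` \big[setU/set0]_(c <- net gr 0) (E `&` ball c (rho gr)).
  move=> x Ex; have [c cn cx] := net_cover gr 0 Ex.
  rewrite -bigcup_seq; exists c => //; split => //.
  by rewrite ballEmdist /=; move: cx; rewrite expr0 divr1.
have LE : (forall c, c \in net gr 0 -> hausdorff d (E `&` ball c (rho gr)) <=
    (hausC gr * rho gr `^ d)%:E).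
  move=> c cn; apply: haus_up; first exact: net_sub cn.
  rewrite rho_gt0 /= ler_peMl ?(ltW (rho_gt0 _))//.
  by apply: le_trans L10; rewrite ler1n.
apply: (@le_trans _ _ (hausdorff_outer X d (\big[setU/set0]_(c <- net gr 0) (E `&` ball c (rho gr))))).
  exact: le_outer_measure.
apply: (@le_trans _ _ (\sum_(c <- net gr 0) hausdorff_outer X d (E `&` ball c (rho gr)))).
  elim: (net gr 0) => [|c l IH]; first by rewrite !big_nil outer_measure0.
  by rewrite !big_cons (le_trans (outer_measureU2 _ _ _))// leeD2l.
by rewrite big_seq [leRHS]big_seq; apply: lee_sum => c /LE.
Qed.

Section pointwise.
Variables (u f : X -> \bar R).
Hypotheses (mu_ : measurable_fun Omega u) (ouf : osc_control gr p beta K u f).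

Let step x : E x -> W f x < +oo -> forall a,
  (2 * dblC gr * osc gr p beta K f a (cell gr a x) <=
   2 * dblC gr * fine (W f x) `^ tau^-1 * eta ^+ a)%R.
Proof.
move=> Ex Wf a; rewrite -[leRHS]mulrA; apply: ler_wpM2l.
  by rewrite mulr_ge0// ltW// dblC_gt0.
by apply: le_trans (osc_le_Wmaj p1 K0 pt e0 a Ex Wf) _; rewrite mulrC.
Qed.

(** The averages [Tavg] converge at a geometric rate by [geometric_cauchy]. A ball centred at [x]
    whose radius lies between [rad a.+1] and [rad a] is comparable to scale [a], so the averages
    over all small balls have the same limit. *)
Lemma trace_pointwise x : E x -> W f x < +oo ->
  average mu (ball_of Omega x r) u @[r --> 0^'+] --> (trace mu Omega u x)%:E /\
  forall a, (`|Tavg gr u a x - trace mu Omega u x| <=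
     Ctr * eta ^+ a * fine (W f x) `^ tau^-1)%R.
Proof.
move=> Ex Wf; have /andP[h0 h1] := eta01.
pose B := (2 * dblC gr * fine (W f x) `^ tau^-1)%R.
have B0 : (0 <= B)%R by rewrite !mulr_ge0 ?powR_ge0 ?(ltW (dblC_gt0 gr)).
have h1' : (0 < 1 - eta)%R by rewrite subr_gt0.
have [l lP] : exists l : R, forall a, (`|Tavg gr u a x - l| <= B / (1 - eta) * eta ^+ a)%R.
  apply: (geometric_cauchy B0 eta01) => a.
  by apply: le_trans (Tavg_step hmu oO L10 K0 mu_ ouf a Ex) _; exact: step.
have B1 : (B <= B / (1 - eta))%R.
  by rewrite ler_pdivlMr// ler_piMr// gerBl ltW.
have near_l a (t : R) : (rad a.+1 <= t <= rad a)%R ->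
    average mu (ball_of Omega x t) u \is a fin_num /\
    (`|fine (average mu (ball_of Omega x t) u) - l| <= 2 * (B / (1 - eta)) * eta ^+ a)%R.
  move=> ta; have [h2 h3] := Tavg_ball hmu oO L10 K0 mu_ ouf Ex ta; split => //.
  have := le_trans h3 (step Ex Wf a); rewrite -/B => h4.
  have h5 : (B * eta ^+ a <= B / (1 - eta) * eta ^+ a)%R by rewrite ler_wpM2r// exprn_ge0// ltW.
  rewrite -(subrK (Tavg gr u a x) (fine _)) -addrA.
  apply: le_trans (ler_normD _ _) _.
  by have := lP a; move: h4 h5; rewrite -mulrA; set z := (_ * eta ^+ a)%R; lra.
have radE a : (rad a = rho gr * 2^-1 ^+ a)%R by rewrite /gradius exprVn.
have find (t : R) : (0 < t <= rho gr)%R -> exists a, (rad a.+1 <= t <= rad a)%R.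
  move=> /andP[t0 tr].
  have [|a aP amin] := @ex_minnP (fun a => (rad a.+1 <= t)%R).
    have : ((2^-1 : R) ^+ n)%R @[n --> \oo] --> (0 : R)%R.
      by apply: cvg_expr; rewrite gtr0_norm ?invr_gt0// invf_lt1 ?ltr1n.
    move=> /cvgrPdist_lt /(_ (t / rho gr)%R); rewrite divr_gt0 ?rho_gt0// => /(_ isT) [M _ HM].
    exists M; have := HM M.+1 (leqnSn M); rewrite /= sub0r normrN gtr0_norm; last first.
      by rewrite exprn_gt0.
    by rewrite ltr_pdivlMr ?rho_gt0// radE mulrC => /ltW.
  exists a; rewrite aP /=; case: a aP amin => [|a] aP amin; first by rewrite radE expr0 mulr1.
  by rewrite leNgt; apply/negP => /ltW /amin; rewrite ltnn.
have cvg_l : average mu (ball_of Omega x r) u @[r --> 0^'+] --> l%:E.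
  apply/fine_cvgP; split.
    exists (rho gr); first exact: rho_gt0.
    move=> t /=; rewrite sub0r normrN => tr t0; rewrite gtr0_norm// in tr.
    have [|a /near_l[]//] := find t; by rewrite t0 ltW.
  apply/cvgrPdist_lt => e e_gt0.
  have : (2 * (B / (1 - eta)) * eta ^+ a)%R @[a --> \oo] --> (2 * (B / (1 - eta)) * 0)%R.
    by apply: cvgMr; apply: cvg_expr; rewrite gtr0_norm.
  rewrite mulr0 => /cvgrPdist_lt /(_ e e_gt0) [M _ HM].
  exists (rad M.+1); first exact: rad_gt0.
  move=> t /=; rewrite sub0r normrN => tr t0; rewrite gtr0_norm// in tr.
  have [|a ta] := find t.
    by rewrite t0 /= (le_trans (ltW tr))// rad_le_rho.
  have [_] := near_l a t ta; rewrite distrC => h; apply: le_lt_trans h _.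
  have Ma : (M <= a)%N.
    rewrite leqNgt; apply/negP => aM; have /andP[h _] := ta.
    by have := rad_le gr aM; have := rad_le gr (leqnSn M); lra.
  have := HM a Ma; rewrite /= sub0r normrN ger0_norm//.
  by rewrite mulr_ge0 ?exprn_ge0 ?(ltW h0)// mulr_ge0// divr_ge0// ltW.
have tl : trace mu Omega u x = l.
  by rewrite /trace; apply/cvg_lim => //; exact: (fine_cvg cvg_l).
rewrite tl; split => // a; apply: le_trans (lP a) _.
rewrite /B /Ctr.
have : (0 <= 2 * dblC gr / (1 - eta) * eta ^+ a * fine (W f x) `^ tau^-1)%R.
  rewrite mulr_ge0 ?powR_ge0// mulr_ge0 ?exprn_ge0 ?(ltW h0)// divr_ge0 ?(ltW h1')//.
  by rewrite mulr_ge0// ltW// dblC_gt0.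
set V := (fine _ `^ _)%R; move: (eta ^+ a)%R ((1 - eta)^-1)%R => P Q.
nra.
Qed.

End pointwise.

Let Cw := (Wcst gr p beta K tau / (1 - theta d s p beta tau))%R.

Let Cw0 : (0 <= Cw)%R.
Proof.
have /andP[_ h] := theta01 e0.
by rewrite divr_ge0 ?subr_ge0 ?(ltW h)// !mulr_ge0 ?powR_ge0// ltW// hausC_gt0.
Qed.

Let int_W (N : R) f : (0 < N)%R -> energy mu Omega f ->
  \int[mu]_(y in Omega) f y <= (N `^ p)%:E ->
  \int[Lam]_(x in (E : set XC)) W f x <= (Cw * N `^ tau)%:E.
Proof.
move=> N0 ef fN.
have := @integral_Wmaj _ _ _ _ _ _ _ _ _ gr hmu oO mE L10 p beta K p1 K0 tau pt e0 f
  (N `^ p)%R ef.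
rewrite -powRrM mulrCA divff ?gt_eqF// mulr1; apply; last by rewrite powR_gt0.
rewrite -lee_fin fineK//; have [_ f0 foo] := ef.
by rewrite ge0_fin_numE//; apply: integral_ge0.
Qed.

Lemma ae_Wmaj_fin (N : R) f : (0 < N)%R -> energy mu Omega f ->
  \int[mu]_(y in Omega) f y <= (N `^ p)%:E ->
  {ae Lam, forall x, E x -> W f x < +oo}.
Proof.
move=> N0 ef fN.
apply: (@ae_fin_integral _ _ XC Lam E (W f) (Cw * N `^ tau)%R mE).
- exact: measurable_Wmaj.
- by move=> x _; exact: Wmaj_ge0.
- exact: int_W.
Qed.

Lemma admissible_has_trace N u : (0 < N)%R -> admissible N u -> has_trace mu Omega d E u.
Proof.
move=> N0 [mu_ _ [f [ef of_ fN]]].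
apply: (@ae_mono _ _ XC Lam _ _ _ (ae_Wmaj_fin N0 ef fN)) => x h Ex.
by have [] := trace_pointwise mu_ of_ Ex (h Ex).
Qed.

Lemma measurable_Tavg u a : measurable_fun (E : set XC) (Tavg gr u a : XC -> R).
Proof.
exact: (measurable_cell gr mE a (fun c => fine (average mu (ball_of Omega c (rad a)) u))).
Qed.

Lemma measurable_trace N u : (0 < N)%R -> admissible N u ->
  measurable_fun (E : set XC) (trace mu Omega u : XC -> R).
Proof.
move=> N0 [mu_ _ [f [ef of_ fN]]].
apply: (@complete_measurable_cvg _ _ XC Lam E (Tavg gr u)).
- exact: measure_is_complete_caratheodory.
- exact: mE.
- exact: measurable_Tavg.
apply: (@ae_mono _ _ XC Lam _ _ _ (ae_Wmaj_fin N0 ef fN)) => x h Ex.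
have [_ H] := trace_pointwise mu_ of_ Ex (h Ex); have /andP[h0 h1] := eta01.
have : (Ctr * fine (W f x) `^ tau^-1 * eta ^+ a)%R @[a --> \oo] --> (Ctr * fine (W f x) `^ tau^-1 * 0)%R.
  by apply: cvgMr; apply: cvg_expr; rewrite gtr0_norm.
rewrite mulr0 => c0; apply/cvgrPdist_lt => e e_gt0.
move/cvgrPdist_lt : c0 => /(_ e e_gt0); apply: filterS => a.
rewrite sub0r normrN distrC => h2; apply: le_lt_trans (H a) _.
by rewrite mulrAC; apply: le_lt_trans h2; exact: ler_norm.
Qed.

(** Integrate [|u| <= N + N ^ (1 - p) * |u| ^ p] over the ball. The bound degenerates as the radius
    shrinks, but it holds uniformly over admissible functions at each fixed scale, as the diagonal
    argument requires. *)
Lemma admissible_average N u a c : (0 < N)%R -> admissible N u -> E c ->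
  (`|fine (average mu (ball_of Omega c (rad a)) u)| <=
     N * (1 + (lowC gr * rad a `^ s)^-1))%R.
Proof.
move=> N0 [mu_ uN _] Ec; set B := ball_of Omega c (rad a).
have mB : measurable B by exact: (mball_ofP hmu oO).
have BO : B `<=` Omega by exact: subIsetr.
have muB : measurable_fun B u by apply: measurable_funS mu_ => //; exact: hmu.1.
have m0 := mass_gt0 gr L10 a Ec.
have Bm : mu B = (mass gr a c)%:E by exact: massE.
have B0 : 0 < mu B < +oo by rewrite Bm lte_fin m0 ltry.
have mup (D : set X) : measurable_fun D u -> measurable_fun D (fun y => `|u y| `^ p).
  by move=> mD; apply: (measurableT_comp (measurable_poweR p)); exact: measurableT_comp.
have k0 : (0 <= N `^ (1 - p))%R by exact: powR_ge0.
have IB : \int[mu]_(y in B) `|u y - 0%:E| <= (N * mass gr a c + N)%:E.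
  apply: (@le_trans _ _ (\int[mu]_(y in B) (N%:E + (N `^ (1 - p))%:E * `|u y| `^ p))).
    apply: ge0_le_integral => //.
    - apply: measurableT_comp => //; apply: emeasurable_funB => //; exact: measurable_cst.
    - apply: emeasurable_funD; first exact: measurable_cst.
      by apply: measurable_funeM; exact: mup.
    move=> y _; rewrite sube0.
    case: (u y) => [r| |] /=; last 2 first.
    - by rewrite gt_eqF// gt0_muley ?lte_fin ?powR_gt0.
    - by rewrite gt_eqF// gt0_muley ?lte_fin ?powR_gt0.
    rewrite lee_fin.
    have := powR_young ltr01 p1 (normr_ge0 r) N0.
    by rewrite powRr1// powRr1 ?(ltW N0).
  rewrite (@ge0_integralD _ _ _ mu B mB (cst N%:E) (fun y => (N `^ (1 - p))%:E * `|u y| `^ p))//; last 3 first.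
  - by move=> y _; rewrite lee_fin ltW.
  - by move=> y _; rewrite mule_ge0 ?lee_fin ?poweR_ge0.
  - by apply: measurable_funeM; exact: mup.
  rewrite integral_cst// Bm -EFinM EFinD leeD2l//.
  rewrite ge0_integralZl//; last 2 first.
  - exact: mup.
  - by move=> y _; exact: poweR_ge0.
  apply: (@le_trans _ _ ((N `^ (1 - p))%:E * (N `^ p)%:E)).
    apply: lee_wpmul2l; first by rewrite lee_fin.
    apply: le_trans uN; apply: ge0_subset_integral => //; [exact: hmu.1|exact: mup|].
    by move=> y _; exact: poweR_ge0.
  by rewrite -EFinM lee_fin -powR_gtD// subrK powRr1// ltW.
have [_ _] := average_close mB mB (@subset_refl _ B) muB B0 IB.
rewrite subr0 Bm /= => h; apply: le_trans h _.
rewrite mulrDl mulrK ?unitfE ?gt_eqF// mulrDr mulr1 lerD2l ler_wpM2l ?(ltW N0)//.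
rewrite lef_pV2 ?posrE//; first exact: mass_ge.
by rewrite mulr_gt0 ?lowC_gt0// powR_gt0// rad_gt0.
Qed.

Section exponent_q.
Variable q : R.
Hypothesis qtau : (1 <= q <= tau)%R.
Let q01 : (0 < q <= tau)%R.
Proof. by have /andP[h1 ->] := qtau; rewrite (lt_le_trans _ h1). Qed.
Let q0 : (0 < q)%R. Proof. by have /andP[] := q01. Qed.

(** The trace is at most the average at scale 0 plus the accumulated oscillation, which the majorant
    controls. The choice of [N] as threshold makes both contributions proportional to [N ^ q]. *)
Lemma admissible_trace_Lq : exists2 C : R, (0 <= C)%R & forall N u, (0 < N)%R -> admissible N u ->
  Lp Lam E q (EFin \o trace mu Omega u) /\
  Lp_norm Lam E q (EFin \o trace mu Omega u) <= (C * N)%:E.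
Proof.
pose c0 := (1 + (lowC gr * rad 0 `^ s)^-1)%R.
have c00 : (0 <= c0)%R.
  by rewrite addr_ge0// invr_ge0 mulr_ge0 ?powR_ge0// ltW// lowC_gt0.
pose l := fine (Lam E).
have l0 : (0 <= l)%R by exact: fine_ge0.
pose C := (l + 2 `^ tau * (c0 `^ tau * l + Ctr `^ tau * Cw))%R.
have C0 : (0 <= C)%R.
  rewrite /C; apply: addr_ge0 => //; apply: mulr_ge0; first exact: powR_ge0.
  by apply: addr_ge0; apply: mulr_ge0 => //; exact: powR_ge0.
exists (C `^ q^-1)%R => [|N u N0 au]; first exact: powR_ge0.
have [mu_ uN [f [ef of_ fN]]] := au.
have mt := measurable_trace N0 au.
have I : \int[Lam]_(x in (E : set XC)) `|(trace mu Omega u x)%:E| `^ q <= (C * N `^ q)%:E.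
  apply: (le_trans (@integral_powR_bound _ _ XC Lam E (trace mu Omega u) (W f)
    (Cw * N `^ tau) (c0 * N) Ctr tau q N mE hausdorff_fin_grid mt _ _ _ _ Ctr0 q01 N0 _)).
  - exact: measurable_Wmaj.
  - by move=> x _; exact: Wmaj_ge0.
  - exact: int_W.
  - by rewrite mulr_ge0// ltW.
  - apply: (@ae_mono _ _ XC Lam _ _ _ (ae_Wmaj_fin N0 ef fN)) => x _ Ex Wx.
    have [_ /(_ 0%N)] := trace_pointwise mu_ of_ Ex Wx.
    have := admissible_average 0 N0 au (cell_E gr 0 Ex).
    rewrite -/(Tavg gr u 0 x) expr0 mulr1 -/c0 => h1 h2.
    rewrite -(subrK (Tavg gr u 0 x) (trace _ _ _ _)) addrC.
    apply: le_trans (ler_normD _ _) _; rewrite (distrC (trace _ _ _ _)).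
    by apply: lerD => //; rewrite mulrC.
  rewrite lee_fin -/l (powRM _ c00 (ltW N0)) /C.
  have -> : (N `^ q = N `^ (q - tau) * N `^ tau)%R by rewrite -powR_gtD// subrK.
  rewrite le_eqVlt; apply/orP; left; apply/eqP; ring.
split; first by apply/LpP => //; split; [exact/(@measurable_EFinP _ XC)|exact: le_lt_trans I (ltry _)].
rewrite Lp_normE ?gt_eqF//.
apply: (le_trans (poweR_le _ _ I)); first by rewrite invr_ge0 ltW.
  by apply: integral_ge0 => x _; exact: poweR_ge0.
rewrite poweR_EFin lee_fin powRM ?powR_ge0// -powRrM divff ?gt_eqF// powRr1// ltW//.
Qed.

(** The limit [v] is built from limits [V a] of averages at each scale, so no limit of the functions
    on [Omega] is needed. The geometric rate of [V a] is inherited from the lower limit of the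
    majorants, which is integrable by Fatou's lemma. *)
Lemma admissible_trace_compact N (u_ : nat -> X -> \bar R) : (0 < N)%R ->
  (forall n, admissible N (u_ n)) ->
  exists2 phi : nat -> nat, {homo phi : m n / (m < n)%N} &
    exists2 v : X -> R, Lp Lam E q (EFin \o v) &
      Lp_norm Lam E q (fun x => (trace mu Omega (u_ (phi n)) x - v x)%R%:E)
        @[n --> \oo] --> 0.
Proof.
move=> N0 au.
have fex n : exists f, [/\ energy mu Omega f, osc_control gr p beta K (u_ n) f &
    \int[mu]_(y in Omega) f y <= (N `^ p)%:E] by have [_ _] := au n.
have [f_ fP] := choice fex.
pose c0 a := (1 + (lowC gr * rad a `^ s)^-1)%R.
have c00 a : (0 <= c0 a)%R.
  by rewrite addr_ge0// invr_ge0 mulr_ge0 ?powR_ge0// ltW// lowC_gt0.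
pose avg n a c := fine (average mu (ball_of Omega c (rad a)) (u_ n)).
(* The number [k] codes a scale [a] and a position [i] in its net; codes of no such pair give 0. *)
pose xx n k : R := if (unpickle k : option (nat * nat)%type) is Some (a, i) then
  if (i < size (net gr a))%N then avg n a (nth point (net gr a) i) else 0%R else 0%R.
pose Bd k : R := if (unpickle k : option (nat * nat)%type) is Some (a, i) then (N * c0 a)%R else 0%R.
have [n k|phi phiS [y yP]] := @diagonal_subsequence R xx Bd.
  rewrite /xx /Bd; case: (unpickle k : option (nat * nat)%type) => [[a i]|]; last by rewrite normr0.
  case: ifPn => [ia|_]; last by rewrite normr0 mulr_ge0// ltW.
  apply: admissible_average => //; apply: (@net_sub _ _ _ _ _ _ _ _ _ gr a).
  exact: mem_nth.
pose idx a c := pickle (a, index c (net gr a)).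
pose V a x := y (idx a (cell gr a x)).
have xxE n a x : E x -> xx n (idx a (cell gr a x)) = Tavg gr (u_ n) a x.
  move=> Ex; rewrite /xx pickleK index_mem; have [h _] := cellP gr a Ex.
  by rewrite h /avg nth_index.
have VT a : exists M, forall n x, (M <= n)%N -> E x ->
    (`|Tavg gr (u_ (phi n)) a x - V a x| < n.+1%:R^-1)%R.
  exists (\max_(i < (size (net gr a)).+1) pickle (a, i : nat)) => n x Mn Ex.
  rewrite -xxE//; apply: yP; apply: leq_trans Mn; rewrite /idx.
  have h : (index (cell gr a x) (net gr a) < (size (net gr a)).+1)%N by rewrite ltnS index_size.
  exact: (leq_bigmax (Ordinal h)).
have mV a : measurable_fun (E : set XC) (V a : XC -> R).
  exact: (measurable_cell gr mE a (fun c => y (idx a c))).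
exists phi => //.
pose w n x := W (f_ (phi n)) x.
(* Where the lower limit is finite, the added 1 makes it strictly smaller than [Winf x], so
   arbitrarily large [n] satisfy [w n x < Winf x]. *)
pose Winf x := limn_einf (fun n => w n x) + 1.
have w0 n x : 0 <= w n x by exact: Wmaj_ge0.
have mw n : measurable_fun (E : set XC) (w n : XC -> \bar R) by exact: measurable_Wmaj.
have iw n : \int[Lam]_(x in (E : set XC)) w n x <= (Cw * N `^ tau)%:E.
  by have [h1 h2 h3] := fP (phi n); exact: int_W.
have li0 x : 0 <= limn_einf (fun n => w n x).
  rewrite limn_einf_lim; apply: lime_ge; first exact: is_cvg_einfs.
  by apply: nearW => n; apply: le_ereal_inf_tmp => _ [k _ <-].
have mli : measurable_fun (E : set XC) (fun x : XC => limn_einf (fun n => w n x)).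
  exact: (@measurable_fun_limn_einf _ _ XC).
have Winf0 x : 0 <= Winf x by rewrite adde_ge0.
have mWinf : measurable_fun (E : set XC) (Winf : XC -> \bar R).
  by apply: (@emeasurable_funD _ XC) => //; exact: (@measurable_cst _ _ XC).
pose l := fine (Lam E).
have lE : Lam E = l%:E by rewrite /l fineK// ge0_fin_numE// hausdorff_fin_grid.
have l0 : (0 <= l)%R by exact: fine_ge0.
have iWinf : \int[Lam]_(x in (E : set XC)) Winf x <= (Cw * N `^ tau + l)%:E.
  rewrite (@ge0_integralD _ XC R Lam E mE _ (cst 1)) => [|//|//||]; last 2 first.
  - by move=> x _; rewrite lee_fin.
  - exact: (@measurable_cst _ _ XC).
  rewrite (@integral_cst _ XC R Lam E mE) mul1e EFinD lE leeD2r//.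
  apply: le_trans (@fatou _ XC R Lam E mE w mw _) _; first by move=> n x _.
  exact: limn_einf_le.
have aeinf : {ae Lam, forall x, E x -> Winf x < +oo}.
  by apply: (@ae_fin_integral _ _ XC Lam E Winf (Cw * N `^ tau + l)%R mE).
have /andP[h0 h1] := eta01.
have Vstep x : E x -> Winf x < +oo -> forall a,
    (`|V a.+1 x - V a x| <= 2 * dblC gr * fine (Winf x) `^ tau^-1 * eta ^+ a)%R.
  move=> Ex Wx a; apply/ler_addgt0Pr => e e_gt0.
  have lf : limn_einf (fun n => w n x) \is a fin_num.
    by rewrite ge0_fin_numE//; apply: le_lt_trans Wx; rewrite leeDl.
  have [M0 HM0] := harmonic_small 2 e_gt0.
  have [M1 HM1] := VT a; have [M2 HM2] := VT a.+1.
  have lt1 : limn_einf (fun n => w n x) < Winf x by rewrite lteDl// lte_fin.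
  have [n Mn wn] := limn_einf_lt lt1 (maxn M0 (maxn M1 M2)).
  move: Mn; rewrite !geq_max => /and3P[/HM0 H0 /HM1 /(_ Ex) H1 /HM2 /(_ Ex) H2].
  have [g1 g2 g3] := fP (phi n); have [mun _ _] := au (phi n).
  have wn' : w n x < +oo by exact: lt_trans wn Wx.
  have S1 := Tavg_step hmu oO L10 K0 mun g2 a Ex.
  have S2 := osc_le_Wmaj p1 K0 pt e0 a Ex wn'.
  have S3 : (fine (w n x) `^ tau^-1 <= fine (Winf x) `^ tau^-1)%R.
    apply: ge0_ler_powR; rewrite ?nnegrE ?invr_ge0 ?(ltW tau0) ?fine_ge0//.
    by apply: fine_le; rewrite ?ge0_fin_numE// ltW.
  have S4 : (osc gr p beta K (f_ (phi n)) a (cell gr a x) <= eta ^+ a * fine (Winf x) `^ tau^-1)%R.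
    by apply: le_trans S2 _; rewrite ler_wpM2l// exprn_ge0// ltW.
  have S5 : (2 * dblC gr * osc gr p beta K (f_ (phi n)) a (cell gr a x) <=
      2 * dblC gr * fine (Winf x) `^ tau^-1 * eta ^+ a)%R.
    rewrite -[leRHS]mulrA (mulrC (fine _ `^ _)%R); apply: ler_wpM2l => //.
    by rewrite mulr_ge0// ltW// dblC_gt0.
  move: S1 S5 H0 H1 H2; rewrite !ler_distl !ltr_distl.
  set P := (2 * dblC gr * _)%R; set Q := (2 * dblC gr * _ * _)%R.
  set T1 := Tavg _ _ _ _; set T2 := Tavg _ _ _ _; set hh := (_^-1)%R.
  move=> /andP[? ?] ? ? /andP[? ?] /andP[? ?]; apply/andP; split; lra.
have Vlim x : E x -> Winf x < +oo -> exists z : R, forall a,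
    (`|V a x - z| <= Ctr * eta ^+ a * fine (Winf x) `^ tau^-1)%R.
  move=> Ex Wx.
  have B0 : (0 <= 2 * dblC gr * fine (Winf x) `^ tau^-1)%R.
    by rewrite !mulr_ge0 ?powR_ge0 ?(ltW (dblC_gt0 gr)).
  have [z zP] := geometric_cauchy B0 eta01 (Vstep x Ex Wx); exists z => a.
  apply: le_trans (zP a) _; rewrite /Ctr.
  have h1' : (0 < 1 - eta)%R by rewrite subr_gt0.
  have : (0 <= 2 * dblC gr / (1 - eta) * eta ^+ a * fine (Winf x) `^ tau^-1)%R.
    rewrite mulr_ge0 ?powR_ge0// mulr_ge0 ?exprn_ge0 ?(ltW h0)// divr_ge0 ?(ltW h1')//.
    by rewrite mulr_ge0// ltW// dblC_gt0.
  by set U := (fine _ `^ _)%R; move: (eta ^+ a)%R ((1 - eta)^-1)%R => P Q; nra.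
have [v vP] : exists v : X -> R, forall x, E x -> Winf x < +oo -> forall a,
    (`|V a x - v x| <= Ctr * eta ^+ a * fine (Winf x) `^ tau^-1)%R.
  have vex x : exists z : R, E x -> Winf x < +oo -> forall a,
      (`|V a x - z| <= Ctr * eta ^+ a * fine (Winf x) `^ tau^-1)%R.
    have [[Ex Wx]|nn] := pselect (E x /\ Winf x < +oo).
      by have [z zP] := Vlim x Ex Wx; exists z.
    by exists 0%R => Ex Wx; exfalso; apply: nn.
  by have [v vP] := choice vex; exists v.
have mv : measurable_fun (E : set XC) (v : XC -> R).
  apply: (@complete_measurable_cvg _ _ XC Lam E V) => //.
    exact: measure_is_complete_caratheodory.
  apply: (@ae_mono _ _ XC Lam _ _ _ aeinf) => x h Ex; have Wx := h Ex.
  apply/cvgrPdist_le => e e_gt0.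
  have [M HM] := geometric_small (Ctr * fine (Winf x) `^ tau^-1)%R eta01 e_gt0.
  exists M => // a /= Ma; rewrite distrC; apply: le_trans (vP x Ex Wx a) _.
  apply: le_trans HM; rewrite mulrAC; apply: ler_wpM2l; first by rewrite mulr_ge0// powR_ge0.
  by rewrite ler_wiXn2l ?(ltW h0) ?(ltW h1).
have [M0 HM0] := VT 0%N.
have vLp : Lp Lam E q (EFin \o v).
  apply/LpP => //; split; first exact/(@measurable_EFinP _ XC).
  apply: (le_lt_trans (@integral_powR_bound _ _ XC Lam E v Winf
    (Cw * N `^ tau + l) (N * c0 0%N + 1) Ctr tau q 1 mE hausdorff_fin_grid mv mWinf _ iWinf
    _ Ctr0 q01 ltr01 _)) => //; last exact: ltry.
    by rewrite addr_ge0// mulr_ge0// ltW.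
  apply: (@ae_mono _ _ XC Lam _ _ _ aeinf) => x _ Ex Wx.
  have := vP x Ex Wx 0%N; have := HM0 M0 x (leqnn _) Ex.
  have := admissible_average 0 N0 (au (phi M0)) (cell_E gr 0 Ex).
  rewrite -/(Tavg gr (u_ (phi M0)) 0 x) expr0 mulr1 -/(c0 0%N).
  have : (M0.+1%:R^-1 <= 1 :> R)%R by rewrite invf_le1 ?ler1n ?ltr0n.
  rewrite ler_norml !ler_distl ltr_distl ler_norml.
  set T1 := Tavg _ _ _ _; set hh := (_^-1)%R; set U := (fine _ `^ _)%R.
  move=> ? /andP[? ?] /andP[? ?] /andP[? ?]; apply/andP; split; lra.
exists v => //.
pose A := (Cw * N `^ tau + (Cw * N `^ tau + l))%R.
have A0 : (0 <= A)%R.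
  by apply: addr_ge0; [|apply: addr_ge0 => //]; apply: mulr_ge0 => //; exact: powR_ge0.
have main (e : R) a : (0 < e)%R -> exists M, forall n, (M <= n)%N ->
   \int[Lam]_(x in (E : set XC)) `|(trace mu Omega (u_ (phi n)) x - v x)%R%:E| `^ q <=
   (e `^ q * l + e `^ (q - tau) * 2 `^ tau * (n.+1%:R^-1 `^ tau * l + (2 * Ctr * eta ^+ a) `^ tau * A))%:E.
  move=> e_gt0; have [M HM] := VT a; exists M => n Mn.
  have mt := measurable_trace N0 (au (phi n)).
  pose g (x : X) := (trace mu Omega (u_ (phi n)) x - v x)%R.
  have mg : measurable_fun (E : set XC) (g : XC -> R).
    exact: (@measurable_funB _ XC R E _ v mt mv).
  pose ww (x : X) := w n x + Winf x.
  have mww : measurable_fun (E : set XC) (ww : XC -> \bar R).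
    exact: (@emeasurable_funD _ XC).
  have ww0 x : E x -> 0 <= ww x by move=> _; rewrite adde_ge0.
  have iww : \int[Lam]_(x in (E : set XC)) ww x <= A%:E.
    rewrite (@ge0_integralD _ XC R Lam E mE (w n) Winf); [|by []..].
    by rewrite EFinD leeD.
  have k0 : (0 <= 2 * Ctr * eta ^+ a)%R.
    by apply: mulr_ge0; [exact: mulr_ge0|apply: exprn_ge0; exact: ltW].
  have n0 : (0 <= n.+1%:R^-1 :> R)%R by rewrite invr_ge0.
  apply: (@integral_powR_bound _ _ XC Lam E g ww A (n.+1%:R^-1)%R (2 * Ctr * eta ^+ a)%R
    tau q e mE hausdorff_fin_grid mg mww ww0 iww n0 k0 q01 e_gt0).
  have [g1 g2 g3] := fP (phi n); have [mun _ _] := au (phi n).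
  apply: (@ae_mono _ _ XC Lam _ _ _ aeinf) => x _ Ex Wx.
  have wn : w n x < +oo by apply: le_lt_trans Wx; rewrite leeDl.
  have Wx' : Winf x < +oo by apply: le_lt_trans Wx; rewrite leeDr.
  have [_ /(_ a) t1] := trace_pointwise mun g2 Ex wn.
  have t2 := HM n x Mn Ex; have t3 := vP x Ex Wx' a.
  have fw : w n x \is a fin_num by rewrite ge0_fin_numE.
  have fW : Winf x \is a fin_num by rewrite ge0_fin_numE.
  have up (z : \bar R) : 0 <= z -> z <= w n x + Winf x ->
     (Ctr * eta ^+ a * fine z `^ tau^-1 <= Ctr * eta ^+ a * fine (w n x + Winf x)%E `^ tau^-1)%R.
    move=> z0 zz; apply: ler_wpM2l; first by rewrite mulr_ge0// exprn_ge0// ltW.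
    apply: ge0_ler_powR; rewrite ?nnegrE ?invr_ge0 ?(ltW tau0) ?fine_ge0 ?adde_ge0//.
    apply: fine_le => //; last by rewrite fin_numD fw.
    by rewrite ge0_fin_numE//; apply: le_lt_trans zz Wx.
  have u1 := up (w n x) (w0 n x) ltac:(rewrite leeDl//).
  have u2 := up (Winf x) (Winf0 x) ltac:(rewrite leeDr//).
  rewrite /g /ww; move: t1 t2 t3 u1 u2; rewrite !ler_distl ltr_distl -/(w n x).
  rewrite -!(mulrA 2%R Ctr) -(mulrA 2%R (_ * _)%R).
  set T1 := Tavg _ _ _ _; set hh := (n.+1%:R^-1)%R.
  set U1 := (_ * fine (w n x) `^ _)%R; set U2 := (_ * fine (Winf x) `^ _)%R.
  set U3 := (_ * fine (_ + _)%E `^ _)%R.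
  move=> /andP[? ?] /andP[? ?] /andP[? ?] ? ?; apply/andP; split; lra.
apply: ge0_cvge0 => [n|e e_gt0]; first exact: Lnorm_ge0.
have eq0 : (0 < e `^ q / 3)%R by rewrite divr_gt0// powR_gt0.
(* Three error terms are each made at most [e ^ q / 3], in this order: the threshold [e'], then the
   scale [a], then the index [n]. *)
pose e' := (e / (3 * (l + 1)) `^ q^-1)%R.
have l1 : (0 < 3 * (l + 1))%R by rewrite mulr_gt0// ltr_pwDr.
have e'0 : (0 < e')%R by rewrite divr_gt0// powR_gt0.
have E1 : (e' `^ q * l <= e `^ q / 3)%R.
  rewrite /e' powRM ?invr_ge0 ?powR_ge0 ?(ltW e_gt0)// -powR_inv1 ?powR_ge0//.
  rewrite -powRrM mulN1r powRN -powRrM mulVf ?gt_eqF// powRr1 ?(ltW l1)//.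
  rewrite -mulrA ler_wpM2l ?powR_ge0// invfM -mulrA ler_piMr// mulrC.
  by rewrite ler_pdivrMr ?mul1r ?lerDl// ltr_pwDr.
have th := theta01 e0; have /andP[th0 th1] := th.
have etat a : ((2 * Ctr * eta ^+ a) `^ tau = (2 * Ctr) `^ tau * theta d s p beta tau ^+ a)%R.
  rewrite powRM; [congr (_ * _)%R|exact: mulr_ge0|by apply: exprn_ge0; exact: ltW].
  have -> : (eta ^+ a = (theta d s p beta tau ^+ a) `^ tau^-1)%R.
    by rewrite -powR_mulrn ?powR_ge0// powRAC powR_mulrn// ltW.
  by rewrite -powRrM mulVf ?gt_eqF// powRr1// exprn_ge0// ltW.
have [a Ha] := geometric_small (e' `^ (q - tau) * 2 `^ tau * (2 * Ctr) `^ tau * A)%R th eq0.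
have [M1 HM1] := harmonic_small (e' `^ (q - tau) * 2 `^ tau * l)%R eq0.
have [M2 HM2] := main e' a e'0.
exists (maxn M1 M2) => n; rewrite geq_max => /andP[/HM1 H1 /HM2 H2].
have n1 : (n.+1%:R^-1 `^ tau <= n.+1%:R^-1 :> R)%R.
  have n0 : (0 < n.+1%:R^-1 :> R)%R by rewrite invr_gt0.
  rewrite powR_predr// ler_piMl ?(ltW n0)//.
  apply: (@le_trans _ _ (1 `^ (tau - 1))%R); last by rewrite powR1.
  apply: ge0_ler_powR; rewrite ?nnegrE ?(ltW n0)//.
    by rewrite subr_ge0 (le_trans p1).
  by rewrite invf_le1 ?ler1n ?ltr0n.
rewrite Lp_normE ?gt_eqF//.
apply: (le_trans (poweR_le (r := q^-1) (y := (e `^ q)%:E) _ _ _)).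
- by rewrite invr_ge0 ltW.
- by apply: integral_ge0 => x _; exact: poweR_ge0.
- apply: (le_trans H2); rewrite lee_fin.
  rewrite etat.
  have P0 : (0 <= e' `^ (q - tau) * 2 `^ tau * l)%R by rewrite mulr_ge0// mulr_ge0 ?powR_ge0.
  have H3 := le_trans (ler_wpM2l P0 n1) H1.
  move: E1 H3 Ha; set a1 := (e' `^ q)%R; set a2 := (e' `^ (q - tau))%R; set a3 := (2 `^ tau)%R.
  set a4 := (_ `^ tau)%R; set a5 := (theta _ _ _ _ _ ^+ a)%R; set a6 := ((2 * Ctr) `^ tau)%R.
  move=> E1 H3 Ha.
  have -> : (a1 * l + a2 * a3 * (a4 * l + a6 * a5 * A) = a1 * l + a2 * a3 * l * a4 + a2 * a3 * a6 * A * a5)%R by ring.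
  by set b := (e `^ q)%R in E1 H3 Ha *; lra.
by rewrite poweR_EFin lee_fin -powRrM divff ?gt_eqF// powRr1// ltW.
Qed.

End exponent_q.
End grid_trace_operator.

(** * Hajlasz gradients *)

Section mean_values.
Context (R : realType) (disp : measure_display) (T : measurableType disp)
  (m : {measure set T -> \bar R}).

(** Holder's inequality up to a constant, from [g <= t + t ^ (1 - p) * g ^ p] with
    [t = (nu / M) ^ (1 / p)]. For [nu = 0] this threshold vanishes, and arbitrarily small positive
    ones are used. *)
Lemma integral_le_powR_mean (B : set T) (g : T -> \bar R) (p A M nu : R) :
  measurable B -> measurable_fun B g -> (forall x, B x -> 0 <= g x) ->
  (1 <= p)%R -> (0 <= A)%R -> (0 < M)%R -> (0 <= nu)%R -> m B <= (A * M)%:E ->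
  \int[m]_(x in B) g x `^ p <= nu%:E ->
  \int[m]_(x in B) g x <= ((A + 1) * M * (nu / M) `^ p^-1)%:E.
Proof.
move=> mB mg g0 p1 A0 M0 nu0 BM gnu.
have p0 : (0 < p)%R by exact: lt_le_trans p1.
have main (t : R) : (0 < t)%R ->
    \int[m]_(x in B) g x <= (t * (A * M) + t `^ (1 - p) * nu)%:E.
  move=> t0; have k0 : (0 <= t `^ (1 - p))%R by exact: powR_ge0.
  apply: (@le_trans _ _ (\int[m]_(x in B) (t%:E + (t `^ (1 - p))%:E * g x `^ p))).
    apply: ge0_le_integral => //.
    - apply: emeasurable_funD; first exact: measurable_cst.
      by apply: measurable_funeM; exact: (measurableT_comp (measurable_poweR p)).
    move=> x Bx; have := g0 x Bx; case: (g x) => [r| |] //= r0.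
    - rewrite lee_fin; have := powR_young ltr01 p1 (r0 : (0 <= r)%R) t0.
      by rewrite !powRr1// ltW.
    - by rewrite gt_eqF// gt0_muley ?lte_fin ?powR_gt0.
  rewrite (@ge0_integralD _ _ _ m B mB (cst t%:E) (fun y => (t `^ (1 - p))%:E * g y `^ p))//; last 3 first.
  - by move=> y _; rewrite lee_fin ltW.
  - by move=> y _; rewrite mule_ge0 ?lee_fin ?poweR_ge0.
  - by apply: measurable_funeM; exact: (measurableT_comp (measurable_poweR p)).
  rewrite integral_cst// ge0_integralZl//; last 2 first.
  - exact: (measurableT_comp (measurable_poweR p)).
  - by move=> y _; exact: poweR_ge0.
  rewrite EFinD (EFinM t); apply: leeD; first by rewrite lee_wpmul2l// lee_fin ltW.
  by rewrite EFinM lee_wpmul2l// lee_fin.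
have [nuE|nuN] := eqVneq nu 0%R.
  rewrite nuE mul0r powR0 ?invr_neq0 ?gt_eqF// mulr0.
  apply/lee_addgt0Pr => e e0; rewrite add0e.
  have AM : (0 < A * M + 1)%R by rewrite ltr_pwDr// mulr_ge0// ltW.
  have e0' : (0 < e / (A * M + 1))%R by rewrite divr_gt0.
  apply: (le_trans (main _ e0')); rewrite nuE mulr0 addr0 lee_fin mulrAC ler_pdivrMr//.
  by rewrite ler_pM2l// lerDl.
have nup : (0 < nu)%R by rewrite lt_neqAle eq_sym nuN.
have t0 : (0 < (nu / M) `^ p^-1)%R by rewrite powR_gt0// divr_gt0.
apply: (le_trans (main _ t0)); rewrite lee_fin.
have -> : (((nu / M) `^ p^-1) `^ (1 - p) * nu = (nu / M) `^ p^-1 * M)%R.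
  rewrite powR_gtD// powRr1 ?(ltW t0)// powRN -powRrM mulVf ?gt_eqF// powRr1; last first.
    by rewrite divr_ge0// ltW.
  by rewrite -mulrA invf_div divfK ?gt_eqF.
by rewrite le_eqVlt; apply/orP; left; apply/eqP; ring.
Qed.

(** Otherwise [g] exceeds its mean off a null set while the constant mean has the same integral, so
    [g] equals its mean almost everywhere and [B] is null. *)
Lemma exists_le_mean (B N : set T) (g : T -> R) : measurable B -> 0 < m B < +oo ->
  m.-negligible N -> measurable_fun B g -> (forall x, B x -> (0 <= g x)%R) ->
  \int[m]_(x in B) (g x)%:E < +oo ->
  exists2 y, (B `\` N) y & (g y)%:E * m B <= \int[m]_(x in B) (g x)%:E.
Proof.
move=> mB /andP[B0 Boo] nN mg g0 goo; apply: contrapT => H.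
pose I := \int[m]_(x in B) (g x)%:E.
have I0 : 0 <= I by apply: integral_ge0 => x /g0; rewrite lee_fin.
have If : I \is a fin_num by rewrite ge0_fin_numE.
have Bf : m B \is a fin_num by rewrite ge0_fin_numE// ltW.
have b0 : (0 < fine (m B))%R by rewrite fine_gt0// B0.
pose k := (fine I / fine (m B))%R.
have k0 : (0 <= k)%R by rewrite divr_ge0 ?fine_ge0// ltW.
have gk y : (B `\` N) y -> (k < g y)%R.
  move=> By; rewrite ltNge; apply/negP => gyk; apply: H; exists y => //.
  by rewrite -[m B]fineK// -EFinM -/I -(fineK If) lee_fin -ler_pdivlMr.
have ig : m.-integrable B (EFin \o g).
  apply/integrableP; split; first exact/measurable_EFinP.
  rewrite (_ : \int[m]_(x in B) _ = I)//; apply: eq_integral => x; rewrite inE => /g0 h.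
  by rewrite gee0_abs.
have ik : m.-integrable B (cst k%:E).
  apply/integrableP; split; first exact: measurable_cst.
  by rewrite integral_cst//= lte_mul_pinfty.
have igk := integrableB mB ig ik.
have z : \int[m]_(x in B) `|(EFin \o g) x - cst k%:E x| = 0.
  transitivity (\int[m]_(x in B) ((EFin \o g) x - cst k%:E x)).
    apply: ae_eq_integral => //.
    - by apply: measurableT_comp => //; case/integrableP : igk.
    - by case/integrableP : igk.
    have [A [mA A0 NA]] := nN; exists A; split => // x /= Hx; apply: NA.
    apply: contrapT => nNx; apply: Hx => Bx; rewrite ger0_norm// subr_ge0 ltW// gk//.
  rewrite (integralB mB ig ik) integral_cst// -[X in X - _](fineK If) -[in X in _ - X](fineK Bf).
  by rewrite -EFinM /k divfK ?gt_eqF// -EFinB subrr.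
have mgk : measurable_fun B (EFin \o g \- cst k%:E) by case/integrableP : igk.
have := (ae_eq_integral_abs m mB mgk).1 z; move=> [A [mA A0 NA]].
have [C [mC C0 NC]] := nN.
have BAC : B `<=` A `|` C.
  move=> x Bx; have [Cx|nC] := pselect (C x); [by right|left].
  apply: NA => /= /(_ Bx); rewrite /cst /= -EFinB => -[] /eqP; rewrite subr_eq0 => /eqP gkx.
  have := gk x; rewrite gkx ltxx => h; have : false by apply: h; split => // /NC.
  by [].
have : m B <= m (A `|` C) by apply: le_measure; rewrite ?inE//; exact: measurableU.
rewrite measureU0// A0 => /(lt_le_trans B0); by rewrite ltxx.
Qed.

End mean_values.

Section hajlasz.
Context (R : realType) (disp : measure_display)
  (X : metricMeasurableType R disp) (mu : {measure set X -> \bar R})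
  (Omega E : set X) (d s L : R) (gr : grid mu Omega E d s L).
Hypotheses (hmu : complete_borel mu) (oO : open Omega) (L10 : (10 <= L)%R).
Variables (p alpha : R).
Hypotheses (p1 : (1 <= p)%R) (a0 : (0 < alpha)%R).
Let p0 : (0 < p)%R. Proof. exact: lt_le_trans p1. Qed.

(** The power of 8 comes from the diameter of a ball of radius [4 * gradius gr a], the factor 2 from
    the two values of the gradient, and [dblC gr + 1] from [integral_le_powR_mean]. *)
Definition hajlasz_cst : R := (2 * 8 `^ alpha * (dblC gr + 1))%R.

Lemma hajlasz_cst_ge0 : (0 <= hajlasz_cst)%R.
Proof. by rewrite mulr_ge0 ?mulr_ge0 ?powR_ge0// addr_ge0// ltW// dblC_gt0. Qed.

(** Comparison of [u] with its value at a single point [y0], chosen off the exceptional null set and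
    with gradient at most its mean, avoids a double integral. *)
Lemma hajlasz_osc_control (u g : X -> R) : measurable_fun Omega (EFin \o u) ->
  hajlasz_gradient mu Omega alpha u g -> Lp mu Omega p (EFin \o g) ->
  energy mu Omega (fun y => (g y)%:E `^ p) /\
  osc_control gr p alpha hajlasz_cst (EFin \o u) (fun y => (g y)%:E `^ p).
Proof.
move=> mu_ [bg g0 [N nN uN]] gLp.
have mO : measurable Omega by exact: hmu.1.
have mg : measurable_fun Omega (EFin \o g) by case: gLp.
have mgp : measurable_fun Omega (fun y => (g y)%:E `^ p).
  exact: (measurableT_comp (measurable_poweR p) mg).
have ef : energy mu Omega (fun y => (g y)%:E `^ p).
  split=> //; first by move=> y _; exact: poweR_ge0.
  have [_] := (Lp_ge0P mu (f := EFin \o g) p0 (fun x Ox => g0 x Ox)).1 gLp.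
  by [].
split => // a c ca; have Ec := net_sub ca.
set B := ball_of Omega c (4 * gradius gr a).
have r0 := rad_gt0 gr a.
have mB : measurable B by exact: (mball_ofP hmu oO).
have BO : B `<=` Omega by exact: subIsetr.
have m0 := mass_gt0 gr L10 a Ec.
have mBle : mu B <= (dblC gr * mass gr a c)%:E.
  have h : mu (ball_of Omega c (L * gradius gr a)) <= (dblC gr)%:E * mu (ball_of Omega c (gradius gr a)).
    by apply: mass_dbl => //; exact: rad1.
  rewrite (massE gr L10 a Ec) in h; rewrite EFinM; apply: le_trans h.
  apply: le_measure; rewrite ?inE; [exact: mB|exact: (mball_ofP hmu oO)|].
  apply: ball_of_subset; rewrite mdistxx add0r ler_pM2r// (le_trans _ L10)// ler_nat//.
set f := (fun y => _) in ef *.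
set n := nu mu Omega f (ball c (L * gradius gr a)).
have n0 : (0 <= n)%R by exact: (nu_ge0 ef).
have mgB : measurable_fun B (EFin \o g) by exact: measurable_funS mg.
have gB : \int[mu]_(y in B) (g y)%:E <=
    ((dblC gr + 1) * mass gr a c * (n / mass gr a c) `^ p^-1)%:E.
  apply: integral_le_powR_mean => //.
  - by move=> y /BO /g0; rewrite lee_fin.
  - exact/ltW/dblC_gt0.
  rewrite -(nuE hmu oO ef); last by apply: hmu.1; exact: mball_open.
  apply: ge0_subset_integral => //.
  - apply: measurableI => //; apply: hmu.1; exact: mball_open.
  - by apply: measurable_funS mgp => //; exact: subIsetr.
  - by move=> y _; exact: poweR_ge0.
  by apply: ball_of_subset; rewrite mdistxx add0r ler_pM2r// (le_trans _ L10)// ler_nat.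
have B01 : 0 < mu B < +oo.
  apply: (ball_mass (gr := gr)) => //.
  by apply: radL => //; rewrite (le_trans _ L10) ?ltr0n ?ler_nat.
have mgB' : measurable_fun B g by exact/measurable_EFinP.
have [y0 [By0 Ny0] gy0] := exists_le_mean mB B01 nN mgB'
  (fun y By => g0 y (BO y By)) (le_lt_trans gB (ltry _)).
exists (u y0).
pose k := ((8 * gradius gr a) `^ alpha)%R.
have k0 : (0 <= k)%R by exact: powR_ge0.
have uB : \int[mu]_(y in B) `|(EFin \o u) y - (u y0)%:E| <=
    \int[mu]_(y in B) (k%:E * (g y)%:E + k%:E * (g y0)%:E).
  apply: ae_ge0_le_integral => //.
  - apply: measurableT_comp => //; apply: emeasurable_funB; last exact: measurable_cst.
    exact: measurable_funS mu_.
  - by move=> y /BO gy; rewrite adde_ge0// mule_ge0// lee_fin ?g0//; exact: BO.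
  - apply: emeasurable_funD; last exact: measurable_cst.
    exact: measurable_funeM.
  have [A [mA A0 NA]] := nN; exists A; split => // y /= Hy; apply: NA.
  apply: contrapT => nNy; apply: Hy => By.
  rewrite -!EFinM -EFinD lee_fin -mulrDr.
  have h := uN y y0 (conj (BO y By) nNy) (conj (BO y0 By0) Ny0).
  apply: le_trans h _; rewrite ler_wpM2r ?addr_ge0 ?g0//; [exact: BO|exact: BO|].
  have r8 : (0 <= 8 * gradius gr a)%R by rewrite mulr_ge0// ltW.
  apply: ge0_ler_powR; rewrite ?nnegrE ?mdist_ge0 ?(ltW a0)//.
  have [+ _] := By; have [+ _] := By0; rewrite ballEmdist /= => h1 h2.
  have := metric_triangle y c y0; rewrite (metric_sym y c); lra.
apply: (le_trans uB).
rewrite (@ge0_integralD _ _ _ mu B mB (fun y => k%:E * (g y)%:E) (cst (k%:E * (g y0)%:E)))//; last 3 first.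
- by move=> y By; rewrite mule_ge0 ?lee_fin// g0//; exact: BO.
- exact: measurable_funeM.
- by move=> y By; rewrite mule_ge0 ?lee_fin// g0//; exact: BO.
rewrite ge0_integralZl//; last by move=> y /BO /g0; rewrite lee_fin.
rewrite integral_cst// -muleA -ge0_muleDr; last 2 first.
- by apply: integral_ge0 => y /BO /g0; rewrite lee_fin.
- by rewrite mule_ge0// lee_fin g0//; exact: BO.
apply: (@le_trans _ _ (k%:E * (2%:E * ((dblC gr + 1) * mass gr a c * (n / mass gr a c) `^ p^-1)%:E))).
  apply: lee_wpmul2l; first by rewrite lee_fin.
  by rewrite mule_natl mule2n; apply: leeD => //; exact: le_trans gB.
rewrite -!EFinM lee_fin /osc /hajlasz_cst /k powRM// ?(ltW r0)//.
by rewrite -/n le_eqVlt; apply/orP; left; apply/eqP; ring.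
Qed.

(** The strict inequality leaves room for a gradient that does not attain the infimum in the
    norm. *)
Lemma hajlasz_admissible (u : X -> R) (N : R) : hajlasz_space mu Omega alpha p u ->
  hajlasz_norm mu Omega alpha p u < N%:E ->
  admissible gr p alpha hajlasz_cst N (EFin \o u).
Proof.
move=> [uLp [g1 hg1 g1Lp]] uN.
have mu_ : measurable_fun Omega (EFin \o u) by case: uLp.
have norm0 (v : X -> \bar R) : 0 <= Lp_norm mu Omega p v by exact: Lnorm_ge0.
have [N0 uN' ex] : [/\ (0 <= N)%R, Lp_norm mu Omega p (EFin \o u) <= N%:E &
    exists2 g, hajlasz_gradient mu Omega alpha u g & Lp_norm mu Omega p (EFin \o g) <= N%:E].
  have i0 : 0 <= ereal_inf [set Lp_norm mu Omega p (EFin \o g) | g in hajlasz_gradient mu Omega alpha u].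
    by apply: le_ereal_inf_tmp => _ [g _ <-].
  split.
  - by rewrite -lee_fin; apply: le_trans (ltW uN); rewrite adde_ge0.
  - by apply: le_trans (ltW uN); rewrite leeDl.
  have : ereal_inf [set Lp_norm mu Omega p (EFin \o g) | g in hajlasz_gradient mu Omega alpha u] < N%:E.
    by apply: le_lt_trans uN; rewrite leeDr.
  by move=> /ereal_inf_lt [_ [g hg <-] /ltW gN]; exists g.
have pow_le (v : X -> \bar R) : Lp_norm mu Omega p v <= N%:E ->
    \int[mu]_(y in Omega) `|v y| `^ p <= (N `^ p)%:E.
  rewrite Lp_normE ?gt_eqF// => /(poweR_le (r := p) (ltW p0)) h.
  rewrite -poweR_EFin; apply: le_trans (h _); rewrite ?poweR_ge0//.
  by rewrite poweRVK ?gt_eqF//; apply: integral_ge0 => y _; exact: poweR_ge0.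
split => //; first exact: pow_le.
have [g hg gN] := ex.
have mg : measurable_fun Omega (EFin \o g).
  by have [bg _ _] := hg; apply/measurable_EFinP; exact: (borel_fun_measurable hmu oO).
have [ef oc] := hajlasz_osc_control mu_ hg (conj mg (le_lt_trans gN (ltry _))).
exists (fun y => (g y)%:E `^ p); split => //.
apply: le_trans (pow_le _ gN); apply: ge0_le_integral => //.
- exact: hmu.1.
- by move=> y _; exact: poweR_ge0.
- exact: (measurableT_comp (measurable_poweR p) mg).
- by apply: (measurableT_comp (measurable_poweR p)); exact: measurableT_comp.
- by move=> y Oy /=; have [_ g0 _] := hg; rewrite ger0_norm ?g0.
Qed.

End hajlasz.

Lemma maxr_lip (R : realDomainType) (a b x y : R) :
  (`|Num.max a x - Num.max b y| <= `|a - b| + `|x - y|)%R.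
Proof.
have := ler_norm (a - b); have := ler_norm (x - y).
have := ler_norm (b - a); have := ler_norm (y - x); rewrite (distrC y) (distrC b).
by rewrite ler_norml /Num.max; case: ifPn; case: ifPn; rewrite -?leNgt; lra.
Qed.

Lemma minr_lip (R : realDomainType) (a b x y : R) :
  (`|Num.min a x - Num.min b y| <= `|a - b| + `|x - y|)%R.
Proof.
have := ler_norm (a - b); have := ler_norm (x - y).
have := ler_norm (b - a); have := ler_norm (y - x); rewrite (distrC y) (distrC b).
by rewrite ler_norml /Num.min; case: ifPn; case: ifPn; rewrite -?leNgt; lra.
Qed.

(** * Poincare inequality and upper gradients *)

Section gradients_along_curves.
Context (R : realType) (disp : measure_display)
  (X : metricMeasurableType R disp) (Z : set X).
Hypothesis oZ : open Z.
Local Notation XB := (g_sigma_algebraType (@open X)).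
Implicit Types (c : R * (R -> X)) (w : X -> R) (G : X -> \bar R).

Definition grad_on c w G := ac_bound c.1 (w \o c.2) (G \o c.2).

Lemma nneg_borelD G1 G2 : nneg_borel Z G1 -> nneg_borel Z G2 ->
  nneg_borel Z (fun x => G1 x + G2 x).
Proof.
move=> [m1 n1] [m2 n2]; split; first exact: emeasurable_funD.
by move=> x Zx; rewrite adde_ge0 ?n1 ?n2.
Qed.

Lemma nneg_borel_cst (k : R) : (0 <= k)%R -> nneg_borel Z (cst k%:E).
Proof. by move=> k0; split; [exact: measurable_cst|move=> x _; rewrite lee_fin]. Qed.

Lemma nneg_borel_indic G (D : set X) : measurable (D : set XB) -> nneg_borel Z G ->
  nneg_borel Z (fun x => G x * (\1_D x)%:E).
Proof.
move=> mD [mG G0]; split.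
  apply: emeasurable_funM => //; apply/measurable_EFinP.
  by apply: measurable_funTS; exact: measurable_indic.
by move=> x Zx; rewrite mule_ge0 ?G0// lee_fin.
Qed.

Lemma borel_ball (x : X) r : measurable (ball x r : set XB).
Proof. by apply: sub_gen_smallest; exact: mball_open. Qed.

Section curve.
Variable c : R * (R -> X).
Hypothesis rc : rectifiable_curve Z c.

Let mG G : nneg_borel Z G -> measurable_fun `[0%R, c.1] (G \o c.2).
Proof. by move=> [+ _]; exact: measurable_along. Qed.

Let G_ge0 G : nneg_borel Z G -> forall t, (0 <= t <= c.1)%R -> 0 <= (G \o c.2) t.
Proof. exact: along_ge0. Qed.

Lemma grad_on_le w G G' : nneg_borel Z G -> nneg_borel Z G' ->
  (forall x, Z x -> G x <= G' x) -> grad_on c w G -> grad_on c w G'.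
Proof.
move=> hG hG' GG' H a b a0 ab bc; apply: le_trans (H a b a0 ab bc) _.
apply: le_Iint.
- exact: measurable_itvS (mG hG).
- exact: measurable_itvS (mG hG').
- by move=> t /andP[ta tb]; apply: G_ge0 => //; rewrite (le_trans a0)// (le_trans tb).
- move=> t /andP[ta tb]; apply: GG'; have [_ cZ _] := rc; apply: cZ.
  by rewrite (le_trans a0)// (le_trans tb).
Qed.

Lemma grad_on_contract w1 w G : (forall x y, (`|w x - w y| <= `|w1 x - w1 y|)%R) ->
  grad_on c w1 G -> grad_on c w G.
Proof.
by move=> h H a b a0 ab bc; apply: le_trans (H a b a0 ab bc); rewrite lee_fin; exact: h.
Qed.

Lemma grad_on_contract2 w1 w2 w G1 G2 : nneg_borel Z G1 -> nneg_borel Z G2 ->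
  (forall x y, (`|w x - w y| <= `|w1 x - w1 y| + `|w2 x - w2 y|)%R) ->
  grad_on c w1 G1 -> grad_on c w2 G2 -> grad_on c w (fun x => G1 x + G2 x).
Proof.
move=> hG1 hG2 h H1 H2 a b a0 ab bc; rewrite /Iint ge0_integralD//.
- apply: le_trans (leeD (H1 a b a0 ab bc) (H2 a b a0 ab bc)).
  by rewrite -EFinD lee_fin; exact: h.
- move=> t /=; rewrite in_itv/= => /andP[ta tb]; apply: (G_ge0 hG1).
  by rewrite (le_trans a0)// (le_trans tb).
- exact: measurable_itvS (mG hG1).
- move=> t /=; rewrite in_itv/= => /andP[ta tb]; apply: (G_ge0 hG2).
  by rewrite (le_trans a0)// (le_trans tb).
- exact: measurable_itvS (mG hG2).
Qed.

Lemma grad_on_lipschitz w (k : R) : (0 <= k)%R ->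
  (forall x y, (`|w x - w y| <= k * mdist x y)%R) -> grad_on c w (cst k%:E).
Proof.
move=> k0 h a b a0 ab bc; rewrite /Iint /= integral_cst//= lebesgue_measure_itv/=.
have H : (`|w (c.2 a) - w (c.2 b)| <= k * (b - a))%R.
  apply: le_trans (h _ _) _; rewrite ler_wpM2l//.
  exact: (rectifiable_lipschitz rc).
rewrite lte_fin; case: ltP => [_|ba]; first by rewrite -EFinB -EFinM lee_fin.
have -> : a = b by apply/eqP; rewrite eq_le ab ba.
by rewrite subrr normr0 mule0.
Qed.

Lemma grad_on_off w G (D : set X) (k : R) : measurable (D : set XB) -> nneg_borel Z G ->
  curve_integral c G < +oo -> (forall x, Z x -> D x -> w x = k) ->
  grad_on c w G -> grad_on c w (fun x => G x * (\1_(~` D) x)%:E).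
Proof.
move=> mD hG fG wk H.
have mcD : measurable (c.2 @^-1` D `&` `[0%R, c.1] : set R).
  have : measurable_fun `[0%R, c.1] ((fun x => (\1_D x : R)%:E) \o c.2).
    have := mG (nneg_borel_indic mD (nneg_borel_cst ler01)).
    by rewrite (_ : (fun x : X => cst 1 x * (\1_D x)%:E) = fun x => (\1_D x : R)%:E)//; apply/funext => x; rewrite mul1e.
  move=> /(_ (measurable_itv _) [set 1] (emeasurable_set1 _)).
  rewrite setIC; congr (measurable _); apply/seteqP; split => t /= [tD ti]; split => //.
    by move: tD; rewrite indicE => -[]; case: (boolP (_ \in D)) => [/set_mem//|_ /eqP]; rewrite eq_sym oner_eq0.
  by rewrite indicE mem_set.
have := ac_bound_off (mG hG) mcD (G_ge0 hG) fG H.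
move=> /(_ k) K a b a0 ab bc.
apply: le_trans (K _ a b a0 ab bc) _; last first.
  rewrite le_eqVlt; apply/orP; left; apply/eqP; apply: eq_integral => t.
  rewrite inE/= in_itv/= => /andP[ta tb]; congr (_ * _); congr EFin; rewrite !indicE.
  congr (nat_of_bool _)%:R; apply/idP/idP => /set_mem /= h; apply/mem_set => /=.
    by move=> Dt; apply: h; split => //; rewrite in_itv/= (le_trans a0)// (le_trans tb).
  by move=> [].
by move=> t t0 [Dt _]; apply: wk => //; have [_ cZ _] := rc; exact: cZ.
Qed.

End curve.

Definition cutoff (x0 : X) (r : R) (x : X) : R := Num.max (0 : R)%R (Num.min (1 : R)%R (2 - mdist x0 x / r)%R).

Lemma cutoff_ge0 x0 r x : (0 <= cutoff x0 r x)%R.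
Proof. by rewrite le_max lexx. Qed.

Lemma cutoff_le1 x0 r x : (cutoff x0 r x <= 1)%R.
Proof. by rewrite ge_max ler01 ge_min lexx. Qed.

Lemma cutoff_eq1 x0 r x : (0 < r)%R -> (mdist x0 x <= r)%R -> cutoff x0 r x = 1%R.
Proof.
move=> r0 h; have : (mdist x0 x / r <= 1)%R by rewrite ler_pdivrMr// mul1r.
rewrite /cutoff => h'; rewrite min_l; last by lra.
by rewrite max_r.
Qed.

Lemma cutoff_eq0 x0 r x : (0 < r)%R -> (2 * r <= mdist x0 x)%R -> cutoff x0 r x = 0%R.
Proof.
move=> r0 h; have : (2 <= mdist x0 x / r)%R by rewrite ler_pdivlMr.
by rewrite /cutoff => h'; rewrite max_l// ge_min; apply/orP; right; lra.
Qed.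

Lemma cutoff_lipschitz x0 r x y : (0 < r)%R ->
  (`|cutoff x0 r x - cutoff x0 r y| <= r^-1 * mdist x y)%R.
Proof.
move=> r0.
have h : (`|mdist x0 x / r - mdist x0 y / r| <= r^-1 * mdist x y)%R.
  rewrite -mulrBl normrM [X in (_ * X)%R]gtr0_norm ?invr_gt0// mulrC.
  rewrite ler_wpM2l ?invr_ge0 ?(ltW r0)// ler_norml.
  have := metric_triangle x0 x y; have := metric_triangle x0 y x; rewrite (metric_sym y x); lra.
apply: le_trans h; rewrite /cutoff.
apply: le_trans (maxr_lip _ _ _ _) _; rewrite subrr normr0 add0r.
apply: le_trans (minr_lip _ _ _ _) _; rewrite subrr normr0 add0r.
rewrite (_ : 2 - mdist x0 x / r - _ = mdist x0 y / r - mdist x0 x / r)%R; last by ring.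
by rewrite distrC.
Qed.

Lemma curve_integral_cst c (k : R) : (0 < c.1)%R -> curve_integral c (cst k%:E) < +oo.
Proof.
move=> c0; rewrite /curve_integral /= integral_cst//= lebesgue_measure_itv/= lte_fin c0.
by rewrite -EFinB -EFinM ltry.
Qed.

Lemma grad_on_cutoff c x0 (r : R) : rectifiable_curve Z c -> (0 < r)%R ->
  grad_on c (cutoff x0 r) (fun x => cst (r^-1)%:E x * (\1_(ball x0 (2 * r)) x)%:E).
Proof.
move=> rc r0; rewrite -[X in \1_X]setCK.
have r1 : (0 <= r^-1)%R by rewrite invr_ge0 ltW.
apply: (@grad_on_off c rc _ _ _ 0%R).
- by apply: measurableC; exact: borel_ball.
- exact: nneg_borel_cst.
- by apply: curve_integral_cst; have [] := rc.
- by move=> x _; rewrite ballEmdist /= => /negP; rewrite -leNgt; exact: cutoff_eq0.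
- by apply: grad_on_lipschitz => // x y; exact: cutoff_lipschitz.
Qed.

(** A supremum and not a sum, so that infinitely many overlapping cutoffs still take values between
    0 and 1. For an empty family [sup] returns 0, which is the value wanted. *)
Definition supcut (A : set (X * R)) (x : X) : R := sup [set cutoff q.1 q.2 x | q in A].

Lemma supcut_ge (A : set (X * R)) q x : A q -> (cutoff q.1 q.2 x <= supcut A x)%R.
Proof.
move=> Aq; apply: ub_le_sup; last by exists q.
by exists 1%R => _ [q' _ <-]; exact: cutoff_le1.
Qed.

Lemma supcut_le (A : set (X * R)) x (k : R) : (0 <= k)%R ->
  (forall q, A q -> (cutoff q.1 q.2 x <= k)%R) -> (supcut A x <= k)%R.
Proof.
move=> k0 H; have [[q Aq]|A0] := pselect (A !=set0).
  by apply: ge_sup; [exists (cutoff q.1 q.2 x), q|move=> _ [q' /H + <-]].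
rewrite /supcut (_ : [set _ | _ in A] = set0) ?sup0//.
by rewrite -subset0 => z [q Aq _]; apply: A0; exists q.
Qed.

Lemma supcut_ge0 (A : set (X * R)) x : (0 <= supcut A x)%R.
Proof.
have [[q Aq]|A0] := pselect (A !=set0).
  by apply: le_trans (supcut_ge x Aq); exact: cutoff_ge0.
rewrite /supcut (_ : [set _ | _ in A] = set0) ?sup0//.
by rewrite -subset0 => z [q Aq _]; apply: A0; exists q.
Qed.

Lemma supcut_le1 (A : set (X * R)) x : (supcut A x <= 1)%R.
Proof. by apply: supcut_le => // q _; exact: cutoff_le1. Qed.

Lemma supcut_eq1 (A : set (X * R)) q x : A q -> (0 < q.2)%R -> (mdist q.1 x <= q.2)%R ->
  supcut A x = 1%R.
Proof.
move=> Aq q0 qx; apply/eqP; rewrite eq_le supcut_le1/=.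
by rewrite -(cutoff_eq1 q0 qx); exact: supcut_ge.
Qed.

Lemma supcut_eq0 (A : set (X * R)) x : (forall q, A q -> (0 < q.2)%R /\ (2 * q.2 <= mdist q.1 x)%R) ->
  supcut A x = 0%R.
Proof.
move=> H; apply/eqP; rewrite eq_le supcut_ge0 andbT; apply: supcut_le => // q /H[q0 qx].
by rewrite cutoff_eq0.
Qed.

Lemma supcut_open (A : set (X * R)) (t : R) : (forall q, A q -> (0 < q.2)%R) ->
  open [set x | (t < supcut A x)%R].
Proof.
move=> A0; have [t0|t0] := ltP t 0%R.
  rewrite (_ : [set _ | _] = setT); first exact: openT.
  by apply/seteqP; split => // x _ /=; apply: lt_le_trans t0 (supcut_ge0 A x).
rewrite (_ : [set _ | _] = \bigcup_(q in A) [set x | (t < cutoff q.1 q.2 x)%R]); last first.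
  apply/seteqP; split => [x /= tx|x [q Aq /= tx]]; last exact: lt_le_trans tx (supcut_ge x Aq).
  apply: contrapT => H; move: tx; apply/negP; rewrite -leNgt; apply: supcut_le => // q Aq.
  by rewrite leNgt; apply/negP => tq; apply: H; exists q.
apply: bigcup_open => q Aq; rewrite openE => x /= tx.
have q0 := A0 q Aq.
have e0 : (0 < (cutoff q.1 q.2 x - t) * q.2)%R by rewrite mulr_gt0// subr_gt0.
apply/nbhs_ballP; exists ((cutoff q.1 q.2 x - t) * q.2)%R => // y.
rewrite ballEmdist /= => xy.
have := cutoff_lipschitz q.1 x y q0; rewrite ler_norml => /andP[_].
have : (q.2^-1 * mdist x y < cutoff q.1 q.2 x - t)%R by rewrite mulrC ltr_pdivrMr.
lra.
Qed.

(** Each cutoff varies by at most the integral of the common bound between the two points, hence so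
    does the supremum of all of them. *)
Lemma grad_on_supcut c (A : set (X * R)) H : rectifiable_curve Z c -> nneg_borel Z H ->
  (forall q, A q -> (0 < q.2)%R) ->
  (forall q x, A q -> (mdist q.1 x < 2 * q.2)%R -> (q.2^-1)%:E <= H x) ->
  grad_on c (supcut A) H.
Proof.
move=> rc hH A0 AH a b a0 ab bc.
have one (q : X * R) : A q -> (`|cutoff q.1 q.2 (c.2 a) - cutoff q.1 q.2 (c.2 b)|)%:E <= Iint (H \o c.2) a b.
  move=> Aq; have q0 := A0 q Aq.
  apply: (@grad_on_le c rc _ _ H _ hH _ (grad_on_cutoff q.1 rc q0)) => //.
    by apply: nneg_borel_indic; [exact: borel_ball|apply: nneg_borel_cst; rewrite invr_ge0 ltW].
  move=> x Zx; rewrite indicE; case: (boolP (_ \in _)) => [/set_mem|_].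
    by rewrite ballEmdist /= mule1 => h; exact: AH.
  by rewrite mule0; exact: hH.2.
case: (Iint (H \o c.2) a b) one (Iint_ge0 (H := H \o c.2) (a := a) (b := b)) => [I| |] one I0; last 2 first.
- by rewrite leey.
- exfalso; have : (0 : \bar R) <= -oo; last by [].
  apply: I0 => t /andP[ta tb]; apply: (along_ge0 rc hH).
  by rewrite (le_trans a0)// (le_trans tb).
have {}I0 : (0 <= I)%R.
  rewrite -lee_fin; apply: I0 => t /andP[ta tb]; apply: (along_ge0 rc hH).
  by rewrite (le_trans a0)// (le_trans tb).
rewrite lee_fin /= ler_norml; apply/andP; split.
  rewrite lerBrDl; have : (supcut A (c.2 b) <= supcut A (c.2 a) + I)%R; last by lra.
  apply: supcut_le => [|q Aq]; first by rewrite addr_ge0// supcut_ge0.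
  have := one q Aq; rewrite lee_fin ler_norml => /andP[h _].
  by have := supcut_ge (c.2 a) Aq; lra.
have : (supcut A (c.2 a) <= supcut A (c.2 b) + I)%R; last by lra.
apply: supcut_le => [|q Aq]; first by rewrite addr_ge0// supcut_ge0.
have := one q Aq; rewrite lee_fin ler_norml => /andP[_ h].
by have := supcut_ge (c.2 b) Aq; lra.
Qed.

End gradients_along_curves.

Lemma poweR_add_le (R : realType) (t : R) (x y : \bar R) : (0 <= t)%R -> 0 <= x -> 0 <= y ->
  (x + y) `^ t <= (2 `^ t)%:E * (x `^ t + y `^ t).
Proof.
move=> t0; have p2 : (0 < 2 `^ t :> R)%R by rewrite powR_gt0.
case: x => [x| |]//; case: y => [y| |]// x0 y0; first by rewrite lee_fin powR_add_le.
all: have [->|tN0] := eqVneq t 0%R; first by rewrite !poweRe0 powRr0 mul1e leeDl.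
all: rewrite /= (negbTE tN0).
- by rewrite gt0_muley ?leey// addey// -ltNye (lt_le_trans _ (poweR_ge0 _ _)).
- by rewrite addye ?gt0_muley ?leey ?lte_fin// -ltNye (lt_le_trans _ (poweR_ge0 _ _)).
- by rewrite addye// gt0_muley ?leey ?lte_fin.
Qed.

Section Lp_gradients.
Context (R : realType) (disp : measure_display)
  (X : metricMeasurableType R disp) (mu : {measure set X -> \bar R}) (Z : set X).
Hypotheses (hmu : complete_borel mu) (oZ : open Z).
Variable (p : R).
Hypothesis p1 : (1 <= p)%R.
Implicit Types (c : R * (R -> X)) (w : X -> R) (G : X -> \bar R).
Let p0 : (0 < p)%R. Proof. exact: lt_le_trans p1. Qed.
Let mZ : measurable Z. Proof. exact: hmu.1. Qed.

Let mpow G : nneg_borel Z G -> measurable_fun Z (fun x => G x `^ p).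
Proof.
move=> [bG _]; apply: (measurableT_comp (measurable_poweR p)).
exact: (borel_fun_measurable hmu oZ).
Qed.

Lemma Lp_le G G' : nneg_borel Z G -> nneg_borel Z G' -> (forall x, Z x -> G x <= G' x) ->
  Lp mu Z p G' -> Lp mu Z p G.
Proof.
move=> hG hG' GG' /(Lp_nneg hmu oZ p1 hG') H; apply/(Lp_nneg hmu oZ p1 hG).
apply: le_lt_trans H; apply: ge0_le_integral => //.
- by move=> x _; exact: poweR_ge0.
- exact: mpow.
- exact: mpow.
- by move=> x Zx; apply: poweR_le; [exact: ltW|exact: hG.2|exact: GG'].
Qed.

Lemma Lp_add G1 G2 : nneg_borel Z G1 -> nneg_borel Z G2 -> Lp mu Z p G1 -> Lp mu Z p G2 ->
  Lp mu Z p (fun x => G1 x + G2 x).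
Proof.
move=> h1 h2 /(Lp_nneg hmu oZ p1 h1) L1 /(Lp_nneg hmu oZ p1 h2) L2.
apply/(Lp_nneg hmu oZ p1 (nneg_borelD h1 h2)).
apply: (@le_lt_trans _ _ (\int[mu]_(x in Z) ((2 `^ p)%:E * (G1 x `^ p + G2 x `^ p)))).
  apply: ge0_le_integral => //.
  - by move=> x _; exact: poweR_ge0.
  - exact: (mpow (nneg_borelD h1 h2)).
  - by apply: measurable_funeM; apply: emeasurable_funD; exact: mpow.
  - by move=> x Zx; apply: poweR_add_le; [exact: ltW|exact: h1.2|exact: h2.2].
rewrite ge0_integralZl//; last 2 first.
- by apply: emeasurable_funD; exact: mpow.
- by move=> x _; rewrite adde_ge0 ?poweR_ge0.
rewrite ge0_integralD//; try (by move=> x _; exact: poweR_ge0); try exact: mpow.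
by rewrite lte_mul_pinfty ?lee_fin ?powR_ge0// lte_add_pinfty.
Qed.

Lemma Lp_cst_indic (D : set X) (k : R) : measurable (D : set (g_sigma_algebraType (@open X))) ->
  (0 <= k)%R -> mu (D `&` Z) < +oo -> Lp mu Z p (fun x => cst k%:E x * (\1_D x)%:E).
Proof.
move=> mD k0 Df; have hk := nneg_borel_indic mD (nneg_borel_cst Z k0).
apply/(Lp_nneg hmu oZ p1 hk).
have mD' : measurable D by exact: (borel_measurable hmu).
apply: (@le_lt_trans _ _ (\int[mu]_(x in Z) ((k `^ p)%:E * (\1_D x)%:E))).
  apply: ge0_le_integral => //.
  - by move=> x _; exact: poweR_ge0.
  - exact: (mpow hk).
  - by apply: measurable_funeM; apply/measurable_EFinP; apply: measurable_funTS; exact: measurable_indic.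
  move=> x _; rewrite indicE; case: (x \in D); rewrite ?mule1// !mule0 poweR0r//.
  by rewrite gt_eqF.
rewrite ge0_integralZl//; last 2 first.
- by apply/measurable_EFinP; apply: measurable_funTS; exact: measurable_indic.
- by rewrite lee_fin powR_ge0.
by rewrite integral_indic// lte_mul_pinfty ?lee_fin ?powR_ge0.
Qed.

Lemma curve_integralD c G1 G2 : rectifiable_curve Z c -> nneg_borel Z G1 -> nneg_borel Z G2 ->
  curve_integral c G1 < +oo -> curve_integral c G2 < +oo ->
  curve_integral c (fun x => G1 x + G2 x) < +oo.
Proof.
move=> rc h1 h2 f1 f2; rewrite /curve_integral ge0_integralD//.
- exact: lte_add_pinfty.
- by move=> t /=; rewrite in_itv/= => ti; exact: (along_ge0 rc h1).
- exact: (measurable_along oZ rc h1.1).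
- by move=> t /=; rewrite in_itv/= => ti; exact: (along_ge0 rc h2).
- exact: (measurable_along oZ rc h2.1).
Qed.

Lemma curve_integral_fin_le c G G' : rectifiable_curve Z c -> nneg_borel Z G -> nneg_borel Z G' ->
  (forall x, Z x -> G x <= G' x) -> curve_integral c G' < +oo -> curve_integral c G < +oo.
Proof.
by move=> rc h h' GG'; apply: le_lt_trans; exact: (le_curve_integral oZ rc h h').
Qed.

Lemma wug_grad_on w G rho c : wug mu Z p (EFin \o w) G rho -> rectifiable_curve Z c ->
  curve_integral c rho < +oo -> curve_integral c G < +oo /\ grad_on c w G.
Proof.
move=> [hG _ _ H] rc cr; have [fG al] := H c rc cr; split => //.
exact: (along_ac oZ rc hG fG al).
Qed.

Lemma grad_on_wug w G rho : nneg_borel Z G -> nneg_borel Z rho -> Lp mu Z p rho ->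
  (forall c, rectifiable_curve Z c -> curve_integral c rho < +oo ->
     curve_integral c G < +oo /\ grad_on c w G) -> wug mu Z p (EFin \o w) G rho.
Proof.
move=> hG hr Lr H; split => // c rc cr; have [fG gw] := H c rc cr; split => //.
by apply: ac_along.
Qed.

Lemma grad_on_scale c w G (k : R) : rectifiable_curve Z c -> nneg_borel Z G -> (0 <= k)%R ->
  grad_on c w G -> grad_on c (fun x => k * w x)%R (fun x => k%:E * G x).
Proof.
move=> rc hG k0 H a b a0 ab bc; rewrite /Iint ge0_integralZl//.
- rewrite /= -mulrBr normrM ger0_norm// EFinM lee_wpmul2l ?lee_fin//; exact: H.
- exact: measurable_itvS (measurable_along oZ rc hG.1).
- move=> t /=; rewrite in_itv/= => /andP[ta tb]; apply: (along_ge0 rc hG).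
  by rewrite (le_trans a0)// (le_trans tb).
Qed.

Lemma measurable_supcut (A : set (X * R)) : (forall q, A q -> (0 < q.2)%R) ->
  measurable_fun Z (supcut A).
Proof.
move=> A0 _; apply: (measurability _ (RGenOInfty.measurableE R)) => // _ [_ [t ->] <-].
apply: measurableI => //; apply: hmu.1.
rewrite (_ : _ @^-1` _ = [set x | (t < supcut A x)%R]); first exact: supcut_open.
by apply/seteqP; split => x /=; rewrite in_itv/= andbT.
Qed.

End Lp_gradients.

Section poincare.
Context (R : realType) (disp : measure_display)
  (X : metricMeasurableType R disp) (mu : {measure set X -> \bar R})
  (Omega E : set X) (d s L : R) (gr : grid mu Omega E d s L).
Hypotheses (hmu : complete_borel mu) (oO : open Omega) (L10 : (10 <= L)%R).
Variables (p C lambda : R).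
Hypotheses (p1 : (1 <= p)%R) (C0 : (0 < C)%R) (lambda1 : (1 <= lambda)%R)
  (Llambda : (10 * lambda + 10 <= L)%R).
Hypothesis PI : forall x r, Omega x -> (0 < r)%R ->
  let B := ball_of Omega x r in let lB := ball_of Omega x (lambda * r) in
  0 < mu B -> mu B < +oo ->
  forall u g, Lp_loc mu Omega 1 u -> minimal_weak_upper_gradient mu Omega p u g ->
    Lp mu Omega p g ->
    average mu B (fun y => `|u y - average mu B u|) <=
    C%:E * diam B * (average mu lB (fun y => g y `^ p)) `^ p^-1.
Let p0 : (0 < p)%R. Proof. exact: lt_le_trans p1. Qed.
Let mO : measurable Omega. Proof. exact: hmu.1. Qed.

(** The factor 10 bounds the diameter of a ball of radius [5 * gradius gr a] in units of that scale,
    and [dblC gr] bounds its mass. *)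
Definition poincare_cst : R := (10 * C * dblC gr)%R.

(** The cutoffs are supported in balls of radius [2 * r2 = L * rho gr], the largest radius at which
    the grid guarantees finite mass. *)
Let r2 : R := (L / 2 * rho gr)%R.
Let r20 : (0 < r2)%R.
Proof. by rewrite mulr_gt0 ?rho_gt0// divr_gt0// (lt_le_trans _ L10). Qed.
Let cuts : set (X * R) := [set q | q.1 \in net gr 0 /\ q.2 = r2].
Let D : set X := \bigcup_(c in [set` net gr 0]) ball c r2.
Let S : set X := \bigcup_(c in [set` net gr 0]) ball c (2 * r2).

Let oD : open D. Proof. by apply: bigcup_open => c _; exact: mball_open. Qed.
Let oS : open S. Proof. by apply: bigcup_open => c _; exact: mball_open. Qed.

Let muS : mu (S `&` Omega) < +oo.
Proof.
have -> : S `&` Omega = \big[setU/set0]_(c <- net gr 0) ball_of Omega c (2 * r2).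
  by rewrite /S setI_bigcupl bigcup_seq.
have r2E : (2 * r2 = L * rho gr)%R by rewrite /r2; field.
have Rb c : c \in net gr 0 -> mu (ball_of Omega c (2 * r2)) < +oo.
  move=> /net_sub Ec; have : 0 < mu (ball_of Omega c (2 * r2)) < +oo.
    by apply: (ball_mass (gr := gr)) => //; rewrite mulr_gt0//= r2E.
  by case/andP.
have mb c : measurable (ball_of Omega c (2 * r2)) by exact: (measurable_ball_of hmu oO).
elim: (net gr 0) Rb => [|c l IH] Rb; first by rewrite big_nil measure0.
rewrite big_cons; apply: le_lt_trans (measureU2 _ _ _) _ => //.
  by apply: bigsetU_measurable.
rewrite lte_add_pinfty//; first by apply: Rb; rewrite mem_head.
by apply: IH => c' c'l; apply: Rb; rewrite inE c'l orbT.
Qed.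

(** The function [w] need not be integrable on balls far from [E]. The Poincare inequality is
    therefore applied to [v], which agrees with [w] on [D] and vanishes off [S], a set of finite
    mass in [Omega]. The balls of the inequality lie in [D], where the gradient [G2] of [v] reduces
    to [G]. *)
Lemma bounded_osc_control (w : X -> R) (T : R) (G rho_ : X -> \bar R) : (0 <= T)%R ->
  measurable_fun Omega w -> (forall x, Omega x -> (`|w x| <= T)%R) ->
  wug mu Omega p (EFin \o w) G rho_ -> Lp mu Omega p G ->
  osc_control gr p 1 poincare_cst (EFin \o w) (fun y => G y `^ p).
Proof.
move=> T0 mw wT wugw LG.
have [hG hr Lr _] := wugw.
have cuts0 q : cuts q -> (0 < q.2)%R by move=> [_ ->].
pose eta := supcut cuts.
have eta1 x : D x -> eta x = 1%R.
  move=> [c /= cn]; rewrite ballEmdist /= => /ltW h.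
  exact: (@supcut_eq1 _ _ _ cuts (c, r2)).
have eta0 x : ~ S x -> eta x = 0%R.
  move=> nS; apply: supcut_eq0 => -[c r] [/= cn ->]; split => //.
  by rewrite leNgt; apply/negP => h; apply: nS; exists c => //; rewrite ballEmdist.
have eta01 x : (0 <= eta x <= 1)%R by rewrite supcut_ge0 supcut_le1.
have mS : measurable (S : set (g_sigma_algebraType (@open X))) by exact: sub_gen_smallest.
have mDb : measurable (D : set (g_sigma_algebraType (@open X))) by exact: sub_gen_smallest.
have k0 : (0 <= r2^-1)%R by rewrite invr_ge0 ltW.
pose H x := cst (r2^-1)%:E x * (\1_S x)%:E : \bar R.
have hH : nneg_borel Omega H by apply: nneg_borel_indic => //; exact: nneg_borel_cst.
have LH : Lp mu Omega p H by exact: (Lp_cst_indic hmu oO p1).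
have H_le x : H x <= (r2^-1)%:E.
  by rewrite /H indicE; case: (x \in S); rewrite ?mule1// mule0 lee_fin.
have geta c : rectifiable_curve Omega c -> grad_on c eta H.
  move=> rc; apply: (grad_on_supcut oO rc hH cuts0) => -[c' r] x [/= cn ->] h.
  by rewrite /H indicE mem_set ?mule1//; exists c' => //; rewrite ballEmdist.
pose TH x := T%:E * H x.
have hTH : nneg_borel Omega TH.
  split; first by apply: measurable_funeM; exact: hH.1.
  by move=> x Ox; rewrite mule_ge0 ?lee_fin//; exact: hH.2.
have LTH : Lp mu Omega p TH.
  apply: (Lp_le hmu oO p1 hTH (nneg_borel_indic mS (nneg_borel_cst _ (mulr_ge0 T0 k0)))).
    by move=> x _; rewrite /TH /H /= muleA EFinM.
  by apply: (Lp_cst_indic hmu oO p1) => //; exact: mulr_ge0.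
(* Clamping between [- T * eta] and [T * eta], instead of multiplying by [eta], avoids a product
   rule for gradients. *)
pose v x := Num.max (- (T * eta x))%R (Num.min (w x) (T * eta x)%R).
have vw x : Omega x -> D x -> v x = w x.
  move=> Ox Dx; rewrite /v eta1// mulr1; have := wT x Ox; rewrite ler_norml => /andP[h1 h2].
  by rewrite min_l// max_r.
have vT x : (`|v x| <= T * eta x)%R.
  have Te : (0 <= T * eta x)%R by rewrite mulr_ge0//; case/andP: (eta01 x).
  rewrite ler_norml /v le_max lexx/= ge_max ge_min lexx orbT andbT.
  by rewrite (le_trans _ Te)// oppr_le0.
have mv : measurable_fun Omega v.
  have mTe : measurable_fun Omega (fun x => T * eta x)%R.
    apply: measurable_funM; first exact: measurable_cst.
    exact: (measurable_supcut hmu oO).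
  apply: measurable_maxr; last exact: measurable_minr.
  exact: measurableT_comp.
pose G1 x := TH x + (G x + TH x).
have hGT := nneg_borelD hG hTH.
have hG1 : nneg_borel Omega G1 by exact: nneg_borelD.
have gv c : rectifiable_curve Omega c -> grad_on c w G -> grad_on c v G1.
  move=> rc gw; have gT := grad_on_scale oO rc hH T0 (geta c rc).
  have m1 : grad_on c (fun x => Num.min (w x) (T * eta x)%R) (fun x => G x + TH x).
    apply: (grad_on_contract2 oO rc hG hTH _ gw gT) => x y; exact: minr_lip.
  apply: (grad_on_contract2 oO rc hTH hGT _ gT m1) => x y.
  by apply: le_trans (maxr_lip _ _ _ _) _; rewrite -opprD normrN.
(* [v] is [w] plus the difference [v - w]. This difference has gradient [G1 + G] and vanishes on
   [D], where its gradient may therefore be dropped. *)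
pose G2 x := G x + (G1 x + G x) * (\1_(~` D) x)%:E.
have hGG := nneg_borelD hG1 hG.
have hoff : nneg_borel Omega (fun x => (G1 x + G x) * (\1_(~` D) x)%:E).
  by apply: nneg_borel_indic => //; exact: measurableC.
have hG2 : nneg_borel Omega G2 by exact: nneg_borelD.
have LG1 : Lp mu Omega p G1.
  by apply: (Lp_add hmu oO p1) => //; apply: (Lp_add hmu oO p1).
have le1 (D' : set X) (f : X -> \bar R) x : 0 <= f x -> f x * (\1_D' x)%:E <= f x.
  by move=> f0; rewrite indicE; case: (x \in D'); rewrite ?mule1// mule0.
have LG2 : Lp mu Omega p G2.
  apply: (Lp_add hmu oO p1) => //.
  apply: (Lp_le hmu oO p1 hoff hGG); last exact: (Lp_add hmu oO p1).
  by move=> x Ox; apply: (le1 _ (fun x => G1 x + G x)); exact: hGG.2.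
have wugv : wug mu Omega p (EFin \o v) G2 rho_.
  apply: grad_on_wug => // c rc cr; have [fG gw] := wug_grad_on oO wugw rc cr.
  have c0 : (0 < c.1)%R by have [] := rc.
  have fTH : curve_integral c TH < +oo.
    apply: (curve_integral_fin_le oO rc hTH (nneg_borel_cst _ (mulr_ge0 T0 k0))).
      by move=> x _; rewrite /TH EFinM lee_wpmul2l.
    exact: curve_integral_cst.
  have fG1 : curve_integral c G1 < +oo.
    by apply: (curve_integralD oO) => //; apply: (curve_integralD oO).
  have fGG : curve_integral c (fun x => G1 x + G x) < +oo by apply: (curve_integralD oO).
  have foff : curve_integral c (fun x => (G1 x + G x) * (\1_(~` D) x)%:E) < +oo.
    apply: (curve_integral_fin_le oO rc hoff hGG) => // x Ox.
    by apply: (le1 _ (fun x => G1 x + G x)); exact: hGG.2.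
  split; first by apply: (curve_integralD oO).
  have gvw : grad_on c (fun x => v x - w x)%R (fun x => G1 x + G x).
    apply: (grad_on_contract2 oO rc hG1 hG _ (gv c rc gw) gw) => x y.
    rewrite (_ : v x - w x - (v y - w y) = (v x - v y) - (w x - w y))%R; last by ring.
    exact: ler_normB.
  have gvwo := grad_on_off oO rc (k := 0%R) mDb hGG fGG _ gvw.
  apply: (grad_on_contract2 oO rc hG hoff _ gw (gvwo _)) => [x y|x Ox Dx].
    rewrite (_ : v x - v y = (w x - w y) + (v x - w x - (v y - w y)))%R; last by ring.
    exact: ler_normD.
  by rewrite vw// subrr.
have Omega_v x : (Omega x -> `|(v x)%:E| <= (T * \1_S x)%:E).
  move=> Ox; rewrite lee_fin; apply: le_trans (vT x) _; rewrite indicE ler_wpM2l//.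
  case: (boolP (x \in S)) => [_|/negP nS]; first by case/andP: (eta01 x).
  by rewrite eta0// => Sx; apply: nS; exact/mem_set.
have v1 : Lp_loc mu Omega 1 (EFin \o v).
  move=> x r Ox r0; have mb := measurable_ball_of hmu oO x r.
  have mvb : measurable_fun (ball_of Omega x r) (EFin \o v).
    by apply/measurable_EFinP; apply: measurable_funS mv => //; exact: subIsetr.
  apply/LpP => //; split => //.
  have mS' : measurable S by exact: hmu.1.
  apply: (@le_lt_trans _ _ (\int[mu]_(y in Omega) (T%:E * (\1_S y)%:E))).
    apply: (@le_trans _ _ (\int[mu]_(y in ball_of Omega x r) (T%:E * (\1_S y)%:E))).
      apply: ge0_le_integral => //.
      - by move=> y _; exact: poweR_ge0.
      - by apply: (measurableT_comp (measurable_poweR 1)); exact: measurableT_comp.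
      - apply: measurable_funeM; apply/measurable_EFinP; apply: measurable_funTS; exact: measurable_indic.
      - by move=> y [_ Oy]; rewrite poweRe1// -EFinM; exact: Omega_v.
    apply: ge0_subset_integral => //.
    - apply: measurable_funeM; apply/measurable_EFinP; apply: measurable_funTS; exact: measurable_indic.
    - by move=> y _; rewrite mule_ge0 ?lee_fin.
    - exact: subIsetr.
  rewrite ge0_integralZl//; last first.
    by apply/measurable_EFinP; apply: measurable_funTS; exact: measurable_indic.
  by rewrite integral_indic// lte_mul_pinfty ?lee_fin.
have [g ming Lg] := exists_minimal_gradient hmu oO p1 (wug_weak wugv) LG2.
have gG2 : {ae mu, forall x, Omega x -> g x <= G2 x}.
  have [_ _] := ming; apply; first exact: wug_weak wugv.
  exact: (Lp_Lp_loc hmu oO p1).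
have hg : nneg_borel Omega g by have [[hg _] _ _] := ming.
move=> a c ca; have Ec := net_sub ca.
pose r := gradius gr a; have r_gt0 : (0 < r)%R by exact: rad_gt0.
have r_le : (r <= rho gr)%R by exact: rad_le_rho.
have m0 := mass_gt0 gr L10 a Ec; have mE := massE gr L10 a Ec.
(* Net points may lie on the boundary of [Omega]. The inequality is applied at a nearby point [y] of
   [Omega], with radius [5 * r] so that the ball still contains the one of radius [4 * r] about
   [c]. *)
have [y [yc Oy]] : ball_of Omega c r !=set0.
  apply/set0P/eqP => e0; have : mu (ball_of Omega c r) = 0 by rewrite e0 measure0.
  by rewrite mE => -[] /eqP; rewrite gt_eqF.
have {}yc : (mdist c y < r)%R by move: yc; rewrite ballEmdist.
have yc' : (mdist y c < r)%R by rewrite metric_sym.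
pose B := ball_of Omega y (5 * r); pose lB := ball_of Omega y (lambda * (5 * r)).
have mb x t : measurable (ball_of Omega x t) by exact: (measurable_ball_of hmu oO).
have mB : measurable B by exact: mb.
have mlB : measurable lB by exact: mb.
have l0 : (0 < lambda)%R by exact: lt_le_trans lambda1.
have r5 : (0 < 5 * r)%R by rewrite mulr_gt0.
have BcL : mu (ball_of Omega c (L * r)) <= (dblC gr * mass gr a c)%:E.
  rewrite EFinM -mE; apply: mass_dbl => //; exact: rad1.
have B4 : ball_of Omega c (4 * r) `<=` B by apply: ball_of_subset; lra.
have mle x t x' t' : (mdist x' x + t <= t')%R -> mu (ball_of Omega x t) <= mu (ball_of Omega x' t').
  by move=> h; apply: le_measure; rewrite ?inE; [exact: mb|exact: mb|exact: ball_of_subset].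
have Bc : mu B <= (dblC gr * mass gr a c)%:E.
  apply: le_trans BcL; apply: mle.
  have : (10 * r <= L * r)%R by rewrite ler_pM2r.
  lra.
have Bm : (mass gr a c)%:E <= mu B by rewrite -mE; apply: mle; rewrite -/r; lra.
have lBm : (mass gr a c)%:E <= mu lB.
  rewrite -mE; apply: mle.
  have : (1 * (5 * r) <= lambda * (5 * r))%R by rewrite ler_pM2r.
  rewrite -/r; lra.
have Ll : (10 * (lambda * r) + 10 * r <= L * r)%R by rewrite mulrA -mulrDl ler_pM2r.
have lr0 : (0 < lambda * r)%R by exact: mulr_gt0.
have lBc : lB `<=` ball_of Omega c (L * r) by apply: ball_of_subset; lra.
have lBfin : mu lB \is a fin_num.
  rewrite ge0_fin_numE//; apply: le_lt_trans (ltry (dblC gr * mass gr a c)).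
  by apply: le_trans BcL; apply: mle; lra.
have Bfin : mu B \is a fin_num.
  by rewrite ge0_fin_numE//; apply: le_lt_trans Bc (ltry _).
have near_D z : (mdist c z <= (5 * lambda + 1) * r)%R -> D z.
  move=> cz; have [h1 h2] := cellP gr 0 Ec.
  exists (cell gr 0 c) => //; rewrite ballEmdist /=.
  have := metric_triangle (cell gr 0 c) c z.
  have r0 : (gradius gr 0 = rho gr)%R by rewrite /gradius expr0 divr1.
  rewrite r0 in h2.
  have h3 : ((5 * lambda + 1) * r <= (5 * lambda + 1) * rho gr)%R.
    by rewrite ler_wpM2l// addr_ge0// mulr_ge0// ltW.
  have : ((10 * lambda + 10) / 2 * rho gr <= r2)%R.
    by rewrite /r2 ler_pM2r ?rho_gt0// ler_pM2r.
  have := rho_gt0 gr; lra.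
have lBD : lB `<=` D.
  move=> z [+ Oz]; rewrite ballEmdist /= => yz; apply: near_D.
  by have := metric_triangle c y z; lra.
have B4D : ball_of Omega c (4 * r) `<=` D.
  move=> z [+ Oz]; rewrite ballEmdist /= => cz; apply: near_D.
  have : (1 * r <= lambda * r)%R by rewrite ler_pM2r.
  lra.
have iv : mu.-integrable B (EFin \o v).
  apply/integrableP; split.
    by apply/measurable_EFinP; apply: measurable_funS mv => //; exact: subIsetr.
  have [_] := (@LpP _ _ _ mu B 1 (EFin \o v) ltr01).1 (v1 y (5 * r)%R Oy r5).
  rewrite [X in X < _ -> _](_ : _ = \int[mu]_(x in B) `|(EFin \o v) x|)//.
  by apply: eq_integral => x _; rewrite poweRe1.
pose b := fine (average mu B (EFin \o v)).
have bE : average mu B (EFin \o v) = b%:E.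
  rewrite /b fineK// /average.
  have If := integrable_fin_num (mb y (5 * r)%R) iv.
  rewrite -/B -(fineK Bfin) inver; case: ifPn => [/eqP B0|_].
    by have := lt_le_trans (_ : 0 < (mass gr a c)%:E) Bm; rewrite lte_fin m0 -(fineK Bfin) B0 ltxx => /(_ isT).
  by rewrite fin_numM.
exists b.
have B0 : 0 < mu B by apply: lt_le_trans Bm; rewrite lte_fin.
have pi := PI Oy r5 B0 (le_lt_trans Bc (ltry _)) v1 ming Lg; rewrite -/B -/lB bE in pi.
have mvb : measurable_fun B (fun y => `|(EFin \o v) y - b%:E|).
  apply: measurableT_comp => //; apply: emeasurable_funB; last exact: measurable_cst.
  by case/integrableP : iv.
set nn := nu mu Omega (fun y => G y `^ p) (ball c (L * gradius gr a)).
have mGp : measurable_fun Omega (fun y => G y `^ p).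
  by apply: (measurableT_comp (measurable_poweR p)); exact: (borel_fun_measurable hmu oO hG.1).
have mgp : measurable_fun Omega (fun y => g y `^ p).
  by apply: (measurableT_comp (measurable_poweR p)); exact: (borel_fun_measurable hmu oO hg.1).
have eG : energy mu Omega (fun y => G y `^ p).
  split => //; first by move=> z _; exact: poweR_ge0.
  exact: ((Lp_nneg hmu oO p1 hG).1 LG).
have nn0 : (0 <= nn)%R by exact: (nu_ge0 eG).
have lBO : lB `<=` Omega by exact: subIsetr.
have Ig : \int[mu]_(z in lB) g z `^ p <= nn%:E.
  rewrite -(nuE hmu oO eG); last by apply: hmu.1; exact: mball_open.
  apply: (@le_trans _ _ (\int[mu]_(z in lB) G z `^ p)).
    apply: ae_ge0_le_integral => //.
    - by move=> z _; exact: poweR_ge0.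
    - exact: measurable_funS mgp.
    - by move=> z _; exact: poweR_ge0.
    - exact: measurable_funS mGp.
    apply: filterS gG2 => z h lBz; apply: poweR_le; first exact: ltW.
      by apply: hg.2; exact: lBO.
    apply: le_trans (h (lBO _ lBz)) _; rewrite /G2 indicE memNset ?mule0 ?adde0//.
    by move=> /(_ (lBD _ lBz)).
  apply: ge0_subset_integral => //.
  - exact: (mb c (L * gradius gr a)%R).
  - by apply: measurable_funS mGp => //; exact: subIsetr.
  - by move=> z _; exact: poweR_ge0.
have avg_le : (average mu lB (fun y => g y `^ p)) `^ p^-1 <= ((nn / mass gr a c) `^ p^-1)%:E.
  rewrite -poweR_EFin; apply: poweR_le; first by rewrite invr_ge0 ltW.
    rewrite /average mule_ge0 ?inve_ge0//; first by apply: integral_ge0 => z _; exact: poweR_ge0.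
  rewrite /average mulrC EFinM; apply: lee_pmul => //.
  - by rewrite inve_ge0.
  - by apply: integral_ge0 => z _; exact: poweR_ge0.
  have lb0 : (0 < fine (mu lB))%R by rewrite -lte_fin fineK//; apply: lt_le_trans lBm; rewrite lte_fin.
  have h : (mass gr a c <= fine (mu lB))%R by rewrite -lee_fin (fineK lBfin).
  by rewrite -(fineK lBfin) inver gt_eqF//= lee_fin lef_pV2 ?posrE.
have diamB : diam B <= (10 * r)%:E.
  apply: ge_ereal_sup => _ [z1 [z1B _]] [z2 [z2B _] <-]; rewrite lee_fin.
  move: z1B z2B; rewrite !ballEmdist /= => h1 h2.
  by have := metric_triangle z1 y z2; rewrite (metric_sym z1 y); lra.
apply: (@le_trans _ _ (\int[mu]_(z in B) `|(EFin \o v) z - b%:E|)).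
  rewrite (_ : \int[mu]_(z in _) `|(EFin \o w) z - _| =
    \int[mu]_(z in ball_of Omega c (4 * r)) `|(EFin \o v) z - b%:E|).
    apply: ge0_subset_integral => //; exact: mb.
  apply: eq_integral => z; rewrite inE => zB /=; rewrite vw//; first by case: zB.
  exact: B4D.
have avB : average mu B (fun y => `|(EFin \o v) y - b%:E|) <=
    (C * (10 * r) * (nn / mass gr a c) `^ p^-1)%:E.
  apply: (le_trans pi); rewrite EFinM; apply: lee_pmul => //.
  - rewrite mule_ge0 ?lee_fin ?(ltW C0)//; apply: (@le_trans _ _ (mdist y y)%:E).
      by rewrite mdistxx.
    have yB : B y by split => //; rewrite ballEmdist /= mdistxx.
    by apply: ereal_sup_ubound; exists y => //; exists y.
  - exact: poweR_ge0.
  - by rewrite EFinM lee_wpmul2l// lee_fin ltW.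
have -> : \int[mu]_(z in B) `|(EFin \o v) z - b%:E| =
    mu B * average mu B (fun y => `|(EFin \o v) y - b%:E|).
  rewrite /average muleA -{1}(fineK Bfin) -[in X in X^-1](fineK Bfin) inver.
  have b0 : (0 < fine (mu B))%R by rewrite -lte_fin fineK.
  by rewrite gt_eqF// -EFinM divff ?gt_eqF// mul1e.
apply: (@le_trans _ _ ((dblC gr * mass gr a c)%:E * (C * (10 * r) * (nn / mass gr a c) `^ p^-1)%:E)).
  apply: lee_pmul => //; rewrite /average mule_ge0 ?inve_ge0//.
  exact: integral_ge0.
rewrite -EFinM lee_fin /osc /poincare_cst powRr1 ?(ltW r_gt0)// -/r -/nn.
by rewrite le_eqVlt; apply/orP; left; apply/eqP; ring.
Qed.

End poincare.

(** * From bounded functions to Newtonian functions *)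

Definition clamp (R : realDomainType) (T x : R) : R := Num.max (- T)%R (Num.min x T).

Section clamp.
Context (R : realType).
Implicit Types T x y : R.

Lemma clamp_lip T x y : (`|clamp T x - clamp T y| <= `|x - y|)%R.
Proof.
apply: le_trans (maxr_lip _ _ _ _) _; rewrite subrr normr0 add0r.
by apply: le_trans (minr_lip _ _ _ _) _; rewrite subrr normr0 addr0.
Qed.

Lemma clamp_norm T x : (0 <= T)%R -> (`|clamp T x| <= T)%R.
Proof.
move=> T0; rewrite ler_norml /clamp le_max lexx/= ge_max ge_min lexx orbT andbT.
by rewrite (le_trans _ T0)// oppr_le0.
Qed.

Lemma clamp_le_norm T x : (0 <= T)%R -> (`|clamp T x| <= `|x|)%R.
Proof.
move=> T0; have := clamp_lip T x 0.
rewrite {2}/clamp min_l// max_r ?oppr_le0//; first by rewrite !subr0.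
Qed.

Lemma clamp_id T x : (`|x| <= T)%R -> clamp T x = x.
Proof. by rewrite ler_norml => /andP[h1 h2]; rewrite /clamp min_l// max_r. Qed.

Lemma measurable_clamp (disp : measure_display) (S : measurableType disp) (D : set S)
  (T : R) (f : S -> R) : measurable_fun D f -> measurable_fun D (fun z => clamp T (f z)).
Proof.
by move=> mf; apply: measurable_maxr; [exact: measurable_cst|apply: measurable_minr => //; exact: measurable_cst].
Qed.

End clamp.

Section clamp_limit.
Context (R : realType) (disp : measure_display) (S : measurableType disp)
  (m : {measure set S -> \bar R}).

(** Integrability of [U] bounds the constants attached to the clamped functions, so a subsequence of
    these constants converges, and Fatou's lemma passes the oscillation bound to the limit. *)
Lemma osc_clamp_limit (B : set S) (U : S -> R) (M : R) : measurable B ->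
  0 < m B < +oo -> measurable_fun B U -> \int[m]_(x in B) (`|U x|)%:E < +oo ->
  (forall n : nat, exists b : R, \int[m]_(x in B) (`|clamp n%:R (U x) - b|)%:E <= M%:E) ->
  exists b : R, \int[m]_(x in B) (`|U x - b|)%:E <= M%:E.
Proof.
move=> mB /andP[B0 Boo] mU UI H.
have [b_ bP] := choice H.
have Bf : m B \is a fin_num by rewrite ge0_fin_numE.
have fb0 : (0 < fine (m B))%R by rewrite fine_gt0 ?B0.
pose I := fine (\int[m]_(x in B) (`|U x|)%:E).
have IE : \int[m]_(x in B) (`|U x|)%:E = I%:E.
  by rewrite /I fineK// ge0_fin_numE//; apply: integral_ge0 => x _; rewrite lee_fin.
have mc n : measurable_fun B (fun x => clamp n%:R (U x)) by exact: measurable_clamp.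
have mcb n (b : R) : measurable_fun B (fun x => (`|clamp n%:R (U x) - b|)%:E).
  apply/measurable_EFinP; apply: measurableT_comp => //.
  by apply: measurable_funB => //; exact: measurable_cst.
have bB n : (`|b_ n| <= (M + I) / fine (m B))%R.
  rewrite ler_pdivlMr// -lee_fin EFinM fineK//.
  have -> : (`|b_ n|)%:E * m B = \int[m]_(x in B) (cst (`|b_ n|)%:E x) by rewrite integral_cst.
  apply: (@le_trans _ _ (\int[m]_(x in B) ((`|clamp n%:R (U x) - b_ n|)%:E + (`|U x|)%:E))).
    apply: ge0_le_integral => //.
    - by move=> x _; rewrite lee_fin.
    - by apply: emeasurable_funD => //; apply/measurable_EFinP; exact: measurableT_comp.
    - move=> x _; rewrite /= lee_fin.
      have h := clamp_le_norm (U x) (ler0n R n).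
      have := ler_normB (clamp n%:R (U x)) (clamp n%:R (U x) - b_ n)%R.
      by rewrite subKr => h2; apply: le_trans h2 _; rewrite [leRHS]addrC lerD2r.
  rewrite ge0_integralD//; last by apply/measurable_EFinP; exact: measurableT_comp.
  by rewrite IE EFinD leeD2r.
have [phi phiS [y yP]] := @diagonal_subsequence R (fun n _ => b_ n) (fun _ => (M + I) / fine (m B))%R (fun n _ => bB n).
exists (y 0%N).
have cv x : (`|clamp (phi n)%:R (U x) - b_ (phi n)|)%:E @[n --> \oo] --> (`|U x - y 0%N|)%:E.
  apply/fine_cvgP; split; first exact: nearW.
  apply/cvgrPdist_le => e e0 /=.
  have [M1 HM1] := harmonic_small 1%R e0.
  exists (maxn M1 (Num.bound `|U x|%R)) => // n /=; rewrite geq_max => /andP[M1n Un].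
  have phin : (n <= phi n)%N.
    by elim: n {M1n Un} => [//|n IH]; exact: leq_ltn_trans IH (phiS _ _ (ltnSn n)).
  rewrite clamp_id; last first.
    apply: le_trans (ltW (archi_boundP (normr_ge0 (U x)))) _.
    by rewrite ler_nat (leq_trans Un).
  have := HM1 n M1n; rewrite mul1r => h.
  have := yP n 0%N (leq0n n) => h2.
  have h3 := ler_dist_dist (U x - y 0%N)%R (U x - b_ (phi n))%R.
  rewrite (_ : U x - y 0%N - (U x - b_ (phi n)) = b_ (phi n) - y 0%N)%R in h3; last by ring.
  by apply: le_trans h3 _; apply: le_trans (ltW h2) h.
have -> : \int[m]_(x in B) (`|U x - y 0%N|)%:E =
    \int[m]_(x in B) limn_einf (fun n => (`|clamp (phi n)%:R (U x) - b_ (phi n)|)%:E).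
  by apply: eq_integral => x _; rewrite (cvg_limn_einf_sup (cv x)).1.
apply: le_trans (fatou m mB (fun n => mcb (phi n) (b_ (phi n))) _) _; first by [].
by apply: limn_einf_le => n; exact: bP.
Qed.

End clamp_limit.

Section newtonian.
Context (R : realType) (disp : measure_display)
  (X : metricMeasurableType R disp) (mu : {measure set X -> \bar R})
  (Omega E : set X) (d s L : R) (gr : grid mu Omega E d s L).
Hypotheses (hmu : complete_borel mu) (oO : open Omega) (L10 : (10 <= L)%R).
Variables (p C lambda : R).
Hypotheses (p1 : (1 <= p)%R) (C0 : (0 < C)%R) (lambda1 : (1 <= lambda)%R)
  (Llambda : (10 * lambda + 10 <= L)%R).
Hypothesis PI : forall x r, Omega x -> (0 < r)%R ->
  let B := ball_of Omega x r in let lB := ball_of Omega x (lambda * r) in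
  0 < mu B -> mu B < +oo ->
  forall u g, Lp_loc mu Omega 1 u -> minimal_weak_upper_gradient mu Omega p u g ->
    Lp mu Omega p g ->
    average mu B (fun y => `|u y - average mu B u|) <=
    C%:E * diam B * (average mu lB (fun y => g y `^ p)) `^ p^-1.
Let p0 : (0 < p)%R. Proof. exact: lt_le_trans p1. Qed.
Let mO : measurable Omega. Proof. exact: hmu.1. Qed.

Lemma upper_gradient_wug u h : Omega !=set0 -> upper_gradient Omega u h -> Lp mu Omega p h ->
  exists rho, wug mu Omega p u h rho.
Proof.
move=> O0 [hh ug] Lh; apply: (weak_wug hmu oO p1 O0); last exact: (Lp_Lp_loc hmu oO p1).
split => //; exists set0; last by move=> c rc _; exact: ug.
have h0 := @nneg_borel_cst R disp X Omega 0%R (lexx _).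
exists (cst 0); split => //.
apply/(Lp_nneg hmu oO p1 h0).
rewrite (_ : \int[mu]_(x in Omega) _ = 0)// integral0_eq// => x _.
by rewrite /cst poweR0r// gt_eqF.
Qed.

(** All clamped functions share the gradient [h], so the bounded case applies with one constant.
    Replacing [u] by its finite part changes it only on a null set, because [|u| ^ p] is
    integrable. *)
Lemma fine_osc_control u h : measurable_fun Omega u -> \int[mu]_(y in Omega) `|u y| `^ p < +oo ->
  upper_gradient Omega u h -> Lp mu Omega p h ->
  osc_control gr p 1 (poincare_cst gr C) u (fun y => h y `^ p).
Proof.
move=> mu_ uLp ug Lh a c ca; have Ec := net_sub ca.
have m0 := mass_gt0 gr L10 a Ec; have mE := massE gr L10 a Ec.
have O0 : Omega !=set0.
  have : ball_of Omega c (gradius gr a) !=set0.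
    apply/set0P/eqP => e0; have : mu (ball_of Omega c (gradius gr a)) = 0 by rewrite e0 measure0.
    by rewrite mE => -[] /eqP; rewrite gt_eqF.
  by move=> [y [_ Oy]]; exists y.
have [rho wugu] := upper_gradient_wug O0 ug Lh.
have [hh hr Lr Hr] := wugu.
pose U x := fine (u x).
have mU : measurable_fun Omega U by exact: (measurableT_comp (fine_measurable measurableT)).
have oscn (n : nat) : osc_control gr p 1 (poincare_cst gr C) (EFin \o (fun x => clamp n%:R (U x)))
    (fun y => h y `^ p).
  apply: (@bounded_osc_control _ _ _ _ _ _ _ _ _ gr hmu oO L10 p C lambda p1 C0 lambda1 Llambda PI
    (fun x => clamp n%:R (U x)) n%:R h rho) => //.
  - exact: measurable_clamp.
  - by move=> x _; exact: clamp_norm.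
  apply: grad_on_wug => // c' rc cr; have [fh al] := Hr c' rc cr; split => //.
  apply: (grad_on_contract (w1 := U)); first by move=> x y; exact: clamp_lip.
  exact: (along_ac oO rc hh fh al).
pose B := ball_of Omega c (4 * gradius gr a).
have mB : measurable B by exact: (mball_ofP hmu oO).
have BO : B `<=` Omega by exact: subIsetr.
have muB : measurable_fun B u by exact: measurable_funS mu_.
have B01 : 0 < mu B < +oo.
  apply: (ball_mass (gr := gr)) => //.
  by apply: radL => //; rewrite (le_trans _ L10) ?ltr0n ?ler_nat.
have mup : measurable_fun Omega (fun y => `|u y| `^ p).
  by apply: (measurableT_comp (measurable_poweR p)); exact: measurableT_comp.
have finO : {ae mu, forall x, Omega x -> u x \is a fin_num}.
  have f0 : \int[mu]_(y in Omega) `|u y| `^ p \is a fin_num.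
    by rewrite ge0_fin_numE//; apply: integral_ge0 => y _; exact: poweR_ge0.
  have := @ae_fin_integral _ _ _ mu Omega (fun y => `|u y| `^ p) (fine (\int[mu]_(y in Omega) `|u y| `^ p)) mO mup.
  rewrite fineK//; move=> /(_ (fun _ _ => poweR_ge0 _ _) (lexx _)).
  apply: filterS => x hx /hx; case: (u x) => //=; rewrite gt_eqF//.
have finB : {ae mu, forall x, B x -> u x \is a fin_num}.
  by apply: filterS finO => x hx /BO.
have UI : \int[mu]_(x in B) (`|U x|)%:E < +oo.
  have [M Mp] : exists2 M : R, (0 < M)%R & mu B <= (1 * M)%:E.
    exists (fine (mu B)); first by rewrite fine_gt0//; case/andP: B01 => -> ->.
    by rewrite mul1r fineK// ge0_fin_numE//; case/andP: B01.
  move=> BM.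
  have mUB : measurable_fun B (fun x => (`|U x|)%:E).
    by apply/measurable_EFinP; apply: measurableT_comp => //; exact: measurable_funS mU.
  have pf : \int[mu]_(y in B) (`|U y|)%:E `^ p <= (fine (\int[mu]_(y in Omega) `|u y| `^ p))%:E.
    rewrite fineK; last by rewrite ge0_fin_numE//; apply: integral_ge0 => y _; exact: poweR_ge0.
    apply: (@le_trans _ _ (\int[mu]_(y in B) `|u y| `^ p)).
      apply: ge0_le_integral => //.
      - by move=> y _; exact: poweR_ge0.
      - exact: (measurableT_comp (measurable_poweR p)).
      - exact: measurable_funS mup.
      move=> y _; apply: poweR_le; [exact: ltW|by rewrite lee_fin|].
      by rewrite /U; case: (u y) => //=; rewrite normr0 leey.
    by apply: ge0_subset_integral => // y _; exact: poweR_ge0.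
  have := integral_le_powR_mean mB mUB _ p1 ler01 Mp _ BM pf.
  move=> H; apply: le_lt_trans (H _ _) (ltry _) => //.
  by rewrite fine_ge0//; apply: integral_ge0 => y _; exact: poweR_ge0.
have [b bP] := osc_clamp_limit mB B01 (measurable_funS mO BO mU) UI (fun n => oscn n a c ca).
exists b; rewrite -/B; apply: le_trans bP.
rewrite (_ : \int[mu]_(y in B) `|u y - b%:E| = \int[mu]_(x in B) (`|U x - b|)%:E)//.
apply: ae_eq_integral => //.
- apply: measurableT_comp => //; apply: emeasurable_funB => //; exact: measurable_cst.
- apply/measurable_EFinP; apply: measurableT_comp => //; apply: measurable_funB.
    exact: measurable_funS mU.
  exact: measurable_cst.
apply: filterS finB => x hx Bx; have := hx Bx; rewrite /U; by case: (u x).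
Qed.

Lemma newtonian_gradient u N : (0 < N)%R -> newtonian_space mu Omega p u ->
  newtonian_norm mu Omega p u < N%:E ->
  \int[mu]_(y in Omega) `|u y| `^ p <= (N `^ p)%:E /\
  exists2 h, upper_gradient Omega u h & \int[mu]_(y in Omega) h y `^ p <= (N `^ p)%:E.
Proof.
move=> N0 [mu_ _] uN; set I := \int[mu]_(y in Omega) `|u y| `^ p.
set S := [set \int[mu]_(x in Omega) g x `^ p | g in upper_gradient Omega u].
have I0 : 0 <= I by apply: integral_ge0 => y _; exact: poweR_ge0.
have S0 : 0 <= ereal_inf S.
  by apply: le_ereal_inf_tmp => _ [g _ <-]; apply: integral_ge0 => y _; exact: poweR_ge0.
have IS : I + ereal_inf S < (N `^ p)%:E.
  rewrite ltNge; apply/negP => /(@poweR_le _ p^-1).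
  rewrite invr_ge0 (ltW p0) lee_fin powR_ge0 => /(_ isT isT).
  rewrite poweR_EFin -powRrM divff ?gt_eqF// powRr1 ?(ltW N0)//.
  by rewrite leNgt uN.
split; first by apply: le_trans (ltW IS); rewrite leeDl.
have : ereal_inf S < (N `^ p)%:E by apply: le_lt_trans IS; rewrite leeDr.
by move=> /ereal_inf_lt [_ [h hh <-] /ltW hN]; exists h.
Qed.

Lemma newtonian_admissible u N : (0 < N)%R -> newtonian_space mu Omega p u ->
  newtonian_norm mu Omega p u < N%:E -> admissible gr p 1 (poincare_cst gr C) N u.
Proof.
move=> N0 us uN; have [uI [h hh hN]] := newtonian_gradient N0 us uN.
have [mu_ _] := us.
have Lh : Lp mu Omega p h.
  by apply/(Lp_nneg hmu oO p1 hh.1); exact: le_lt_trans hN (ltry _).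
split => //; exists (fun y => h y `^ p); split => //.
  split.
  - apply: (measurableT_comp (measurable_poweR p)).
    by apply: (borel_fun_measurable hmu oO); case: hh => -[].
  - by move=> y _; exact: poweR_ge0.
  - exact: le_lt_trans hN (ltry _).
by apply: fine_osc_control => //; apply: le_lt_trans uI (ltry _).
Qed.

End newtonian.

(** * Truncation by cutoff functions *)

Section grid_restrict.
Context (R : realType) (disp : measure_display)
  (X : metricMeasurableType R disp) (mu : {measure set X -> \bar R})
  (Omega E : set X) (d s L L1 : R).
Hypotheses (hmu : complete_borel mu) (oO : open Omega) (LL : (L <= L1)%R).
Variable g1 : grid mu Omega E d s L1.
Let Lr : (L * rho g1 <= L1 * rho g1)%R. Proof. by rewrite ler_pM2r ?rho_gt0. Qed.

Lemma restrict_overlap a y :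
  (size [seq c <- net g1 a | (mdist c y < L * (rho g1 / 2 ^+ a))%R] <= overlap g1)%N.
Proof.
apply: leq_trans (net_overlap g1 a y); rewrite !size_filter.
apply: sub_count => c /= /lt_le_trans; apply; by rewrite ler_pM2r// divr_gt0 ?rho_gt0.
Qed.

Lemma restrict_fin x (t : R) : E x -> (0 < t <= L * rho g1)%R ->
  0 < mu (ball_of Omega x t) < +oo.
Proof.
by move=> Ex /andP[t0 tL]; apply: (@mass_fin _ _ _ _ _ _ _ _ _ g1 x t Ex); rewrite t0 (le_trans tL).
Qed.

Lemma restrict_dbl x (t : R) : E x -> (0 < t <= rho g1)%R ->
  mu (ball_of Omega x (L * t)) <= (dblC g1)%:E * mu (ball_of Omega x t).
Proof.
move=> Ex tr; apply: le_trans (@mass_dbl _ _ _ _ _ _ _ _ _ g1 x t Ex tr).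
apply: le_measure; rewrite ?inE; [exact: (measurable_ball_of hmu oO)..|].
by apply: ball_of_subset; rewrite mdistxx add0r ler_pM2r//; case/andP: tr.
Qed.

Lemma restrict_haus x (t : R) : E x -> (0 < t <= L * rho g1)%R ->
  hausdorff d (E `&` ball x t) <= (hausC g1 * t `^ d)%:E.
Proof.
by move=> Ex /andP[t0 tL]; apply: (@haus_up _ _ _ _ _ _ _ _ _ g1 x t Ex); rewrite t0 (le_trans tL).
Qed.

(** The cutting argument needs overlap bounds at the large dilation [L1], the oscillation estimates
    only at [L], and both must refer to the same nets and radii. *)
Definition grid_restrict : grid mu Omega E d s L :=
  @Grid _ _ _ _ _ _ _ _ _ (rho g1) (net g1) (overlap g1) (dblC g1) (lowC g1) (hausC g1)
  (rho_gt0 g1) (dblC_gt0 g1) (lowC_gt0 g1) (hausC_gt0 g1) (@net_sub _ _ _ _ _ _ _ _ _ g1)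
  (@net_cover _ _ _ _ _ _ _ _ _ g1) restrict_overlap restrict_fin restrict_dbl
  (@mass_low _ _ _ _ _ _ _ _ _ g1) restrict_haus.

End grid_restrict.

Section cut.
Context (R : realType) (disp : measure_display)
  (X : metricMeasurableType R disp) (mu : {measure set X -> \bar R})
  (Omega E : set X) (d s L1 : R) (gr : grid mu Omega E d s L1).
Hypotheses (hmu : complete_borel mu) (oO : open Omega).
Variables (p L g : R).
Hypotheses (p1 : (1 <= p)%R) (L10 : (10 <= L)%R) (LL1 : (8 * L <= L1)%R) (g1 : (1 < g)%R).
Local Notation XB := (g_sigma_algebraType (@open X)).
Local Notation rad := (gradius gr).
Let p0 : (0 < p)%R. Proof. exact: lt_le_trans p1. Qed.
Let L0 : (0 < L)%R. Proof. exact: lt_le_trans L10. Qed.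
Let L110 : (10 <= L1)%R.
Proof. by apply: le_trans LL1; apply: le_trans L10 _; rewrite ler_peMl// ?ler1n// ltW. Qed.
Let mO : measurable Omega. Proof. exact: hmu.1. Qed.

Definition tauc n c : R := (mass gr n c / rad n `^ p)%R.

Lemma tauc_gt0 n c : E c -> (0 < tauc n c)%R.
Proof. by move=> Ec; rewrite divr_gt0 ?(mass_gt0 gr L110)// powR_gt0// rad_gt0. Qed.

Variables (f : X -> \bar R) (b : nat) (T : R).
Hypotheses (ef : energy mu Omega f) (T0 : (0 < T)%R).
Local Notation nuf := (nu mu Omega f).

(* [tauc] is the capacity of the ball up to a constant, so the factor [g ^+ n] makes the
   capacities of the cut balls summable over [n]. *)
Definition cutset n := [seq c <- net gr (b + n) |
  (T * g ^+ n * tauc (b + n) c <= nuf (ball c (L * rad (b + n))))%R].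

(** The [p]-th power of a gradient for the supremum of the cutoffs: the sum dominates each term, and
    a sum of [p]-th powers is integrated term by term. *)
Definition cutHp (x : X) : \bar R := \sum_(n <oo) \sum_(c <- cutset n)
  cst ((rad (b + n) `^ (- p))%:E) x * (\1_(ball c (2 * (L * rad (b + n)))) x)%:E.

Definition cut_union : set X := \bigcup_n \bigcup_(c in [set` cutset n]) ball c (L * rad (b + n)).

Definition cutpairs : set (X * R) :=
  [set q | exists2 n, q.1 \in cutset n & q.2 = (L * rad (b + n))%R].

Lemma cutsetP n c : c \in cutset n -> [/\ c \in net gr (b + n), E c &
  (T * g ^+ n * tauc (b + n) c <= nuf (ball c (L * rad (b + n))))%R].
Proof. by rewrite mem_filter => /andP[h cn]; split => //; exact: net_sub cn. Qed.

Lemma cut_union_open : open cut_union.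
Proof. by apply: bigcup_open => n _; apply: bigcup_open => c _; exact: mball_open. Qed.

Let rn n : (0 <= rad n `^ (- p))%R. Proof. exact: powR_ge0. Qed.

Let term_ge0 n (c x : X) :
  0 <= cst ((rad (b + n) `^ (- p))%:E) x * (\1_(ball c (2 * (L * rad (b + n)))) x)%:E :> \bar R.
Proof. by rewrite mule_ge0// lee_fin. Qed.

Lemma cutHp_ge0 x : 0 <= cutHp x.
Proof. by apply: nneseries_ge0 => n _ _; apply: sume_ge0 => c _. Qed.

Lemma cutHp_borel : nneg_borel Omega cutHp.
Proof.
split; last by move=> x _; exact: cutHp_ge0.
apply: (@ge0_emeasurable_sum _ XB R Omega (fun n x => \sum_(c <- cutset n)
  cst ((rad (b + n) `^ (- p))%:E) x * (\1_(ball c (2 * (L * rad (b + n)))) x)%:E) xpredT).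
  by move=> n x _ _; apply: sume_ge0 => c _.
move=> n _; apply: (@emeasurable_sum _ XB) => c.
by apply: (nneg_borel_indic (borel_ball _ _) (nneg_borel_cst _ (rn _))).1.
Qed.

Lemma cutHp_ge n c x : c \in cutset n -> (mdist c x < 2 * (L * rad (b + n)))%R ->
  ((rad (b + n) `^ (- p))%:E <= cutHp x).
Proof.
move=> cn cx.
pose F i := \sum_(c <- cutset i)
  cst ((rad (b + i) `^ (- p))%:E) x * (\1_(ball c (2 * (L * rad (b + i)))) x)%:E : \bar R.
have F0 i : 0 <= F i by apply: sume_ge0 => c' _; exact: term_ge0.
apply: le_trans (lee_nneseries_term n F0).
apply: le_trans (lee_bigsum_term (fun c => term_ge0 n c x) cn).
have -> : (\1_(ball c (2 * (L * rad (b + n)))) x)%:E = 1 :> \bar R.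
  by rewrite indicE mem_set// ballEmdist.
by rewrite mule1 lexx.
Qed.

Definition cutC : R := (dblC gr * (overlap gr)%:R / (1 - g^-1))%R.

(** A term integrates to at most [dblC gr] times the value [tauc] of its ball, and the selection
    rule bounds that by the energy of the ball divided by [T * g ^+ n]. The overlap bound sums the
    energies at one scale, and the powers of [g] sum the scales. Only balls whose double meets [A]
    contribute, which keeps the estimate local. *)
Lemma cutHp_integral (A A' : set X) : measurable A -> measurable A' ->
  (forall n c, c \in cutset n -> A `&` ball c (2 * (L * rad (b + n))) !=set0 ->
     ball c (L * rad (b + n)) `<=` A') ->
  \int[mu]_(x in A `&` Omega) cutHp x <= (cutC / T * nuf A')%:E.
Proof.
move=> mA mA' AA'.
have g0 : (0 < g)%R by exact: lt_trans g1.
have gV : (0 < g^-1 < 1)%R by rewrite invr_gt0 g0 invf_lt1.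
have mAO : measurable (A `&` Omega) by exact: measurableI.
have mt n c : measurable_fun (A `&` Omega)
   (fun x => cst ((rad (b + n) `^ (- p))%:E) x * (\1_(ball c (2 * (L * rad (b + n)))) x)%:E).
  apply: emeasurable_funM; first exact: measurable_cst.
  apply/measurable_EFinP; apply: measurable_funTS; apply: measurable_indic.
  by apply: hmu.1; exact: mball_open.
rewrite integral_nneseries//; last 2 first.
- by move=> n; exact: emeasurable_sum.
- by move=> n x _; apply: sume_ge0 => c _.
have nA0 : (0 <= nuf A')%R by exact: nu_ge0.
have K0 : (0 <= dblC gr * (overlap gr)%:R / T * nuf A')%R.
  by rewrite mulr_ge0// divr_ge0 ?(ltW T0)// mulr_ge0// ltW// dblC_gt0.
have -> : (cutC / T * nuf A' = dblC gr * (overlap gr)%:R / T * nuf A' / (1 - g^-1))%R.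
  by rewrite /cutC; ring.
apply: le_trans (nneseries_geometric K0 gV).
apply: lee_nneseries => [n _ _|n _].
  by apply: integral_ge0 => x _; apply: sume_ge0 => c _.
rewrite ge0_integral_sum//.
pose meets c := `[< A `&` ball c (2 * (L * rad (b + n))) !=set0 >].
have r0 := rad_gt0 gr (b + n).
have one c : c \in cutset n -> \int[mu]_(x in A `&` Omega) (cst ((rad (b + n) `^ (- p))%:E) x *
    (\1_(ball c (2 * (L * rad (b + n)))) x)%:E) <=
    (if meets c then dblC gr / (T * g ^+ n) * nuf (ball c (L * rad (b + n))) else 0)%:E.
  move=> cn; have [cnet Ec cnu] := cutsetP cn.
  rewrite /meets; case: asboolP => [_|nm]; last first.
    rewrite integral0_eq// => x [Ax Ox]; rewrite indicE memNset ?mule0//.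
    by move=> bx; apply: nm; exists x.
  rewrite ge0_integralZl//; last 2 first.
  - apply/measurable_EFinP; apply: measurable_funTS; apply: measurable_indic; apply: hmu.1; exact: mball_open.
  - by rewrite lee_fin.
  rewrite integral_indic//; last by apply: hmu.1; exact: mball_open.
  have h1 : mu (ball c (2 * (L * rad (b + n))) `&` (A `&` Omega)) <= (dblC gr * mass gr (b + n) c)%:E.
    rewrite EFinM -(massE gr L110 (b + n) Ec).
    have h : mu (ball_of Omega c (L1 * rad (b + n))) <= (dblC gr)%:E * mu (ball_of Omega c (rad (b + n))).
      by apply: mass_dbl => //; exact: rad1.
    apply: le_trans h; apply: le_measure; rewrite ?inE; [|exact: (measurable_ball_of hmu oO)|].
      by apply: measurableI => //; apply: hmu.1; exact: mball_open.
    move=> x [bx [_ Ox]]; split => //; apply: le_ball bx; rewrite mulrA ler_pM2r//.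
    by apply: le_trans LL1; rewrite ler_pM2r// ler_nat.
  apply: (le_trans (lee_wpmul2l _ h1)); first by rewrite lee_fin.
  rewrite -EFinM lee_fin powRN.
  have gn : (0 < T * g ^+ n)%R by rewrite mulr_gt0// exprn_gt0.
  have tE : (mass gr (b + n) c = tauc (b + n) c * rad (b + n) `^ p)%R.
    by rewrite /tauc divfK// gt_eqF// powR_gt0.
  have r0p : (0 < rad (b + n) `^ p)%R by rewrite powR_gt0.
  rewrite tE [leLHS](_ : _ = dblC gr * tauc (b + n) c)%R; last first.
    by field; rewrite gt_eqF.
  rewrite -mulrA ler_wpM2l ?(ltW (dblC_gt0 _))//.
  by rewrite mulrC ler_pdivlMr// mulrC.
apply: (@le_trans _ _ (\sum_(c <- cutset n)
    (if meets c then dblC gr / (T * g ^+ n) * nuf (ball c (L * rad (b + n))) else 0)%:E)).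
  by rewrite big_seq [leRHS]big_seq; apply: lee_sum => c; exact: one.
rewrite sumEFin lee_fin -big_mkcond /= -mulr_sumr -big_filter.
have sn : (\sum_(c <- [seq c <- cutset n | meets c]) nuf (ball c (L * rad (b + n))) <=
    (overlap gr)%:R * nuf A')%R.
  apply: (sum_nu hmu oO ef) => //.
  - by move=> c; apply: hmu.1; exact: mball_open.
  - by move=> c; rewrite mem_filter => /andP[/asboolP m cn]; exact: AA'.
  - move=> y; apply: leq_trans (net_overlap gr (b + n) y).
    rewrite !size_filter !count_filter -!size_filter /=.
    rewrite !size_filter; apply: sub_count => c /=.
    move=> /andP[/andP[+ _] _]; rewrite inE ballEmdist /= => /lt_le_trans; apply.
    by rewrite ler_pM2r//; apply: le_trans LL1; rewrite ler_peMl// ?ler1n// ltW.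
have gn : (0 < T * g ^+ n)%R by rewrite mulr_gt0// exprn_gt0.
apply: (le_trans (ler_wpM2l _ sn)).
  by rewrite divr_ge0 ?(ltW gn)// ltW// dblC_gt0.
rewrite le_eqVlt; apply/orP; left; apply/eqP; rewrite exprVn.
by field; rewrite !gt_eqF// exprn_gt0.
Qed.

Lemma cutHp_fin : \int[mu]_(x in Omega) cutHp x < +oo.
Proof.
rewrite -(setTI Omega); apply: le_lt_trans (cutHp_integral measurableT measurableT _) (ltry _).
by [].
Qed.

End cut.

Section cut_function.
Context (R : realType) (disp : measure_display)
  (X : metricMeasurableType R disp) (mu : {measure set X -> \bar R})
  (Omega E : set X) (d s L1 : R) (gr : grid mu Omega E d s L1).
Hypotheses (hmu : complete_borel mu) (oO : open Omega).
Variables (p L g : R).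
Hypotheses (p1 : (1 <= p)%R) (L10 : (10 <= L)%R) (LL1 : (8 * L <= L1)%R) (g1 : (1 < g)%R).
Local Notation XB := (g_sigma_algebraType (@open X)).
Local Notation rad := (gradius gr).
Let p0 : (0 < p)%R. Proof. exact: lt_le_trans p1. Qed.
Let L0 : (0 < L)%R. Proof. exact: lt_le_trans L10. Qed.
Let mO : measurable Omega. Proof. exact: hmu.1. Qed.

Variables (u h : X -> \bar R).
Hypotheses (mu_ : measurable_fun Omega u) (hh : nneg_borel Omega h) (Lh : Lp mu Omega p h)
  (uh : exists rho0, wug mu Omega p u h rho0).
Let f y := h y `^ p.
Let ef : energy mu Omega f.
Proof.
split.
- apply: (measurableT_comp (measurable_poweR p)).
  exact: (borel_fun_measurable hmu oO hh.1).
- by move=> y _; exact: poweR_ge0.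
- exact: ((Lp_nneg hmu oO p1 hh).1 Lh).
Qed.

Variables (b : nat) (T t : R).
Hypotheses (T0 : (0 < T)%R) (t0 : (0 < t)%R).
Local Notation pairs := (cutpairs gr p L g f b T).
Local Notation DD := (cut_union gr p L g f b T).
Local Notation Hp := (cutHp gr p L g f b T).

Definition cutphi := supcut pairs.
(* [cutphi] is 1 on the cut balls, where [cutfun] therefore vanishes and its gradient may be
   taken to be 0. *)
Definition cutfun (x : X) : R := Num.min (`|fine (u x)|)%R (t * (1 - cutphi x))%R.
Definition cutgrad (x : X) : \bar R :=
  (h x + t%:E * Hp x `^ p^-1) * (\1_(~` DD) x)%:E.

Let pairs0 q : pairs q -> (0 < q.2)%R.
Proof. by move=> [n _ ->]; rewrite mulr_gt0// rad_gt0. Qed.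

Lemma cutphi_01 x : (0 <= cutphi x <= 1)%R.
Proof. by rewrite supcut_ge0 supcut_le1. Qed.

Lemma cutfun_ge0 x : (0 <= cutfun x)%R.
Proof.
by rewrite /cutfun le_min normr_ge0/= mulr_ge0 ?(ltW t0)// subr_ge0; case/andP: (cutphi_01 x).
Qed.

Lemma cutfun_le x : (cutfun x <= t)%R.
Proof.
rewrite /cutfun ge_min; apply/orP; right.
by rewrite ler_piMr ?(ltW t0)// gerBl; case/andP: (cutphi_01 x).
Qed.

Lemma cutfun_le_abs x : (cutfun x <= `|fine (u x)|)%R.
Proof. by rewrite /cutfun ge_min lexx. Qed.

Lemma measurable_cutfun : measurable_fun Omega cutfun.
Proof.
apply: measurable_minr.
  by apply: measurableT_comp => //; apply: (measurableT_comp (fine_measurable measurableT)).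
apply: measurable_funM; first exact: measurable_cst.
apply: measurable_funB; first exact: measurable_cst.
exact: (measurable_supcut hmu oO).
Qed.

Lemma cutfun_eq0 x : DD x -> cutfun x = 0%R.
Proof.
move=> [n _ [c /= cn]]; rewrite ballEmdist /= => /ltW cx.
have phi1 : cutphi x = 1%R.
  apply: (@supcut_eq1 _ _ _ pairs (c, (L * rad (b + n))%R)) => //.
    by exists n.
  by rewrite /= mulr_gt0// rad_gt0.
by rewrite /cutfun phi1 subrr mulr0 min_r.
Qed.

Let rn n : (0 <= rad n `^ (- p))%R. Proof. exact: powR_ge0. Qed.

Let Hr x := Hp x `^ p^-1.

Let hHp : nneg_borel Omega Hp. Proof. exact: cutHp_borel. Qed.

Let hHr : nneg_borel Omega Hr.
Proof.
split; last by move=> x _; exact: poweR_ge0.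
by apply: (measurableT_comp (measurable_poweR p^-1)); exact: hHp.1.
Qed.

Let HrK x : Hr x `^ p = Hp x.
Proof. by rewrite /Hr poweRVK ?gt_eqF//; exact: cutHp_ge0. Qed.

Let LHr : Lp mu Omega p Hr.
Proof.
apply/(Lp_nneg hmu oO p1 hHr).
rewrite (_ : \int[mu]_(x in Omega) _ = \int[mu]_(x in Omega) Hp x).
  by apply: cutHp_fin.
by apply: eq_integral => x _; exact: HrK.
Qed.

Let tH x := t%:E * Hr x.

Let htH : nneg_borel Omega tH.
Proof.
split; first by apply: measurable_funeM; exact: hHr.1.
by move=> x Ox; rewrite mule_ge0 ?lee_fin ?(ltW t0)//; exact: hHr.2.
Qed.

Let LtH : Lp mu Omega p tH.
Proof.
apply/(Lp_nneg hmu oO p1 htH).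
have := (Lp_nneg hmu oO p1 hHr).1 LHr => H.
rewrite (_ : \int[mu]_(x in Omega) _ = \int[mu]_(x in Omega) ((t `^ p)%:E * Hr x `^ p)); last first.
  by apply: eq_integral => x _; rewrite /tH poweRM ?lee_fin ?(ltW t0)//; exact: poweR_ge0.
rewrite ge0_integralZl//.
- by rewrite lte_mul_pinfty ?lee_fin ?powR_ge0.
- apply: (measurableT_comp (measurable_poweR p)).
  exact: (borel_fun_measurable hmu oO hHr.1).
- by move=> x _; exact: poweR_ge0.
- by rewrite lee_fin powR_ge0.
Qed.

Lemma cutgrad_borel : nneg_borel Omega cutgrad.
Proof.
apply: (@nneg_borel_indic _ _ _ Omega (fun x => h x + tH x)); last exact: nneg_borelD.
by apply: measurableC; apply: sub_gen_smallest; exact: cut_union_open.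
Qed.

Lemma cutgrad_le x : Omega x -> cutgrad x <= h x + tH x.
Proof.
move=> Ox; have := (nneg_borelD hh htH).2 x Ox; rewrite /cutgrad indicE -/(Hr x) -/(tH x).
by case: (x \in _) => h0; rewrite ?mule1// mule0.
Qed.

Lemma Lp_cutgrad : Lp mu Omega p cutgrad.
Proof.
apply: (Lp_le hmu oO p1 cutgrad_borel (nneg_borelD hh htH) cutgrad_le).
exact: (Lp_add hmu oO p1).
Qed.

(** The root of [Hp] bounds the gradients of all cutoffs, as [L * rad n >= rad n]. It is added to
    the exceptional weight, so that it is integrable along the remaining curves. On [DD] the
    function vanishes and its gradient is dropped. *)
Lemma cutfun_wug : exists rho0, wug mu Omega p (EFin \o cutfun) cutgrad rho0.
Proof.
have [rho0 [_ hr Lr Hr0]] := uh.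
exists (fun x => rho0 x + Hr x).
apply: grad_on_wug; [exact: cutgrad_borel|exact: nneg_borelD|by apply: (Lp_add hmu oO p1)|].
move=> c rc cr.
have le1 x : Omega x -> rho0 x <= rho0 x + Hr x by move=> Ox; rewrite leeDl// (hHr.2 x).
have le2 x : Omega x -> Hr x <= rho0 x + Hr x by move=> Ox; rewrite leeDr// (hr.2 x).
have cr1 := curve_integral_fin_le oO rc hr (nneg_borelD hr hHr) le1 cr.
have cr2 := curve_integral_fin_le oO rc hHr (nneg_borelD hr hHr) le2 cr.
have [fh al] := Hr0 c rc cr1.
have gU : grad_on c (fun x => fine (u x)) h by exact: (along_ac oO rc hh fh al).
have gphi : grad_on c cutphi Hr.
  apply: (grad_on_supcut oO rc hHr pairs0) => -[c' r] x [n /= cn ->] cx.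
  have h1 := cutHp_ge cn cx.
  apply: (@le_trans _ _ (((rad (b + n) `^ (- p))%:E) `^ p^-1)); last first.
    by apply: poweR_le => //; rewrite ?invr_ge0 ?(ltW p0)// lee_fin.
  have r0 := rad_gt0 gr (b + n).
  rewrite poweR_EFin -powRrM mulNr divff ?gt_eqF// powR_inv1 ?(ltW r0)//.
  rewrite lee_fin lef_pV2 ?posrE//; last exact: mulr_gt0.
  by rewrite ler_peMl ?(ltW r0)// (le_trans _ L10)// ler1n.
have gtphi := grad_on_scale oO rc hHr (ltW t0) gphi.
have ftH : curve_integral c tH < +oo.
  rewrite /curve_integral ge0_integralZl//.
  - by rewrite lte_mul_pinfty// ?lee_fin ?(ltW t0)//; apply: curve_integral_ge0.
  - exact: (measurable_along oO rc hHr.1).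
  - by move=> x; rewrite /= in_itv/= => xi; exact: (along_ge0 rc hHr).
  - by rewrite lee_fin ltW.
have fG : curve_integral c (fun x => h x + tH x) < +oo by apply: (curve_integralD oO).
have gw : grad_on c cutfun (fun x => h x + tH x).
  apply: (grad_on_contract2 oO rc hh htH _ gU gtphi) => x y.
  apply: le_trans (minr_lip _ _ _ _) _; apply: lerD; first exact: ler_dist_dist.
  rewrite (_ : t * (1 - cutphi x) - t * (1 - cutphi y) = - (t * cutphi x - t * cutphi y))%R; last by ring.
  by rewrite normrN.
split.
  apply: (curve_integral_fin_le oO rc cutgrad_borel (nneg_borelD hh htH)) => //; exact: cutgrad_le.
apply: (grad_on_off oO rc (k := 0%R)) => //.
- by apply: sub_gen_smallest; exact: cut_union_open.
- exact: nneg_borelD.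
- by move=> x _; exact: cutfun_eq0.
Qed.

Local Notation nuf := (nu mu Omega f).

Lemma cutgrad_nu (A : set X) : measurable A ->
  (nu mu Omega (fun y => (cutgrad y `^ p)%E) A <=
   2 `^ p * (nuf (A `\` DD) + t `^ p * fine (\int[mu]_(x in A `&` Omega) Hp x)))%R.
Proof.
move=> mA.
have eG : energy mu Omega (fun y => cutgrad y `^ p).
  split.
  - apply: (measurableT_comp (measurable_poweR p)).
    exact: (borel_fun_measurable hmu oO cutgrad_borel.1).
  - by move=> y _; exact: poweR_ge0.
  - exact: ((Lp_nneg hmu oO p1 cutgrad_borel).1 Lp_cutgrad).
have mDD : measurable DD by apply: hmu.1; exact: cut_union_open.
have mAO : measurable (A `&` Omega) by exact: measurableI.
have mAD : measurable (A `\` DD) by exact: measurableD.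
have AO : A `&` Omega `<=` Omega by exact: subIsetr.
rewrite -lee_fin -(nuE hmu oO eG mA) EFinM EFinD EFinM -(nuE hmu oO ef mAD).
have mHp : measurable_fun Omega Hp by exact: (borel_fun_measurable hmu oO hHp.1).
have mf : measurable_fun Omega f by case: ef.
have If : \int[mu]_(x in A `&` Omega) Hp x \is a fin_num.
  rewrite ge0_fin_numE; last by apply: integral_ge0 => x _; exact: cutHp_ge0.
  apply: (@le_lt_trans _ _ (\int[mu]_(x in Omega) Hp x)); last by apply: cutHp_fin.
  by apply: ge0_subset_integral => // x _; exact: cutHp_ge0.
rewrite fineK//.
have -> : \int[mu]_(x in (A `\` DD) `&` Omega) f x =
    \int[mu]_(x in A `&` Omega) (f x * (\1_(~` DD) x)%:E).
  rewrite [LHS]integral_mkcond [RHS]integral_mkcond; apply: eq_integral => x _.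
  rewrite !patchE !in_setI indicE in_setC; case: (x \in A) => //=; case: (x \in Omega); rewrite ?andbF ?andbT//.
  by case: (x \in DD); rewrite /= ?mule0 ?mule1.
have mi : measurable_fun (A `&` Omega) (fun x => (\1_(~` DD) x)%:E : \bar R).
  by apply/measurable_EFinP; apply: measurable_funTS; apply: measurable_indic; exact: measurableC.
have mf1 : measurable_fun (A `&` Omega) (fun x => f x * (\1_(~` DD) x)%:E).
  by apply: emeasurable_funM => //; exact: measurable_funS mf.
have mH1 : measurable_fun (A `&` Omega) (fun x => (t `^ p)%:E * Hp x).
  by apply: measurable_funeM; exact: measurable_funS mHp.
have f10 x : 0 <= f x * (\1_(~` DD) x)%:E.
  by rewrite mule_ge0 ?lee_fin//; exact: poweR_ge0.
have tp0 : 0 <= (t `^ p)%:E by rewrite lee_fin powR_ge0.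
have H10 x : 0 <= (t `^ p)%:E * Hp x by rewrite mule_ge0//; exact: cutHp_ge0.
rewrite -ge0_integralZl//; last 2 first.
- exact: measurable_funS mHp.
- by move=> x _; exact: cutHp_ge0.
rewrite -ge0_integralD// -ge0_integralZl//; last 2 first.
- exact: emeasurable_funD.
- by move=> x _; rewrite adde_ge0.
apply: ge0_le_integral => //.
- by move=> x _; exact: poweR_ge0.
- by apply: measurable_funS (let: And3 a _ _ := eG in a).
- by apply: measurable_funeM; exact: emeasurable_funD.
move=> x [_ Ox]; rewrite /cutgrad indicE -/(Hr x) -/(tH x).
case: (x \in ~` DD); last first.
  by rewrite mule0 poweR0r ?gt_eqF// mule0 add0e mule_ge0// lee_fin powR_ge0.
rewrite !mule1; apply: le_trans (poweR_add_le (ltW p0) (hh.2 x Ox) (htH.2 x Ox)) _.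
by rewrite /tH poweRM ?lee_fin ?(ltW t0) ?HrK//; exact: poweR_ge0.
Qed.

End cut_function.

Lemma powR_root_prod (R : realType) (p e t A r : R) : (0 < p)%R -> (0 <= e)%R ->
  (0 <= t)%R -> (0 <= A)%R -> (0 < r)%R ->
  ((2 `^ p * (e * t `^ p * A) / r `^ p) `^ p^-1 = 2 * e `^ p^-1 * t * A `^ p^-1 / r)%R.
Proof.
move=> p0 e0 t0 A0 r0.
have K x : (0 <= x -> (x `^ p) `^ p^-1 = x)%R.
  by move=> x0; rewrite -powRrM mulfV ?gt_eqF// powRr1.
have rV : ((r `^ p)^-1 = r^-1 `^ p)%R.
  by rewrite -(powR_inv1 (ltW r0)) -powRrM mulN1r powRN.
have eA : (0 <= e * t `^ p)%R by rewrite mulr_ge0 ?powR_ge0.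
rewrite rV powRM ?mulr_ge0 ?powR_ge0// K ?invr_ge0 ?(ltW r0)//.
rewrite powRM ?mulr_ge0 ?powR_ge0// K// powRM// powRM ?powR_ge0// K//.
by rewrite !mulrA.
Qed.

(** * A scale at which the energy off the cut balls is large *)

Section stopping.
Context (R : realType) (disp : measure_display)
  (X : metricMeasurableType R disp) (mu : {measure set X -> \bar R})
  (Omega E : set X) (d s L1 : R) (gr : grid mu Omega E d s L1).
Hypotheses (hmu : complete_borel mu) (oO : open Omega).
Variables (p L g C lambda : R).
Hypotheses (p1 : (1 <= p)%R) (L10 : (10 <= L)%R) (LL1 : (8 * L <= L1)%R) (g1 : (1 < g)%R)
  (C0 : (0 < C)%R) (lambda1 : (1 <= lambda)%R) (Llambda : (10 * lambda + 10 <= L)%R).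
Hypothesis PI : forall x r, Omega x -> (0 < r)%R ->
  let B := ball_of Omega x r in let lB := ball_of Omega x (lambda * r) in
  0 < mu B -> mu B < +oo ->
  forall u g, Lp_loc mu Omega 1 u -> minimal_weak_upper_gradient mu Omega p u g ->
    Lp mu Omega p g ->
    average mu B (fun y => `|u y - average mu B u|) <=
    C%:E * diam B * (average mu lB (fun y => g y `^ p)) `^ p^-1.
Local Notation rad := (gradius gr).
Let p0 : (0 < p)%R. Proof. exact: lt_le_trans p1. Qed.
Let L0 : (0 < L)%R. Proof. exact: lt_le_trans L10. Qed.
Let LL : (L <= L1)%R.
Proof. by apply: le_trans LL1; rewrite ler_peMl ?ler1n// ltW. Qed.
Let L110 : (10 <= L1)%R. Proof. exact: le_trans LL. Qed.
Let mO : measurable Omega. Proof. exact: hmu.1. Qed.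
Let Kp : R := poincare_cst gr C.

Variables (u h : X -> \bar R).
Hypotheses (mu_ : measurable_fun Omega u) (hh : nneg_borel Omega h) (Lh : Lp mu Omega p h)
  (uh : exists rho0, wug mu Omega p u h rho0).
Let f y := h y `^ p.
Let ef : energy mu Omega f.
Proof.
split.
- apply: (measurableT_comp (measurable_poweR p)).
  exact: (borel_fun_measurable hmu oO hh.1).
- by move=> y _; exact: poweR_ge0.
- exact: ((Lp_nneg hmu oO p1 hh).1 Lh).
Qed.
Local Notation nuf := (nu mu Omega f).

Variables (b : nat) (T t a eps l : R) (x : X).
Hypotheses (T0 : (0 < T)%R) (t0 : (0 < t)%R) (a01 : (0 < a < 1)%R) (eps01 : (0 < eps < 1)%R).
Local Notation DD := (cut_union gr p L g f b T).
Local Notation Hp := (cutHp gr p L g f b T).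
Local Notation phi := (cutphi gr p L g h b T).
Local Notation w := (cutfun gr p L g u h b T t).
Local Notation tau := (tauc gr p).

Hypothesis Ex : E x.
Hypothesis growth : forall n c, c \in net gr (b + n) -> (mdist c x < 4 * (L * rad (b + n)))%R ->
  (nuf (ball c (4 * (L * rad (b + n)))) <= eps * T * a ^+ n * tau (b + n) c)%R.
Hypothesis tl : (t < `|l|)%R.
Hypothesis lim_l : forall e : R, (0 < e)%R -> exists M, forall n, (M <= n)%N ->
  \int[mu]_(y in ball_of Omega (cell gr n x) (rad n)) `|u y - l%:E| <=
  (mass gr n (cell gr n x) * e)%:E.
Hypothesis start : \int[mu]_(y in ball_of Omega (cell gr b x) (rad b)) `|u y| <=
  (mass gr b (cell gr b x) * (t / 4))%:E.

Let stepC : R := (2 * dblC gr * (2 * Kp * ((1 + cutC gr g) * eps) `^ p^-1))%R.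
Hypothesis small : (stepC / (1 - a `^ p^-1) <= 2^-1)%R.

Let wosc : osc_control (grid_restrict hmu oO LL gr) p 1 Kp (EFin \o w)
  (fun y => cutgrad gr p L g h b T t y `^ p).
Proof.
have [rho0 ww] := cutfun_wug gr hmu oO p1 L10 LL1 g1 hh Lh uh b T0 t0.
apply: (@bounded_osc_control _ _ _ _ _ _ _ _ _ (grid_restrict hmu oO LL gr) hmu oO L10
  p C lambda p1 C0 lambda1 Llambda PI _ t _ _ (ltW t0) _ _ ww).
- exact: measurable_cutfun.
- by move=> y _; rewrite ger0_norm ?cutfun_ge0// cutfun_le.
- exact: Lp_cutgrad.
Qed.

Let Kp0 : (0 <= Kp)%R.
Proof. by rewrite !mulr_ge0// ltW// dblC_gt0. Qed.

(** A cut ball close to [x] would carry energy at least [T * g ^+ n * tau], but [growth] allows at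
    most [eps * T * a ^+ n * tau], which is smaller. *)
Let cut_far n c : c \in cutset gr p L g f b T n -> (4 * (L * rad (b + n)) <= mdist c x)%R.
Proof.
move=> cn; have [cnet Ec cnu] := cutsetP cn; rewrite leNgt; apply/negP => cx.
have h1 := growth cnet cx.
have r0 := rad_gt0 gr (b + n); have Lr0 : (0 < L * rad (b + n))%R by exact: mulr_gt0.
have h2 : (nuf (ball c (L * rad (b + n))) <= nuf (ball c (4 * (L * rad (b + n)))))%R.
  apply: (le_nu hmu oO ef); try (by apply: hmu.1; exact: mball_open).
  by apply: le_ball; rewrite ler_peMl ?ler1n// ltW.
have h3 := le_trans cnu (le_trans h2 h1).
have tau0 := tauc_gt0 gr p L10 LL1 (b + n) Ec.
move: h3; rewrite ler_pM2r// (mulrC eps) -mulrA ler_pM2l// leNgt => /negP; apply.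
have /andP[e0 e1] := eps01; have /andP[a0 a1] := a01.
apply: (@lt_le_trans _ _ 1%R); last by rewrite exprn_ege1// ltW.
apply: (@le_lt_trans _ _ eps); last by [].
by rewrite ler_piMr ?(ltW e0)// exprn_ile1// ltW.
Qed.

(** With [r] and [r'] the radii at the two scales, [cut_far] puts [c'] at distance at least
    [4 * L * r'] from [x], while the common point [y] puts it at less than
    [2 * L * r' + (L + 1) * r]. As [L >= 10], this leaves [r'] below [11 / 20] of [r]. *)
Let near_cut n n' c' y : (mdist (cell gr (b + n) x) y < L * rad (b + n))%R ->
  c' \in cutset gr p L g f b T n' -> (mdist c' y < 2 * (L * rad (b + n')))%R ->
  (rad (b + n') <= rad (b + n))%R /\
  ball c' (L * rad (b + n')) `<=` ball (cell gr (b + n) x) (4 * (L * rad (b + n))).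
Proof.
move=> cy c'n c'y; have [cn cx] := cellP gr (b + n) Ex.
have far := cut_far c'n; have r0 := rad_gt0 gr (b + n); have r0' := rad_gt0 gr (b + n').
have tr := metric_triangle c' y x; have tr2 := metric_triangle y (cell gr (b + n) x) x.
rewrite (metric_sym y (cell gr (b + n) x)) in tr2.
have h1 : (2 * (L * rad (b + n')) < (L + 1) * rad (b + n))%R by lra.
have h2 : (10 * rad (b + n) <= L * rad (b + n))%R by rewrite ler_pM2r.
have h3 : (L * (2 * rad (b + n')) < L * (11 / 10 * rad (b + n)))%R by lra.
rewrite ltr_pM2l// in h3.
split; first lra.
move=> z; rewrite !ballEmdist /= => c'z.
have tr3 := metric_triangle (cell gr (b + n) x) y z; have tr4 := metric_triangle y c' z.
rewrite (metric_sym y c') in tr4; lra.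
Qed.
Let Hp_near n : let c := cell gr (b + n) x in
  \int[mu]_(y in ball_of Omega c (L * rad (b + n))) Hp y <=
  (cutC gr g * eps * a ^+ n * tau (b + n) c)%:E.
Proof.
cbv zeta; set c := cell gr (b + n) x; have [cn cx] := cellP gr (b + n) Ex; rewrite -/c in cn cx.
have r0 := rad_gt0 gr (b + n).
apply: le_trans (cutHp_integral hmu oO L10 LL1 g1 ef T0 (A := ball c (L * rad (b + n)))
  (A' := ball c (4 * (L * rad (b + n)))) _ _ _) _.
- by apply: hmu.1; exact: mball_open.
- by apply: hmu.1; exact: mball_open.
- move=> n' c' c'n [y []]; rewrite !ballEmdist /= => cy c'y.
  by have [_] := near_cut cy c'n c'y; rewrite !ballEmdist.
have cc0 : (0 <= cutC gr g)%R.
  have g0 : (0 < g)%R by exact: lt_trans g1.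
  by rewrite divr_ge0 ?mulr_ge0 ?(ltW (dblC_gt0 _))// subr_ge0 invf_le1// ltW.
have h4 : (mdist c x < 4 * (L * rad (b + n)))%R.
  apply: lt_le_trans cx _; rewrite mulrA ler_peMl ?(ltW r0)//.
  by have := L10; lra.
rewrite lee_fin; apply: le_trans (ler_wpM2l _ (growth cn h4)) _.
  by rewrite divr_ge0// ltW.
by rewrite le_eqVlt; apply/orP; left; apply/eqP; field; rewrite gt_eqF.
Qed.

Hypothesis never : forall n,
  (nuf (ball (cell gr (b + n) x) (L * rad (b + n)) `\` DD) <
     eps * t `^ p * a ^+ n * tau (b + n) (cell gr (b + n) x))%R.

Let ap := (a `^ p^-1)%R.
Let ap01 : (0 < ap < 1)%R.
Proof.
have /andP[a0 a1] := a01; rewrite powR_gt0//= /ap.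
have : (a `^ p^-1 < 1 `^ p^-1)%R.
  by apply: gt0_ltr_powR; rewrite ?nnegrE ?invr_gt0 ?(ltW a0).
by rewrite powR1.
Qed.

(** Off the cut balls the energy is small by [never], and the cost of cutting is small by [Hp_near];
    both decay like [a ^+ n]. *)
Let osc_small n : let c := cell gr (b + n) x in
  (Kp * rad (b + n) * (nu mu Omega (fun y => (cutgrad gr p L g h b T t y `^ p)%E)
     (ball c (L * rad (b + n))) / mass gr (b + n) c) `^ p^-1 <=
   2 * Kp * ((1 + cutC gr g) * eps) `^ p^-1 * t * ap ^+ n)%R.
Proof.
cbv zeta; set c := cell gr (b + n) x; have Ec : E c by exact: cell_E.
have r0 := rad_gt0 gr (b + n); have m0 := mass_gt0 gr L110 (b + n) Ec.
have /andP[a0 a1] := a01; have /andP[e0 e1] := eps01.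
have mB : measurable (ball c (L * rad (b + n))) by apply: hmu.1; exact: mball_open.
set nn := nu _ _ _ _.
have nnle : (nn <= 2 `^ p * ((1 + cutC gr g) * eps * t `^ p * a ^+ n * tau (b + n) c))%R.
  apply: le_trans (cutgrad_nu gr hmu oO p1 L10 LL1 g1 hh Lh b T0 t0 mB) _.
  rewrite ler_wpM2l ?powR_ge0//.
  have h1 := ltW (never n); rewrite -/c in h1.
  have h2 : (fine (\int[mu]_(y in ball c (L * rad (b + n)) `&` Omega) Hp y) <=
      cutC gr g * eps * a ^+ n * tau (b + n) c)%R.
    have H := Hp_near n; rewrite -/c in H.
    rewrite -lee_fin fineK// ge0_fin_numE; first exact: le_lt_trans H (ltry _).
    by apply: integral_ge0 => y _; exact: cutHp_ge0.
  have h3 := ler_wpM2l (powR_ge0 t p) h2.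
  apply: le_trans (lerD h1 h3) _.
  by rewrite le_eqVlt; apply/orP; left; apply/eqP; ring.
have nn0 : (0 <= nn)%R by apply: fine_ge0; apply: integral_ge0 => y _; exact: poweR_ge0.
have g0 : (0 < g)%R by exact: lt_trans g1.
have cc0 : (0 <= cutC gr g)%R.
  by rewrite divr_ge0 ?mulr_ge0 ?(ltW (dblC_gt0 _))// subr_ge0 invf_le1// ltW.
have ce0 : (0 <= (1 + cutC gr g) * eps)%R by rewrite mulr_ge0 ?addr_ge0// ltW.
have step : ((nn / mass gr (b + n) c) `^ p^-1 <=
    2 * ((1 + cutC gr g) * eps) `^ p^-1 * t * ap ^+ n / rad (b + n))%R.
  have -> : (ap ^+ n = (a ^+ n) `^ p^-1)%R.
    by rewrite /ap -powR_mulrn ?powR_ge0// powRAC powR_mulrn// ltW.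
  rewrite -powR_root_prod//; [|exact: ltW|by rewrite exprn_ge0// ltW].
  apply: ge0_ler_powR; rewrite ?nnegrE ?invr_ge0 ?(ltW p0)//.
  - by rewrite divr_ge0// ltW.
  - apply: divr_ge0; last exact: powR_ge0.
    apply: mulr_ge0; first exact: powR_ge0.
    by apply: mulr_ge0; [apply: mulr_ge0 => //; exact: powR_ge0|rewrite exprn_ge0// ltW].
  rewrite ler_pdivrMr//; apply: le_trans nnle _.
  have mE : (mass gr (b + n) c = tau (b + n) c * rad (b + n) `^ p)%R.
    by rewrite /tauc divfK// gt_eqF// powR_gt0.
  rewrite mE le_eqVlt; apply/orP; left; apply/eqP; field.
  by rewrite gt_eqF// powR_gt0.
apply: (le_trans (ler_wpM2l _ step)); first by rewrite mulr_ge0// ltW.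
by rewrite le_eqVlt; apply/orP; left; apply/eqP; field; rewrite gt_eqF.
Qed.

Let mw : measurable_fun Omega (EFin \o w).
Proof. by apply/measurable_EFinP; exact: measurable_cutfun. Qed.

Let w_step n : (`|Tavg gr (EFin \o w) (b + n.+1) x - Tavg gr (EFin \o w) (b + n) x| <=
  stepC * t * ap ^+ n)%R.
Proof.
rewrite addnS.
have := Tavg_step (gr := grid_restrict hmu oO LL gr) hmu oO L10 Kp0 mw wosc (b + n) Ex.
move=> H; apply: le_trans H _.
have := osc_small n; rewrite /= -[X in (Kp * X)%R]powRr1 ?(ltW (rad_gt0 _ _))// => H.
have d0 : (0 <= 2 * dblC gr)%R by rewrite mulr_ge0// ltW// dblC_gt0.
apply: le_trans (ler_wpM2l d0 H) _.
by rewrite le_eqVlt; apply/orP; left; apply/eqP; rewrite /stepC; ring.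
Qed.
Let mphi : measurable_fun Omega phi.
Proof.
apply: (measurable_supcut hmu oO) => q [n _ ->].
by apply: mulr_gt0 => //; exact: rad_gt0.
Qed.

Let Bn n := ball_of Omega (cell gr (b + n) x) (rad (b + n)).
Let mBn n : measurable (Bn n). Proof. exact: (measurable_ball_of hmu oO). Qed.
Let BnO n : Bn n `<=` Omega. Proof. exact: subIsetr. Qed.
Let mn n := mass gr (b + n) (cell gr (b + n) x).
Let mn0 n : (0 < mn n)%R. Proof. by apply: mass_gt0 => //; exact: cell_E. Qed.
Let muBn n : mu (Bn n) = (mn n)%:E. Proof. by apply: massE => //; exact: cell_E. Qed.

(** Where [phi] is not 0, some cut ball of radius parameter at most [rad (b + n)] has its double at
    that point, whence [phi <= rad (b + n) ^ p * Hp] there. The cut thus affects a vanishing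
    proportion of the balls around [x]. *)
Let phi_int n : \int[mu]_(y in Bn n) (phi y)%:E <= (mn n * (cutC gr g * eps * a ^+ n))%:E.
Proof.
set c := cell gr (b + n) x; have r0 := rad_gt0 gr (b + n).
have rp0 : (0 < rad (b + n) `^ p)%R by rewrite powR_gt0.
have BL : Bn n `<=` ball_of Omega c (L * rad (b + n)).
  apply: ball_of_subset; rewrite mdistxx add0r ler_peMl ?(ltW r0)//.
  by rewrite (le_trans _ L10)// ler1n.
have mHp : measurable_fun Omega Hp.
  have [bH _] : nneg_borel Omega Hp by exact: cutHp_borel.
  exact: (borel_fun_measurable hmu oO).
have mHB (D : set X) : D `<=` Omega -> measurable_fun D (fun y => (rad (b + n) `^ p)%:E * Hp y).
  by move=> DO; apply: measurable_funeM; exact: measurable_funS mHp.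
apply: (@le_trans _ _ (\int[mu]_(y in Bn n) ((rad (b + n) `^ p)%:E * Hp y))).
  apply: ge0_le_integral => //.
  - by move=> y _; rewrite lee_fin; case/andP: (cutphi_01 gr p L g h b T y).
  - by apply/measurable_EFinP; exact: measurable_funS mphi.
  - exact: mHB.
  move=> y By; have [[n' [c' [c'n c'y]]]|noc] := pselect (exists n' c',
      c' \in cutset gr p L g f b T n' /\ (mdist c' y < 2 * (L * rad (b + n')))%R).
    have cy : (mdist c y < L * rad (b + n))%R.
      by have [+ _] := BL y By; rewrite ballEmdist.
    have [rr _] := near_cut cy c'n c'y.
    apply: (@le_trans _ _ 1).
      by rewrite lee_fin; case/andP: (cutphi_01 gr p L g h b T y).
    apply: (@le_trans _ _ ((rad (b + n) `^ p)%:E * (rad (b + n') `^ (- p))%:E)); last first.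
      by apply: lee_wpmul2l; [rewrite lee_fin powR_ge0|exact: (cutHp_ge c'n)].
    have r0' := rad_gt0 gr (b + n').
    rewrite -EFinM lee_fin powRN ler_pdivlMr ?powR_gt0// mul1r.
    by apply: ge0_ler_powR; rewrite ?nnegrE ?(ltW p0) ?(ltW r0) ?(ltW r0').
  rewrite (_ : phi y = 0%R); last first.
    apply: supcut_eq0 => -[c' r] [n' /= c'n ->]; split.
      by apply: mulr_gt0 => //; exact: rad_gt0.
    by rewrite leNgt; apply/negP => c'y; apply: noc; exists n', c'.
  by rewrite mule_ge0 ?lee_fin ?powR_ge0//; exact: cutHp_ge0.
apply: (@le_trans _ _ (\int[mu]_(y in ball_of Omega c (L * rad (b + n))) ((rad (b + n) `^ p)%:E * Hp y))).
  apply: ge0_subset_integral => //.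
  - exact: (measurable_ball_of hmu oO).
  - by apply: mHB; exact: subIsetr.
  - by move=> y _; rewrite mule_ge0 ?lee_fin ?powR_ge0//; exact: cutHp_ge0.
rewrite ge0_integralZl//; last 4 first.
- exact: (measurable_ball_of hmu oO).
- by apply: measurable_funS mHp => //; exact: subIsetr.
- by move=> y _; exact: cutHp_ge0.
- by rewrite lee_fin powR_ge0.
apply: le_trans (lee_wpmul2l _ (Hp_near n)) _; first by rewrite lee_fin powR_ge0.
rewrite -EFinM lee_fin /mn -/c.
have mE : (mass gr (b + n) c = tau (b + n) c * rad (b + n) `^ p)%R.
  by rewrite /tauc divfK// gt_eqF.
by rewrite mE le_eqVlt; apply/orP; left; apply/eqP; ring.
Qed.

Let B01 n : 0 < mu (Bn n) < +oo. Proof. by rewrite muBn lte_fin mn0 ltry. Qed.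

(** Because [|l| > t], the truncation is active near [x]: pointwise
    [|w - t| <= |u - l| + t * phi]. *)
Let w_dist n (e : R) : \int[mu]_(y in Bn n) `|u y - l%:E| <= (mn n * e)%:E ->
  (`|Tavg gr (EFin \o w) (b + n) x - t| <= e + t * (cutC gr g * eps * a ^+ n))%R.
Proof.
move=> he.
have muB : measurable_fun (Bn n) u by exact: measurable_funS mu_.
have mphB : measurable_fun (Bn n) phi by exact: measurable_funS mphi.
have mul : measurable_fun (Bn n) (fun y => `|u y - l%:E|).
  by apply: measurableT_comp => //; apply: emeasurable_funB => //; exact: measurable_cst.
have mph : measurable_fun (Bn n) (fun y => t%:E * (phi y)%:E).
  by apply: measurable_funeM; exact/measurable_EFinP.
have mwB : measurable_fun (Bn n) (EFin \o w) by exact: measurable_funS mw.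
have ph0 y : 0 <= (phi y)%:E by rewrite lee_fin; case/andP: (cutphi_01 gr p L g h b T y).
have tph0 y : 0 <= t%:E * (phi y)%:E by rewrite mule_ge0// lee_fin ltW.
have IB : \int[mu]_(y in Bn n) `|(EFin \o w) y - t%:E| <=
    (mn n * (e + t * (cutC gr g * eps * a ^+ n)))%:E.
  apply: (@le_trans _ _ (\int[mu]_(y in Bn n) (`|u y - l%:E| + t%:E * (phi y)%:E))).
    apply: ge0_le_integral => //.
    - by apply: measurableT_comp => //; apply: emeasurable_funB => //; exact: measurable_cst.
    - exact: emeasurable_funD.
    move=> y By; have -> : (EFin \o w) y = (Num.min (`|fine (u y)|)%R (t * (1 - phi y))%R)%:E by [].
    case: (u y) => [r| |] /=; last 2 first.
    - by rewrite addye ?leey// -ltNye (lt_le_trans _ (tph0 y)).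
    - by rewrite addye ?leey// -ltNye (lt_le_trans _ (tph0 y)).
    rewrite -EFinM -EFinD lee_fin.
    have [p0' p1'] := andP (cutphi_01 gr p L g h b T y).
    have tp : (0 <= t * phi y)%R by rewrite mulr_ge0// ltW.
    rewrite distrC ger0_norm; last first.
      by rewrite subr_ge0 ge_min; apply/orP; right; rewrite ler_piMr ?(ltW t0)// gerBl.
    have h2 : (`|l| <= `|r - l| + `|r|)%R.
      by have := ler_normD (l - r)%R r; rewrite subrK distrC.
    have := tl; rewrite lerBlDr -lerBlDl le_min; move=> tl'; apply/andP; split.
      by have := normr_ge0 (r - l)%R; lra.
    by have := normr_ge0 (r - l)%R; lra.
  rewrite ge0_integralD// ge0_integralZl//; last 2 first.
  - exact/measurable_EFinP.
  - by rewrite lee_fin ltW.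
  rewrite mulrDr EFinD; apply: leeD => //.
  apply: le_trans (lee_wpmul2l _ (phi_int n)) _; first by rewrite lee_fin ltW.
  by rewrite -EFinM lee_fin le_eqVlt; apply/orP; left; apply/eqP; ring.
have [_ _ H] := average_close (mBn n) (mBn n) (@subset_refl _ (Bn n)) mwB (B01 n) IB.
apply: le_trans H _; rewrite muBn /= mulrAC divff ?mul1r//.
by rewrite gt_eqF.
Qed.

Let w_start : (Tavg gr (EFin \o w) (b + 0) x <= t / 4)%R.
Proof.
have st : \int[mu]_(y in Bn 0) `|u y| <= (mn 0 * (t / 4))%:E.
  by rewrite /Bn /mn addn0.
have mwB : measurable_fun (Bn 0) (EFin \o w) by exact: measurable_funS mw.
have IB : \int[mu]_(y in Bn 0) `|(EFin \o w) y - 0%:E| <= (mn 0 * (t / 4))%:E.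
  apply: le_trans st; apply: ge0_le_integral => //.
  - by apply: measurableT_comp => //; apply: emeasurable_funB => //; exact: measurable_cst.
  - by apply: measurableT_comp => //; exact: measurable_funS mu_.
  move=> y By; rewrite sube0 /= ger0_norm; last exact: cutfun_ge0.
  have := cutfun_le_abs gr p L g u h b T t y; case: (u y) => [r| |] /= hw; rewrite ?leey//.
have [_ _] := average_close (mBn 0) (mBn 0) (@subset_refl _ (Bn 0)) mwB (B01 0) IB.
rewrite subr0 muBn /= mulrAC divff ?mul1r ?gt_eqF// => H.
exact: le_trans (ler_norm _) H.
Qed.

Lemma stopping_absurd : False.
Proof.
have /andP[h0 h1] := ap01; have /andP[a0 a1] := a01; have /andP[e0 e1] := eps01.
have g0 : (0 < g)%R by exact: lt_trans g1.
have cc0 : (0 <= cutC gr g)%R.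
  by rewrite divr_ge0 ?mulr_ge0 ?(ltW (dblC_gt0 _))// subr_ge0 invf_le1// ltW.
have sC0 : (0 <= stepC * t)%R.
  by rewrite mulr_ge0 ?(ltW t0)// mulr_ge0// ?mulr_ge0 ?powR_ge0// ltW// dblC_gt0.
have [l' l'P] := geometric_cauchy sC0 ap01 w_step.
have l'0 := l'P 0%N; rewrite expr0 mulr1 in l'0.
have lt : (`|l' - t| <= 0)%R.
  apply/ler_addgt0Pl => e e_gt0; rewrite addr0.
  have e4 : (0 < e / 4)%R by rewrite divr_gt0.
  have [M1 HM1] := geometric_small (stepC * t / (1 - ap))%R ap01 e4.
  have [M2 HM2] := geometric_small (t * (cutC gr g * eps))%R a01 e4.
  have [M3 HM3] := lim_l e4.
  pose n := maxn M1 (maxn M2 M3).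
  have k1 : (stepC * t / (1 - ap) * ap ^+ n <= e / 4)%R.
    apply: le_trans HM1; rewrite ler_wpM2l ?divr_ge0 ?subr_ge0 ?(ltW h1)//.
    by rewrite ler_wiXn2l ?(ltW h0) ?(ltW h1)// leq_maxl.
  have k2 : (t * (cutC gr g * eps) * a ^+ n <= e / 4)%R.
    apply: le_trans HM2; apply: ler_wpM2l.
      by apply: mulr_ge0; [exact: ltW|apply: mulr_ge0 => //; exact: ltW].
    by rewrite ler_wiXn2l ?(ltW a0) ?(ltW a1)// leq_max leq_max leqnn orbT.
  have k3 : \int[mu]_(y in Bn n) `|u y - l%:E| <= (mn n * (e / 4))%:E.
    by apply: HM3; rewrite (leq_trans _ (leq_addl b n))// !leq_max leqnn !orbT.
  have := w_dist k3; have := l'P n.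
  move: k1 k2; rewrite !mulrA !ler_distl.
  set P := (stepC * t / _ * _)%R; set Q := (t * _ * _ * _)%R.
  set W := Tavg _ _ _ _ => ? ? /andP[? ?] /andP[? ?].
  by apply/andP; split; lra.
have {}lt : l' = t by apply/eqP; rewrite -subr_eq0 -normr_le0.
have sm : (stepC * t / (1 - ap) <= t / 2)%R.
  have := ler_wpM2r (ltW t0) small; rewrite -/ap.
  by rewrite mulrAC [X in (_ <= X)%R -> _]mulrC.
move: l'0; rewrite lt ler_distl => /andP[k1 k2].
have := w_start; have := t0; lra.
Qed.

End stopping.

Section stopping_time.
Context (R : realType) (disp : measure_display)
  (X : metricMeasurableType R disp) (mu : {measure set X -> \bar R})
  (Omega E : set X) (d s L1 : R) (gr : grid mu Omega E d s L1).
Hypotheses (hmu : complete_borel mu) (oO : open Omega).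
Variables (p L g C lambda : R).
Hypotheses (p1 : (1 <= p)%R) (L10 : (10 <= L)%R) (LL1 : (8 * L <= L1)%R) (g1 : (1 < g)%R)
  (C0 : (0 < C)%R) (lambda1 : (1 <= lambda)%R) (Llambda : (10 * lambda + 10 <= L)%R).
Hypothesis PI : forall x r, Omega x -> (0 < r)%R ->
  let B := ball_of Omega x r in let lB := ball_of Omega x (lambda * r) in
  0 < mu B -> mu B < +oo ->
  forall u g, Lp_loc mu Omega 1 u -> minimal_weak_upper_gradient mu Omega p u g ->
    Lp mu Omega p g ->
    average mu B (fun y => `|u y - average mu B u|) <=
    C%:E * diam B * (average mu lB (fun y => g y `^ p)) `^ p^-1.

(* Otherwise the averages of the cut function over the cells of [x] would vary by less than
   [t / 2] in total, although they start below [t / 4] and tend to [t]. *)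
Lemma stopping_time (u h : X -> \bar R) (b : nat) (T t a eps l : R) (x : X) :
  measurable_fun Omega u -> nneg_borel Omega h -> Lp mu Omega p h ->
  (exists rho0, wug mu Omega p u h rho0) ->
  (0 < T)%R -> (0 < t)%R -> (0 < a < 1)%R -> (0 < eps < 1)%R -> E x ->
  (forall n c, c \in net gr (b + n) -> (mdist c x < 4 * (L * gradius gr (b + n)))%R ->
    (nu mu Omega (fun y => (h y `^ p)%E) (ball c (4 * (L * gradius gr (b + n)))) <=
     eps * T * a ^+ n * tauc gr p (b + n) c)%R) ->
  (t < `|l|)%R ->
  (forall e : R, (0 < e)%R -> exists M, forall n, (M <= n)%N ->
    \int[mu]_(y in ball_of Omega (cell gr n x) (gradius gr n)) `|u y - l%:E| <=
    (mass gr n (cell gr n x) * e)%:E) ->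
  \int[mu]_(y in ball_of Omega (cell gr b x) (gradius gr b)) `|u y| <=
    (mass gr b (cell gr b x) * (t / 4))%:E ->
  (2 * dblC gr * (2 * poincare_cst gr C * ((1 + cutC gr g) * eps) `^ p^-1) /
     (1 - a `^ p^-1) <= 2^-1)%R ->
  exists n, (eps * t `^ p * a ^+ n * tauc gr p (b + n) (cell gr (b + n) x) <=
    nu mu Omega (fun y => (h y `^ p)%E) (ball (cell gr (b + n) x) (L * gradius gr (b + n)) `\`
      cut_union gr p L g (fun y => (h y `^ p)%E) b T))%R.
Proof.
move=> mu_ hh Lh uh T0 t0 a01 eps01 Ex growth tl lim_l start small.
apply: contrapT => H.
apply: (stopping_absurd hmu oO p1 L10 LL1 g1 C0 lambda1 Llambda PI mu_ hh Lh uh T0 t0 a01 eps01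
  Ex growth tl lim_l start small) => n.
by rewrite ltNge; apply/negP => h'; apply: H; exists n.
Qed.

End stopping_time.

Lemma outer_measure_bigcup_seq (R : realType) (T : choiceType)
  (m : {outer_measure set T -> \bar R}) (l : seq T) (F : T -> set T) :
  m (\bigcup_(c in [set` l]) F c) <= \sum_(c <- l) m (F c).
Proof.
rewrite bigcup_seq; elim: l => [|c l IH]; first by rewrite !big_nil outer_measure0.
by rewrite !big_cons (le_trans (outer_measureU2 _ _ _))// leeD2l.
Qed.

(** All selected indices lie in the interval of length [J] that starts at the least one. *)
Lemma count_close (P : pred nat) (J B : nat) : (0 < J)%N ->
  (forall b b', (b < b')%N -> P b -> P b' -> (b' - b < J)%N) ->
  (count P (iota 0 B) <= J)%N.
Proof.
move=> J0 H; rewrite -size_filter.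
case E : [seq b <- iota 0 B | P b] => [//|b0 l]; rewrite -E.
have b0l : b0 \in [seq b <- iota 0 B | P b] by rewrite E mem_head.
have : P b0 by move: b0l; rewrite mem_filter => /andP[].
have srt : sorted ltn [seq b <- iota 0 B | P b].
  by apply: sorted_filter; [exact: ltn_trans|exact: iota_ltn_sorted].
have b0min b : b \in [seq b <- iota 0 B | P b] -> (b0 <= b)%N.
  rewrite E inE => /orP[/eqP->//|bl].
  move: srt; rewrite E /= (path_sortedE ltn_trans) => /andP[/allP h _].
  by apply: ltnW; exact: h.
move=> Pb0; rewrite -(size_iota b0 J); apply: uniq_leq_size.
  by apply: filter_uniq; exact: iota_uniq.
move=> b bl; have bmin := b0min b bl; move: bl; rewrite mem_filter => /andP[Pb _].
rewrite mem_iota bmin /=; move: bmin; rewrite leq_eqVlt => /orP[/eqP <-|b0b].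
  by rewrite -addn1 leq_add2l.
by have := H b0 b b0b Pb0 Pb; rewrite ltn_subLR// ltnW.
Qed.

(* Interpolation: [min A B <= A^(m/(m+1)) * B^(1/(m+1))]. *)
Lemma min_root (R : realFieldType) (z K a D h x y : R) (m n i : nat) :
  (0 <= z)%R -> (0 <= K)%R -> (0 < a < 1)%R -> (0 < D)%R -> (0 < h)%R ->
  (0 < x)%R -> (0 < y)%R -> (x ^+ m.+1 = a)%R -> (y ^+ m.+1 = h)%R -> (a ^+ m * D <= a)%R ->
  (z <= K * a ^+ n)%R -> (z <= K * (D ^+ n * h ^+ i))%R -> (z <= K * (x ^+ n * y ^+ i))%R.
Proof.
move=> z0 K0 /andP[a0 a1] D0 h0 x0 y0 xa yh aD z1 z2; rewrite leNgt; apply/negP => zK.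
have [Kz|KN] := eqVneq K 0%R; first by move: zK z1; rewrite Kz !mul0r => /lt_le_trans h1 /h1; rewrite ltxx.
have Kp : (0 < K)%R by rewrite lt_neqAle eq_sym KN.
set e := (x ^+ n * y ^+ i)%R in zK.
have e0 : (0 < e)%R by rewrite mulr_gt0// exprn_gt0.
have e1 : (e < a ^+ n)%R by rewrite -(ltr_pM2l Kp); exact: lt_le_trans zK z1.
have e2 : (e < D ^+ n * h ^+ i)%R by rewrite -(ltr_pM2l Kp); exact: lt_le_trans zK z2.
have : (e ^+ m * e < (a ^+ n) ^+ m * (D ^+ n * h ^+ i))%R.
  apply: (@le_lt_trans _ _ ((a ^+ n) ^+ m * e)%R).
    by rewrite ler_pM2r// lerXn2r ?nnegrE ?(ltW e0) ?exprn_ge0 ?(ltW a0)// ltW.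
  by rewrite ltr_pM2l// exprn_gt0// exprn_gt0.
apply/negP; rewrite -leNgt.
have -> : (e ^+ m * e = a ^+ n * h ^+ i)%R.
  by rewrite -exprSr /e exprMn -!exprM !(mulnC _ m.+1) !exprM xa yh.
rewrite mulrA ler_pM2r ?exprn_gt0// -exprM mulnC exprM -exprMn.
by rewrite lerXn2r ?nnegrE ?mulr_ge0 ?exprn_ge0 ?(ltW a0) ?(ltW D0).
Qed.

(** The rate is worsened to the midpoint of [x] and 1; Bernoulli's inequality for the ratio of the
    two rates absorbs the linear factor. *)
Lemma linear_geometric (R : realFieldType) (x : R) : (0 < x < 1)%R ->
  exists c x' : R, [/\ (0 < c)%R, (0 < x' < 1)%R &
    forall n : nat, (n.+1%:R * x ^+ n <= c * x' ^+ n)%R].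
Proof.
move=> /andP[x0 x1].
pose x' := ((1 + x) / 2)%R.
have x'0 : (0 < x')%R by rewrite /x'; lra.
have x'1 : (x' < 1)%R by rewrite /x'; lra.
pose e := Num.min 1%R (x' / x - 1)%R.
have xx' : (x < x')%R by rewrite /x'; lra.
have e0 : (0 < e)%R by rewrite lt_min ltr01/= subr_gt0 ltr_pdivlMr// mul1r.
exists e^-1%R, x'; split; [by rewrite invr_gt0|by rewrite x'0|move=> n].
have bern (k : nat) : (1 + k%:R * (x' / x - 1) <= (x' / x) ^+ k)%R.
  elim: k => [|k IH]; first by rewrite mul0r addr0 expr0.
  have d0 : (0 < x' / x - 1)%R by rewrite subr_gt0 ltr_pdivlMr// mul1r.
  rewrite exprS -natr1; set dd := (x' / x - 1)%R in IH d0 *.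
  have -> : (x' / x = 1 + dd)%R by rewrite /dd addrC subrK.
  have kk0 : (0 <= k%:R :> R)%R by [].
  have h := ler_wpM2l (_ : (0 <= 1 + dd)%R) IH.
  have /h h' : (0 <= 1 + dd)%R by lra.
  rewrite (_ : x' / x = 1 + dd)%R in h'; last by rewrite /dd addrC subrK.
  by apply: le_trans h'; nra.
have h1 : (e * n.+1%:R <= (x' / x) ^+ n)%R.
  apply: le_trans (bern n).
  have ea : (e <= 1)%R by rewrite ge_min lexx.
  have eb : (e <= x' / x - 1)%R by rewrite ge_min lexx orbT.
  have n0 : (0 <= n%:R :> R)%R by [].
  by rewrite -natr1; nra.
have xn : (0 < x ^+ n)%R by rewrite exprn_gt0.
rewrite ler_pdivlMl// mulrA.
have -> : (x' ^+ n = (x' / x) ^+ n * x ^+ n)%R by rewrite -exprMn divfK// gt_eqF.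
by rewrite ler_pM2r.
Qed.

(** * The borderline exponent *)

Section borderline_levels.
Context (R : realType) (disp : measure_display)
  (X : metricMeasurableType R disp) (mu : {measure set X -> \bar R})
  (Omega E : set X) (d s L1 : R) (gr : grid mu Omega E d s L1).
Hypotheses (hmu : complete_borel mu) (oO : open Omega).
Variables (p L g q a rd lt0 Np Nq eps V : R) (t : nat -> R) (f : X -> \bar R).
Hypotheses (p1 : (1 <= p)%R) (L10 : (10 <= L)%R) (LL1 : (8 * L <= L1)%R) (g1 : (1 < g)%R)
  (a01 : (0 < a < 1)%R) (rd0 : (0 < rd)%R) (lt00 : (0 < lt0)%R) (Np0 : (0 < Np)%R)
  (Nq0 : (0 < Nq)%R) (eps01 : (0 < eps < 1)%R).
Local Notation rad := (gradius gr).
Local Notation tau := (tauc gr p).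
Local Notation nuf := (nu mu Omega f).
Hypotheses (ef : energy mu Omega f) (V0 : (0 < V)%R)
  (fV : (fine (\int[mu]_(y in Omega) f y) <= V)%R).
Hypotheses
  (rad_d : forall n, (rad n `^ d = rd * (a ^+ 2 / g ^+ 2) ^+ n)%R)
  (tau_low : forall n c, E c -> (lt0 * (g ^- 2) ^+ n <= tau n c)%R)
  (t_gt0 : forall b, (0 < t b)%R)
  (t_p : forall b, (t b `^ p = Np * (g ^+ 2) ^+ b)%R)
  (t_q : forall b, (t b `^ q = Nq * (g ^+ 2 / a ^+ 2) ^+ b)%R).
Let p0 : (0 < p)%R. Proof. exact: lt_le_trans p1. Qed.
Let L0 : (0 < L)%R. Proof. exact: lt_le_trans L10. Qed.
Let L110 : (10 <= L1)%R.
Proof. by apply: le_trans LL1; apply: le_trans L10 _; rewrite ler_peMl// ?ler1n// ltW. Qed.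
Let a0 : (0 < a)%R. Proof. by case/andP: a01. Qed.
Let g0 : (0 < g)%R. Proof. exact: lt_trans g1. Qed.
Let eps0 : (0 < eps)%R. Proof. by case/andP: eps01. Qed.

Definition levelC (Rr : R) : R :=
  (hausC gr * Rr `^ d * rd * (overlap gr)%:R * Nq / (lt0 * Np))%R.

Lemma levelC_ge0 Rr : (0 <= levelC Rr)%R.
Proof.
by rewrite divr_ge0 ?mulr_ge0 ?powR_ge0 ?(ltW lt00) ?(ltW Np0) ?(ltW Nq0) ?(ltW rd0)// ltW// hausC_gt0.
Qed.

Let mball c r : measurable (ball c r : set X). Proof. by apply: hmu.1; exact: mball_open. Qed.

(** Over [n] scales [t b ^ q * rad (b + n) ^ d] shrinks by [(a ^ 2 / g ^ 2) ^ n], whereas the energy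
    required of a selected ball may shrink only by [(a / g ^ 2) ^ n]. The quotient of the two is the
    gain [a ^+ n], and the overlap bound sums the energies. *)
Lemma level_cover (b n : nat) (P : pred X) (Rr vt : R) (Bs : X -> set X) (A' : set X) :
  let l := [seq c <- net gr (b + n) | P c] in
  (forall c, measurable (Bs c)) -> measurable A' ->
  (forall c, c \in l -> Bs c `<=` A') ->
  (forall c, Bs c `<=` ball c (L1 * rad (b + n))) ->
  (0 < Rr <= L1)%R -> (0 < vt)%R ->
  (forall c, c \in l -> (vt * t b `^ p * a ^+ n * tau (b + n) c <= nuf (Bs c))%R) ->
  (t b `^ q)%:E * hausdorff_outer X d (\bigcup_(c in [set` l]) (E `&` ball c (Rr * rad (b + n)))) <=
  (levelC Rr * (a ^+ n / vt) * nuf A')%:E.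
Proof.
move=> l mBs mA' BsA Bsb /andP[Rr0 RrL] vt0 lP.
have r0 := rad_gt0 gr (b + n).
have h0 : (0 < hausC gr)%R by exact: hausC_gt0.
apply: (@le_trans _ _ ((t b `^ q)%:E * (\sum_(c <- l) (hausC gr * (Rr * rad (b + n)) `^ d)%:E))).
  apply: lee_wpmul2l; first by rewrite lee_fin powR_ge0.
  apply: le_trans (outer_measure_bigcup_seq _ _ _) _.
  rewrite big_seq [leRHS]big_seq; apply: lee_sum => c; rewrite mem_filter => /andP[_ cn].
  apply: haus_up; first exact: net_sub cn.
  rewrite mulr_gt0//=; apply: ler_pM => //; [exact: ltW|exact: ltW|exact: rad_le_rho].
have gn0 : (0 < g ^+ 2 :> R)%R by rewrite exprn_gt0.
have an0 : (0 < a ^+ n)%R by rewrite exprn_gt0.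
have one c : c \in l -> (1 <= nuf (Bs c) * ((g ^+ 2) ^+ n / (vt * Np * a ^+ n * lt0)))%R.
  move=> cl; have h1 := lP c cl; move: cl; rewrite mem_filter => /andP[_ /net_sub Ec].
  have h2 := tau_low (b + n) Ec.
  have h3 : (0 <= vt * t b `^ p * a ^+ n)%R.
    by rewrite mulr_ge0 ?(ltW an0)// mulr_ge0 ?powR_ge0// ltW.
  have h4 := le_trans (ler_wpM2l h3 h2) h1.
  have Dn0 : (0 < vt * Np * a ^+ n * lt0)%R by rewrite !mulr_gt0.
  rewrite mulrA ler_pdivlMr// mul1r.
  have h5 : (0 <= (g ^+ 2) ^+ n)%R by rewrite exprn_ge0// ltW.
  apply: le_trans (ler_wpM2r h5 h4); rewrite t_p exprVn exprD le_eqVlt; apply/orP; left; apply/eqP.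
  have : ((g ^+ 2) ^+ b != 0)%R by rewrite gt_eqF// exprn_gt0.
  have : ((g ^+ 2) ^+ n != 0)%R by rewrite gt_eqF// exprn_gt0.
  move: ((g ^+ 2) ^+ b)%R ((g ^+ 2) ^+ n)%R => x y y0 x0; field; by rewrite x0 y0.
rewrite sumEFin -EFinM lee_fin mulr_sumr.
pose kk : R := (Nq * hausC gr * Rr `^ d * rd * (a ^+ 2 / g ^+ 2) ^+ n)%R.
have kk0 : (0 <= kk)%R.
  rewrite !mulr_ge0 ?powR_ge0 ?(ltW Nq0) ?(ltW h0) ?(ltW rd0)//.
  by rewrite exprn_ge0// divr_ge0// exprn_ge0// ltW.
have kkE : (t b `^ q * (hausC gr * (Rr * rad (b + n)) `^ d) = kk)%R.
  rewrite powRM ?(ltW Rr0) ?(ltW r0)// rad_d t_q exprD /kk.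
  have -> : ((g ^+ 2 / a ^+ 2) ^+ b = ((a ^+ 2 / g ^+ 2) ^+ b)^-1)%R.
    by rewrite -[RHS]exprVn invf_div.
  have : ((a ^+ 2 / g ^+ 2) ^+ b != 0)%R.
    by rewrite gt_eqF// exprn_gt0// divr_gt0// exprn_gt0.
  by move: ((a ^+ 2 / g ^+ 2) ^+ b)%R ((a ^+ 2 / g ^+ 2) ^+ n)%R => x y x0; field.
apply: (@le_trans _ _ (\sum_(c <- l) kk * (nuf (Bs c) * ((g ^+ 2) ^+ n / (vt * Np * a ^+ n * lt0))))%R).
  rewrite big_seq [leRHS]big_seq; apply: ler_sum => c cl; rewrite kkE.
  by rewrite -{1}(mulr1 kk); apply: ler_wpM2l => //; exact: one.
rewrite -mulr_sumr -mulr_suml.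
have sn : (\sum_(c <- l) nuf (Bs c) <= (overlap gr)%:R * nuf A')%R.
  apply: (sum_nu hmu oO ef) => // y; apply: leq_trans (net_overlap gr (b + n) y).
  rewrite !size_filter count_filter; apply: sub_count => c /= /andP[/set_mem By _].
  by have := Bsb c y By; rewrite ballEmdist.
have z0 : (0 <= (g ^+ 2) ^+ n / (vt * Np * a ^+ n * lt0))%R.
  by rewrite divr_ge0 ?exprn_ge0// ?ltW// !mulr_gt0.
apply: le_trans (ler_wpM2l kk0 (ler_wpM2r z0 sn)) _.
rewrite /kk /levelC le_eqVlt; apply/orP; left; apply/eqP; rewrite expr_div_n -!exprM.
rewrite !(mulnC 2%N) !exprM.
have : (g ^+ n != 0)%R by rewrite gt_eqF// exprn_gt0.
have : (a ^+ n != 0)%R by rewrite gt_eqF.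
move: (g ^+ n)%R (a ^+ n)%R => x y y0 x0; field.
by rewrite y0 x0 !gt_eqF.
Qed.

(** Chosen so that [eps * Tcut b i] is the factor [2 ^+ i.+1 * t b ^ p] in [heavy_sel b i.+1]:
    outside [heavy_set b i.+1] the growth condition of the stopping argument holds with this [T]. *)
Definition Tcut b i : R := (2 ^+ i.+1 * t b `^ p / eps)%R.
Local Notation DD b i := (cut_union gr p L g f b (Tcut b i)).
Definition stop_sel b i n := [seq c <- net gr (b + n) |
  (eps * t b `^ p * a ^+ n * tau (b + n) c <= nuf (ball c (L * rad (b + n)) `\` DD b i))%R].
Definition stop_set b i n : set X :=
  \bigcup_(c in [set` stop_sel b i n]) (ball c (L * rad (b + n)) `\` DD b i).
Definition near_stop b i n : set X :=
  \bigcup_(c in [set` stop_sel b i n]) (E `&` ball c (1 * rad (b + n))).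
Definition heavy_sel b i n := [seq c <- net gr (b + n) |
  (2 ^+ i * t b `^ p * a ^+ n * tau (b + n) c < nuf (ball c (4 * L * rad (b + n))))%R].
Definition heavy_level b i n : set X :=
  \bigcup_(c in [set` heavy_sel b i n]) (E `&` ball c (4 * L * rad (b + n))).
Definition heavy_set b i : set X := \bigcup_n heavy_level b i n.
Local Notation Y b i n := (nuf (stop_set b i n)).

Let mDD b i : measurable (DD b i). Proof. by apply: hmu.1; exact: cut_union_open. Qed.

Lemma measurable_stop_set b i n : measurable (stop_set b i n).
Proof.
by rewrite /stop_set bigcup_seq; apply: bigsetU_measurable => c _; exact: measurableD.
Qed.

Let LL : (L <= L1)%R.
Proof. by apply: le_trans LL1; rewrite ler_peMl ?ler1n// ltW. Qed.

Lemma near_stop_le b i n :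
  (t b `^ q)%:E * hausdorff_outer X d (near_stop b i n) <= (levelC 1 / eps * Y b i n * a ^+ n)%:E.
Proof.
apply: le_trans (@level_cover b n _ 1%R eps (fun c => ball c (L * rad (b + n)) `\` DD b i)
  (stop_set b i n) _ _ _ _ _ _ _) _.
- by move=> c; exact: measurableD.
- exact: measurable_stop_set.
- by move=> c cS y yc; exists c.
- move=> c y [cy _]; apply: le_ball cy; rewrite ler_pM2r//; exact: rad_gt0.
- by rewrite ltr01 (le_trans _ L110)// ler1n.
- by case/andP: eps01.
- by move=> c; rewrite mem_filter => /andP[].
by rewrite lee_fin le_eqVlt; apply/orP; left; apply/eqP; field; rewrite gt_eqF.
Qed.

Lemma nu_setT_le A : measurable A -> (nuf A <= V)%R.
Proof. by move=> mA; apply: le_trans (nu_le_total hmu oO ef mA) fV. Qed.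

Lemma heavy_set_le b i :
  (t b `^ q)%:E * hausdorff_outer X d (heavy_set b i) <=
  (levelC (4 * L) * V / (1 - a) * (2^-1) ^+ i)%:E.
Proof.
have lev n : (t b `^ q)%:E * hausdorff_outer X d (heavy_level b i n) <=
    (levelC (4 * L) * V * (2^-1) ^+ i * a ^+ n)%:E.
  have i20 : (0 < 2 ^+ i :> R)%R by rewrite exprn_gt0.
  apply: le_trans (@level_cover b n _ (4 * L)%R (2 ^+ i)%R (fun c => ball c (4 * L * rad (b + n)))
    setT _ _ _ _ _ _ _) _ => //.
  - move=> c; apply: le_ball; rewrite ler_pM2r ?rad_gt0//.
    by apply: le_trans LL1; rewrite ler_pM2r// ler_nat.
  - by rewrite mulr_gt0//=; apply: le_trans LL1; rewrite ler_pM2r// ler_nat.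
  - by move=> c; rewrite mem_filter => /andP[/ltW].
  rewrite lee_fin.
  have k0 : (0 <= levelC (4 * L) * (a ^+ n / 2 ^+ i))%R.
    by apply: mulr_ge0; [exact: levelC_ge0|rewrite divr_ge0 ?exprn_ge0// ltW].
  apply: le_trans (ler_wpM2l k0 (nu_setT_le measurableT)) _.
  by rewrite exprVn le_eqVlt; apply/orP; left; apply/eqP; ring.
apply: (@le_trans _ _ ((t b `^ q)%:E * \sum_(n <oo) hausdorff_outer X d (heavy_level b i n))).
  apply: lee_wpmul2l; first by rewrite lee_fin powR_ge0.
  exact: outer_measure_sigma_subadditive.
rewrite -nneseriesZl//.
have K0 : (0 <= levelC (4 * L) * V * (2^-1) ^+ i)%R.
  apply: mulr_ge0; first by apply: mulr_ge0; [exact: levelC_ge0|exact: ltW].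
  by rewrite exprn_ge0.
apply: (@le_trans _ _ (levelC (4 * L) * V * (2^-1) ^+ i / (1 - a))%:E).
  apply: le_trans (nneseries_geometric K0 a01); apply: lee_nneseries => [n _ _|n _]; last exact: lev.
  by rewrite mule_ge0// lee_fin powR_ge0.
by rewrite lee_fin le_eqVlt; apply/orP; left; apply/eqP; ring.
Qed.

(** An absolute lower bound for the energy at a nonempty level. Through it an estimate that does not
    involve [Y b i n] becomes one proportional to [Y b i n], at the price of the growing factor
    [(g ^ 2 / a) ^ n]. *)
Lemma stop_sel_energy b i n x : near_stop b i n x ->
  (eps * Np * lt0 * (a / g ^+ 2) ^+ n <= Y b i n)%R.
Proof.
move=> [c /= cS _].
have h2 : (nuf (ball c (L * rad (b + n)) `\` DD b i) <= Y b i n)%R.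
  apply: (le_nu hmu oO ef); [exact: measurableD|exact: measurable_stop_set|].
  by move=> y yc; exists c.
move: cS; rewrite mem_filter => /andP[h1 /net_sub Ec].
apply: le_trans (le_trans h1 h2).
have k0 : (0 <= eps * t b `^ p * a ^+ n)%R.
  by apply: mulr_ge0; [apply: mulr_ge0; [exact: ltW|exact: powR_ge0]|rewrite exprn_ge0// ltW].
apply: le_trans (ler_wpM2l k0 (tau_low (b + n) Ec)).
rewrite t_p exprVn exprD le_eqVlt; apply/orP; left; apply/eqP.
rewrite expr_div_n.
have : ((g ^+ 2) ^+ b != 0)%R by rewrite gt_eqF// exprn_gt0// exprn_gt0.
have : ((g ^+ 2) ^+ n != 0)%R by rewrite gt_eqF// exprn_gt0// exprn_gt0.
move: ((g ^+ 2) ^+ b)%R ((g ^+ 2) ^+ n)%R => x' y' y0 x0; field; by rewrite x0 y0.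
Qed.

Variable M : nat.
Hypotheses (M1 : (2 / eps ^+ 2 <= g ^+ M)%R) (M2 : (2 <= g ^+ M)%R) (M3 : (g / a <= g ^+ M)%R).

(* A ball selected at the level [b'] would have been cut at the level [b] if [b'] were much
   larger than [b]. *)
Lemma stop_set_close b b' i n y : (b < b')%N -> stop_set b i n y -> stop_set b' i n y ->
  (b' - b < M * (1 + i + n))%N.
Proof.
move=> bb' [_ _ [_ nDD]] [c /= cS [cy _]].
move: cS; rewrite mem_filter => /andP[h1 cn]; have Ec := net_sub cn.
pose k := (b' - b)%N.
have bE : (b' + n = b + (k + n))%N by rewrite addnA subnKC// ltnW.
have h2 : (nuf (ball c (L * rad (b' + n)) `\` DD b' i) <= nuf (ball c (L * rad (b' + n))))%R.
  by apply: (le_nu hmu oO ef) => //; exact: measurableD.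
have tau0 := tauc_gt0 gr p L10 LL1 (b' + n) Ec.
have h3 : (nuf (ball c (L * rad (b' + n))) < Tcut b i * g ^+ (k + n) * tau (b' + n) c)%R.
  rewrite ltNge; apply/negP => h; apply: nDD.
  exists (k + n)%N => //; exists c; last by rewrite -bE.
  by rewrite /= mem_filter -bE h cn.
have := le_lt_trans (le_trans h1 h2) h3; rewrite ltr_pM2r// /Tcut !t_p.
have -> : ((g ^+ 2) ^+ b' = (g ^+ 2) ^+ b * (g ^+ k * g ^+ k))%R.
  by rewrite -{1}(subnKC (ltnW bb')) exprD -/k; congr (_ * _)%R; rewrite -exprD addnn -mul2n exprM.
have gb0 : (0 < (g ^+ 2) ^+ b)%R by rewrite exprn_gt0// exprn_gt0.
have gk0 : (0 < g ^+ k)%R by rewrite exprn_gt0.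
have gn0 : (0 < g ^+ n)%R by rewrite exprn_gt0.
have an0 : (0 < a ^+ n)%R by rewrite exprn_gt0.
rewrite exprD => H.
have H1 : (g ^+ k < 2 / eps ^+ 2 * (2 ^+ i * (g / a) ^+ n))%R.
  have pos : (0 < eps * (Np * (g ^+ 2) ^+ b) * a ^+ n * g ^+ k)%R by rewrite !mulr_gt0.
  rewrite -(ltr_pM2l pos).
  apply: le_lt_trans (lt_le_trans H _); rewrite le_eqVlt; apply/orP; left; apply/eqP; first by ring.
  rewrite exprS expr_div_n; field; by rewrite !gt_eqF.
(* [M1], [M2] and [M3] absorb in turn the constant, the factor [2 ^+ i] and the factor
   [(g / a) ^+ n]. *)
have H2 : (g ^+ k < g ^+ (M * (1 + i + n)))%R.
  apply: lt_le_trans H1 _; rewrite !mulnDr !exprD muln1 -[leRHS]mulrA.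
  apply: ler_pM => //.
  - by rewrite divr_ge0// exprn_ge0// ltW.
  - by rewrite mulr_ge0 ?exprn_ge0// divr_ge0// ltW.
  rewrite !exprM; apply: ler_pM; rewrite ?exprn_ge0 ?divr_ge0 ?(ltW g0) ?(ltW a0)//.
    by rewrite lerXn2r// nnegrE// (le_trans _ M2).
  by rewrite lerXn2r// nnegrE ?divr_ge0 ?(ltW g0) ?(ltW a0)// exprn_ge0// ltW.
by move: H2; rewrite ltr_eXn2l.
Qed.

(** By [stop_set_close] a point lies in at most [M * (1 + i + n)] of these sets as [b] varies. This
    growth is only linear and is later absorbed by geometric factors. *)
Lemma sum_stop_set i n B : (\sum_(0 <= b < B) Y b i n <= (M * (1 + i + n))%:R * V)%R.
Proof.
have M0 : (0 < M)%N.
  by rewrite lt0n; apply/eqP => M0; have := M2; rewrite M0 expr0; lra.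
apply: le_trans (_ : ((M * (1 + i + n))%:R * nuf setT <= _)%R); last first.
  by rewrite ler_wpM2l//; exact: nu_setT_le.
rewrite /index_iota subn0; apply: (sum_nu hmu oO ef) => //.
  by move=> b; exact: measurable_stop_set.
move=> y; rewrite size_filter; apply: count_close; first by rewrite muln_gt0 M0.
by move=> b b' bb' /set_mem h1 /set_mem h2; exact: stop_set_close bb' h1 h2.
Qed.

(** The index [i] stands for the least one with the point outside [heavy_set b i.+1]; minimality
    gives membership in [heavy_set b i] except when [i] is 0. *)
Definition stop_level b i n : set X :=
  [set z | near_stop b i n z /\ (i = 0%N \/ heavy_set b i z)].

Variables (Cm x y c1 c2 x' y' : R) (m : nat).
Hypotheses (Cm1 : (levelC 1 / eps <= Cm)%R)
  (Cm2 : (levelC (4 * L) * V / (1 - a) / (eps * Np * lt0) <= Cm)%R)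
  (x0 : (0 < x)%R) (y0 : (0 < y)%R) (xa : (x ^+ m.+1 = a)%R) (yh : (y ^+ m.+1 = 2^-1)%R)
  (am : (a ^+ m * (g ^+ 2 / a) <= a)%R)
  (x'01 : (0 < x' < 1)%R) (y'01 : (0 < y' < 1)%R) (c10 : (0 < c1)%R) (c20 : (0 < c2)%R)
  (xx' : forall n, (n.+1%:R * x ^+ n <= c1 * x' ^+ n)%R)
  (yy' : forall n, (n.+1%:R * y ^+ n <= c2 * y' ^+ n)%R).

(** The bound from [near_stop_le] decays in [n] but not in [i]; the one from [heavy_set_le] and
    [stop_sel_energy] decays in [i] but grows in [n]. By the hypothesis [am], interpolation with a
    large [m] keeps some decay in both indices. *)
Lemma stop_level_le b i n : (t b `^ q)%:E * hausdorff_outer X d (stop_level b i n) <=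
  (Cm * Y b i n * (x ^+ n * y ^+ i))%:E.
Proof.
have Y0 : (0 <= Y b i n)%R by exact: nu_ge0.
have Cm0 : (0 <= Cm)%R by apply: le_trans Cm1; rewrite divr_ge0 ?levelC_ge0// ltW.
have CY0 : (0 <= Cm * Y b i n)%R by exact: mulr_ge0.
have tq0 : 0 <= (t b `^ q)%:E by rewrite lee_fin powR_ge0.
have [[z [nz _]]|/set0P/negP] := pselect (stop_level b i n !=set0); last first.
  rewrite negbK => /eqP ->; rewrite outer_measure0 mule0 lee_fin.
  by apply: mulr_ge0 => //; rewrite mulr_ge0// exprn_ge0// ltW.
have an0 : (0 < a ^+ n)%R by rewrite exprn_gt0.
have b1 : (t b `^ q)%:E * hausdorff_outer X d (stop_level b i n) <= (Cm * Y b i n * a ^+ n)%:E.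
  apply: (@le_trans _ _ (levelC 1 / eps * Y b i n * a ^+ n)%:E).
    apply: le_trans (near_stop_le b i n); apply: lee_wpmul2l => //.
    by apply: le_outer_measure => w [].
  by rewrite lee_fin ler_pM2r// ler_wpM2r.
have D0 : (0 < g ^+ 2 / a)%R by rewrite divr_gt0// exprn_gt0.
have b2 : (t b `^ q)%:E * hausdorff_outer X d (stop_level b i n) <=
    (Cm * Y b i n * ((g ^+ 2 / a) ^+ n * 2^-1 ^+ i))%:E.
  have [i0|i0] := eqVneq i 0%N.
    apply: (le_trans b1); rewrite lee_fin i0 expr0 mulr1; apply: ler_wpM2l; first by rewrite -i0.
    apply: lerXn2r; rewrite ?nnegrE ?(ltW a0) ?(ltW D0)//.
    rewrite ler_pdivlMr// -expr2; apply: lerXn2r; rewrite ?nnegrE ?(ltW a0) ?(ltW g0)//.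
    by case/andP: a01 => _ a1; apply: ltW; exact: lt_trans g1.
  apply: (@le_trans _ _ (levelC (4 * L) * V / (1 - a) * (2^-1) ^+ i)%:E).
    apply: le_trans (heavy_set_le b i); apply: lee_wpmul2l => //.
    by apply: le_outer_measure => w [_ []// i00]; rewrite i00 in i0.
  rewrite lee_fin mulrA; apply: ler_wpM2r; first by rewrite exprn_ge0.
  have P0 : (0 < eps * Np * lt0)%R by rewrite !mulr_gt0.
  have e1 : (1 <= Y b i n * (g ^+ 2 / a) ^+ n / (eps * Np * lt0))%R.
    rewrite ler_pdivlMr// mul1r.
    have dn : (0 <= (g ^+ 2 / a) ^+ n)%R by rewrite exprn_ge0// ltW.
    apply: le_trans (ler_wpM2r dn (stop_sel_energy nz)).
    rewrite -[leRHS]mulrA -exprMn mulrA divfK ?gt_eqF// ?exprn_gt0//.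
    by rewrite divff ?gt_eqF// expr1n mulr1.
  have z0 : (0 <= levelC (4 * L) * V / (1 - a))%R.
    case/andP: a01 => _ a1.
    by apply: divr_ge0; [apply: mulr_ge0; [exact: levelC_ge0|exact: ltW]|rewrite subr_ge0 ltW].
  apply: le_trans (_ : (levelC (4 * L) * V / (1 - a) * (Y b i n * (g ^+ 2 / a) ^+ n / (eps * Np * lt0)) <= _)%R).
    by rewrite -{1}(mulr1 (levelC _ * V / _)%R); apply: ler_wpM2l.
  have yd : (0 <= Y b i n * (g ^+ 2 / a) ^+ n)%R by apply: mulr_ge0 => //; rewrite exprn_ge0// ltW.
  have := ler_wpM2r yd Cm2; rewrite [X in (_ <= X)%R -> _]mulrA; apply: le_trans.
  by rewrite le_eqVlt; apply/orP; left; apply/eqP; ring.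
have zf : (t b `^ q)%:E * hausdorff_outer X d (stop_level b i n) \is a fin_num.
  by rewrite ge0_fin_numE ?(le_lt_trans b1) ?ltry// mule_ge0.
move: b1 b2; rewrite -(fineK zf) !lee_fin => b1 b2.
apply: (min_root _ CY0 a01 D0 _ x0 y0 xa yh am b1 b2) => //.
by rewrite fine_ge0// mule_ge0.
Qed.

Lemma sum_stop_level i n : \sum_(b <oo) ((t b `^ q)%:E * hausdorff_outer X d (stop_level b i n)) <=
  (Cm * (M%:R * V) * c1 * c2 * (x' ^+ n * y' ^+ i))%:E.
Proof.
have Cm0 : (0 <= Cm)%R by apply: le_trans Cm1; rewrite divr_ge0 ?levelC_ge0// ltW.
apply: lime_le.
  by apply: is_cvg_nneseries => b _ _; rewrite mule_ge0// lee_fin powR_ge0.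
apply: nearW => B.
apply: (@le_trans _ _ (\sum_(0 <= b < B) (Cm * Y b i n * (x ^+ n * y ^+ i))%:E)).
  by apply: lee_sum => b _; exact: stop_level_le.
rewrite sumEFin lee_fin -mulr_suml -mulr_sumr.
have xy0 : (0 <= x ^+ n * y ^+ i)%R by rewrite mulr_ge0// exprn_ge0// ltW.
apply: le_trans (ler_wpM2r xy0 (ler_wpM2l Cm0 (sum_stop_set i n B))) _.
have cnt : ((M * (1 + i + n))%:R <= M%:R * (i.+1%:R * n.+1%:R) :> R)%R.
  rewrite -!natrM ler_nat leq_mul2l; apply/orP; right.
  by rewrite mulSn mulnS add1n addSnnS addnC leq_add2l leq_addr.
have V0' := ltW V0.
apply: le_trans (ler_wpM2r xy0 (ler_wpM2l Cm0 (ler_wpM2r V0' cnt))) _.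
have -> : (Cm * (M%:R * (i.+1%:R * n.+1%:R) * V) * (x ^+ n * y ^+ i) =
  Cm * (M%:R * V) * ((n.+1%:R * x ^+ n) * (i.+1%:R * y ^+ i)))%R by ring.
have -> : (Cm * (M%:R * V) * c1 * c2 * (x' ^+ n * y' ^+ i) =
  Cm * (M%:R * V) * ((c1 * x' ^+ n) * (c2 * y' ^+ i)))%R by ring.
apply: ler_wpM2l; first by apply: mulr_ge0 => //; exact: mulr_ge0.
by apply: ler_pM => //; rewrite mulr_ge0// exprn_ge0// ltW.
Qed.

(** The points lying in every [heavy_set b i.+1] form a null set, by the decay in [heavy_set_le].
    The other points are covered by stop levels, whose bounds are summed first over [b] and then as
    geometric series in [n] and [i]. *)
Lemma borderline_sum (U : nat -> set X) :
  (forall b z, U b z -> (exists i n, stop_level b i n z) \/ forall i, heavy_set b i.+1 z) ->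
  \sum_(b <oo) ((t b `^ q)%:E * hausdorff_outer X d (U b)) <=
  (Cm * (M%:R * V) * c1 * c2 / (1 - x') / (1 - y'))%:E.
Proof.
move=> UP.
have Cm0 : (0 <= Cm)%R by apply: le_trans Cm1; rewrite divr_ge0 ?levelC_ge0// ltW.
have tq0 b : 0 <= (t b `^ q)%:E by rewrite lee_fin powR_ge0.
have null b : hausdorff_outer X d (\bigcap_i heavy_set b i.+1) = 0.
  have tq : (0 < t b `^ q)%R by rewrite powR_gt0.
  have z0 : (0 <= levelC (4 * L) * V / (1 - a))%R.
    case/andP: a01 => _ a1.
    by apply: divr_ge0; [apply: mulr_ge0; [exact: levelC_ge0|exact: ltW]|rewrite subr_ge0 ltW].
  have bnd i : (t b `^ q)%:E * hausdorff_outer X d (\bigcap_i heavy_set b i.+1) <=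
      (levelC (4 * L) * V / (1 - a) * (2^-1) ^+ i.+1)%:E.
    apply: le_trans (heavy_set_le b i.+1); apply: lee_wpmul2l => //.
    by apply: le_outer_measure => w; exact.
  have eq0 : (t b `^ q)%:E * hausdorff_outer X d (\bigcap_i heavy_set b i.+1) <= 0.
    have h := @cvg_geometric R (levelC (4 * L) * V / (1 - a))%R 2^-1%R.
    have /h h' : (`|2^-1| < 1 :> R)%R by rewrite ger0_norm//; lra.
    apply/lee_addgt0Pr => e e0; rewrite add0e.
    have /cvgrPdist_lt/(_ e e0)[n _ /(_ n.+1)] := h'.
    move=> /(_ (leqW (leqnn _))); rewrite /= sub0r normrN ger0_norm; last first.
      by rewrite mulr_ge0// exprn_ge0.
    by move=> /ltW he; apply: le_trans (bnd n) _; rewrite lee_fin.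
  apply/eqP; rewrite eq_le outer_measure_ge0 andbT -(@lee_pmul2l _ (t b `^ q)%:E)// ?lte_fin//.
  by rewrite mule0.
have stepU b : (t b `^ q)%:E * hausdorff_outer X d (U b) <=
    \sum_(i <oo) \sum_(n <oo) ((t b `^ q)%:E * hausdorff_outer X d (stop_level b i n)).
  apply: (@le_trans _ _ ((t b `^ q)%:E * \sum_(i <oo) \sum_(n <oo) hausdorff_outer X d (stop_level b i n))).
    apply: lee_wpmul2l => //.
    apply: (@le_trans _ _ (hausdorff_outer X d ((\bigcup_i \bigcup_n stop_level b i n) `|` \bigcap_i heavy_set b i.+1))).
      apply: le_outer_measure => z /UP [[i [n zn]]|zb]; first by left; exists i => //; exists n.
      by right => i _; exact: zb.
    apply: le_trans (outer_measureU2 _ _ _) _; rewrite null adde0.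
    apply: le_trans (outer_measure_sigma_subadditive _ _) _.
    apply: lee_nneseries => [i _ _|i _]; first exact: outer_measure_ge0.
    exact: outer_measure_sigma_subadditive.
  rewrite -nneseriesZl//; last first.
    by move=> i _; apply: nneseries_ge0 => n _ _; exact: outer_measure_ge0.
  apply: lee_nneseries => [i _ _|i _].
    by rewrite mule_ge0//; apply: nneseries_ge0 => n _ _; exact: outer_measure_ge0.
  by rewrite -nneseriesZl// => n _; exact: outer_measure_ge0.
have pos b i n : 0 <= (t b `^ q)%:E * hausdorff_outer X d (stop_level b i n).
  by rewrite mule_ge0// outer_measure_ge0.
apply: (@le_trans _ _ (\sum_(b <oo) \sum_(i <oo) \sum_(n <oo)
    ((t b `^ q)%:E * hausdorff_outer X d (stop_level b i n)))).
  apply: lee_nneseries => [b _ _|b _]; last exact: stepU.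
  by rewrite mule_ge0// outer_measure_ge0.
rewrite nneseries_interchange; last first.
  by move=> b i; apply: nneseries_ge0 => n _ _; exact: pos.
have K0 : (0 <= Cm * (M%:R * V) * c1 * c2)%R.
  by rewrite !mulr_ge0// ltW.
have K1 : (0 <= Cm * (M%:R * V) * c1 * c2 / (1 - x'))%R.
  by apply: divr_ge0 => //; case/andP: x'01 => _ h; rewrite subr_ge0 ltW.
apply: le_trans (nneseries_geometric K1 y'01).
apply: lee_nneseries => [i _ _|i _].
  by apply: nneseries_ge0 => b _ _; apply: nneseries_ge0 => n _ _; exact: pos.
rewrite nneseries_interchange; last by move=> b n; exact: pos.
have yi : (0 <= y' ^+ i)%R by case/andP: y'01 => h _; rewrite exprn_ge0// ltW.
have K2 : (0 <= Cm * (M%:R * V) * c1 * c2 * y' ^+ i)%R by exact: mulr_ge0.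
apply: (@le_trans _ _ (Cm * (M%:R * V) * c1 * c2 * y' ^+ i / (1 - x'))%:E); last first.
  by rewrite lee_fin mulrAC.
apply: le_trans (nneseries_geometric K2 x'01).
apply: lee_nneseries => [n _ _|n _].
  by apply: nneseries_ge0 => b _ _; exact: pos.
apply: le_trans (sum_stop_level i n) _.
by rewrite lee_fin le_eqVlt; apply/orP; left; apply/eqP; ring.
Qed.

End borderline_levels.

(** At each point the least [b] with [|v x| <= t b] decides: a successor [b.+1] gives the term of
    index [b] in the series, and 0 gives the constant term. *)
Lemma layer_cake_le (R : realType) (disp : measure_display) (T : measurableType disp)
  (m : {measure set T -> \bar R}) (D : set T) (v : T -> R) (q : R) (t : nat -> R) :
  (0 < q)%R -> measurable D -> measurable_fun D v -> (forall b, 0 <= t b)%R ->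
  (forall y, exists b, y <= t b)%R ->
  \int[m]_(x in D) `|(v x)%:E| `^ q <= (t 0%N `^ q)%:E * m D +
    \sum_(b <oo) ((t b.+1 `^ q)%:E * m (D `&` [set x | (t b < `|v x|)%R])).
Proof.
move=> q0 mD mv t0 tinf.
pose U b := D `&` [set x | (t b < `|v x|)%R].
have mU b : measurable (U b).
  have mf : measurable_fun D (fun x => t b < `|v x|)%R.
    by apply: measurable_fun_ltr; [exact: measurable_cst|exact: measurableT_comp].
  rewrite (_ : U b = D `&` (fun x => t b < `|v x|)%R @^-1` [set true]); first exact: mf.
  by [].
pose S x := \sum_(b <oo) ((t b.+1 `^ q)%:E * (\1_(U b) x)%:E).
have ter0 b x : 0 <= (t b.+1 `^ q)%:E * (\1_(U b) x)%:E.
  by rewrite mule_ge0// lee_fin powR_ge0.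
have mter b : measurable_fun D (fun x => (t b.+1 `^ q)%:E * (\1_(U b) x)%:E).
  apply: measurable_funeM; apply/measurable_EFinP; apply: measurable_funTS.
  exact: measurable_indic.
have S0 x : 0 <= S x by apply: nneseries_ge0.
apply: (@le_trans _ _ (\int[m]_(x in D) ((t 0%N `^ q)%:E + S x))).
  apply: ge0_le_integral => //.
  - by move=> x _; exact: poweR_ge0.
  - apply: (measurableT_comp (measurable_poweR q)); apply: measurableT_comp => //.
    exact/measurable_EFinP.
  - apply: emeasurable_funD; first exact: measurable_cst.
    exact: ge0_emeasurable_sum.
  - move=> x Dx; rewrite (_ : `|(v x)%:E| = (`|v x|)%:E)// poweR_EFin.
    have vb : exists b, (`|v x| <= t b)%R by exact: tinf.
    case: (ex_minnP vb) => -[|b] xb bmin.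
      apply: le_trans (leeDl _ (S0 x)); rewrite lee_fin.
      by apply: ge0_ler_powR; rewrite ?nnegrE ?(ltW q0).
    apply: (@le_trans _ _ (S x)); last by rewrite leeDr// lee_fin powR_ge0.
    apply: le_trans (@lee_nneseries_term _ (fun b => (t b.+1 `^ q)%:E * (\1_(U b) x)%:E) b (ter0^~ x)).
    rewrite indicE mem_set ?mule1.
      by rewrite lee_fin; apply: ge0_ler_powR; rewrite ?nnegrE ?(ltW q0).
    split => //=; rewrite ltNge; apply/negP => h.
    by have := bmin b h; rewrite ltnn.
rewrite ge0_integralD//; last 2 first.
- by move=> x _; rewrite lee_fin powR_ge0.
- exact: ge0_emeasurable_sum.
apply: leeD; first by rewrite integral_cst.
rewrite integral_nneseries//; apply: lee_nneseries => [b _ _|b _].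
  by apply: integral_ge0.
rewrite ge0_integralZl//; last first.
- by rewrite lee_fin powR_ge0.
- by apply/measurable_EFinP; apply: measurable_funTS; exact: measurable_indic.
apply: lee_wpmul2l; first by rewrite lee_fin powR_ge0.
by rewrite integral_indic// setIidl// => x [].
Qed.

Lemma powR_expr (R : realType) (x e : R) (n : nat) : (0 <= x)%R ->
  ((x ^+ n) `^ e = (x `^ e) ^+ n)%R.
Proof. by move=> x0; rewrite -!powR_mulrn ?powR_ge0// -!powRrM mulrC. Qed.

Lemma exists_expr_ge (R : realType) (C g : R) : (1 < g)%R -> exists n, (C <= g ^+ n)%R.
Proof.
move=> g1; have g0 : (0 < g)%R by exact: lt_trans g1.
have gi : (0 < g^-1 < 1)%R by rewrite invr_gt0 g0 invf_lt1.
have [n hn] := geometric_small C gi ltr01; exists n.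
by move: hn; rewrite exprVn ler_pdivrMr ?exprn_gt0// mul1r.
Qed.

(** * Growth of averages at the borderline exponent *)

Section borderline_growth.
Context (R : realType) (disp : measure_display)
  (X : metricMeasurableType R disp) (mu : {measure set X -> \bar R})
  (Omega E : set X) (d s L : R) (gr : grid mu Omega E d s L).
Hypotheses (hmu : complete_borel mu) (oO : open Omega)
  (mE : (hausdorff_outer X d).-caratheodory E) (L10 : (10 <= L)%R).
Variables (p K : R).
Hypotheses (p1 : (1 <= p)%R) (K0 : (0 <= K)%R).
Let p0 : (0 < p)%R. Proof. exact: lt_le_trans p1. Qed.
Local Notation rad := (gradius gr).

Lemma Tavg_osc_at u f l n x : measurable_fun Omega u -> osc_control gr p 1 K u f -> E x ->
  \int[mu]_(y in ball_of Omega (cell gr n x) (rad n)) `|u y - l%:E| <=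
  (mass gr n (cell gr n x) * ((1 + dblC gr) * osc gr p 1 K f n (cell gr n x) +
    `|Tavg gr u n x - l|))%:E.
Proof.
move=> mu_ ouf Ex; have h := Tavg_osc hmu oO L10 K0 mu_ ouf n Ex.
set B := ball_of _ _ _ in h *; set T := Tavg _ _ _ _ in h *.
have Ec := cell_E gr n Ex.
have mB : measurable B by exact: (measurable_ball_of hmu oO).
have muB : measurable_fun B u by apply: measurable_funS mu_ => //; [exact: hmu.1|exact: subIsetr].
have mc (k : R) : measurable_fun B (fun y => `|u y - k%:E|).
  by apply: measurableT_comp => //; apply: emeasurable_funB => //; exact: measurable_cst.
rewrite mulrDr EFinD; apply: (@le_trans _ _ (\int[mu]_(y in B) (`|u y - T%:E| + `|T - l|%:E))).
  apply: ge0_le_integral => //.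
  - by apply: emeasurable_funD => //; exact: measurable_cst.
  - move=> y _; have -> : u y - l%:E = (u y - T%:E) + (T - l)%:E by rewrite EFinB addeA subeK.
    exact: lee_abs_add.
rewrite ge0_integralD//.
rewrite integral_cst// (massE gr L10 n Ec) -EFinM; apply: leeD => //.
by rewrite lee_fin mulrC.
Qed.

(** A Lebesgue point property with the trace as value: the oscillation in the cell of [x] and the
    distance of its average to the trace both decay geometrically. *)
Lemma Tavg_limit u f tau x : (p <= tau)%R -> (0 < d + 1 * tau - s * tau / p)%R ->
  measurable_fun Omega u -> osc_control gr p 1 K u f -> E x -> Wmaj gr p 1 K tau f x < +oo ->
  forall e : R, (0 < e)%R -> exists M, forall n, (M <= n)%N ->
    \int[mu]_(y in ball_of Omega (cell gr n x) (rad n)) `|u y - (trace mu Omega u x)%:E| <=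
    (mass gr n (cell gr n x) * e)%:E.
Proof.
move=> pt e0 mu_ ouf Ex Wx e e_gt0.
have [_ H] := trace_pointwise hmu oO L10 p1 K0 pt e0 mu_ ouf Ex Wx.
set eta := (theta d s p 1 tau `^ tau^-1)%R in H; set l := trace mu Omega u x in H *.
have tau0 : (0 < tau)%R by exact: lt_le_trans pt.
have eta01 : (0 < eta < 1)%R.
  have /andP[t0 t1] := theta01 e0; rewrite powR_gt0//= (_ : 1 = 1 `^ tau^-1)%R; last by rewrite powR1.
  by apply: gt0_ltr_powR; rewrite ?nnegrE ?invr_gt0 ?(ltW t0).
set W := (fine _ `^ _)%R in H.
have [M HM] := geometric_small ((1 + dblC gr) * W + 4 * dblC gr / (1 - eta) * W)%R eta01 e_gt0.
exists M => n Mn; apply: le_trans (Tavg_osc_at l n mu_ ouf Ex) _.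
have m0 := mass_gt0 gr L10 n (cell_E gr n Ex).
rewrite lee_fin ler_pM2l//.
have W0 : (0 <= W)%R by exact: powR_ge0.
have d0 := ltW (dblC_gt0 gr).
have /andP[h0 h1] := eta01.
apply: (@le_trans _ _ (((1 + dblC gr) * W + 4 * dblC gr / (1 - eta) * W) * eta ^+ n)%R).
  rewrite [leRHS]mulrDl; apply: lerD; last by apply: le_trans (H n) _; rewrite mulrAC.
  rewrite -mulrA; apply: ler_wpM2l; first by rewrite addr_ge0.
  by rewrite mulrC; exact: (osc_le_Wmaj p1 K0 pt e0 n Ex Wx).
apply: le_trans HM; apply: ler_wpM2l.
  by rewrite addr_ge0// mulr_ge0 ?addr_ge0// divr_ge0 ?mulr_ge0// subr_ge0 ltW.
by apply: ler_wiXn2l => //; exact: ltW.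
Qed.

Hypothesis ps : (p < s)%R.
Let G : R := (2 `^ ((s - p) / p))%R.
Let G1 : (1 < G)%R.
Proof.
rewrite (_ : 1 = 1 `^ ((s - p) / p))%R; last by rewrite powR1.
by apply: gt0_ltr_powR; rewrite ?nnegrE ?divr_gt0 ?subr_gt0 ?ltr1n.
Qed.

(** With energy at most [N ^ p] the oscillation at scale [a] is at most a constant times
    [N * rad a ^ (1 - s / p)], which is a multiple of [N * G ^+ a]. As [G > 1], the sum over the
    scales up to [b] is of the order of its last term. This growth dictates the levels of the
    truncation. *)
Lemma average_growth : exists2 A : R, (0 < A)%R & forall (N : R) u f b x, (0 < N)%R ->
  admissible gr p 1 K N u -> energy mu Omega f -> osc_control gr p 1 K u f ->
  \int[mu]_(y in Omega) f y <= (N `^ p)%:E -> E x ->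
  \int[mu]_(y in ball_of Omega (cell gr b x) (rad b)) `|u y| <=
    (mass gr b (cell gr b x) * (A * N * G ^+ b))%:E.
Proof.
have d0 := dblC_gt0 gr; have r0 := rho_gt0 gr; have l0 := lowC_gt0 gr.
pose A0 := (1 + (lowC gr * rad 0 `^ s)^-1)%R.
pose Ko := (K * (lowC gr `^ p^-1)^-1 * rho gr `^ (1 - s / p))%R.
have Ko0 : (0 <= Ko)%R by rewrite !mulr_ge0 ?powR_ge0// invr_ge0 powR_ge0.
(* Chosen so that [A1 * (G - 1)] is the constant of one step, which closes the induction in [TN]. *)
pose A1 := (2 * dblC gr * Ko / (G - 1))%R.
have A00 : (0 <= A0)%R by rewrite addr_ge0// invr_ge0 mulr_ge0 ?powR_ge0// ltW.
have G0 : (0 < G)%R by exact: lt_trans G1.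
have A10 : (0 <= A1)%R by apply: divr_ge0; [exact: mulr_ge0 (mulr_ge0 (ler0n _ 2) (ltW d0)) Ko0|rewrite subr_ge0 ltW].
exists (A0 + A1 + (1 + dblC gr) * Ko + 1)%R.
  apply: ltr_wpDl => //; apply: addr_ge0; first exact: addr_ge0.
  by apply: mulr_ge0 => //; apply: addr_ge0 => //; exact: ltW.
move=> N u f b x N0 au ef ouf fN Ex.
have [mu_ _ _] := au.
have oscN a : (osc gr p 1 K f a (cell gr a x) <= Ko * N * G ^+ a)%R.
  have Ec := cell_E gr a Ex; have ra := rad_gt0 gr a.
  have m0 := mass_gt0 gr L10 a Ec; have ml := mass_ge gr L10 a Ec.
  have lm : (0 < lowC gr * rad a `^ s)%R by rewrite mulr_gt0// powR_gt0.
  have nuN : (nu mu Omega f (ball (cell gr a x) (L * rad a)) <= N `^ p)%R.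
    apply: le_trans (nu_le_total hmu oO ef _) _; first by apply: hmu.1; exact: mball_open.
    rewrite -lee_fin fineK//; have [_ f0 foo] := ef.
    by rewrite ge0_fin_numE//; apply: integral_ge0.
  have nu0 : (0 <= nu mu Omega f (ball (cell gr a x) (L * rad a)))%R.
    by apply: (nu_ge0 ef).
  have q1 : (nu mu Omega f (ball (cell gr a x) (L * rad a)) / mass gr a (cell gr a x) <=
      N `^ p / (lowC gr * rad a `^ s))%R.
    by apply: ler_pM => //; [rewrite invr_ge0 ltW|rewrite lef_pV2].
  have q2 : ((N `^ p / (lowC gr * rad a `^ s)) `^ p^-1 =
      N * (lowC gr `^ p^-1)^-1 * rad a `^ (- (s / p)))%R.
    rewrite powRM ?powR_ge0 ?invr_ge0 ?(ltW lm)// -powRrM divff ?gt_eqF// powRr1 ?(ltW N0)//.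
    have -> : ((lowC gr * rad a `^ s)^-1 `^ p^-1 = ((lowC gr * rad a `^ s) `^ p^-1)^-1)%R.
      by rewrite -{1}(powR_inv1 (ltW lm)) -powRrM mulN1r powRN.
    by rewrite (powRM _ (ltW l0) (powR_ge0 _ _)) invfM mulrA -powRrM -(powRN (rad a)).
  rewrite /osc; apply: (@le_trans _ _ (K * rad a `^ 1 * (N * (lowC gr `^ p^-1)^-1 * rad a `^ (- (s / p))))%R).
    apply: ler_wpM2l; first by apply: mulr_ge0 => //; exact: powR_ge0.
    rewrite -q2; apply: ge0_ler_powR => //; rewrite ?nnegrE ?invr_ge0 ?(ltW p0)//.
      by rewrite divr_ge0// ltW.
    by rewrite divr_ge0 ?powR_ge0// ltW.
  have -> : (K * rad a `^ 1 * (N * (lowC gr `^ p^-1)^-1 * rad a `^ (- (s / p))) =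
    K * (lowC gr `^ p^-1)^-1 * N * (rad a `^ (1 - s / p)))%R.
    by rewrite powRD; [ring|rewrite (gt_eqF ra) implybT].
  rewrite rad_powR (_ : (- (1 - s / p) = (s - p) / p)%R); last by field; rewrite gt_eqF.
  by rewrite /Ko -/G le_eqVlt; apply/orP; left; apply/eqP; ring.
have TN a : (`|Tavg gr u a x| <= N * (A0 + A1 * G ^+ a))%R.
  elim: a => [|a IH].
    apply: le_trans (admissible_average hmu oO L10 p1 0 N0 au (cell_E gr 0 Ex)) _.
    by rewrite ler_pM2l// expr0 mulr1 -/A0 lerDl.
  have st := Tavg_step hmu oO L10 K0 mu_ ouf a Ex.
  have -> : (Tavg gr u a.+1 x = (Tavg gr u a.+1 x - Tavg gr u a x) + Tavg gr u a x)%R by rewrite subrK.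
  apply: le_trans (ler_normD _ _) _.
  apply: (@le_trans _ _ (2 * dblC gr * (Ko * N * G ^+ a) + N * (A0 + A1 * G ^+ a))%R).
    by apply: lerD => //; apply: le_trans st _; apply: ler_wpM2l => //; rewrite mulr_ge0// ltW.
  rewrite exprS /A1 le_eqVlt; apply/orP; left; apply/eqP; field.
  by rewrite subr_eq0 gt_eqF.
have := Tavg_osc_at 0 b mu_ ouf Ex.
under eq_integral do rewrite sube0.
move=> /le_trans; apply; rewrite lee_fin ler_pM2l; last exact: mass_gt0 (cell_E gr b Ex).
rewrite subr0.
have Gb : (1 <= G ^+ b)%R by apply: exprn_ege1; exact: ltW.
have h1 := oscN b; have h2 := TN b.
have h3 : ((1 + dblC gr) * osc gr p 1 K f b (cell gr b x) <= (1 + dblC gr) * (Ko * N * G ^+ b))%R.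
  by apply: ler_wpM2l => //; rewrite addr_ge0// ltW.
apply: le_trans (lerD h3 h2) _.
have -> : ((A0 + A1 + (1 + dblC gr) * Ko + 1) * N * G ^+ b =
  (1 + dblC gr) * (Ko * N * G ^+ b) + N * (A0 * G ^+ b + A1 * G ^+ b) + N * G ^+ b)%R by ring.
apply: (@le_trans _ _ ((1 + dblC gr) * (Ko * N * G ^+ b) + N * (A0 * G ^+ b + A1 * G ^+ b))%R).
  by rewrite lerD2l ler_pM2l// lerD2r ler_peMr.
by rewrite lerDl mulr_ge0 ?(ltW N0)// (le_trans _ Gb).
Qed.

End borderline_growth.

Lemma exists_small_powR (R : realType) (B c e : R) : (0 <= B)%R -> (0 <= c)%R -> (0 < e)%R ->
  exists2 eps : R, (0 < eps < 1)%R & (B * ((1 + c) * eps) `^ e <= 2^-1)%R.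
Proof.
move=> B0 c0 e0; pose z := (2 * B + 2)^-1%R.
have B2 : (0 < 2 * B + 2)%R by lra.
have z0 : (0 < z)%R by rewrite invr_gt0.
have z1 : (z < 1)%R by rewrite invf_lt1//; lra.
have c1 : (0 < 1 + c)%R by lra.
exists (z `^ e^-1 / (1 + c))%R.
  rewrite divr_gt0 ?powR_gt0//= ltr_pdivrMr// mul1r.
  have : (z `^ e^-1 < 1 `^ e^-1)%R.
    by apply: gt0_ltr_powR; rewrite ?nnegrE ?invr_gt0// ltW.
  by rewrite powR1; lra.
rewrite [X in (X `^ e)%R]mulrC divfK ?gt_eqF// -powRrM mulVf ?gt_eqF// powRr1 ?(ltW z0)//.
by rewrite /z ler_pdivrMr//; lra.
Qed.

Lemma root_lt1 (R : realType) (a : R) (m : nat) : (0 < a < 1)%R ->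
  let x := (a `^ m.+1%:R^-1)%R in
  [/\ (0 < x)%R, (x < 1)%R & (x ^+ m.+1 = a)%R].
Proof.
move=> /andP[a0 a1]; split.
- exact: powR_gt0.
- have : (a `^ m.+1%:R^-1 < 1 `^ m.+1%:R^-1)%R.
    by apply: gt0_ltr_powR; rewrite ?nnegrE ?invr_gt0// ltW.
  by rewrite powR1.
- by rewrite -powR_mulrn ?powR_ge0// -powRrM mulVf// powRr1// ltW.
Qed.

Lemma powR2_ltlt1 (R : realType) (e : R) : (0 < e)%R ->
  (0 < (2 : R) `^ (- e) < 1)%R /\ (1 < (2 : R) `^ e)%R.
Proof.
move=> e0; have h : (1 < (2 : R) `^ e)%R.
  have : ((1 : R) `^ e < (2 : R) `^ e)%R by apply: gt0_ltr_powR; rewrite ?nnegrE// ltr1n.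
  by rewrite powR1.
by split => //; rewrite powR_gt0//= powRN invf_lt1// (lt_trans _ h).
Qed.

Section borderline.
Context (R : realType) (disp : measure_display)
  (X : metricMeasurableType R disp) (mu : {measure set X -> \bar R})
  (Omega E : set X) (d s L1 : R) (gr : grid mu Omega E d s L1).
Hypotheses (hmu : complete_borel mu) (oO : open Omega)
  (mE : (hausdorff_outer X d).-caratheodory E).
Variables (p L C lambda : R).
Hypotheses (p1 : (1 <= p)%R) (L10 : (10 <= L)%R) (LL1 : (8 * L <= L1)%R)
  (C0 : (0 < C)%R) (lambda1 : (1 <= lambda)%R) (Llambda : (10 * lambda + 10 <= L)%R).
Hypothesis PI : forall x r, Omega x -> (0 < r)%R ->
  let B := ball_of Omega x r in let lB := ball_of Omega x (lambda * r) in
  0 < mu B -> mu B < +oo ->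
  forall u g, Lp_loc mu Omega 1 u -> minimal_weak_upper_gradient mu Omega p u g ->
    Lp mu Omega p g ->
    average mu B (fun y => `|u y - average mu B u|) <=
    C%:E * diam B * (average mu lB (fun y => g y `^ p)) `^ p^-1.
Let p0 : (0 < p)%R. Proof. exact: lt_le_trans p1. Qed.
Let L0 : (0 < L)%R. Proof. exact: lt_le_trans L10. Qed.
Let LL : (L <= L1)%R.
Proof. by apply: le_trans LL1; rewrite ler_peMl ?ler1n// ltW. Qed.
Let L110 : (10 <= L1)%R. Proof. exact: le_trans LL. Qed.
Let grL := grid_restrict hmu oO LL gr.
Local Notation rad := (gradius gr).
Local Notation Lam := (hausdorff_measure X d).
Local Notation XC := (caratheodory_type (hausdorff_outer X d)).

(** If [x] is outside some [heavy_set b i.+1], take the least such [i]. Then [stopping_time] applies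
    with [T = Tcut b i], and minimality places [x] in [heavy_set b i] unless [i] is 0. *)
Lemma stop_cover (u h : X -> \bar R) (g a eps l : R) (t : nat -> R) (b : nat) (x : X) :
  let f y := h y `^ p in
  measurable_fun Omega u -> nneg_borel Omega h -> Lp mu Omega p h ->
  (exists rho0, wug mu Omega p u h rho0) ->
  (1 < g)%R -> (0 < t b)%R -> (0 < a < 1)%R -> (0 < eps < 1)%R -> E x ->
  (t b < `|l|)%R ->
  (forall e : R, (0 < e)%R -> exists M, forall n, (M <= n)%N ->
    \int[mu]_(y in ball_of Omega (cell gr n x) (rad n)) `|u y - l%:E| <=
    (mass gr n (cell gr n x) * e)%:E) ->
  \int[mu]_(y in ball_of Omega (cell gr b x) (rad b)) `|u y| <=
    (mass gr b (cell gr b x) * (t b / 4))%:E ->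
  (2 * dblC gr * (2 * poincare_cst gr C * ((1 + cutC gr g) * eps) `^ p^-1) /
     (1 - a `^ p^-1) <= 2^-1)%R ->
  (exists i n, stop_level gr p L g a eps t f b i n x) \/
    forall i, heavy_set gr p L a t f b i.+1 x.
Proof.
move=> f mu_ hh Lh uh g1 t0 a01 eps01 Ex tl lim_l start small.
have [?|] := pselect (forall i, heavy_set gr p L a t f b i.+1 x); [by right|move=> nb; left].
have ex : exists i, ~~ `[< heavy_set gr p L a t f b i.+1 x >].
  by apply: contrapT => H; apply: nb => i; apply: contrapT => Hi; apply: H; exists i; apply/asboolP.
case: (ex_minnP ex) => i /asboolP nbi imin.
have T0 : (0 < Tcut p eps t b i)%R.
  have /andP[e0 _] := eps01.
  by rewrite /Tcut divr_gt0// mulr_gt0 ?exprn_gt0// powR_gt0.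
have [|n hn] := stopping_time hmu oO p1 L10 LL1 g1 C0 lambda1 Llambda PI mu_ hh Lh uh T0 t0 a01
    eps01 Ex _ tl lim_l start small.
  move=> n c cn cx; rewrite leNgt; apply/negP => H; apply: nbi; exists n => //; exists c.
    rewrite (mulrA 4%R) in H; rewrite /= mem_filter cn andbT; apply: le_lt_trans H.
    have /andP[e0 _] := eps01.
    by rewrite /Tcut le_eqVlt; apply/orP; left; apply/eqP; field; rewrite gt_eqF.
  by split => //; rewrite ballEmdist /= -mulrA.
exists i, n; split.
  have [cn cx] := cellP gr (b + n) Ex.
  exists (cell gr (b + n) x); first by rewrite /= mem_filter cn andbT.
  by split => //; rewrite ballEmdist /= mul1r.
case: i {hn T0 nbi} imin => [|i] imin; [by left|right].
apply: contrapT => H; have := imin i; rewrite ltnn => h'.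
by apply/notF/h'; apply/asboolP.
Qed.

Hypotheses (d0 : (0 < d)%R) (ps : (p < s)%R) (sd : (s - p < d)%R).
Variable q : R.
Hypotheses (q1 : (1 <= q)%R) (qd : (q * (s - p) = d * p)%R).

(** The numbers [eps], [M], [m] and the geometric rates are fixed before [N] and [u]. Only [Np],
    [Nq] and [V] depend on [N], and they occur in the combination [Nq / Np * V], a multiple of
    [N ^ q]. *)
Lemma borderline_trace_Lq : exists2 K : R, (0 <= K)%R & forall (N : R) u, (0 < N)%R ->
  newtonian_space mu Omega p u -> newtonian_norm mu Omega p u < N%:E ->
  Lp_norm Lam E q (EFin \o trace mu Omega u) <= (K * N)%:E.
Proof.
have sp0 : (0 < s - p)%R by rewrite subr_gt0.
have q0 : (0 < q)%R by exact: lt_le_trans q1.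
pose Kp := poincare_cst grL C; pose Kg := poincare_cst gr C.
have Kp0 : (0 <= Kp)%R by rewrite /Kp /poincare_cst mulr_ge0 ?mulr_ge0// ltW// dblC_gt0.
have Kg0 : (0 <= Kg)%R by rewrite /Kg /poincare_cst mulr_ge0 ?mulr_ge0// ltW// dblC_gt0.
have [A A0 HA] := @average_growth _ _ _ _ _ _ _ _ _ grL hmu oO L10 p Kp p1 Kp0 ps.
(* Three relations tie the levels to the scales: [a ^ 2 / g ^ 2 = 2 ^ (- d)], [G ^ p = g ^ 2], and,
   by the borderline identity [qd], [G ^ q = g ^ 2 / a ^ 2]. *)
pose G := (2 `^ ((s - p) / p) : R)%R.
pose a := (2 `^ (- ((d - s + p) / 2)) : R)%R.
pose g := (2 `^ ((s - p) / 2) : R)%R.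
have kap0 : (0 < (d - s + p) / 2)%R by apply: divr_gt0 => //; move: sd; lra.
have [a01 _] := powR2_ltlt1 kap0; rewrite -/a in a01.
have [_ g1] : (0 < (2 : R) `^ (- ((s - p) / 2)) < 1)%R /\ (1 < g)%R by apply: powR2_ltlt1; rewrite divr_gt0.
have [_ G1] : (0 < (2 : R) `^ (- ((s - p) / p)) < 1)%R /\ (1 < G)%R by apply: powR2_ltlt1; rewrite divr_gt0.
have [a0 a1] := andP a01.
have g0 : (0 < g)%R by exact: lt_trans g1.
have G0 : (0 < G)%R by exact: lt_trans G1.
have pow2 (e : R) : ((2 `^ e) ^+ 2 = 2 `^ (e * 2) :> R)%R by rewrite -powR_mulrn ?powR_ge0// -powRrM.
have g2 : (g ^+ 2 = 2 `^ (s - p))%R by rewrite /g pow2 divfK.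
have ag : (a ^+ 2 / g ^+ 2 = 2 `^ (- d))%R.
  rewrite g2 /a pow2 -powRN -powRD; last by rewrite pnatr_eq0 implybT.
  by congr (_ `^ _)%R; field.
have Gp : (G `^ p = g ^+ 2)%R by rewrite g2 /G -powRrM divfK// gt_eqF.
have Gq : (G `^ q = g ^+ 2 / a ^+ 2)%R.
  rewrite -invf_div ag -powRN opprK /G -powRrM; congr (_ `^ _)%R.
  by rewrite mulrAC (mulrC (s - p)%R) qd mulfK// gt_eqF.
rewrite -/G in HA; clearbody G a g.
have ap01 : (0 < 1 - a `^ p^-1)%R.
  rewrite subr_gt0 (_ : 1 = 1 `^ p^-1)%R; last by rewrite powR1.
  by apply: gt0_ltr_powR; rewrite ?nnegrE ?invr_gt0 ?(ltW a0).
have cC0 : (0 <= cutC gr g)%R.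
  by rewrite divr_ge0 ?mulr_ge0 ?(ltW (dblC_gt0 _))// subr_ge0 invf_le1// ltW.
have dC0 := dblC_gt0 gr.
have [eps eps01 epsB] : exists2 eps : R, (0 < eps < 1)%R &
  (2 * dblC gr * (2 * Kg * ((1 + cutC gr g) * eps) `^ p^-1) / (1 - a `^ p^-1) <= 2^-1)%R.
  have B0 : (0 <= 2 * dblC gr * (2 * Kg) / (1 - a `^ p^-1))%R.
    apply: divr_ge0; last exact: ltW.
    by apply: mulr_ge0; apply: mulr_ge0 => //; exact: ltW.
  have pi0 : (0 < p^-1)%R by rewrite invr_gt0.
  have [eps e01 h] := exists_small_powR B0 cC0 pi0; exists eps => //.
  by apply: le_trans h; rewrite le_eqVlt; apply/orP; left; apply/eqP; ring.
have /andP[eps0 eps1] := eps01.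
have [M HM] := exists_expr_ge (2 / eps ^+ 2 + 2 + g / a)%R g1.
have e20 : (0 <= 2 / eps ^+ 2)%R by rewrite divr_ge0// exprn_ge0// ltW.
have ga0 : (0 <= g / a)%R by rewrite divr_ge0// ltW.
have M1 : (2 / eps ^+ 2 <= g ^+ M)%R by apply: le_trans HM; rewrite -addrA lerDl addr_ge0.
have M2 : (2 <= g ^+ M)%R by apply: le_trans HM; rewrite -addrA addrCA lerDl addr_ge0.
have M3 : (g / a <= g ^+ M)%R by apply: le_trans HM; rewrite lerDr addr_ge0.
have [m am'] := geometric_small (g ^+ 2 / a)%R a01 a0.
have am : (a ^+ m * (g ^+ 2 / a) <= a)%R by rewrite mulrC.
have [x0 x1 xa] := root_lt1 m a01; set x := (a `^ _)%R in x0 x1 xa.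
have h01 : (0 < (2 : R)^-1 < 1)%R by rewrite invr_gt0 ltr0n invf_lt1 ?ltr1n.
have [y0 y1 yh] := root_lt1 m h01; set y := (2^-1 `^ _)%R in y0 y1 yh.
have x01 : (0 < x < 1)%R by rewrite x0.
have y01 : (0 < y < 1)%R by rewrite y0.
have [c1 [x' [c10 x'01 xx']]] := linear_geometric x01.
have [c2 [y' [c20 y'01 yy']]] := linear_geometric y01.
pose rd := (rho gr `^ d)%R.
pose lt0 := (lowC gr * rho gr `^ (s - p))%R.
have r0 := rho_gt0 gr.
have rd0 : (0 < rd)%R by exact: powR_gt0.
have lt00 : (0 < lt0)%R by rewrite mulr_gt0 ?lowC_gt0// powR_gt0.
(* With [t b = 4 * A * N * G ^+ b], [average_growth] is exactly the initial bound [t b / 4] of the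
   stopping argument. *)
pose k0 := (4 * A)%R.
have k00 : (0 < k0)%R by rewrite mulr_gt0.
pose kp := (k0 `^ p)%R; pose kq := (k0 `^ q)%R.
have kp0 : (0 < kp)%R by exact: powR_gt0.
have kq0 : (0 < kq)%R by exact: powR_gt0.
have rad_d n : (rad n `^ d = rd * (a ^+ 2 / g ^+ 2) ^+ n)%R by rewrite rad_powR ag.
have tau_low n c : E c -> (lt0 * (g ^- 2) ^+ n <= tauc gr p n c)%R.
  move=> Ec; have rn := rad_gt0 gr n.
  rewrite /tauc ler_pdivlMr ?powR_gt0//; apply: le_trans (mass_ge gr L110 n Ec).
  rewrite le_eqVlt; apply/orP; left; apply/eqP.
  rewrite g2 -powRN /lt0 -mulrA -(mulrA (lowC gr)); congr (_ * _)%R.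
  rewrite -rad_powR -powRD; last by rewrite (gt_eqF rn) implybT.
  by rewrite subrK.
pose lv (Rr : R) := levelC gr rd lt0 1 1 Rr.
have lvE Np Nq Rr : (0 < Np)%R -> levelC gr rd lt0 Np Nq Rr = (lv Rr * (Nq / Np))%R.
  by move=> Np0; rewrite /lv /levelC; field; rewrite !gt_eqF.
pose B := (lv 1 / eps + lv (4 * L) / kp / (1 - a) / (eps * lt0))%R.
have lv0 Rr : (0 <= lv Rr)%R by apply: levelC_ge0 => //; exact: ltr01.
have a1' : (0 < 1 - a)%R by rewrite subr_gt0.
have B1 : (0 <= lv 1 / eps)%R by rewrite divr_ge0// ltW.
have B2 : (0 <= lv (4 * L) / kp / (1 - a) / (eps * lt0))%R.
  apply: divr_ge0; last by apply: mulr_ge0; exact: ltW.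
  by apply: divr_ge0; last exact: ltW; apply: divr_ge0; last exact: ltW; exact: lv0.
have EA : Lam E < +oo by exact: (hausdorff_fin_grid gr L110).
pose S := (B * (kq / kp) * M%:R * c1 * c2 / (1 - x') / (1 - y'))%R.
have S0 : (0 <= S)%R.
  have /andP[_ hx] := x'01; have /andP[_ hy] := y'01.
  have ? : (0 <= B)%R by rewrite addr_ge0.
  have ? : (0 <= kq / kp)%R by rewrite divr_ge0// ltW.
  apply: divr_ge0; last by rewrite subr_ge0 ltW.
  apply: divr_ge0; last by rewrite subr_ge0 ltW.
  by apply: mulr_ge0; [apply: mulr_ge0; [apply: mulr_ge0 => //; exact: mulr_ge0|exact: ltW]|exact: ltW].
pose K := (kq * fine (Lam E) + (g ^+ 2 / a ^+ 2) * S)%R.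
have GA0 : (0 <= g ^+ 2 / a ^+ 2)%R by apply: divr_ge0; apply: exprn_ge0; exact: ltW.
have K0 : (0 <= K)%R.
  by apply: addr_ge0; apply: mulr_ge0 => //; exact: ltW.
exists (K `^ q^-1)%R; first exact: powR_ge0.
move=> N u N0 us uN.
(* A point of [E] provides a point of [Omega], which is needed to choose an exceptional weight for
   the gradient. *)
have [->|/set0P E0] := eqVneq E set0.
  rewrite /Lp_norm patch_set0 Lnorm0 ?lee_fin; first by rewrite mulr_ge0 ?powR_ge0// ltW.
  by rewrite eqe gt_eqF.
have au := newtonian_admissible grL hmu oO L10 p1 C0 lambda1 Llambda PI N0 us uN.
have [uI [h uh hN]] := newtonian_gradient p1 N0 us uN.
have [mu_ _] := us.
have hh : nneg_borel Omega h by case: uh.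
have Lh : Lp mu Omega p h.
  by apply/(Lp_nneg hmu oO p1 hh); exact: le_lt_trans hN (ltry _).
have O0 : Omega !=set0.
  have [z Ez] := E0.
  have r1 : (0 < rho gr <= L1 * rho gr)%R by rewrite r0 ler_peMl ?(ltW r0)// (le_trans _ L110)// ler1n.
  have := mass_fin Ez r1.
  by have [->|/set0P[w [_ Ow]] _] := eqVneq (ball_of Omega z (rho gr)) set0; [rewrite measure0 ltxx|exists w].
have wu := upper_gradient_wug hmu oO p1 O0 uh Lh.
pose f z := h z `^ p.
have ouf : osc_control grL p 1 Kp u f.
  have uoo : \int[mu]_(y in Omega) `|u y| `^ p < +oo by exact: le_lt_trans uI (ltry _).
  exact: (fine_osc_control hmu oO L10 p1 C0 lambda1 Llambda PI mu_ uoo uh Lh).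
have ef : energy mu Omega f.
  split.
  - apply: (measurableT_comp (measurable_poweR p)).
    by apply: (borel_fun_measurable hmu oO); case: hh.
  - by move=> z _; exact: poweR_ge0.
  - exact: le_lt_trans hN (ltry _).
pose V := (N `^ p)%R.
have V0 : (0 < V)%R by exact: powR_gt0.
have fV : (fine (\int[mu]_(z in Omega) f z) <= V)%R.
  rewrite -lee_fin fineK//; have [_ f0 foo] := ef.
  by rewrite ge0_fin_numE//; apply: integral_ge0.
pose t b := (k0 * N * G ^+ b)%R.
have t0 b : (0 < t b)%R by rewrite mulr_gt0 ?exprn_gt0// mulr_gt0.
pose Np := (kp * N `^ p)%R; pose Nq := (kq * N `^ q)%R.
have Np0 : (0 < Np)%R by rewrite mulr_gt0.
have Nq0 : (0 < Nq)%R by rewrite mulr_gt0// powR_gt0.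
have tE e b : (t b `^ e = k0 `^ e * N `^ e * (G `^ e) ^+ b)%R.
  have kN0 : (0 <= k0 * N)%R by apply: mulr_ge0; exact: ltW.
  rewrite /t (powRM _ kN0 (exprn_ge0 _ (ltW G0))) (powRM _ (ltW k00) (ltW N0)).
  by rewrite (powR_expr _ _ (ltW G0)).
have t_p b : (t b `^ p = Np * (g ^+ 2) ^+ b)%R by rewrite tE Gp.
have t_q b : (t b `^ q = Nq * (g ^+ 2 / a ^+ 2) ^+ b)%R by rewrite tE Gq.
pose Cm := (B * (Nq / Np))%R.
have NN0 : (0 <= Nq / Np)%R by rewrite divr_ge0// ltW.
have Cm1 : (levelC gr rd lt0 Np Nq 1 / eps <= Cm)%R.
  by rewrite lvE// mulrAC ler_wpM2r// lerDl.
have Cm2 : (levelC gr rd lt0 Np Nq (4 * L) * V / (1 - a) / (eps * Np * lt0) <= Cm)%R.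
  rewrite lvE//; apply: (@le_trans _ _ (lv (4 * L) / kp / (1 - a) / (eps * lt0) * (Nq / Np))%R).
    rewrite le_eqVlt; apply/orP; left; apply/eqP; rewrite /Np -/V.
    by field; rewrite !gt_eqF.
  by rewrite ler_wpM2r// lerDr.
have e0 : (0 < d + 1 * p - s * p / p)%R by rewrite mulfK ?gt_eqF//; lra.
pose W := Wmaj grL p 1 Kp p f.
have aeW : {ae Lam, forall z, E z -> W z < +oo}.
  exact: (ae_Wmaj_fin grL hmu oO mE L10 p1 Kp0 (lexx p) e0 N0 ef hN).
(* Finiteness of [W z] makes the trace a genuine limit at [z]. The points excluded by it are null by
   [aeW] and are restored when the level sets of the trace are measured. *)
pose U b := [set z | [/\ E z, W z < +oo & (t b < `|trace mu Omega u z|)%R]].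
have sumU := borderline_sum (gr := gr) hmu oO L10 LL1 g1 a01 rd0 lt00 Np0 Nq0 eps01 ef V0 fV
  rad_d tau_low t0 t_p t_q M1 M2 M3 Cm1 Cm2 x0 y0 xa yh am x'01 y'01 c10 c20 xx' yy' (U := U) _.
have {}sumU : \sum_(b <oo) ((t b `^ q)%:E * hausdorff_outer X d (U b)) <= (S * N `^ q)%:E.
  apply: le_trans (sumU _) _; last first.
    rewrite lee_fin le_eqVlt; apply/orP; left; apply/eqP.
    rewrite /Cm /S /Nq /Np -/V; field.
    by have /andP[_ hx] := x'01; have /andP[_ hy] := y'01; rewrite !subr_eq0 !gt_eqF.
  move=> b z [Ez Wz tz].
  apply: (stop_cover mu_ hh Lh wu g1 (t0 b) a01 eps01 Ez tz _ _ epsB).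
    exact: (Tavg_limit (gr := grL) hmu oO L10 p1 Kp0 (lexx p) e0 mu_ ouf Ez Wz).
  have := HA N u f b z N0 au ef ouf hN Ez; rewrite (_ : A * N * G ^+ b = t b / 4)%R//.
  by rewrite /t /k0; field.
have tinf v : exists b, (v <= t b)%R.
  have [b hb] := exists_expr_ge (v / (k0 * N))%R G1; exists b.
  by move: hb; rewrite ler_pdivrMr ?mulr_gt0// mulrC.
have mtr := measurable_trace (gr := grL) hmu oO mE L10 p1 Kp0 (lexx p) e0 N0 au.
have I : \int[Lam]_(z in (E : set XC)) `|(trace mu Omega u z)%:E| `^ q <= (K * N `^ q)%:E.
  apply: le_trans (@layer_cake_le _ _ XC Lam E (trace mu Omega u) q t q0 mE mtr _ tinf) _.
    by move=> b; exact: ltW.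
  have EF : Lam E \is a fin_num by rewrite ge0_fin_numE.
  rewrite /K mulrDl EFinD; apply: leeD.
    by rewrite -(fineK EF) -EFinM lee_fin t_q expr0 mulr1 /Nq mulrAC.
  apply: (@le_trans _ _ ((g ^+ 2 / a ^+ 2)%:E * \sum_(b <oo) ((t b `^ q)%:E * hausdorff_outer X d (U b)))).
    rewrite -nneseriesZl; last by move=> b _; rewrite mule_ge0// lee_fin powR_ge0.
    apply: lee_nneseries => [b _ _|b _]; first by rewrite mule_ge0// lee_fin powR_ge0.
    rewrite muleA -EFinM; have -> : (t b.+1 `^ q = g ^+ 2 / a ^+ 2 * t b `^ q)%R.
      by rewrite !t_q exprS mulrCA.
    apply: lee_wpmul2l; first by rewrite lee_fin; apply: mulr_ge0 => //; exact: powR_ge0.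
    have [Z [mZ Z0 ZP]] := aeW.
    apply: (@le_trans _ _ (hausdorff_outer X d (U b `|` Z))).
      apply: le_outer_measure => z [Ez tz].
      have [Wz|Wz] := pselect (W z < +oo); first by left.
      by right; apply: ZP => /= H; apply: Wz; exact: H.
    apply: le_trans (outer_measureU2 _ _ _) _.
    by rewrite [X in _ + X](_ : _ = 0) ?adde0.
  rewrite -[(_ * S * _)%R]mulrA [leRHS]EFinM; apply: lee_wpmul2l => //.
rewrite Lp_normE ?gt_eqF//.
apply: (le_trans (poweR_le _ _ I)); first by rewrite invr_ge0 ltW.
  by apply: integral_ge0 => z _; exact: poweR_ge0.
by rewrite poweR_EFin lee_fin powRM ?powR_ge0// -powRrM divff ?gt_eqF// powRr1// ltW.
Qed.

End borderline.

(** * Passage to the two function spaces *)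

Lemma lt_EFin_bound (R : realType) (x : \bar R) : x < +oo ->
  exists2 N : R, (0 < N)%R & x < N%:E.
Proof.
case: x => [r| |] // _; last by exists 1%R; rewrite ?ltr01 ?ltNyr.
by exists (`|r| + 1)%R; [rewrite ltr_wpDl|rewrite lte_fin ltr_pwDr ?ler_norm].
Qed.

(** The estimates are proved for positive [N] strictly above the norm, since the infimum over
    gradients may not be attained and the norm may be 0; letting [N] decrease gives the norm
    itself. *)
Lemma lee_mul_of_gt (R : realType) (C : R) (x y : \bar R) : (0 <= C)%R ->
  0 <= x < +oo -> (forall N, (0 < N)%R -> x < N%:E -> y <= (C * N)%:E) -> y <= C%:E * x.
Proof.
move=> C0; case: x => [r| |]; [|by case/andP|by case/andP].
rewrite lee_fin => /andP[r0 _] H; apply/lee_addgt0Pr => e e0.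
have C1 : (0 < C + 1)%R by rewrite ltr_wpDl.
have eC : (0 < e / (C + 1))%R by rewrite divr_gt0.
apply: le_trans (H (r + e / (C + 1))%R _ _) _.
- by rewrite ltr_wpDl.
- by rewrite lte_fin ltrDl.
rewrite -EFinM -EFinD lee_fin mulrDr lerD2l mulrCA ler_piMr ?(ltW e0)//.
by rewrite ler_pdivrMr// mul1r lerDl.
Qed.

Section admissible_spaces.
Context (R : realType) (disp : measure_display)
  (X : metricMeasurableType R disp) (mu : {measure set X -> \bar R})
  (Omega E : set X) (d s L : R) (gr : grid mu Omega E d s L).
Hypotheses (hmu : complete_borel mu) (oO : open Omega)
  (mE : (hausdorff_outer X d).-caratheodory E) (L10 : (10 <= L)%R).
Local Notation Lam := (hausdorff_measure X d).
Variables (p q beta K : R).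
Hypotheses (p1 : (1 <= p)%R) (q1 : (1 <= q)%R) (K0 : (0 <= K)%R)
  (sd : (s - beta * p < d)%R).
Variables (V : Type) (dom : set V) (norm : V -> \bar R) (f : V -> X -> \bar R).
Hypotheses (dom_norm : forall u, dom u -> 0 <= norm u < +oo)
  (dom_admissible : forall u N, (0 < N)%R -> dom u -> norm u < N%:E ->
     admissible gr p beta K N (f u)).
Let p0 : (0 < p)%R. Proof. exact: lt_le_trans p1. Qed.

Let ep : (0 < d + beta * p - s * p / p)%R.
Proof. by rewrite mulfK ?gt_eqF//; move: sd; rewrite ltrBlDr => h; rewrite subr_gt0. Qed.

Lemma dom_has_trace u : dom u -> has_trace mu Omega d E (f u).
Proof.
move=> du; have [N N0 uN] := lt_EFin_bound (andP (dom_norm du)).2.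
exact: (admissible_has_trace hmu oO mE L10 p1 K0 (lexx p) ep N0 (dom_admissible N0 du uN)).
Qed.

Hypothesis qsd : (q * (s - beta * p) < d * p)%R.

(** The majorant requires [tau >= p] and the target space requires [tau >= q]. *)
Let tau := Num.max p q.
Let pt : (p <= tau)%R. Proof. by rewrite le_max lexx. Qed.
Let qt : (1 <= q <= tau)%R. Proof. by rewrite q1 le_max lexx orbT. Qed.

(** For [q <= p] this is the condition under which traces exist; otherwise it is the strict
    inequality on [q] divided by [p]. *)
Let et : (0 < d + beta * tau - s * tau / p)%R.
Proof.
rewrite /tau; case: (leP q p) => [qp|pq]; first exact: ep.
rewrite -(pmulr_rgt0 _ p0).
have -> : (p * (d + beta * q - s * q / p) = d * p - q * (s - beta * p))%R.
  by field; rewrite gt_eqF.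
by rewrite subr_gt0.
Qed.

Lemma dom_bounded_into_Lq :
  bounded_into_Lq Lam dom norm E q (fun u => trace mu Omega (f u)).
Proof.
have [C C0 H] := admissible_trace_Lq gr hmu oO mE L10 p1 K0 pt et qt.
split=> [u du|].
  have [N N0 uN] := lt_EFin_bound (andP (dom_norm du)).2.
  by have [] := H N (f u) N0 (dom_admissible N0 du uN).
exists C => u du; apply: lee_mul_of_gt => //; first exact: dom_norm.
by move=> N N0 uN; have [] := H N (f u) N0 (dom_admissible N0 du uN).
Qed.

Lemma dom_compact_into_Lq :
  compact_into_Lq Lam dom norm E q (fun u => trace mu Omega (f u)).
Proof.
split; first exact: dom_bounded_into_Lq.1.
move=> u_ du [M uM].
have N0 : (0 < `|M| + 1)%R by rewrite ltr_wpDl.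
have uN n : norm (u_ n) < (`|M| + 1)%:E.
  by apply: le_lt_trans (uM n) _; rewrite lte_fin ltr_pwDr ?ler_norm.
exact: (admissible_trace_compact hmu oO mE L10 p1 K0 pt et qt N0
  (fun n => dom_admissible N0 (du n) (uN n))).
Qed.

End admissible_spaces.

Lemma hajlasz_norm_fin (R : realType) (disp : measure_display)
  (X : metricMeasurableType R disp) (mu : {measure set X -> \bar R}) (Omega : set X)
  (alpha p : R) (u : X -> R) : hajlasz_space mu Omega alpha p u ->
  0 <= hajlasz_norm mu Omega alpha p u < +oo.
Proof.
move=> [[_ uoo] [g hg [_ goo]]].
rewrite adde_ge0 ?Lnorm_ge0//=; last first.
  by apply: le_ereal_inf_tmp => _ [h _ <-]; exact: Lnorm_ge0.
apply: lte_add_pinfty => //; apply: le_lt_trans goo.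
by apply: ereal_inf_lbound; exists g.
Qed.

Theorem proposition1p4 (R : realType) (disp : measure_display)
  (X : metricMeasurableType R disp) (mu : {measure set X -> \bar R})
  (hmu : complete_borel mu)
  (p q d s r0 : R) (hp : (1 <= p)%R) (hq : (1 <= q)%R) (hd : (0 < d)%R)
  (hs : (0 < s)%R) (hr0 : (0 < r0)%R)
  (Omega E F : set X) (hOmega : open Omega)
  (hEF : E `<=` F) (hF : F `<=` closure Omega)
  (hE0 : 0 < hausdorff d E)
  (hreg : exists C C' : R, [/\ (0 < C)%R, (0 < C')%R &
    forall x r, E x -> (0 < r <= r0)%R ->
      (C * r `^ d)%:E <= hausdorff d (F `&` ball x r) <= (C' * r `^ d)%:E])
  (hEtb : totally_bounded E)
  (hEm : (hausdorff_outer X d).-caratheodory E)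
  (hdbl : exists C'' C''' : R, [/\ (0 < C'')%R, (0 < C''')%R &
    forall x r, E x -> (0 < r <= r0)%R ->
      [/\ 0 < mu (ball x (2 * r) `&` Omega),
          mu (ball x (2 * r) `&` Omega) <= C''%:E * mu (ball x r `&` Omega),
          C''%:E * mu (ball x r `&` Omega) < +oo &
          (C''' * r `^ s)%:E <= mu (ball x r `&` Omega)]]) :
  (forall alpha : R, (0 < alpha)%R -> (s - alpha * p < d)%R ->
    (forall u : X -> R, hajlasz_space mu Omega alpha p u ->
      has_trace mu Omega d E (EFin \o u)) /\
    ((q * (s - alpha * p) < d * p)%R ->
      compact_into_Lq (hausdorff_measure X d)
        (hajlasz_space mu Omega alpha p) (hajlasz_norm mu Omega alpha p)
        E q (fun u => trace mu Omega (EFin \o u)))) /\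
  ((s - p < d)%R -> supports_poincare mu Omega p ->
    (forall u : X -> \bar R, newtonian_space mu Omega p u ->
      has_trace mu Omega d E u) /\
    ((q * (s - p) <= d * p)%R ->
      bounded_into_Lq (hausdorff_measure X d)
        (newtonian_space mu Omega p) (newtonian_norm mu Omega p)
        E q (trace mu Omega)) /\
    ((q * (s - p) < d * p)%R ->
      compact_into_Lq (hausdorff_measure X d)
        (newtonian_space mu Omega p) (newtonian_norm mu Omega p)
        E q (trace mu Omega))).
Proof.
have p0 : (0 < p)%R by exact: lt_le_trans hp.
have q0 : (0 < q)%R by exact: lt_le_trans hq.
split=> [alpha a0 sad|spd [C [lambda [C0 lambda1 PI]]]].
  have L1 : (1 <= 10 :> R)%R by rewrite ler1n.
  have [gr _] := exists_grid hmu hOmega hr0 hEF hreg hEtb hdbl L1 ltr01.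
  have K0 := hajlasz_cst_ge0 gr alpha.
  have adm (u : X -> R) N : (0 < N)%R -> hajlasz_space mu Omega alpha p u ->
      hajlasz_norm mu Omega alpha p u < N%:E ->
      admissible gr p alpha (hajlasz_cst gr alpha) N (EFin \o u).
    by move=> N0; exact: hajlasz_admissible.
  split=> [u us|qsd].
    by apply: (dom_has_trace hmu hOmega hEm (lexx _) hp K0 sad _ adm us) => v; exact: hajlasz_norm_fin.
  by apply: (dom_compact_into_Lq hmu hOmega hEm (lexx _) hp hq K0 sad _ adm qsd) => v; exact: hajlasz_norm_fin.
pose L := (10 * lambda + 10)%R.
have L10 : (10 <= L)%R by rewrite /L lerDr mulr_ge0// (le_trans _ lambda1).
have L8 : (1 <= 8 * L)%R by apply: le_trans (_ : 8 * 10 <= _)%R; rewrite ?ler_pM2l// -natrM ler1n.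
(* The dilation [8 * L] is what the cut in the borderline case requires; the strict inequalities are
   treated on the restriction of this grid to [L]. *)
have [gr1 _] := exists_grid hmu hOmega hr0 hEF hreg hEtb hdbl L8 ltr01.
have LL : (L <= 8 * L)%R by rewrite ler_peMl ?ler1n// (le_trans _ L10).
pose gr := grid_restrict hmu hOmega LL gr1.
have K0 : (0 <= poincare_cst gr C)%R.
  by rewrite /poincare_cst mulr_ge0 ?mulr_ge0// ltW// dblC_gt0.
have sd : (s - 1 * p < d)%R by rewrite mul1r.
have adm u N : (0 < N)%R -> newtonian_space mu Omega p u -> newtonian_norm mu Omega p u < N%:E ->
    admissible gr p 1 (poincare_cst gr C) N u.
  by move=> N0; exact: (newtonian_admissible gr hmu hOmega L10 hp C0 lambda1 (lexx _) PI N0).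
have nfin u : newtonian_space mu Omega p u -> 0 <= newtonian_norm mu Omega p u < +oo.
  by move=> [_ ->]; rewrite poweR_ge0.
split; first by move=> u us; exact: (dom_has_trace hmu hOmega hEm L10 hp K0 sd nfin adm us).
split=> [|qsd]; last first.
  by apply: (dom_compact_into_Lq hmu hOmega hEm L10 hp hq K0 sd nfin adm); rewrite mul1r.
rewrite le_eqVlt => /orP[/eqP qsd|qsd]; last first.
  by apply: (dom_bounded_into_Lq hmu hOmega hEm L10 hp hq K0 sd nfin adm); rewrite mul1r.
have ps : (p < s)%R.
  have : (0 < q * (s - p))%R by rewrite qsd mulr_gt0.
  by rewrite pmulr_rgt0// subr_gt0.
have [K K0' H] := borderline_trace_Lq gr1 hmu hOmega hEm hp L10 (lexx _) C0 lambda1 (lexx _) PI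
  ps spd hq qsd.
(* With [tau = p] the condition reads [s - p < d], which holds at the borderline too and gives
   measurability of the trace; only the bound in [L^q] rests on the truncation argument. *)
have e0 : (0 < d + 1 * p - s * p / p)%R by rewrite mulfK ?gt_eqF// mul1r; lra.
split=> [u us|].
  have [N N0 uN] := lt_EFin_bound (andP (nfin u us)).2.
  split; last by apply: le_lt_trans (H N u N0 us uN) (ltry _).
  apply/measurable_EFinP.
  exact: (measurable_trace hmu hOmega hEm L10 hp K0 (lexx p) e0 N0 (adm u N N0 us uN)).
exists K => u us; apply: lee_mul_of_gt => //; first exact: nfin.
by move=> N N0 uN; exact: H.
Qed.
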